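(* Let $\alpha\in(0,1)$. There is a constant $C$, depending only on $\alpha$, with the following property. Let $n\ge 1$, $d>0$, and let $$E=B(z_0,r_0)\setminus\bigcup_{k=1}^{n}\overline{B(z_k,r_k)}\subset\mathbb{R}^2$$ satisfy: $r_i\ge d$ for all $i\ge1$; $B(z_i,r_i+d)\subset B(z_0,r_0)$ for all $i\geq 1$; and $\operatorname{dist}(\overline{B(z_i,r_i)},\overline{B(z_j,r_j)})\ge 2d$ for all $i\ne j$, $i,j\ge1$. Let $g\in C^{1,\alpha}\big(\bigcup_{k=0}^n\partial B(z_k,r_k)\big)$ satisfy $\int_{\partial B(z_0,r_0)}g=\sum_{k=1}^n\int_{\partial B(z_k,r_k)}g$, and let $u$ be the solution of $$\Delta u=0\ \text{in }E,\qquad \frac{\partial u}{\partial\nu}=g\ \text{on }\partial E,\qquad \int_E u(y)\,dy=0 .$$ Then, with $B=B(E)$ the quantity defined in the context, $$\|Du\|_{\infty(E)}\le C(1+Bd^{-4}r_0)\|g\|_\infty+Cr_0^{\alpha}[g]_{0,\alpha},$$ $$[Du]_{0,\alpha(E)}\le C(d^{-\alpha}+Bd^{-5}r_0^{2-\alpha})\|g\|_\infty+C[g]_{0,\alpha},$$ $$\|D^2u\|_{\infty(E)}\le C(d^{-1}+Bd^{-5}r_0)\|g\|_\infty+Cd^{\alpha-1}[g]_{0,\alpha}+C\|g'\|_\infty+Cr_0^{\alpha}[g']_{0,\alpha},$$ $$[D^2u]_{0,\alpha(E)}\le C(d^{-1-\alpha}+Bd^{-6}r_0^{2-\alpha})\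|g\|_\infty+Cd^{-1}[g]_{0,\alpha}+Cd^{-\alpha}\|g'\|_\infty+C[g']_{0,\alpha}.$$
   Context: $B(z,r)$ is the open disk in $\mathbb{R}^2$. On each circle $\partial B(z_k,r_k)$, $k=0,\dots,n$, $\nu$ is the unit normal pointing outward from the disk $B(z_k,r_k)$, and $g'$ is the tangential (arclength) derivative of $g$. $\|f\|_{\infty(A)}=\sup_A|f|$ and $[f]_{0,\alpha(A)}=\sup_{x\ne y\in A}|f(x)-f(y)|/|x-y|^\alpha$; norms of $g,g'$ without indicated set are over $\bigcup_{k=0}^n\partial B(z_k,r_k)$. The Poincaré constant is $$C_P(E)=\sup\Big\{\|\phi\|_{L^2(E)}:\phi\in H^1(E),\ \|D\phi\|_{L^2(E)}=1,\ \int_E\phi=0\Big\},$$ and $$B=B(E)=|E|^{1/2}\,C_P(E)\,\big(d^{-1/2}C_P(E)+d^{1/2}\big)\,n^{1/2}r_0^{1/2}.$$ *)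

(* Defs.v *)
From HB Require Import structures.
From mathcomp Require Export all_boot all_order all_algebra.
From mathcomp Require Export all_classical all_reals all_analysis.
Import Order.TTheory GRing.Theory Num.Theory.
Import numFieldNormedType.Exports.

Set Implicit Arguments.
Unset Strict Implicit.
Unset Printing Implicit Defensive.

Local Open Scope classical_set_scope.
Local Open Scope ring_scope.

(* The library norm on a product type is the max norm; it is used below only
   through the topology and the differentiability notions it induces, which
   agree with the Euclidean ones.  Metric quantities use enorm. *)
Notation plane R := (R * R)%type.

Section Euclidean.
Context {R : realType}.
Implicit Types (x y z : plane R) (r : R) (A : set (plane R)).

Definition dot x y : R := x.1 * y.1 + x.2 * y.2.

Definition enorm x : R := Num.sqrt (x.1 ^+ 2 + x.2 ^+ 2).

(* Frobenius norm of a 2x2 matrix given by its rows *)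
Definition hnorm (M : plane R * plane R) : R :=
  Num.sqrt (enorm M.1 ^+ 2 + enorm M.2 ^+ 2).

Definition disk z r : set (plane R) := [set x | enorm (x - z) < r].

Definition circle z r : set (plane R) := [set x | enorm (x - z) = r].

Definition setdist A A' : \bar R :=
  ereal_inf [set e | exists x y, [/\ A x, A' y & e = (enorm (x - y))%:E]].

End Euclidean.

(* Two-dimensional Lebesgue measure.  Its domain is plane R, up to conversion;
   measurableTypeR is the copy of R on which lebesgue_measure is defined. *)
Notation mplane R := (measurableTypeR R * measurableTypeR R)%type.
Notation area R := (@lebesgue_measure R \x @lebesgue_measure R)%E.

Section Domain.
Context {R : realType} {n : nat}.
Variables (z : 'I_n.+1 -> plane R) (r : 'I_n.+1 -> R).

Definition holed_disk : set (plane R) :=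
  disk (z ord0) (r ord0) `\`
    \bigcup_(k in [set k | k != ord0]) closure (disk (z k) (r k)).

Definition circles : set (plane R) := \bigcup_k circle (z k) (r k).

End Domain.

Section Norms.
Context {R : realType} {W : zmodType}.

(* sup_A |f| and the Hoelder seminorm [f]_{0,alpha(A)}, where N is the norm on
   the values of f; both are +oo when the supremum is not finite *)
Definition supnorm (N : W -> R) (A : set (plane R)) (f : plane R -> W)
    : \bar R :=
  ereal_sup [set e | exists2 x, A x & e = (N (f x))%:E].

Definition holder (N : W -> R) (alpha : R) (A : set (plane R))
    (f : plane R -> W) : \bar R :=
  ereal_sup [set e | exists x y,
    [/\ A x, A y, x <> y & e = (N (f x - f y) / enorm (x - y) `^ alpha)%:E]].

End Norms.

Section Circles.
Context {R : realType}.
Implicit Types (x z : plane R) (r : R) (g dg : plane R -> R).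

Definition circle_integral z r g : R :=
  r * \int[@lebesgue_measure R]_(t in `[0, 2 * pi])
        g (z.1 + r * cos t, z.2 + r * sin t).

Definition outer_normal z r x : plane R :=
  ((x.1 - z.1) / r, (x.2 - z.2) / r).

(* counterclockwise arclength parametrization of circle z r, equal to x at 0 *)
Definition arclength z r x (t : R) : plane R :=
  (z.1 + cos (t / r) * (x.1 - z.1) - sin (t / r) * (x.2 - z.2),
   z.2 + sin (t / r) * (x.1 - z.1) + cos (t / r) * (x.2 - z.2)).

Definition tangential_derivative {n} (z : 'I_n.+1 -> plane R) (r : 'I_n.+1 -> R)
    g dg : Prop :=
  forall k x, circle (z k) (r k) x ->
    is_derive (0 : R) (1 : R) (fun t : R => g (arclength (z k) (r k) x t)) (dg x).

(* g is of class C^{1,alpha} on the union of the circles, and g' = dg there;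
   the values of g and dg elsewhere are irrelevant *)
Definition C1alpha {n} (alpha : R) (z : 'I_n.+1 -> plane R) (r : 'I_n.+1 -> R)
    g dg : Prop :=
  tangential_derivative z r g dg /\
  (holder Num.norm alpha (circles z r) dg < +oo)%E.

End Circles.

Section Derivatives.
Context {R : realType}.
Implicit Types (f : plane R -> R) (x : plane R).

Definition e1 : plane R := (1, 0).
Definition e2 : plane R := (0, 1).

Definition partial1 f x : R := 'D_e1 f x.
Definition partial2 f x : R := 'D_e2 f x.

Definition grad f x : plane R := (partial1 f x, partial2 f x).

Definition hess f x : plane R * plane R :=
  (grad (partial1 f) x, grad (partial2 f) x).

Definition laplacian f x : R :=
  partial1 (partial1 f) x + partial2 (partial2 f) x.

(* f is of class C^m on the open set U *)
Fixpoint Ck (m : nat) (U : set (plane R)) (f : plane R -> R) : Prop :=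
  (forall x, U x -> {for x, continuous f}) /\
  match m with
  | 0 => True
  | m'.+1 => [/\ forall x, U x -> derivable f x e1 /\ derivable f x e2,
                 Ck m' U (partial1 f) & Ck m' U (partial2 f)]
  end.

End Derivatives.

Section Sobolev.
Context {R : realType}.
Variable E : set (plane R).
Implicit Types (f phi psi : plane R -> R) (G : plane R -> plane R).

Definition L2norm {W : Type} (N : W -> R) (f : plane R -> W) : \bar R :=
  ((\int[area R]_(x in E) (N (f x) ^+ 2)%:E) `^ 2^-1)%E.

Definition L2 f : Prop :=
  measurable_fun (E : set (mplane R)) (f : mplane R -> R) /\ (L2norm Num.norm f < +oo)%E.

Definition test_function psi : Prop :=
  [/\ forall m, Ck m setT psi,
      compact (closure [set x | psi x != 0]) &
      closure [set x | psi x != 0] `<=` E].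

Definition weak_gradient phi G : Prop :=
  forall psi, test_function psi ->
    (\int[area R]_(x in E) (phi x * partial1 psi x) =
       - \int[area R]_(x in E) ((G x).1 * psi x)) /\
    (\int[area R]_(x in E) (phi x * partial2 psi x) =
       - \int[area R]_(x in E) ((G x).2 * psi x)).

(* phi is in H^1(E), with weak gradient G *)
Definition H1 phi G : Prop :=
  [/\ L2 phi, L2 (fst \o G), L2 (snd \o G) & weak_gradient phi G].

Definition poincare : \bar R :=
  ereal_sup [set e | exists phi G,
    [/\ H1 phi G, L2norm enorm G = 1%E,
        \int[area R]_(x in E) phi x = 0 & e = L2norm Num.norm phi]].

Definition Bconst (n : nat) (d r0 : R) : \bar R :=
  ((area R) E `^ 2^-1 * poincare *
   ((d `^ (- 2^-1))%:E * poincare + (d `^ 2^-1)%:E) *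
   (n%:R `^ 2^-1 * r0 `^ 2^-1)%:E)%E.

End Sobolev.

Section Neumann.
Context {R : realType} {n : nat}.
Variables (z : 'I_n.+1 -> plane R) (r : 'I_n.+1 -> R).
Let E := holed_disk z r.

(* Classical solution, of class C^2(E) and C^1 up to the boundary: the gradient
   of u has a continuous extension G to the closure of E, which gives a meaning
   to the normal derivative on each boundary circle.  On all the circles the
   normal points out of the disk they bound, hence into E on the inner ones. *)
Definition neumann_solution (g u : plane R -> R) : Prop :=
  [/\ Ck 2 E u,
      {within closure E, continuous u},
      exists G : plane R -> plane R,
        [/\ {within closure E, continuous G},
            forall x, E x -> G x = grad u x &
            forall k x, circle (z k) (r k) x ->
              dot (G x) (outer_normal (z k) (r k) x) = g x],
      forall x, E x -> laplacian u x = 0 &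
      \int[area R]_(x in E) u x = 0].

End Neumann.

(* Main.v *)
(* Two mechanisms are combined.

   Globally, testing the equation with [u] bounds the Dirichlet integral of [u]
   by the supremum of [g] times the mass of [|u|] on the circles, and the mass on
   a circle is bounded by an integral over an adjacent shell whose width is
   comparable to [d].  With the Poincare inequality this bounds the integral of
   [|u|] by a multiple of [B] times the supremum of [g], and the mean value
   property then controls every derivative of [u] at distance [d / 32] from the
   boundary.

   Near a circle of centre [c] and radius [r], [w = r^-1 (x - c) . Du] is harmonic
   with trace [g].  A barrier gives [|w(x) - g(x0)| <= K |x - x0|^a] for every [x0]
   on the circle, hence [|Dw| <= K' s^(a - 1)] where [s] is the distance to the
   circle.  Since [D_i u + (x - c) . D(D_i u) = r D_i w], integration along the rays
   from [c] bounds [Du], and it also bounds [D^2 u] by a multiple of [s^(a - 1)], from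
   which the Hoelder bound follows as in the lemma of Hardy and Littlewood.
   The second derivatives are treated in the same way, starting from the angular
   derivative of [u], which is harmonic with Neumann datum [r g']. *)

(* No line integral over a circle appears in the energy argument. The measure on a circle is
   replaced by [dcut e] of [sg * (|y - c| ^ 2 - r ^ 2)], a density on a thin shell, so the
   divergence theorem is needed only for compactly supported fields, and the Neumann datum enters as
   a limit when the shell shrinks. Shells of different circles are disjoint, so the sum of all
   traces costs a single integral over [E], and the number of holes enters only through the sum of
   the radii.

   The gradient of [u] is merely continuous up to the circles, so the boundary condition cannot be
   differentiated. Difference quotients under rotations about the centre take the place of the
   angular derivative of [wnor]: they are harmonic, their traces are difference quotients of [g],
   and the bounds are uniform in the angle. Since angular and radial derivatives are harmonic
   conjugates, the limit bounds the gradient of the radial derivative.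

   As for the powers of [d] next to [B]: a mean value over a disk of radius comparable to [d] costs
   [d ^- 2], each derivative a further [d^-1], and [d <= r0] trades powers of [d] for powers of
   [r0]. *)
From HB Require Import structures.
Require Import Defs.
From mathcomp Require Import ring lra zify.
Import Order.TTheory GRing.Theory Num.Theory.
Import numFieldNormedType.Exports.

Set Implicit Arguments.
Unset Strict Implicit.
Unset Printing Implicit Defensive.

Local Open Scope classical_set_scope.
Local Open Scope ring_scope.

(** * Calculus in the plane *)

Section EnormFacts.
Context {R : realType}.
Implicit Types (x y z : plane R) (a : R).

Lemma sqr_enorm x : enorm x ^+ 2 = x.1 ^+ 2 + x.2 ^+ 2.
Proof. by rewrite sqr_sqrtr// addr_ge0// sqr_ge0. Qed.

Lemma enorm_ge0 x : 0 <= enorm x.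
Proof. exact: sqrtr_ge0. Qed.

Lemma le_enorm x a : 0 <= a -> x.1 ^+ 2 + x.2 ^+ 2 <= a ^+ 2 -> enorm x <= a.
Proof.
by move=> a0 h; rewrite -(ler_pXn2r (n:=2))// ?nnegrE ?enorm_ge0// sqr_enorm.
Qed.

Lemma dot_le x y : `|dot x y| <= enorm x * enorm y.
Proof.
rewrite -(ler_pXn2r (n:=2))// ?nnegrE ?mulr_ge0 ?enorm_ge0//.
rewrite real_normK ?num_real// exprMn !sqr_enorm /dot.
have := sqr_ge0 (x.1 * y.2 - x.2 * y.1); nra.
Qed.

Lemma enormD x y : enorm (x + y) <= enorm x + enorm y.
Proof.
apply: le_enorm; first by rewrite addr_ge0// enorm_ge0.
have := le_trans (ler_norm _) (dot_le x y).
rewrite /dot => h; rewrite (sqrrD (enorm x)) !sqr_enorm -mulr_natl /=; nra.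
Qed.

Lemma enormN x : enorm (- x) = enorm x.
Proof. by rewrite /enorm /= !sqrrN. Qed.

Lemma enorm_sym x y : enorm (x - y) = enorm (y - x).
Proof. by rewrite -enormN opprB. Qed.

Lemma enormZ a x : enorm (a *: x) = `|a| * enorm x.
Proof.
rewrite /enorm /= /GRing.scale /= !exprMn -mulrDr sqrtrM ?sqr_ge0//.
by rewrite sqrtr_sqr.
Qed.

Lemma enorm0 : enorm (0 : plane R) = 0.
Proof. by rewrite /enorm /= expr0n /= addr0 sqrtr0. Qed.

Lemma enorm_eq0 x : (enorm x == 0) = (x == 0).
Proof.
apply/eqP/eqP => [h|->]; last exact: enorm0.
have := sqr_enorm x; rewrite h expr0n /= => /esym/eqP.
rewrite paddr_eq0 ?sqr_ge0// !sqrf_eq0 => /andP[/eqP h1 /eqP h2].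
by rewrite [x]surjective_pairing h1 h2.
Qed.

Lemma enorm_gt0 x : (0 < enorm x) = (x != 0).
Proof. by rewrite lt_def enorm_eq0 enorm_ge0 andbT. Qed.

Lemma enorm_sub x y z : enorm (x - z) <= enorm (x - y) + enorm (y - z).
Proof. by rewrite -[x - z](subrKA y); exact: enormD. Qed.

Lemma enormB_le x y : enorm x - enorm y <= enorm (x - y).
Proof. by rewrite lerBlDr -{1}[x](subrK y); exact: enormD. Qed.

Lemma abs1_le_enorm x : `|x.1| <= enorm x.
Proof.
by rewrite -sqrtr_sqr ler_sqrt ?lerDl ?sqr_ge0// addr_ge0 ?sqr_ge0.
Qed.

Lemma abs2_le_enorm x : `|x.2| <= enorm x.
Proof.
by rewrite -sqrtr_sqr ler_sqrt ?lerDr ?sqr_ge0// addr_ge0 ?sqr_ge0.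
Qed.

Lemma norm_le_enorm x : `|x| <= enorm x.
Proof. by rewrite prod_normE ge_max abs1_le_enorm abs2_le_enorm. Qed.

Lemma enorm_le_norm x : enorm x <= 2 * `|x|.
Proof.
apply: le_enorm; first by rewrite mulr_ge0.
have h1 : `|x.1| <= `|x| by rewrite prod_normE le_max lexx.
have h2 : `|x.2| <= `|x| by rewrite prod_normE le_max lexx orbT.
have := normr_ge0 x.1; have := normr_ge0 x.2; have := normr_ge0 x.
rewrite -(real_normK (num_real x.1)) -(real_normK (num_real x.2)); nra.
Qed.

Lemma enorm_le_abs x : enorm x <= `|x.1| + `|x.2|.
Proof.
apply: le_enorm; first by rewrite addr_ge0.
rewrite -(real_normK (num_real x.1)) -(real_normK (num_real x.2)).
have := normr_ge0 x.1; have := normr_ge0 x.2; nra.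
Qed.

(** The product topology is that of the max norm, which is within a factor 2 of [enorm]; from here
    on neighbourhood arguments run with Euclidean disks. *)
Lemma nbhs_diskP x (A : set (plane R)) :
  nbhs x A <-> exists2 e, 0 < e & disk x e `<=` A.
Proof.
split.
  move=> /nbhs_ballP[e /= e0 h]; exists e => // y hy; apply: h.
  rewrite -ball_normE /=; apply: le_lt_trans (norm_le_enorm _) _.
  by rewrite enorm_sym.
move=> [e e0 h]; apply/nbhs_ballP; exists (e / 2) => /=; first by rewrite divr_gt0.
move=> y; rewrite -ball_normE /= => hy; apply: h; rewrite /disk /=.
apply: le_lt_trans (enorm_le_norm _) _.
by rewrite distrC; lra.
Qed.

Lemma enorm_continuous z : continuous (fun x => enorm (x - z)).
Proof.
move=> x; apply/cvgrPdist_le => e e0; apply/nbhs_diskP; exists e => // y hy /=.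
rewrite ler_norml; apply/andP; split.
  rewrite lerNl opprB; apply: le_trans (enormB_le _ _) _.
  by rewrite opprB subrKA ltW.
apply: le_trans (enormB_le _ _) _.
by rewrite opprB subrKA enorm_sym ltW.
Qed.

Lemma disk_open z a : open (disk z a).
Proof.
rewrite (_ : disk z a = (fun x => enorm (x - z)) @^-1` [set t | t < a]) //.
apply: open_comp; last exact: open_lt.
by move=> x _; exact: enorm_continuous.
Qed.

Lemma disk_center z a : 0 < a -> disk z a z.
Proof. by rewrite /disk /= subrr enorm0. Qed.

Lemma cdisk_closed z a : closed [set x | enorm (x - z) <= a].
Proof.
rewrite (_ : [set x | _] = (fun x => enorm (x - z)) @^-1` [set t | t <= a]) //.
by apply: closed_comp; [move=> x _; exact: enorm_continuous|exact: closed_le].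
Qed.

Lemma closed_bounded_compact (K : set (plane R)) M :
  closed K -> (forall x, K x -> enorm x <= M) -> compact K.
Proof.
move=> cK KM.
apply: (subclosed_compact cK (B := `[- M, M] `*` `[- M, M])).
  by apply: compact_setX; exact: segment_compact.
move=> x /KM h; split; rewrite /= in_itv /= -ler_norml.
  exact: le_trans (abs1_le_enorm _) h.
exact: le_trans (abs2_le_enorm _) h.
Qed.

End EnormFacts.

(** * Functions of class C^k on an open set *)

Section CkTheory.
Context {R : realType}.
Implicit Types (U V : set (plane R)) (f g : plane R -> R) (x : plane R).

(** Coordinates are indexed by booleans, so that one lemma about [pd i] covers both partial
    derivatives; [pd false] and [pd true] unfold to [partial1] and [partial2]. *)
Definition ee (i : bool) : plane R := if i then e2 else e1.
Definition co (i : bool) x : R := if i then x.2 else x.1.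
Definition pd (i : bool) f x : R := 'D_(ee i) f x.

Lemma CkS m U f : Ck m.+1 U f <->
  [/\ forall x, U x -> {for x, continuous f},
      forall i x, U x -> derivable f x (ee i) & forall i, Ck m U (pd i f)].
Proof.
split.
  case=> cf [df h1 h2]; split; [exact: cf| |by case].
  move=> i x Ux; have [d1 d2] := df x Ux.
  case: i; [exact: d2|exact: d1].
case=> cf df h; split => //; split; last 2 first.
- exact: (h false).
- exact: (h true).
by move=> x Ux; split; [exact: (df false)|exact: (df true)].
Qed.

Lemma Ck_continuous m U f x : Ck m U f -> U x -> {for x, continuous f}.
Proof. by case: m => [|m] [+ _]; apply. Qed.

Lemma Ck_derivable m U f i x : Ck m.+1 U f -> U x -> derivable f x (ee i).
Proof. by move=> /CkS[_ + _]; apply. Qed.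

Lemma Ck_pd m U f i : Ck m.+1 U f -> Ck m U (pd i f).
Proof. by move=> /CkS[_ _ +]; apply. Qed.

Lemma Ck_pred m U f : Ck m.+1 U f -> Ck m U f.
Proof.
elim: m f => [|m IH] f; first by case.
by move=> /CkS[h1 h2 h3]; apply/CkS; split => // i; exact: IH.
Qed.

Lemma Ck_leq m k U f : (k <= m)%N -> Ck m U f -> Ck k U f.
Proof.
elim: m => [|m IH]; first by rewrite leqn0 => /eqP ->.
rewrite leq_eqVlt => /predU1P[-> //|]; rewrite ltnS => km /Ck_pred.
exact: IH.
Qed.

Lemma Ck_subset m U V f : V `<=` U -> Ck m U f -> Ck m V f.
Proof.
move=> VU; elim: m f => [|m IH] f.
  by case=> h _; split => // x /VU; exact: h.
move=> /CkS[h1 h2 h3]; apply/CkS; split.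
- by move=> x /VU; exact: h1.
- by move=> i x /VU; exact: h2.
- by move=> i; exact: IH.
Qed.

(** Every clause of [Ck] is a statement at a point, so the property is local and can be checked on
    an arbitrary cover. *)
Lemma Ck_bigcup m U f :
  (forall x, U x -> exists2 V : set (plane R), V x & Ck m V f) -> Ck m U f.
Proof.
elim: m f => [|m IH] f h.
  by split => // x /h[V Vx [+ _]]; apply.
apply/CkS; split.
- by move=> x /h[V Vx /CkS[+ _ _]]; apply.
- by move=> i x /h[V Vx /CkS[_ + _]]; apply.
- by move=> i; apply: IH => x /h[V Vx /CkS[_ _ hV]]; exists V.
Qed.

Lemma near_eq_open U f g x : open U -> (forall y, U y -> f y = g y) -> U x ->
  {near x, f =1 g}.
Proof. by move=> oU fg Ux; near=> y; apply: fg; near: y; exact: open_nbhs_nbhs.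
Unshelve. all: by end_near. Qed.

Lemma pd_ext U f g i x : open U -> (forall y, U y -> f y = g y) -> U x ->
  pd i f x = pd i g x.
Proof. by move=> oU fg Ux; apply: near_eq_derive; exact: near_eq_open Ux. Qed.

Lemma Ck_ext m U f g : open U -> (forall x, U x -> f x = g x) ->
  Ck m U f -> Ck m U g.
Proof.
move=> oU; have cont f' g' : (forall x, U x -> f' x = g' x) ->
    (forall x, U x -> {for x, continuous f'}) ->
    forall x, U x -> {for x, continuous g'}.
  move=> fg cf x Ux; have n := near_eq_open oU fg Ux.
  rewrite /continuous_at /prop_for -(fg _ Ux).
  by apply: cvg_trans (cf _ Ux); exact: near_eq_cvg.
elim: m f g => [|m IH] f g fg.
  by case=> h _; split => //; exact: cont fg h.
move=> /CkS[h1 h2 h3]; apply/CkS; split.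
- exact: cont fg h1.
- move=> i x Ux.
  by apply: near_eq_derivable (h2 i x Ux); exact: near_eq_open Ux.
- move=> i; apply: IH (h3 i) => x Ux; exact: pd_ext Ux.
Qed.

Lemma Ck_cst m U (c : R) : Ck m U (fun=> c).
Proof.
elim: m c => [|m IH] c; first by split => // x _; exact: cvg_cst.
apply/CkS; split => [x _|i x _|i]; [exact: cvg_cst|exact: derivable_cst|].
rewrite (_ : pd i _ = fun=> 0)//; apply/funext => x.
exact: derive_cst.
Qed.

Lemma is_derive_co i j x : is_derive x (ee j) (co i) ((i == j)%:R).
Proof.
have dd : is_diff x (co i) (co i).
  have lin : linear (co i) by move=> a u v; case: i.
  have cl : continuous (co i : plane R -> R).
    by case: i {lin} => y; [exact: cvg_snd|exact: cvg_fst].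
  pose l : {linear plane R -> R} :=
    HB.pack (co i) (GRing.isLinear.Build R (plane R) R _ (co i) lin).
  by split; [exact: (@linear_differentiable _ _ _ l)|exact: (@diff_lin _ _ _ l)].
apply: DeriveDef; first exact: diff_derivable.
rewrite deriveE ?diff_val//.
by case: i {dd}; case: j.
Qed.

Lemma pd_co i j x : pd j (co i) x = (i == j)%:R.
Proof. by rewrite /pd (@derive_val _ _ _ _ _ _ _ (is_derive_co i j x)). Qed.

Lemma Ck_co m U i : Ck m U (co i).
Proof.
have cc : continuous (co i : plane R -> R).
  by case: i => x; [exact: cvg_snd|exact: cvg_fst].
case: m => [|m]; first by split => // x _; exact: cc.
apply/CkS; split => [x _|j x _|j].
- exact: cc.
- by have [] := is_derive_co i j x.
- rewrite (_ : pd j _ = fun=> (i == j)%:R); first exact: Ck_cst.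
  by apply/funext => x; exact: pd_co.
Qed.

Lemma pdD i f g x : derivable f x (ee i) -> derivable g x (ee i) ->
  pd i (fun y => f y + g y) x = pd i f x + pd i g x.
Proof. exact: deriveD. Qed.

Lemma pdM i f g x : derivable f x (ee i) -> derivable g x (ee i) ->
  pd i (fun y => f y * g y) x = f x * pd i g x + g x * pd i f x.
Proof. exact: deriveM. Qed.

Lemma pdZ i (c : R) f x : derivable f x (ee i) ->
  pd i (fun y => c * f y) x = c * pd i f x.
Proof. by move=> df; rewrite -[RHS](deriveZ c df). Qed.

Lemma CkD m U f g : open U -> Ck m U f -> Ck m U g ->
  Ck m U (fun x => f x + g x).
Proof.
move=> oU; elim: m f g => [|m IH] f g.
  by move=> [hf _] [hg _]; split => // x Ux; apply: cvgD; [exact: hf|exact: hg].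
move=> /CkS[f1 f2 f3] /CkS[g1 g2 g3]; apply/CkS; split.
- by move=> x Ux; apply: cvgD; [exact: f1|exact: g1].
- by move=> i x Ux; apply: derivableD; [exact: f2|exact: g2].
- move=> i; apply: Ck_ext (IH _ _ (f3 i) (g3 i)) => // x Ux.
  by rewrite pdD//; [exact: f2|exact: g2].
Qed.

Lemma CkM m U f g : open U -> Ck m U f -> Ck m U g ->
  Ck m U (fun x => f x * g x).
Proof.
move=> oU; elim: m f g => [|m IH] f g.
  by move=> [hf _] [hg _]; split => // x Ux; apply: cvgM; [exact: hf|exact: hg].
move=> hf hg; move: (hf) (hg) => /CkS[f1 f2 f3] /CkS[g1 g2 g3].
apply/CkS; split.
- by move=> x Ux; apply: cvgM; [exact: f1|exact: g1].
- by move=> i x Ux; apply: derivableM; [exact: f2|exact: g2].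
- move=> i.
  apply: Ck_ext (CkD oU (IH _ _ (Ck_pred hf) (g3 i))
                        (IH _ _ (Ck_pred hg) (f3 i))) => // x Ux.
  by rewrite pdM//; [exact: f2|exact: g2].
Qed.

Lemma CkZ m U (c : R) f : open U -> Ck m U f -> Ck m U (fun x => c * f x).
Proof. by move=> oU hf; apply: CkM => //; exact: Ck_cst. Qed.

Lemma CkN m U f : open U -> Ck m U f -> Ck m U (fun x => - f x).
Proof.
move=> oU hf; apply: Ck_ext (CkZ (-1) oU hf) => // x _.
by rewrite mulN1r.
Qed.

Lemma CkB m U f g : open U -> Ck m U f -> Ck m U g ->
  Ck m U (fun x => f x - g x).
Proof. by move=> oU hf hg; apply: CkD => //; exact: CkN. Qed.

Lemma Ck_sum (I : Type) (r : seq I) (P : pred I) m U (F : I -> plane R -> R) :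
  open U -> (forall i, P i -> Ck m U (F i)) ->
  Ck m U (fun x => \sum_(i <- r | P i) F i x).
Proof.
move=> oU h; elim: r => [|a r IH].
  apply: Ck_ext (Ck_cst m U 0) => // x _; by rewrite big_nil.
case Pa : (P a).
  apply: Ck_ext (CkD oU (h a Pa) IH) => // x _; by rewrite big_cons Pa.
by apply: Ck_ext IH => // x _; rewrite big_cons Pa.
Qed.

(** The plane is covered by [U], where the regularity is assumed, and by the open complement of [K],
    where the function is 0. *)
Lemma Ck_extend0 m U K f : open U -> closed K -> K `<=` U ->
  (forall x, ~ K x -> f x = 0) -> Ck m U f -> Ck m setT f.
Proof.
move=> oU cK KU f0 hf; apply: Ck_bigcup => x _.
have [Kx|nKx] := pselect (K x); first by exists U => //; exact: KU.
exists (~` K) => //; apply: Ck_ext (Ck_cst m _ 0); first exact: closed_openC.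
by move=> y /f0.
Qed.

End CkTheory.

(** * Differentiability, mean values and mixed derivatives *)

Section Differentiability.
Context {R : realType}.
Implicit Types (U V : set (plane R)) (f g : plane R -> R) (x v : plane R).

Lemma is_derive_line f x v (s : R) : derivable f (x + s *: v) v ->
  is_derive s 1 (fun t : R => f (x + t *: v)) ('D_v f (x + s *: v)).
Proof.
move=> df.
have E : (fun h : R => h^-1 *: ((fun t : R => f (x + t *: v)) (h *: 1 + s)
             - f (x + s *: v)))
       = (fun h : R => h^-1 *: (f (h *: v + (x + s *: v)) - f (x + s *: v))).
  apply/funext => h; congr (_ *: (f _ - _)).
  by rewrite [h *: (1 : R)]mulr1 scalerDl addrCA.
by apply: DeriveDef; rewrite /derivable /derive /= E.
Qed.

(** The intermediate point is parametrized by [s * c] with [s] in the unit interval, so that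
    increments of either sign are treated alike. *)
Lemma mvt_e i f x (c : R) :
  (forall s : R, 0 <= s <= 1 -> derivable f (x + (s * c) *: ee i) (ee i)) ->
  exists2 s : R, 0 <= s <= 1 &
    f (x + c *: ee i) - f x = c * pd i f (x + (s * c) *: ee i).
Proof.
move=> df.
have D (s : R) : 0 <= s <= 1 ->
    is_derive s (1 : R) (fun t : R => f (x + (t * c) *: ee i))
      (c * pd i f (x + (s * c) *: ee i)).
  move=> s01.
  have h := is_derive_line (df _ s01).
  have hc : is_derive s (1:R) ( *%R^~ c) c.
    have := @is_deriveM _ _ id (cst c) s 1 1 0 (is_derive_id _ _) (is_derive_cst _ _ _).
    by rewrite /= scaler0 add0r [_ *: _]mulr1.
  by have := is_derive1_comp (f := fun t => f (x + t *: ee i)) (g := fun t => t * c) h hc; rewrite mulrC.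
have [|s s01 E] := @MVT_segment R (fun t : R => f (x + (t * c) *: ee i))
   (fun s => c * pd i f (x + (s * c) *: ee i)) 0 1 ler01
   (fun s hs => D s (subset_itv_oo_cc hs)).
  apply: derivable_within_continuous => s; rewrite in_itv /= => s01.
  by have [] := D s s01.
exists s; first by move: s01; rewrite in_itv.
by move: E; rewrite mul1r mul0r scale0r addr0 subr0 mulr1.
Qed.

Lemma enorm_ee i : enorm (ee i : plane R) = 1.
Proof. by case: i; rewrite /enorm /= expr0n /= expr1n ?add0r ?addr0 sqrtr1. Qed.

Lemma plane_decomp x : x = x.1 *: ee false + x.2 *: ee true.
Proof.
case: x => a b; congr pair; rewrite /= /GRing.scale /=.
  by rewrite mulr1 mulr0 addr0.
by rewrite mulr1 mulr0 add0r.
Qed.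

Lemma near_continuous f x (e : R) : {for x, continuous f} -> 0 < e ->
  exists2 r : R, 0 < r & forall y, disk x r y -> `|f y - f x| <= e.
Proof.
move=> cf e0; have /cvgrPdist_le/(_ _ e0)/nbhs_diskP[r r0 h] := cf.
by exists r => // y /h; rewrite distrC.
Qed.

Lemma disk_nbhs U x : open U -> U x -> exists2 r : R, 0 < r & disk x r `<=` U.
Proof. by move=> oU Ux; apply/nbhs_diskP; exact: open_nbhs_nbhs. Qed.

Lemma diskD x v (r : R) : enorm v < r -> disk x r (x + v).
Proof. by rewrite /disk /= addrC addKr. Qed.

(** An increment is split into a horizontal leg followed by a vertical one. The mean value theorem
    on each leg leaves differences of partial derivatives at nearby points, which continuity makes
    small. *)
Lemma C1_is_diff U f x : open U -> Ck 1 U f -> U x ->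
  is_diff x f (fun h => h.1 * pd false f x + h.2 * pd true f x).
Proof.
move=> oU /CkS[_ df cf] Ux.
set L := (fun h : plane R => _).
have linL : linear L.
  move=> a [u1 u2] [v1 v2]; rewrite /L /= /GRing.scale /=.
  by move: (pd _ _ _) (pd _ _ _) => p q; ring.
pose l : {linear plane R -> R} := HB.pack L (GRing.isLinear.Build R (plane R) R _ L linL).
have cl : continuous l.
  move=> y; apply: cvgD; apply: cvgMl; [exact: cvg_fst|exact: cvg_snd].
suff E (e : R) : 0 < e ->
    \forall h \near (0 : plane R), `|f (h + x) - (f x + L h)| <= e * `|h|.
  have D : 'd f x = l :> (plane R -> R).
    by apply: diff_unique => //; apply/eqaddoP => e e0; exact: E.
  split; last by rewrite D.
  by apply/diff_locallyP; rewrite D; split => //; apply/eqaddoP => e e0; exact: E.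
move=> e0; apply/nbhs_diskP.
have e20 : 0 < e / 2 by rewrite divr_gt0.
have [r1 r10 h1] := near_continuous (Ck_continuous (cf false) Ux) e20.
have [r2 r20 h2] := near_continuous (Ck_continuous (cf true) Ux) e20.
have [r3 r30 h3] := disk_nbhs oU Ux.
set r := Num.min r1 (Num.min r2 r3).
have r0 : 0 < r by rewrite !lt_min r10 r20 r30.
exists (r / 2) => [|h]; first by rewrite divr_gt0.
rewrite /disk /= subr0 => hr.
have ha1 : `|h.1| < r / 2 by apply: le_lt_trans hr; exact: abs1_le_enorm.
have ha2 : `|h.2| < r / 2 by apply: le_lt_trans hr; exact: abs2_le_enorm.
have P s t : 0 <= s <= 1 -> 0 <= t <= 1 ->
    disk x r (x + ((s * h.1) *: ee false + (t * h.2) *: ee true)).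
  move=> /andP[s0 s1] /andP[t0 t1]; apply: diskD.
  apply: le_lt_trans (enormD _ _) _; rewrite !enormZ !enorm_ee !mulr1 !normrM.
  rewrite (ger0_norm s0) (ger0_norm t0).
  have := normr_ge0 h.1; have := normr_ge0 h.2; nra.
have sub y : disk x r y -> [/\ disk x r1 y, disk x r2 y & U y].
  rewrite /disk /= /r !lt_min => /andP[? /andP[? ?]]; split => //.
  exact: h3.
have [|s s01 E1] := @mvt_e false f x h.1.
  move=> s s01; apply: df; have := P s 0 s01; rewrite lexx ler01 mul0r scale0r addr0.
  by move=> /(_ isT)/sub[].
have [|t t01 E2] := @mvt_e true f (x + h.1 *: ee false) h.2.
  move=> t t01; apply: df; have := P 1 t; rewrite lexx ler01 mul1r addrA.
  by move=> /(_ isT t01)/sub[].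
have -> : h + x = x + h.1 *: ee false + h.2 *: ee true.
  by rewrite -addrA -plane_decomp addrC.
rewrite /L.
have -> : f (x + h.1 *: ee false + h.2 *: ee true) -
    (f x + (h.1 * pd false f x + h.2 * pd true f x)) =
    h.2 * (pd true f (x + h.1 *: ee false + (t * h.2) *: ee true) - pd true f x)
  + h.1 * (pd false f (x + (s * h.1) *: ee false) - pd false f x).
  rewrite !mulrBr -E1 -E2; move: (f _) (f (x + _)) (f x) => u1 u2 u3.
  move: (h.2 * _) (h.1 * _) => u4 u5.
  by ring.
have Q1 : `|pd false f (x + (s * h.1) *: ee false) - pd false f x| <= e / 2.
  apply: h1; have := P s 0 s01; rewrite lexx ler01 mul0r scale0r addr0.
  by move=> /(_ isT)/sub[].
have Q2 : `|pd true f (x + h.1 *: ee false + (t * h.2) *: ee true) - pd true f x| <= e / 2.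
  apply: h2; have := P 1 t; rewrite lexx ler01 mul1r addrA.
  by move=> /(_ isT t01)/sub[].
have N1 : `|h.1| <= `|h| by rewrite prod_normE le_max lexx.
have N2 : `|h.2| <= `|h| by rewrite prod_normE le_max lexx orbT.
move: Q1 Q2 N1 N2; move: (_ - pd false f x) (_ - pd true f x) => p q Q1 Q2 N1 N2.
move: `|h| N1 N2 => M N1 N2.
apply: le_trans (ler_normD _ _) _; rewrite !normrM.
rewrite (splitr e) mulrDl -![e / 2 * M]mulrC.
by apply: lerD; apply: ler_pM.
Qed.

Lemma C1_chain U f (c1 c2 : R -> R) (t a b : R) : open U -> Ck 1 U f ->
  U (c1 t, c2 t) -> is_derive t 1 c1 a -> is_derive t 1 c2 b ->
  is_derive t 1 (fun s => f (c1 s, c2 s))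
    (a * pd false f (c1 t, c2 t) + b * pd true f (c1 t, c2 t)).
Proof.
move=> oU cf Uc d1 d2.
have D := C1_is_diff oU cf Uc.
have D1 : is_diff t c1 ( *:%R^~ a).
  have [h1 h2] := d1; apply: DiffDef; first exact/derivable1_diffP.
  by rewrite deriv1E// derive1E h2.
have D2 : is_diff t c2 ( *:%R^~ b).
  have [h1 h2] := d2; apply: DiffDef; first exact/derivable1_diffP.
  by rewrite deriv1E// derive1E h2.
have D3 := @is_diff_comp _ _ _ _ _ _ _ _ _ (is_diff_pair D1 D2) D.
apply: DeriveDef; first by apply/derivable1_diffP; have [] := D3.
have -> : (fun s => f (c1 s, c2 s)) = f \o (fun s => (c1 s, c2 s)) by [].
by rewrite deriveE ?diff_val /= ?scale1r//; have [] := D3.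
Qed.

Lemma C1_derive_dir U f x v : open U -> Ck 1 U f -> U x ->
  is_derive x v f (v.1 * pd false f x + v.2 * pd true f x).
Proof.
move=> oU cf Ux; have D := C1_is_diff oU cf Ux.
apply: DeriveDef; first by apply: diff_derivable; have [] := D.
by rewrite deriveE ?diff_val//; have [] := D.
Qed.

Lemma C1_segment U f x v (L : R) : open U -> Ck 1 U f ->
  (forall s : R, 0 <= s <= 1 -> U (x + s *: v) /\
     enorm (grad f (x + s *: v)) <= L) ->
  `|f (x + v) - f x| <= L * enorm v.
Proof.
move=> oU cf h.
have D (s : R) : 0 <= s <= 1 ->
   is_derive s 1 (fun t : R => f (x + t *: v)) (dot v (grad f (x + s *: v))).
  move=> s01; have [Us _] := h s s01.
  have Ds := C1_derive_dir v oU cf Us.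
  have [dd E] := Ds.
  by apply: is_derive_eq (is_derive_line dd) _; rewrite E.
have [|s s01 E] := @MVT_segment R (fun t : R => f (x + t *: v))
   (fun s => dot v (grad f (x + s *: v))) 0 1 ler01
   (fun s hs => D s (subset_itv_oo_cc hs)).
  apply: derivable_within_continuous => s; rewrite in_itv /= => s01.
  by have [] := D s s01.
move: E; rewrite scale1r scale0r addr0 subr0 mulr1 => ->.
apply: le_trans (dot_le _ _) _; rewrite mulrC ler_wpM2r ?enorm_ge0//.
by have [] := h s s01.
Qed.

Lemma is_derive_translate f x v a : derivable f (x + a) v ->
  is_derive x v (fun y => f (y + a)) ('D_v f (x + a)).
Proof.
move=> df; apply: DeriveDef; rewrite /derivable /derive /=.
  by under eq_fun do rewrite -addrA.
by under eq_fun do rewrite -addrA.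
Qed.

(** The second difference on the left does not depend on the order of [i] and [j], while the mixed
    derivative on the right does; comparing the two orders is the proof of [schwarz]. *)
Lemma C2_mvt U f x i j (t r : R) : open U -> Ck 2 U f -> disk x r `<=` U ->
  0 <= t -> 2 * t < r ->
  exists2 y, disk x r y &
  f (x + t *: ee i + t *: ee j) - f (x + t *: ee i) - (f (x + t *: ee j) - f x)
    = t * (t * pd j (pd i f) y).
Proof.
move=> oU cf xU t0 tr.
have P (s s' : R) : 0 <= s <= 1 -> 0 <= s' <= 1 ->
    disk x r (x + (s * t) *: ee i + (s' * t) *: ee j).
  move=> /andP[s0 s1] /andP[s0' s1']; rewrite -addrA; apply: diskD.
  apply: le_lt_trans (enormD _ _) _; rewrite !enormZ !enorm_ee !mulr1.
  rewrite !ger0_norm ?mulr_ge0//; nra.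
have i01 : 0 <= (1 : R) <= 1 by rewrite ler01 lexx.
have i00 : 0 <= (0 : R) <= 1 by rewrite ler01 lexx.
have D (y : plane R) : U y -> derivable f y (ee i) by move=> Uy; exact: Ck_derivable cf Uy.
have DF (s : R) : 0 <= s <= 1 ->
    is_derive (x + (s * t) *: ee i) (ee i) (fun y => f (y + t *: ee j) - f y)
    (pd i f (x + (s * t) *: ee i + t *: ee j) - pd i f (x + (s * t) *: ee i)).
  move=> s01; apply: is_deriveB.
    by apply: is_derive_translate; apply: D; apply: xU; have := P s 1 s01 i01; rewrite mul1r.
  apply: derivableP; apply: D; apply: xU.
  by have := P s 0 s01 i00; rewrite mul0r scale0r addr0.
have [s s01|s s01 E1] := @mvt_e i (fun y => f (y + t *: ee j) - f y) x t.
  by have [] := DF s s01.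
have [s' s01'|s' s01' E2] := @mvt_e j (pd i f) (x + (s * t) *: ee i) t.
  by apply: (@Ck_derivable _ 0 U); [exact: Ck_pd cf|apply: xU; exact: P].
exists (x + (s * t) *: ee i + (s' * t) *: ee j); first exact: P.
by rewrite -E2 E1; congr (_ * _); have [] := DF s s01.
Qed.

Lemma schwarz U f x : open U -> Ck 2 U f -> U x ->
  pd true (pd false f) x = pd false (pd true f) x.
Proof.
move=> oU cf Ux; apply/eqP; rewrite -subr_eq0 -normr_le0.
apply/ler_addgt0Pr => e e0; rewrite add0r.
have e20 : 0 < e / 2 by rewrite divr_gt0.
have c2 i j : {for x, continuous (pd i (pd j f))}.
  by apply: (@Ck_continuous _ 0 U) => //; apply: Ck_pd; apply: Ck_pd.
have [r1 r10 h1] := near_continuous (c2 true false) e20.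
have [r2 r20 h2] := near_continuous (c2 false true) e20.
have [r3 r30 h3] := disk_nbhs oU Ux.
set r := Num.min r1 (Num.min r2 r3).
have r0 : 0 < r by rewrite !lt_min r10 r20 r30.
have sub y : disk x r y -> [/\ disk x r1 y, disk x r2 y & U y].
  rewrite /disk /= /r !lt_min => /andP[? /andP[? ?]]; split => //.
  exact: h3.
have xr : disk x r `<=` U by move=> y /sub[].
have t0 : 0 < r / 3 by rewrite divr_gt0.
have tr : 2 * (r / 3) < r by lra.
have [y ry E1] := C2_mvt false true oU cf xr (ltW t0) tr.
have [z rz E2] := C2_mvt true false oU cf xr (ltW t0) tr.
have E : pd true (pd false f) y = pd false (pd true f) z.
  apply: (mulfI (lt0r_neq0 t0)); apply: (mulfI (lt0r_neq0 t0)).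
  have Q : x + (r / 3) *: ee true + (r / 3) *: ee false =
    x + (r / 3) *: ee false + (r / 3) *: ee true by exact: addrAC.
  apply: etrans (esym E1) _; apply: etrans _ E2; rewrite Q {E1 Q}.
  by move: (f _) (f (x + _)) (f (x + _)) (f x) => a b c d; ring.
have /sub[/h1 H1 _ _] := ry; have /sub[_ /h2 H2 _] := rz.
apply: le_trans (ler_distD (pd false (pd true f) z) _ _) _.
rewrite (splitr e); apply: lerD; last exact: H2.
by rewrite -E distrC; exact: H1.
Qed.

End Differentiability.

Notation integ E f := ((area _).-integrable (E : set (mplane _)) (EFin \o f)).

(** * Measurability and integration in the plane *)

Section PlaneIntegral.
Context {R : realType}.
Implicit Types (U E : set (plane R)) (f g : plane R -> R) (x : plane R).

(** The product sigma-algebra is generated by measurable rectangles, so an open set is written as a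
    countable union of squares with rational centre. *)
Lemma open_measurable2 U : open U -> measurable (U : set (mplane R)).
Proof.
move=> oU.
pose rect (p : rat * rat * nat) : set (mplane R) :=
  `](ratr p.1.1 - p.2.+1%:R^-1), (ratr p.1.1 + p.2.+1%:R^-1)[ `*`
  `](ratr p.1.2 - p.2.+1%:R^-1), (ratr p.1.2 + p.2.+1%:R^-1)[.
pose F p := if `[< rect p `<=` U >] then rect p else set0.
have -> : U = \bigcup_p F p.
  apply/seteqP; split => x; last first.
    by move=> [p _]; rewrite /F; case: asboolP => // h /h.
  move=> Ux; have [r r0 xU] := disk_nbhs oU Ux.
  (* Two points of a square of half-side [e] around a centre within [e] of [x] differ from [x] by
     less than [2 * e] in each coordinate, hence by less than [4 * e < r] in [enorm]. *)
  have [k kr] : exists k : nat, k.+1%:R^-1 < r / 4.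
    have r40 : 0 < r / 4 by rewrite divr_gt0.
    exists (Num.truncn (r / 4)^-1); rewrite invf_plt ?posrE//.
    by apply: Num.Theory.truncnS_gt; rewrite invr_ge0 ltW.
  have : 0 < (k.+1%:R : R)^-1 by rewrite invr_gt0.
  move: kr (erefl (k.+1%:R^-1 : R)); move: {1 3 4}(k.+1%:R^-1 : R) => e er ee' e0.
  have [q1] : exists q : rat, ratr q \in `](x.1 - e), (x.1 + e)[.
    by have [|q] := @rat_in_itvoo R (x.1 - e) (x.1 + e); [lra|exists q].
  have [q2] : exists q : rat, ratr q \in `](x.2 - e), (x.2 + e)[.
    by have [|q] := @rat_in_itvoo R (x.2 - e) (x.2 + e); [lra|exists q].
  rewrite !in_itv /= => /andP[h1 h2] /andP[h3 h4].
  exists (q1, q2, k) => //; rewrite /F /rect /= ee'; case: asboolP => h.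
    by split; rewrite /= in_itv /=; apply/andP; split; lra.
  exfalso; apply: h => y [/=]; rewrite !in_itv /= => /andP[g1 g2] /andP[g3 g4].
  apply: xU; rewrite /disk /=; apply: le_lt_trans (enorm_le_abs _) _ => /=.
  have A : `|y.1 - x.1| < 2 * e by rewrite ltr_norml; apply/andP; split; lra.
  have B : `|y.2 - x.2| < 2 * e by rewrite ltr_norml; apply/andP; split; lra.
  lra.
apply: countable_bigcupT_measurable => [|p]; first exact: countableP.
rewrite /F; case: asboolP => // _.
by apply: measurableX; exact: measurable_itv.
Qed.

Lemma closed_measurable2 E : closed E -> measurable (E : set (mplane R)).
Proof.
move=> cE; rewrite -[E]setCK; apply: measurableC; apply: open_measurable2.
exact: closed_openC.
Qed.

Lemma open_continuous_measurable2 U f : open U ->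
  (forall x, U x -> {for x, continuous f}) ->
  measurable_fun (U : set (mplane R)) (f : mplane R -> R).
Proof.
move=> oU cf; apply: (measurability _ (measurable_realfun.RGenOpens.measurableE R)).
move=> _ [_ [a [b ->] <-]]; apply: open_measurable2.
rewrite openE => x [Ux xab]; apply: filterI; first exact: open_nbhs_nbhs.
by apply: cf => //; apply: open_nbhs_nbhs; split => //; exact: interval_open.
Qed.

Lemma continuous_measurable2 E f : measurable (E : set (mplane R)) ->
  continuous f -> measurable_fun (E : set (mplane R)) (f : mplane R -> R).
Proof.
move=> mE cf; apply: measurable_funTS.
by apply: open_continuous_measurable2 => [|x _]; [exact: openT|exact: cf].
Qed.

(** The circumscribed square suffices, as constants are followed only up to absolute factors. *)
Lemma area_disk_le x (r : R) : 0 < r -> (area R (disk x r) <= (4 * r ^+ 2)%:E)%E.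
Proof.
move=> r0.
pose I1 : set (measurableTypeR R) := [set` `[(x.1 - r), (x.1 + r)]].
pose I2 : set (measurableTypeR R) := [set` `[(x.2 - r), (x.2 + r)]].
apply: (@le_trans _ _ (area R (I1 `*` I2))).
  apply: le_measure; rewrite ?inE.
  - by apply: open_measurable2; exact: disk_open.
  - by apply: measurableX; exact: measurable_itv.
  - move=> y; rewrite /disk /= => h; rewrite /I1 /I2 /=.
    have h1 := le_lt_trans (abs1_le_enorm _) h.
    have h2 := le_lt_trans (abs2_le_enorm _) h.
    move: h1 h2; rewrite /= !ltr_norml => /andP[? ?] /andP[? ?].
    by split; rewrite /= in_itv /=; apply/andP; split; lra.
have E (a : R) : @lebesgue_measure R [set` `[(a - r), (a + r)]] = (2 * r)%:E.
  rewrite lebesgue_measure_itv /= lte_fin.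
  have -> : a - r < a + r by lra.
  by rewrite -EFinD; congr EFin; ring.
rewrite product_measure1E; try exact: measurable_itv.
rewrite [X in (X * _)%E](E x.1) [X in (_ * X)%E](E x.2) -EFinM lee_fin; nra.
Qed.

Lemma continuous_FTC0 (h h' : R -> R) (M : R) : 0 < M ->
  (forall t : R, is_derive t (1 : R) h (h' t)) -> continuous h' ->
  (forall t, M <= `|t| -> h t = 0) -> (forall t, M <= `|t| -> h' t = 0) ->
  (\int[@lebesgue_measure R]_t (h' t)%:E = 0)%E.
Proof.
move=> M0 dh ch h0 h'0.
rewrite (_ : (fun t => (h' t)%:E) = (fun t => (h' t)%:E) \_ `[(- M), M]); last first.
  apply/funext => t; rewrite patchE; case: ifPn => // /negP; rewrite inE /= in_itv /= => /negP.
  by rewrite -ler_norml -ltNge => /ltW/h'0 ->.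
have c : continuous h.
  by move=> t; apply/differentiable_continuous/derivable1_diffP; have [] := dh t.
rewrite -integral_mkcond (@continuous_FTC2 _ h' h).
- by rewrite !h0 ?subee// ?normrN ger0_norm// ltW.
- lra.
- exact: continuous_subspaceT.
- split.
  + by move=> t _; have [] := dh t.
  + by apply: cvg_at_right_filter; exact: c.
  + by apply: cvg_at_left_filter; exact: c.
- by move=> t _; rewrite derive1E; have [_ ->] := dh t.
Qed.

Lemma area_bounded_lty E (M : R) : measurable (E : set (mplane R)) ->
  (forall x, E x -> enorm x <= M) -> (area R E < +oo)%E.
Proof.
move=> mE EM; set r := `|M| + 1.
have r0 : 0 < r by rewrite ltr_wpDl.
apply: (@le_lt_trans _ _ (area R (disk 0 r))); last first.
  by apply: le_lt_trans (area_disk_le _ r0) _; rewrite ltry.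
apply: le_measure; rewrite ?inE//.
  by apply: open_measurable2; exact: disk_open.
move=> x /EM h; rewrite /disk /= subr0 /r; apply: le_lt_trans h _.
by apply: le_lt_trans (ler_norm _) _; rewrite ltrDl.
Qed.

Lemma integ_bounded E f (M C : R) : measurable (E : set (mplane R)) ->
  (forall x, E x -> enorm x <= M) ->
  measurable_fun (E : set (mplane R)) (f : mplane R -> R) ->
  (forall x, E x -> `|f x| <= C) -> integ E f.
Proof.
move=> mE EM mf fC; apply: measurable_bounded_integrable => //.
  exact: area_bounded_lty EM.
exists C; split; first exact: num_real.
by move=> y Cy x Ex; apply: le_trans (fC x Ex) (ltW Cy).
Qed.

Lemma compact_bounded_fun E f : compact E -> {within E, continuous f} ->
  exists2 C : R, 0 <= C & forall x, E x -> `|f x| <= C.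
Proof.
move=> cE cf; have [M [_ h]] := compact_bounded (continuous_compact cf cE).
exists (`|M| + 1) => [|x Ex]; first by rewrite addr_ge0.
by apply: h; [apply: le_lt_trans (ler_norm _) _; rewrite ltrDl|exists x].
Qed.

Lemma compact_support_bounded f (M : R) : continuous f ->
  (forall x, M <= enorm x -> f x = 0) ->
  exists2 C : R, 0 <= C & forall x, `|f x| <= C.
Proof.
move=> cf f0.
have cK : compact [set x : plane R | enorm (x - 0) <= M].
  apply: (closed_bounded_compact (M := M)); first exact: cdisk_closed.
  by move=> x /=; rewrite subr0.
have [C C0 h] := compact_bounded_fun cK (continuous_subspaceT cf).
exists C => // x; have [xM|/ltW/f0 ->] := leP (enorm x) M; last by rewrite normr0.
by apply: h; rewrite /= subr0.
Qed.

Lemma integ_compact_support f (M : R) : continuous f ->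
  (forall x, M <= enorm x -> f x = 0) -> integ setT f.
Proof.
move=> cf f0; have [C C0 h] := compact_support_bounded cf f0.
have mD : measurable (disk 0 M : set (mplane R)).
  by apply: open_measurable2; exact: disk_open.
have : integ (disk 0 M) f.
  apply: (integ_bounded (M := M) (C := C)) => //.
    by move=> x; rewrite /disk /= subr0 => /ltW.
  exact: continuous_measurable2.
rewrite integrable_mkcond//; congr (is_true (integrable _ _ _)).
apply/funext => x; rewrite patchE; case: ifPn => //= /negP.
by rewrite inE /disk /= subr0 => /negP; rewrite -leNgt => /f0 ->.
Qed.

Lemma continuous_pairl (a : R) : continuous (fun t : R => (a, t) : plane R).
Proof.
by move=> t; apply: differentiable_continuous; apply: differentiable_pair; [exact: differentiable_cst|].
Qed.

Lemma continuous_pairr (a : R) : continuous (fun t : R => (t, a) : plane R).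
Proof.
by move=> t; apply: differentiable_continuous; apply: differentiable_pair; [|exact: differentiable_cst].
Qed.

(* Fubini and the fundamental theorem of calculus on lines. *)
Lemma integral_pd_eq0 i f (M : R) : Ck 1 setT f ->
  (forall x, M <= enorm x -> f x = 0) -> \int[area R]_x pd i f x = 0.
Proof.
wlog M0 : M / 0 < M => [hw cf f0|].
  have M1 : 0 < `|M| + 1 by rewrite ltr_wpDl.
  apply: (hw _ M1) => // x h; apply: f0; apply: le_trans _ h.
  by apply: le_trans (ler_norm _) _; rewrite lerDl.
move=> cf f0.
have cp : continuous (pd i f).
  by move=> x; apply: (Ck_continuous (m := 0) (U := setT)) => //; exact: Ck_pd.
have p0 x : M < enorm x -> pd i f x = 0.
  move=> Mx; have oU : open [set y : plane R | M < enorm y].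
    rewrite (_ : mkset _ = (fun y : plane R => enorm (y - 0)) @^-1` [set t | M < t]).
      by apply: open_comp; [move=> y _; exact: enorm_continuous|exact: open_gt].
    by apply/funext => y; rewrite /= subr0.
  rewrite (pd_ext (g := fun=> 0) i oU)//; last by move=> y /= /ltW/f0.
  exact: derive_cst.
(* The derivative is known to vanish only strictly outside the ball of radius [M], hence the margin
   [M + 1]. *)
have ip : integ setT (pd i f).
  apply: (integ_compact_support (M := M + 1)) => // x h; apply: p0.
  by apply: lt_le_trans h; rewrite ltrDl.
rewrite /Rintegral.
have line (h h' : R -> R) : (forall t : R, is_derive t (1:R) h (h' t)) -> continuous h' ->
    (forall t, M + 1 <= `|t| -> h t = 0 /\ h' t = 0) ->
    (\int[@lebesgue_measure R]_t (h' t)%:E = 0)%E.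
  move=> dh ch hh; apply: (continuous_FTC0 (M := M + 1)) dh ch _ _.
  - by rewrite addr_gt0.
  - by move=> t /hh[].
  - by move=> t /hh[].
have big (x : plane R) : M + 1 <= `|x.1| \/ M + 1 <= `|x.2| -> f x = 0 /\ pd i f x = 0.
  move=> h; suff : M < enorm x by move=> hx; split; [apply: f0; exact: ltW|exact: p0].
  have := abs1_le_enorm x; have := abs2_le_enorm x; case: h => h; lra.
case: i cp p0 ip big => cp p0 ip big.
- rewrite -(integral12_prod_meas1 ip) /fubini_F /=.
  rewrite (eq_integral (fun=> 0%E)) ?integral0// => a _.
  apply: (line (fun t => f (a, t)) (fun t => pd true f (a, t))).
  + move=> t; have := is_derive_line (f := f) (x := (a, 0)) (v := ee true) (s := t).
    have E s : (a, 0) + s *: (ee true : plane R) = (a, s).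
      by congr pair; rewrite /= /GRing.scale /= ?mulr0 ?addr0 ?mulr1 ?add0r.
    rewrite E; under [in X in _ -> X]eq_fun do rewrite -E.
    by apply; exact: (Ck_derivable cf Logic.I).
  + move=> t; apply: (continuous_comp (f := fun t => (a, t)) (g := pd true f)); last exact: cp.
    exact: continuous_pairl.
  + by move=> t ht; apply: big; right.
- rewrite -(integral21_prod_meas1 ip) /fubini_G /=.
  rewrite (eq_integral (fun=> 0%E)) ?integral0// => a _.
  apply: (line (fun t => f (t, a)) (fun t => pd false f (t, a))).
  + move=> t; have := is_derive_line (f := f) (x := (0, a)) (v := ee false) (s := t).
    have E s : (0, a) + s *: (ee false : plane R) = (s, a).
      by congr pair; rewrite /= /GRing.scale /= ?mulr0 ?addr0 ?mulr1 ?add0r.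
    rewrite E; under [in X in _ -> X]eq_fun do rewrite -E.
    by apply; exact: (Ck_derivable cf Logic.I).
  + move=> t; apply: (continuous_comp (f := fun t => (t, a)) (g := pd false f)); last exact: cp.
    exact: continuous_pairr.
  + by move=> t ht; apply: big; left.
Qed.

End PlaneIntegral.

(** * Composition with functions of one variable, powers of the positive part *)

Section Composition.
Context {R : realType}.
Implicit Types (U : set (plane R)) (f g : plane R -> R) (x v : plane R).

Lemma is_derive_of_line f x v (a : R) :
  is_derive (0 : R) (1 : R) (fun t : R => f (x + t *: v)) a -> is_derive x v f a.
Proof.
have E : (fun h : R => h^-1 *: ((fun t : R => f (x + t *: v)) (h *: 1 + 0)
             - f (x + 0 *: v)))
       = (fun h : R => h^-1 *: (f (h *: v + x) - f x)).
  apply/funext => h; rewrite scale0r !addr0 [h *: (1 : R)]mulr1.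
  by rewrite (addrC x).
move=> [h1 h2]; apply: DeriveDef; first by move: h1; rewrite /derivable E.
by move: h2; rewrite /derive E.
Qed.

Lemma is_derive_comp (h : R -> R) f x v (a b : R) :
  is_derive (f x) (1 : R) h a -> is_derive x v f b ->
  is_derive x v (fun y => h (f y)) (a * b).
Proof.
move=> dh [df <-]; apply: is_derive_of_line.
have dl : derivable f (x + 0 *: v) v by rewrite scale0r addr0.
have := is_derive_line dl.
rewrite scale0r addr0 => d0.
apply: (is_derive1_comp (f := h) (g := fun t : R => f (x + t *: v))) => //.
by rewrite scale0r addr0.
Qed.

(** The difference quotient at 0 is [h] itself. This differentiates [pp] at its kink. *)
Lemma is_derive_mulX0 (h : R -> R) : {for 0, continuous h} ->
  is_derive (0 : R) (1 : R) (fun t : R => t * h t) (h 0).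
Proof.
move=> ch.
have E : {near (0 : R)^', h =1 (fun t : R => t^-1 *: ((t *: 1 + 0) * h (t *: 1 + 0) - 0 * h 0))}.
  near=> t; have t0 : t != 0 by near: t; exact: nbhs_dnbhs_neq.
  by rewrite addr0 [t *: (1 : R)]mulr1 mul0r subr0 /GRing.scale /= mulrA mulVf ?mul1r.
have L : (t^-1 *: ((t *: 1 + 0) * h (t *: 1 + 0) - 0 * h 0)) @[t --> (0 : R)^'] --> h 0.
  apply: cvg_trans; first exact: near_eq_cvg E.
  by apply: cvg_trans ch; apply: cvg_app; exact: cvg_within.
apply: DeriveDef; first by apply/cvg_ex; exists (h 0).
by apply: cvg_lim => //.
Unshelve. all: by end_near. Qed.

(** Truncated powers are the source of all kernels and cutoffs below: [pp m.+1] is of class C^m, and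
    its derivatives are again truncated powers. *)
Definition pp (m : nat) (t : R) : R := Num.max t 0 ^+ m.

Lemma pp_ge0 m t : 0 <= pp m t.
Proof. by rewrite exprn_ge0// le_max lexx orbT. Qed.

Lemma pp_le0 m t : t <= 0 -> pp m.+1 t = 0.
Proof. by move=> t0; rewrite /pp max_r// expr0n. Qed.

Lemma pp_pos m t : 0 <= t -> pp m t = t ^+ m.
Proof. by move=> t0; rewrite /pp max_l. Qed.

Lemma pp_le1 m t : t <= 1 -> pp m t <= 1.
Proof. by move=> t1; rewrite exprn_ile1 ?ge_max ?le_max ?lexx ?orbT ?ler01 ?t1. Qed.

Lemma ppS m t : pp m.+2 t = t * pp m.+1 t.
Proof.
have [t0|/ltW t0] := leP t 0; first by rewrite !pp_le0 ?mulr0.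
by rewrite !pp_pos// exprS.
Qed.

Lemma pp_continuous m : continuous (pp m).
Proof.
move=> t; apply: (continuous_comp (f := fun t : R => Num.max t 0) (g := fun t => t ^+ m)).
  by apply: continuous_max; [exact: cvg_id|exact: cvg_cst].
exact: exprn_continuous.
Qed.

Lemma is_derive_pp m (t : R) : is_derive t (1 : R) (pp m.+2) (m.+2%:R * pp m.+1 t).
Proof.
have [t0|t0|->] := ltgtP t 0.
- rewrite pp_le0 ?mulr0 ?(ltW t0)//.
  have E : {near t, (fun=> 0 : R) =1 pp m.+2}.
    near=> s; rewrite pp_le0//; apply: ltW; near: s.
    by apply: open_nbhs_nbhs; split => //; exact: open_lt.
  split; first by apply: near_eq_derivable E _; exact: derivable_cst.
  by rewrite -(near_eq_derive _ E) derive_cst.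
- rewrite pp_pos ?(ltW t0)//.
  have E : {near t, (fun s : R => s ^+ m.+2) =1 pp m.+2}.
    near=> s; rewrite pp_pos//; apply: ltW; near: s.
    by apply: open_nbhs_nbhs; split => //; exact: open_gt.
  split; first by apply: near_eq_derivable E _; exact: exprn_derivable.
  by rewrite -(near_eq_derive _ E) exp_derive /= /GRing.scale /= mulr1.
- rewrite pp_le0// mulr0; have := @is_derive_mulX0 (pp m.+1) (@pp_continuous _ _).
  rewrite pp_le0// (_ : (fun t => _) = pp m.+2)//.
  by apply/funext => s; rewrite ppS.
Unshelve. all: by end_near. Qed.

Lemma Ck_pp m U f : open U -> Ck m U f -> Ck m U (fun x => pp m.+1 (f x)).
Proof.
move=> oU; elim: m f => [|m IH] f hf.
  split => // x Ux; apply: (continuous_comp (f := f) (g := pp 1)).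
    by apply: (Ck_continuous hf).
  exact: pp_continuous.
have d i x : U x -> is_derive x (ee i) (fun x => pp m.+2 (f x))
    (m.+2%:R * pp m.+1 (f x) * pd i f x).
  move=> Ux; apply: is_derive_comp; first exact: is_derive_pp.
  exact: derivableP (Ck_derivable hf Ux).
apply/CkS; split.
- move=> x Ux; apply: (continuous_comp (f := f) (g := pp m.+2)).
    by apply: (Ck_continuous hf).
  exact: pp_continuous.
- by move=> i x Ux; have [] := d i x Ux.
- move=> i; apply: Ck_ext (CkM oU (CkZ m.+2%:R oU (IH _ (Ck_pred hf))) (Ck_pd i hf)) => //.
  by move=> x Ux; have [_] := d i x Ux.
Qed.

Lemma Ck_inv m U f : open U -> (forall x, U x -> f x != 0) -> Ck m U f ->
  Ck m U (fun x => (f x)^-1).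
Proof.
move=> oU f0; elim: m => [|m IH] hf.
  by split => // x Ux; apply: cvgV; [exact: f0|exact: (Ck_continuous hf)].
apply/CkS; split.
- by move=> x Ux; apply: cvgV; [exact: f0|exact: (Ck_continuous hf)].
- by move=> i x Ux; apply: derivableV; [exact: f0|exact: Ck_derivable hf Ux].
- move=> i; have h := IH (Ck_pred hf).
  apply: Ck_ext (CkZ (-1) oU (CkM oU (CkM oU h h) (Ck_pd i hf))) => // x Ux.
  rewrite /pd deriveV; [|exact: f0|exact: Ck_derivable hf Ux].
  by rewrite /GRing.scale /= mulN1r mulNr -expr2 exprVn.
Qed.

End Composition.

(** * Mean values and interior estimates of harmonic functions *)

Section Kernel.
Context {R : realType}.
Implicit Types (U : set (plane R)) (f g : plane R -> R) (x v c : plane R).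

Definition sq c x : R := (co false x - co false c) ^+ 2 + (co true x - co true c) ^+ 2.

Lemma sqE c x : sq c x = enorm (x - c) ^+ 2.
Proof. by rewrite sqr_enorm. Qed.

Lemma sq_ge0 c x : 0 <= sq c x.
Proof. by rewrite sqE exprn_ge0// enorm_ge0. Qed.

Lemma Ck_sq m U c : open U -> Ck m U (sq c).
Proof.
move=> oU; have h i : Ck m U (fun x => co i x - co i c).
  by apply: CkB => //; [exact: Ck_co|exact: Ck_cst].
apply: Ck_ext (CkD oU (CkM oU (h false) (h false)) (CkM oU (h true) (h true))) => //.
Qed.

Lemma is_derive_sq i c x : is_derive x (ee i) (sq c) (2 * (co i x - co i c)).
Proof.
have h j : is_derive x (ee i) (fun x => co j x - co j c) ((j == i)%:R).
  rewrite -[_%:R]subr0; apply: is_deriveB; exact: is_derive_co.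
have := is_deriveD (is_deriveX 2 (h false)) (is_deriveX 2 (h true)).
rewrite (_ : _ + _ = sq c)// => d; apply: is_derive_eq d _.
by case: i {h}; rewrite /GRing.scale /= expr1 ?mulr0 ?mulr1 ?addr0 ?add0r.
Qed.

(** For [0 < m] and [0 < s], a bump centred at [c] that vanishes outside the disk of radius
    [s ^ (-1/2)]. A power of a truncated quadratic is preferred to a smooth bump because its
    Laplacian has the explicit form of [ker_lap]. *)
Definition ker (m : nat) (s : R) c x : R := pp m (1 - s * sq c x).

Lemma Ck_ker m s c U : open U -> Ck m U (ker m.+1 s c).
Proof.
by move=> oU; apply: Ck_pp => //; apply: CkB => //; [exact: Ck_cst|apply: CkZ => //; exact: Ck_sq].
Qed.

Lemma is_derive_ker i m s c x :
  is_derive x (ee i) (ker m.+2 s c) (- (2 * m.+2%:R * s) * ((co i x - co i c) * ker m.+1 s c x)).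
Proof.
have d : is_derive x (ee i) (fun y => 1 - s * sq c y) (- (s * (2 * (co i x - co i c)))).
  have d := is_deriveB (is_derive_cst (1 : R) x (ee i)) (is_deriveZ s (is_derive_sq i c x)).
  by apply: is_derive_eq d _; rewrite sub0r.
have := is_derive_comp (is_derive_pp m (1 - s * sq c x)) d.
move=> d'; apply: is_derive_eq d' _; rewrite /ker; ring.
Qed.

Lemma pd_ker i m s c x : pd i (ker m.+2 s c) x =
  - (2 * m.+2%:R * s) * ((co i x - co i c) * ker m.+1 s c x).
Proof. by have [_] := is_derive_ker i m s c x. Qed.

Lemma ker_ge0 m s c x : 0 <= ker m s c x.
Proof. exact: pp_ge0. Qed.

Lemma ker_le1 m s c x : 0 <= s -> ker m s c x <= 1.
Proof. by move=> s0; rewrite pp_le1// gerBl mulr_ge0// sq_ge0. Qed.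

Lemma ker_eq0 m s c x : 1 <= s * sq c x -> ker m.+1 s c x = 0.
Proof. by move=> h; rewrite /ker pp_le0// subr_le0. Qed.

(** The last bracket is the derivative in [s] of [s * ker m.+2 s c x], see [is_derive_sker].
    Changing the scale of the normalized bump thus adds a Laplacian, which is orthogonal to harmonic
    functions; the mean value property follows without averages over circles. *)
Lemma ker_lap m s c x :
  pd false (pd false (ker m.+3 s c)) x + pd true (pd true (ker m.+3 s c)) x =
  - (4 * s * m.+3%:R) * (ker m.+2 s c x - m.+2%:R * s * sq c x * ker m.+1 s c x).
Proof.
have h i : pd i (pd i (ker m.+3 s c)) x =
    - (2 * m.+3%:R * s) * (ker m.+2 s c x + (co i x - co i c) *
      (- (2 * m.+2%:R * s) * ((co i x - co i c) * ker m.+1 s c x))).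
  have E : pd i (ker m.+3 s c) = fun x => - (2 * m.+3%:R * s) * ((co i x - co i c) * ker m.+2 s c x).
    by apply/funext => y; rewrite pd_ker.
  have d1 : is_derive x (ee i) (fun x => co i x - co i c) 1.
    rewrite -[1]subr0; apply: is_deriveB.
    by apply: is_derive_eq (is_derive_co i i x) _; rewrite eqxx.
  have d2 := is_derive_ker i m s c x.
  have d3 := is_deriveM d1 d2.
  have d := is_deriveZ (- (2 * m.+3%:R * s)) d3.
  rewrite E; have [_] := d; rewrite /pd => ->.
  by rewrite /GRing.scale /= mulr1 (addrC (ker _ _ _ _)).
by rewrite !h /sq; ring.
Qed.

End Kernel.

(** * Mean value property *)

Section MeanValue.
Context {R : realType}.
Implicit Types (U D : set (plane R)) (f g v : plane R -> R) (x y c : plane R).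

Definition harm U v := Ck 2 U v /\ forall x, U x -> laplacian v x = 0.

Lemma integ_continuous U D f (M : R) : open U -> closed D -> D `<=` U ->
  (forall x, D x -> enorm x <= M) -> (forall x, U x -> {for x, continuous f}) ->
  integ D f.
Proof.
move=> oU cD DU DM cf.
have kD : compact D := closed_bounded_compact cD DM.
have [|C C0 h] := @compact_bounded_fun _ D f kD.
  by apply: continuous_in_subspaceT => x /set_mem/DU; exact: cf.
apply: (integ_bounded (M := M) (C := C)) => //.
  exact: closed_measurable2.
apply: measurable_funS (open_continuous_measurable2 oU cf) => //.
exact: open_measurable2.
Qed.

Lemma pd_eq0_off D f i x : closed D -> (forall y, ~ D y -> f y = 0) -> ~ D x ->
  pd i f x = 0.
Proof.
move=> cD f0 Dx; rewrite (pd_ext (U := ~` D) (g := fun=> 0))//.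
- exact: derive_cst.
- exact: closed_openC.
Qed.

Lemma integral_pd_eq0_on U D i f (M : R) : open U -> closed D -> D `<=` U ->
  (forall x, D x -> enorm x <= M) -> Ck 1 U f -> (forall x, ~ D x -> f x = 0) ->
  \int[area R]_(x in D) pd i f x = 0.
Proof.
move=> oU cD DU DM cf f0; have cT := Ck_extend0 oU cD DU f0 cf.
rewrite Rintegral_mkcond (_ : _ \_ _ = pd i f).
  apply: (@integral_pd_eq0 _ i f (M + 1)) => // x Mx; apply: f0 => /DM; lra.
apply/funext => x; rewrite patchE; case: ifPn => // /negP h.
by rewrite (pd_eq0_off i cD f0)// => Dx; apply: h; rewrite inE.
Qed.

(** The field [v D psi - psi D v] vanishes outside [D], so its divergence integrates to 0, and this
    divergence is [v * laplacian psi] because [v] is harmonic. *)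
Lemma green U D v psi (M : R) : open U -> closed D -> D `<=` U ->
  (forall x, D x -> enorm x <= M) -> harm U v -> Ck 2 setT psi ->
  (forall x, ~ D x -> psi x = 0) ->
  \int[area R]_(x in D) (v x * laplacian psi x) = 0.
Proof.
move=> oU cD DU DM [cv hv] cp p0.
have cpU k : (k <= 2)%N -> Ck k U psi by move=> k2; apply: Ck_subset (Ck_leq k2 cp).
pose F i x := v x * pd i psi x - psi x * pd i v x.
have cF i : Ck 1 U (F i).
  exact: (CkB oU (CkM oU (Ck_pred cv) (Ck_pd i (cpU 2%N isT))) (CkM oU (cpU 1%N isT) (Ck_pd i cv))).
have F0 i x : ~ D x -> F i x = 0.
  by move=> Dx; rewrite /F p0// (pd_eq0_off i cD p0)// mulr0 mul0r subrr.
have dF i x : U x -> pd i (F i) x = v x * pd i (pd i psi) x - psi x * pd i (pd i v) x.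
  move=> Ux.
  have d1 := derivableP (@Ck_derivable _ _ _ _ i _ cv Ux).
  have d2 := derivableP (@Ck_derivable _ _ _ _ i _ (cpU 2%N (leqnn _)) Ux).
  have d3 := derivableP (@Ck_derivable _ _ _ _ i _ (Ck_pd i cv) Ux).
  have d4 := derivableP (@Ck_derivable _ _ _ _ i _ (Ck_pd i (cpU 2%N (leqnn _))) Ux).
  have [_] := is_deriveB (is_deriveM d1 d4) (is_deriveM d2 d3).
  rewrite -/(pd i (F i) x) => E; apply: (etrans E) => {E}.
  rewrite /pd; move: ('D__ _ _) (v x) (psi x) ('D__ _ _) ('D__ _ _) ('D__ _ _) => a b b' d e f.
  by rewrite /GRing.scale /=; ring.
have iF i : integ D (pd i (F i)).
  apply: (integ_continuous (M := M) oU cD DU DM) => x Ux.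
  exact: (Ck_continuous (Ck_pd i (cF i)) Ux).
have : \int[area R]_(x in D) (pd false (F false) x + pd true (F true) x) = 0.
  rewrite RintegralD//; last exact: closed_measurable2.
  have Z i := integral_pd_eq0_on i oU cD DU DM (cF i) (F0 i).
  by apply: (etrans (congr2 +%R (Z false) (Z true))); exact: addr0.
move=> <-; apply: eq_Rintegral => x /set_mem/DU Ux.
have alg (V P A B a b : R) : a + b = 0 ->
    V * (A + B) = V * A - P * a + (V * B - P * b).
  by move=> /eqP; rewrite addr_eq0 => /eqP ->; ring.
by apply: (etrans (alg _ _ _ _ _ _ (hv x Ux))); apply/esym/(congr2 +%R); exact: dF.
Qed.

Lemma sker_le1 m (s : R) c x : 0 <= s -> s * sq c x * ker m.+1 s c x <= 1.
Proof.
move=> s0; have [h|h] := leP 1 (s * sq c x); first by rewrite ker_eq0 ?mulr0.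
rewrite mulr_ile1 ?ker_ge0 ?ker_le1 ?(ltW h)//.
by rewrite mulr_ge0// sq_ge0.
Qed.

Lemma is_derive_sker m (s : R) c x : is_derive s (1 : R)
  (fun s => s * ker m.+2 s c x) (ker m.+2 s c x - m.+2%:R * s * sq c x * ker m.+1 s c x).
Proof.
have d : is_derive s (1 : R) (fun s => 1 - s * sq c x) (- sq c x).
  have d := is_deriveB (is_derive_cst (1 : R) s (1:R))
     (is_deriveM (is_derive_id s (1:R)) (is_derive_cst (sq c x) s (1:R))).
  by apply: is_derive_eq d _; rewrite /GRing.scale /= mulr0 mulr1 !add0r.
have d1 := is_derive1_comp (f := pp m.+2) (g := fun s => 1 - s * sq c x)
  (is_derive_pp m (1 - s * sq c x)) d.
have d2 := is_deriveM (is_derive_id s (1:R)) d1.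
apply: is_derive_eq d2 _; rewrite /GRing.scale /= /ker /=; ring.
Qed.

Section MVP.
Variables (m : nat) (U D : set (plane R)) (M rho : R) (c : plane R).
Hypotheses (oU : open U) (cD : closed D) (DU : D `<=` U)
  (DM : forall x, D x -> enorm x <= M) (rho0 : 0 < rho)
  (cDr : forall y, enorm (y - c) <= rho -> D y).

Let mD : measurable (D : set (mplane R)) := closed_measurable2 cD.

Lemma sq_off (s : R) y : rho ^- 2 < s -> ~ D y -> 1 <= s * sq c y.
Proof.
move=> rs nDy; have r2 : 0 < rho ^+ 2 by rewrite exprn_gt0.
have h : rho < enorm (y - c).
  by rewrite ltNge; apply/negP => /cDr.
rewrite sqE; apply: (@le_trans _ _ (rho ^- 2 * enorm (y - c) ^+ 2)).
  by rewrite mulrC ler_pdivlMr// mul1r lerXn2r ?nnegrE ?enorm_ge0// ltW.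
by rewrite ler_wpM2r ?exprn_ge0 ?enorm_ge0// ltW.
Qed.

(** The factor [s] compensates the shrinking support, so that the mass does not depend on the
    scale. *)
Let W v (s : R) := \int[area R]_(y in D) (s * ker m.+2 s c y * v y).

Let integ_ker v (s : R) : harm U v -> integ D (fun y => s * ker m.+2 s c y * v y).
Proof.
move=> [cv _]; apply: (integ_continuous (M := M) oU cD DU DM) => x Ux.
apply: (@Ck_continuous _ 0 U) => //; apply: CkM => //.
  by apply: CkZ => //; exact: (@Ck_leq _ m.+1 0 _ _ isT (Ck_ker _ _ _ oU)).
exact: (@Ck_leq _ 2 0 _ _ isT cv).
Qed.

Lemma weighted_mean_derive v (s : R) : harm U v -> rho ^- 2 < s ->
  is_derive s (1 : R) (W v) 0.
Proof.
move=> hv rs.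
have r20 : 0 < rho ^- 2 by rewrite invr_gt0 exprn_gt0.
have [C C0 vC] : exists2 C : R, 0 <= C & forall y, D y -> `|v y| <= C.
  apply: compact_bounded_fun; first exact: closed_bounded_compact DM.
  apply: continuous_in_subspaceT => x /set_mem/DU; exact: Ck_continuous hv.1.
pose F (s : R) y := s * ker m.+2 s c y * v y.
have dF (t : R) y : is_derive t (1 : R) (F^~ y)
    ((ker m.+2 t c y - m.+2%:R * t * sq c y * ker m.+1 t c y) * v y).
  have d := is_deriveM (is_derive_sker m t c y) (is_derive_cst (v y) t (1:R)).
  by apply: is_derive_eq d _; rewrite /GRing.scale /= mulr0 add0r mulrC.
have Is : `]rho ^- 2, s + 1[%classic s by rewrite /= in_itv /= rs ltrDl ltr01.
have iF t : `]rho ^- 2, s + 1[%classic t -> integ D (F t).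
  by move=> _; exact: integ_ker.
have d1F t y : `]rho ^- 2, s + 1[%classic t -> D y -> derivable (F^~ y) t 1.
  by move=> _ _; have [] := dF t y.
(* By [ker_le1] and [sker_le1] the derivative in [s] of the normalized kernel is at most [1 + m.+2]
   in absolute value, uniformly in [s]. *)
pose G (y : plane R) := m.+3%:R * C.
have G0 y : 0 <= G y by rewrite mulr_ge0.
have iG : integ D G.
  apply: (integ_continuous (M := M) oU cD DU DM) => x Ux; exact: cvg_cst.
have Gub t y : `]rho ^- 2, s + 1[%classic t -> D y -> `|partial1of2 F t y| <= G y.
  rewrite /= in_itv /= => /andP[h1 _] Dy; have t0 : 0 <= t by rewrite ltW// (lt_trans r20).
  rewrite partial1of2E; have [_ ->] := dF t y; rewrite normrM /G.
  apply: ler_pM => //; last exact: vC.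
  apply: le_trans (ler_normB _ _) _; rewrite -(natr1 m.+2) [leRHS]addrC.
  apply: lerD; first by rewrite ger0_norm ?ker_ge0// ker_le1.
  rewrite -!mulrA normrM normr_nat ler_piMr// ger0_norm ?mulrA ?sker_le1//.
  by rewrite !mulr_ge0// ?sq_ge0 ?ker_ge0.
have D1 := @derivable_under_integral R _ _ (area R) F D mD s _ _ Is iF d1F G G0 iG Gub.
have D2 := @differentiation_under_integral R _ _ (area R) F D mD s _ _ Is iF d1F G G0 iG Gub.
apply: DeriveDef; first exact: D1.
rewrite -derive1E D2.
have s0 : s != 0 by rewrite gt_eqF// (lt_trans r20).
rewrite (_ : Rintegral _ _ _ = \int[area R]_(y in D)
    (- (4 * s * m.+3%:R)^-1 * (v y * laplacian (ker m.+3 s c) y))); last first.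
  apply: eq_Rintegral => y _; rewrite partial1of2E; have [_ ->] := dF s y.
  rewrite [laplacian _ _]ker_lap.
  have a0 : 4 * s * m.+3%:R != 0 by rewrite !mulf_neq0// pnatr_eq0.
  move: (_ - _) (v y) (4 * s * _) a0 => A B a a0; by field.
have ck : Ck 2 setT (ker m.+3 s c).
  exact: (@Ck_leq _ m.+2 2 _ _ isT (Ck_ker _ _ _ openT)).
rewrite RintegralZl//.
  rewrite (green oU cD DU DM hv ck) ?mulr0// => y nDy.
  by rewrite ker_eq0//; exact: sq_off.
apply: (integ_continuous (M := M) oU cD DU DM) => x Ux.
apply: cvgM; first exact: Ck_continuous hv.1 Ux.
apply: (@Ck_continuous _ 0 setT) => //.
apply: CkD; first exact: openT.
  exact: (Ck_pd false (Ck_pd false ck)).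
exact: (Ck_pd true (Ck_pd true ck)).
Qed.

Lemma weighted_mean_cst v (s t : R) : harm U v -> rho ^- 2 < s -> s <= t -> W v s = W v t.
Proof.
move=> hv rs; rewrite le_eqVlt => /predU1P[->//|st].
have d (x : R) : s <= x -> is_derive x (1:R) (W v) 0.
  by move=> sx; apply: weighted_mean_derive => //; exact: lt_le_trans sx.
have [x|x|x _] := @MVT _ (W v) (fun=> 0) s t st.
- by rewrite in_itv /= => /andP[/ltW sx _]; exact: d.
- move: x; apply: derivable_within_continuous => x; rewrite in_itv /= => /andP[sx _].
  by have [] := d x sx.
- by rewrite mul0r => /subr0_eq.
Qed.

Lemma harm_cst (a : R) : harm U (fun=> a).
Proof.
split; first exact: Ck_cst.
move=> x _; rewrite /laplacian; have E i : pd i (fun=> a) = fun=> 0.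
  by apply/funext => y; exact: derive_cst.
have -> : partial1 (fun=> a) = fun=> 0 := E false.
have -> : partial2 (fun=> a) = fun=> 0 := E true.
by rewrite [partial1 _ x]derive_cst [partial2 _ x]derive_cst addr0.
Qed.

(** Both sides are constant in [s], the right one because the function 1 is harmonic. For large [s]
    the bump lives where [v] is close to [v c], and the error is a small multiple of the fixed
    mass. *)
Lemma weighted_mean v (s : R) : harm U v -> rho ^- 2 < s ->
  W v s = v c * \int[area R]_(y in D) (s * ker m.+2 s c y).
Proof.
move=> hv rs; have r20 : 0 < rho ^- 2 by rewrite invr_gt0 exprn_gt0.
have W1 t : \int[area R]_(y in D) (t * ker m.+2 t c y) = W (fun=> 1) t.
  by apply: eq_Rintegral => y _; rewrite mulr1.
have W1_ge0 t : 0 <= t -> 0 <= W (fun=> 1) t.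
  by move=> t0; apply: Rintegral_ge0 => y _; rewrite mulr1 mulr_ge0// ker_ge0.
have Dc : D c by apply: cDr; rewrite subrr enorm0 ltW.
rewrite W1; apply/eqP; rewrite -subr_eq0 -normr_le0; apply/ler_addgt0Pr => e e0.
rewrite add0r.
set e' := e / (W (fun=> 1) s + 1).
have e'0 : 0 < e' by rewrite divr_gt0// ltr_wpDl// W1_ge0// ltW// (lt_trans r20).
have [d d0 hd] := near_continuous (Ck_continuous hv.1 (DU Dc)) e'0.
(* From the scale [d ^- 2] on, the bump vanishes off the disk of radius [d], where [v] is within
   [e'] of [v c]. *)
set t := Num.max s (d ^- 2).
have st : s <= t by rewrite le_max lexx.
have t0 : 0 <= t by apply: le_trans st; rewrite ltW// (lt_trans r20).
have h1 := harm_cst 1.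
rewrite (weighted_mean_cst hv rs st) (weighted_mean_cst h1 rs st).
rewrite /W -RintegralZl//; last exact: integ_ker.
rewrite -RintegralB//; last 2 first.
- exact: integ_ker.
- have := integ_ker t (harm_cst (v c)).
  by congr (is_true (integrable _ _ _)); apply/funext => y /=; rewrite mulr1 mulrC.
have iB : integ D (fun y => t * ker m.+2 t c y * v y - v c * (t * ker m.+2 t c y * 1)).
  apply: (integ_continuous (M := M) oU cD DU DM) => x Ux.
  have ck : {for x, continuous (fun y => t * ker m.+2 t c y)}.
    apply: (@Ck_continuous _ 0 U) => //.
    by apply: CkZ => //; exact: (@Ck_leq _ m.+1 0 _ _ isT (Ck_ker _ _ _ oU)).
  apply: cvgB; apply: cvgM => //; first exact: Ck_continuous hv.1 Ux.
    exact: cvg_cst.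
  by apply: cvgM => //; exact: cvg_cst.
apply: le_trans (le_normr_Rintegral mD iB) _.
apply: (@le_trans _ _ (\int[area R]_(y in D) (e' * (t * ker m.+2 t c y * 1)))).
  apply: le_Rintegral => //.
  - rewrite (_ : EFin \o _ = abse \o (EFin \o (fun y => t * ker m.+2 t c y * v y - v c * (t * ker m.+2 t c y * 1))))//.
    exact: integrable_abse.
  - have := integ_ker t (harm_cst e').
    by congr (is_true (integrable _ _ _)); apply/funext => y /=; rewrite mulr1 mulrC.
  - move=> y Dy; rewrite !mulr1.
    have k0 : 0 <= t * ker m.+2 t c y by rewrite mulr_ge0// ker_ge0.
    rewrite [v c * _]mulrC -mulrBr normrM (ger0_norm k0) [leRHS]mulrC.
    have [h|h] := ltP (enorm (y - c)) d; first by rewrite ler_wpM2l//; exact: hd.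
    rewrite ker_eq0 ?mulr0 ?mul0r//.
    rewrite sqE; apply: (@le_trans _ _ (d ^- 2 * enorm (y - c) ^+ 2)).
      by rewrite mulrC ler_pdivlMr ?exprn_gt0// mul1r lerXn2r ?nnegrE ?enorm_ge0// ltW.
    by rewrite ler_wpM2r ?exprn_ge0 ?enorm_ge0// /t le_max lexx orbT.
rewrite RintegralZl//; last exact: integ_ker.
rewrite -/(W (fun=> 1) t) -(weighted_mean_cst h1 rs st) /e' mulrAC ler_pdivrMr; last first.
  by rewrite ltr_wpDl// W1_ge0// ltW// (lt_trans r20).
by rewrite ler_wpM2l ?lerDl// ltW.
Qed.

End MVP.
End MeanValue.

(** * Smoothness and interior estimates of harmonic functions *)

Section Convolution.
Context {R : realType}.
Implicit Types (U D : set (plane R)) (f g v k : plane R -> R) (x y c : plane R).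

Lemma integD D f g : measurable (D : set (mplane R)) -> integ D f -> integ D g ->
  integ D (fun x => f x + g x).
Proof.
move=> mD iF iG; have := integrableD mD iF iG.
by congr (is_true (integrable _ _ _)); apply/funext => x /=; rewrite EFinD.
Qed.

Lemma integB D f g : measurable (D : set (mplane R)) -> integ D f -> integ D g ->
  integ D (fun x => f x - g x).
Proof.
move=> mD iF iG; have := integrableB mD iF iG.
by congr (is_true (integrable _ _ _)); apply/funext => x /=; rewrite EFinB.
Qed.

Lemma integZ D (a : R) f : measurable (D : set (mplane R)) -> integ D f ->
  integ D (fun x => a * f x).
Proof.
move=> mD iF; have := integrableZl mD a iF.
by congr (is_true (integrable _ _ _)); apply/funext => x /=; rewrite EFinM.
Qed.

Lemma integ_norm D f : integ D f -> integ D (fun x => `|f x|).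
Proof. by move=> iF; exact: integrable_abse iF. Qed.

Lemma integ_subset A D f : measurable (A : set (mplane R)) ->
  measurable (D : set (mplane R)) -> A `<=` D -> integ D f -> integ A f.
Proof. by move=> mA mD AD; apply: integrableS. Qed.

Lemma le_Rintegral_subset A D f : measurable (A : set (mplane R)) ->
  measurable (D : set (mplane R)) -> A `<=` D -> integ D f ->
  (forall x, D x -> 0 <= f x) ->
  \int[area R]_(x in A) f x <= \int[area R]_(x in D) f x.
Proof.
move=> mA mD AD iF f0; rewrite /Rintegral; apply: fine_le.
- by apply: integrable_fin_num => //; exact: integ_subset AD iF.
- exact: integrable_fin_num.
- apply: (@ge0_subset_integral _ _ _ (area R) _ _ mA mD _ _ _ AD); first exact: measurable_int iF.
  by move=> x Dx; rewrite lee_fin; exact: f0.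
Qed.

Lemma normr_Rintegral_le D f (C : R) : measurable (D : set (mplane R)) ->
  (area R D < +oo)%E -> integ D f -> (forall x, D x -> `|f x| <= C) ->
  `|\int[area R]_(x in D) f x| <= C * fine (area R D).
Proof.
move=> mD fD iF fC; apply: le_trans (le_normr_Rintegral mD iF) _.
rewrite -Rintegral_cst//; apply: le_Rintegral => //; first exact: integrable_abse iF.
apply: measurable_bounded_integrable => //; exact: bounded_cst.
Qed.

Lemma continuous_ball_bounded f (r : R) : continuous f ->
  exists2 C : R, 0 <= C & forall y, enorm y <= r -> `|f y| <= C.
Proof.
move=> cf; have [||C C0 h] := @compact_bounded_fun _ [set y : plane R | enorm (y - 0) <= r] f.
- apply: (closed_bounded_compact (M := r)); first exact: cdisk_closed.
  by move=> y; rewrite /= subr0.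
- exact: continuous_subspaceT.
by exists C => // y hy; apply: h; rewrite /= subr0.
Qed.

Section Conv.
Variables (U D : set (plane R)) (M : R) (f : plane R -> R).
Hypotheses (oU : open U) (cD : closed D) (DU : D `<=` U)
  (DM : forall x, D x -> enorm x <= M)
  (cf : forall x, U x -> {for x, continuous f}).

Let mD : measurable (D : set (mplane R)) := closed_measurable2 cD.

(** A convolution truncated to a closed bounded subset of [U], since [f] is controlled only there.
    For [x] deep in [D] and a kernel of small support the truncation is invisible. *)
Definition conv k x := \int[area R]_(y in D) (k (x - y) * f y).

Lemma subr_continuous x : continuous (fun y : plane R => x - y).
Proof. by move=> y; apply: cvgB; [exact: cvg_cst|exact: cvg_id]. Qed.

Lemma integ_conv k x : continuous k -> integ D (fun y => k (x - y) * f y).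
Proof.
move=> ck; apply: (integ_continuous (M := M) oU cD DU DM) => y Uy.
apply: cvgM; last exact: cf.
apply: (continuous_comp (f := fun y => x - y) (g := k)); last exact: ck.
exact: subr_continuous.
Qed.

Let fbd : exists2 C : R, 0 <= C & forall y, D y -> `|f y| <= C.
Proof.
apply: compact_bounded_fun; first exact: closed_bounded_compact DM.
by apply: continuous_in_subspaceT => x /set_mem/DU; exact: cf.
Qed.

Lemma conv_is_derive k i x : Ck 1 setT k ->
  is_derive x (ee i) (conv k) (conv (pd i k) x).
Proof.
move=> ck; have [C C0 fC] := fbd.
have cpk : continuous (pd i k).
  by move=> y; apply: (@Ck_continuous _ 0 setT) => //; exact: Ck_pd.
have ck0 : continuous k by move=> y; exact: Ck_continuous ck Logic.I.
have [C1 C10 kC] := continuous_ball_bounded (enorm x + 1 + M) cpk.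
pose F (t : R) y := k (x + t *: ee i - y) * f y.
have dF (t : R) y : is_derive t (1:R) (F^~ y) (pd i k (x + t *: ee i - y) * f y).
  have dk : derivable k (x + t *: ee i - y) (ee i) by exact: Ck_derivable ck Logic.I.
  have [d1 E1] := is_derive_translate dk.
  have d2 := is_derive_line d1; rewrite E1 in d2.
  have d := is_deriveM d2 (is_derive_cst (f y) t (1:R)).
  by apply: is_derive_eq d _; rewrite /GRing.scale /= mulr0 add0r mulrC.
apply: is_derive_of_line.
have I0 : `]-1, 1[%classic (0 : R) by rewrite /= in_itv /= ltrN10 ltr01.
have iF t : `]-1, 1[%classic t -> integ D (F t) by move=> _; exact: integ_conv.
have d1F t y : `]-1, 1[%classic t -> D y -> derivable (F^~ y) t 1.
  by move=> _ _; have [] := dF t y.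
pose G (y : plane R) := C1 * C.
have G0 y : 0 <= G y by rewrite mulr_ge0.
have iG : integ D G.
  by apply: (integ_continuous (M := M) oU cD DU DM) => y Uy; exact: cvg_cst.
have Gub t y : `]-1, 1[%classic t -> D y -> `|partial1of2 F t y| <= G y.
  rewrite /= in_itv /= => /andP[h1 h2] Dy.
  rewrite partial1of2E; have [_ ->] := dF t y; rewrite normrM /G.
  apply: ler_pM => //; last exact: fC.
  apply: kC; apply: le_trans (enormD _ _) _; rewrite enormN.
  apply: lerD; last exact: DM.
  apply: le_trans (enormD _ _) _; rewrite lerD2l enormZ enorm_ee mulr1.
  by rewrite ler_norml !ltW.
have D1 := @derivable_under_integral R _ _ (area R) F D mD 0 _ _ I0 iF d1F G G0 iG Gub.
have D2 := @differentiation_under_integral R _ _ (area R) F D mD 0 _ _ I0 iF d1F G G0 iG Gub.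
apply: DeriveDef; first exact: D1.
rewrite -derive1E; apply: (etrans D2); apply: eq_Rintegral => y _.
rewrite partial1of2E; have [_ ->] := dF 0 y.
by rewrite scale0r addr0.
Qed.

Lemma conv_continuous k : Ck 1 setT k -> continuous (conv k).
Proof.
move=> ck x; have [C C0 fC] := fbd.
have cpk i : continuous (pd i k).
  by move=> y; apply: (@Ck_continuous _ 0 setT) => //; exact: Ck_pd.
have ck0 : continuous k by move=> y; exact: Ck_continuous ck Logic.I.
have [C1 C10 kC1] := continuous_ball_bounded (enorm x + 1 + M) (cpk false).
have [C2 C20 kC2] := continuous_ball_bounded (enorm x + 1 + M) (cpk true).
set A := (C1 + C2) * C * fine (area R D).
have A0 : 0 <= A by rewrite !mulr_ge0 ?addr_ge0 ?fine_ge0.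
apply/cvgrPdist_le => e e0; apply/nbhs_diskP; exists (Num.min 1 (e / (A + 1))).
  by rewrite lt_min ltr01 divr_gt0// ltr_wpDl.
move=> z; rewrite /disk /= lt_min => /andP[z1 ze].
rewrite -RintegralB//; try exact: integ_conv.
apply: (@le_trans _ _ ((C1 + C2) * enorm (z - x) * C * fine (area R D))).
  apply: normr_Rintegral_le => //; first exact: area_bounded_lty DM.
    by apply: integB => //; exact: integ_conv.
  move=> y Dy; rewrite -mulrBl normrM ler_pM// ?fC//.
  rewrite distrC.
  have -> : z - y = (x - y) + (z - x) by rewrite [RHS]addrC addrA subrK.
  apply: (C1_segment openT ck) => s /andP[s0 s1]; split => //.
  apply: le_trans (enorm_le_abs _) _.
  have h : enorm (x - y + s *: (z - x)) <= enorm x + 1 + M.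
    apply: le_trans (enormD _ _) _; rewrite enormZ ger0_norm//.
    have := enormD x (- y); rewrite enormN; have := DM Dy.
    have := enorm_ge0 (z - x); nra.
  by apply: lerD; [exact: kC1|exact: kC2].
have -> : (C1 + C2) * enorm (z - x) * C * fine (area R D) = A * enorm (z - x).
  by rewrite /A; ring.
have A1 : 0 < A + 1 by rewrite ltr_wpDl.
move: ze; rewrite ltr_pdivlMr//; have := enorm_ge0 (z - x); nra.
Qed.

(** One order is lost because continuity of [conv] is obtained from a Lipschitz bound on a C^1
    kernel. The loss is harmless: the kernels can be taken as smooth as desired. *)
Lemma conv_Ck N k : Ck N.+1 setT k -> Ck N setT (conv k).
Proof.
elim: N k => [|N IH] k ck; first by split => // x _; exact: conv_continuous.
have c1 : Ck 1 setT k by exact: Ck_leq ck.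
apply/CkS; split.
- by move=> x _; exact: conv_continuous.
- by move=> i x _; have [] := conv_is_derive i x c1.
- move=> i; rewrite (_ : pd i (conv k) = conv (pd i k)).
    by apply: IH; exact: Ck_pd.
  by apply/funext => x; have [_] := conv_is_derive i x c1.
Qed.

End Conv.

Lemma area_disk_ge x (r : R) : 0 < r -> ((r ^+ 2)%:E <= area R (disk x r))%E.
Proof.
move=> r0.
pose I1 : set (measurableTypeR R) := [set` `[(x.1 - r / 2), (x.1 + r / 2)]].
pose I2 : set (measurableTypeR R) := [set` `[(x.2 - r / 2), (x.2 + r / 2)]].
apply: (@le_trans _ _ (area R (I1 `*` I2))); last first.
  apply: le_measure; rewrite ?inE.
  - by apply: measurableX; exact: measurable_itv.
  - by apply: open_measurable2; exact: disk_open.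
  - move=> [y1 y2]; rewrite /I1 /I2 /= !in_itv /= => -[/andP[a1 a2] /andP[b1 b2]].
    apply: (@le_lt_trans _ _ (3 / 4 * r)); last by lra.
    apply: le_enorm; first by lra.
    rewrite /=; nra.
have E (a : R) : @lebesgue_measure R [set` `[(a - r / 2), (a + r / 2)]] = r%:E.
  rewrite lebesgue_measure_itv /= lte_fin.
  have -> : a - r / 2 < a + r / 2 by lra.
  by rewrite -EFinD; congr EFin; lra.
rewrite product_measure1E; try exact: measurable_itv.
by rewrite [X in (X * _)%E](E x.1) [X in (_ * X)%E](E x.2) -EFinM lee_fin expr2.
Qed.

(** On the disk of radius [rho / 2] one has [s * sq <= 1 / 2], so the kernel is at least
    [2 ^- m.+2]. The area of that disk is at least [(rho / 2) ^+ 2], and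
    [s * (rho / 2) ^+ 2 = 1 / 2]. *)
Lemma ker_mass_ge m D c (rho M : R) : 0 < rho -> closed D ->
  (forall x, D x -> enorm x <= M) -> (forall y, enorm (y - c) <= rho -> D y) ->
  2 ^- m.+3 <= \int[area R]_(y in D) (2 * rho ^- 2 * ker m.+2 (2 * rho ^- 2) c y).
Proof.
move=> r0 cD DM cDr; set s := 2 * rho ^- 2.
have r2 : 0 < rho ^+ 2 by rewrite exprn_gt0.
have s0 : 0 < s by rewrite mulr_gt0// invr_gt0.
have mD := closed_measurable2 cD.
have sE : s * (rho / 2) ^+ 2 = 2^-1 by rewrite /s; field; rewrite gt_eqF.
set B := disk c (rho / 2).
have mB : measurable (B : set (mplane R)) by apply: open_measurable2; exact: disk_open.
have fD : (area R D < +oo)%E by exact: area_bounded_lty DM.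
have BD : B `<=` D by move=> y; rewrite /B /disk /= => h; apply: cDr; lra.
have ik : integ D (fun y => s * ker m.+2 s c y).
  apply: (integ_continuous (M := M) openT cD (@subsetT _ _) DM) => x _.
  apply: (@Ck_continuous _ 0 setT) => //.
  by apply: CkZ; [exact: openT|exact: (@Ck_leq _ m.+1 0 _ _ isT (Ck_ker _ _ _ openT))].
apply: le_trans _ (le_Rintegral_subset mB mD BD ik _); last first.
  by move=> y _; rewrite mulr_ge0 ?ker_ge0 ?ltW.
have iB : integ B (fun=> s * 2 ^- m.+2).
  apply: integ_subset BD _ => //; apply: measurable_bounded_integrable => //.
  exact: bounded_cst.
apply: (@le_trans _ _ (\int[area R]_(y in B) (s * 2 ^- m.+2))); last first.
  apply: le_Rintegral => //; first exact: integ_subset BD ik.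
  move=> y; rewrite /B /disk /= => h; rewrite ler_wpM2l ?(ltW s0)//.
  have h2 : s * sq c y <= 2^-1.
    rewrite -sE ler_wpM2l ?(ltW s0)// sqE lerXn2r ?nnegrE ?enorm_ge0 ?(ltW h)//.
    by rewrite divr_ge0 ?ltW.
  rewrite /ker pp_pos; last by rewrite subr_ge0; apply: le_trans h2 _; lra.
  rewrite -exprVn lerXn2r ?nnegrE ?invr_ge0//; last by lra.
  by rewrite subr_ge0; apply: le_trans h2 _; lra.
rewrite Rintegral_cst//.
have aB : (rho / 2) ^+ 2 <= fine (area R B).
  rewrite -lee_fin fineK; first by apply: area_disk_ge; rewrite divr_gt0.
  rewrite ge0_fin_numE//; apply: le_lt_trans (area_disk_le _ _) _; last exact: ltry.
  by rewrite divr_gt0.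
have := aB; rewrite -(ler_pM2l s0).
rewrite sE => h; rewrite exprS invfM mulrAC ler_pM2r ?invr_gt0 ?exprn_gt0//.
Qed.

(** By the mean value property [v] is, near [x0], the quotient of its convolution [F] with a bump by
    the convolution [G] of 1 with that bump. Both are nearly as smooth as the bump, and dividing by
    [G] spares the computation of the mass. *)
Lemma harm_Ck N U v : open U -> harm U v -> Ck N U v.
Proof.
move=> oU hv; apply: Ck_bigcup => x0 Ux0.
have [r r0 rU] := disk_nbhs oU Ux0.
set rho := r / 3; have rho0 : 0 < rho by rewrite divr_gt0.
(* The radius is doubled so that a bump of radius at most [rho] centred anywhere in [disk x0 rho]
   vanishes off [D]. *)
set D := [set y : plane R | enorm (y - x0) <= 2 * rho].
have cD : closed D by exact: cdisk_closed.
have DU : D `<=` U by move=> y h; apply: rU; apply: le_lt_trans h _; rewrite /rho; lra.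
have DM y : D y -> enorm y <= enorm x0 + 2 * rho.
  by move=> h; rewrite -lerBlDl; apply: le_trans (enormB_le _ _) h.
exists (disk x0 rho); first exact: disk_center.
set s := 2 * rho ^- 2.
have rs : rho ^- 2 < s.
  have : 0 < rho ^- 2 by rewrite invr_gt0 exprn_gt0.
  by rewrite /s; lra.
pose k := ker N.+2 s (0 : plane R).
have ck : Ck N.+1 setT k by exact: Ck_ker openT.
have kE x y : k (x - y) = ker N.+2 s x y.
  by rewrite /k /ker !sqE subr0 enorm_sym.
pose F := conv D v k; pose G := conv D (fun=> 1) k.
have cF : Ck N setT F.
  by apply: (conv_Ck oU cD DU DM) => // x Ux; exact: Ck_continuous hv.1 Ux.
have cG : Ck N setT G.
  by apply: (conv_Ck oU cD DU DM) => // x Ux; exact: cvg_cst.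
have cDx x : disk x0 rho x -> forall y, enorm (y - x) <= rho -> D y.
  rewrite /disk /= => hx y hy; rewrite /D /=.
  by have := enorm_sub y x x0; lra.
have ik x : integ D (ker N.+2 s x).
  apply: (integ_continuous (M := enorm x0 + 2 * rho) openT cD (@subsetT _ _) DM) => y _.
  by apply: (@Ck_continuous _ 0 setT) => //; exact: (@Ck_leq _ N.+1 0 _ _ isT (Ck_ker _ _ _ openT)).
have mD := closed_measurable2 cD.
have G0 x : disk x0 rho x -> G x != 0.
  move=> hx; have h := ker_mass_ge N rho0 cD DM (cDx x hx).
  apply/eqP => Gx; move: h; rewrite RintegralZl//.
  have -> : \int[area R]_(y in D) ker N.+2 s x y = G x.
    by apply: eq_Rintegral => y _; rewrite kE mulr1.
  by rewrite Gx mulr0 leNgt invr_gt0 exprn_gt0.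
have E x : disk x0 rho x -> F x * (G x)^-1 = v x.
  move=> hx; have := weighted_mean N oU cD DU DM rho0 (cDx x hx) hv rs.
  have -> : \int[area R]_(y in D) (s * ker N.+2 s x y * v y) = s * F x.
    rewrite -RintegralZl//; first by apply: eq_Rintegral => y _; rewrite kE mulrA.
    apply: (integ_conv oU cD DU DM) => [y Uy|]; first exact: Ck_continuous hv.1 Uy.
    by move=> y; exact: Ck_continuous ck Logic.I.
  have -> : \int[area R]_(y in D) (s * ker N.+2 s x y) = s * G x.
    rewrite -RintegralZl//; first by apply: eq_Rintegral => y _; rewrite kE mulr1.
    apply: (integ_conv openT cD (@subsetT _ _) DM) => [y Uy|]; first exact: cvg_cst.
    by move=> y; exact: Ck_continuous ck Logic.I.
  move=> h; apply/eqP; rewrite -[_ == _](inj_eq (mulfI (x := s * G x) _)); last first.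
    by rewrite mulf_neq0 ?G0// gt_eqF// (lt_trans _ rs)// invr_gt0 exprn_gt0.
  by rewrite [s * G x * v x]mulrC -h mulrACA divff ?mulr1// G0.
have oD : open (disk x0 rho) by exact: disk_open.
apply: Ck_ext E _ => //; apply: CkM => //; first exact: Ck_subset cF.
by apply: Ck_inv => //; exact: Ck_subset cG.
Qed.

Lemma lap_pd U v i x : open U -> Ck 3 U v -> U x ->
  laplacian (pd i v) x = pd i (laplacian v) x.
Proof.
move=> oU cv Ux.
have sw j y : U y -> pd j (pd i v) y = pd i (pd j v) y.
  move=> Uy; have s := schwarz oU (Ck_pred cv) Uy.
  case: i; case: j; [exact: erefl|exact: esym s|exact: s|exact: erefl].
have sw2 j : pd j (pd j (pd i v)) x = pd i (pd j (pd j v)) x.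
  rewrite (pd_ext j oU (sw j) Ux).
  have s := schwarz oU (Ck_pd j cv) Ux.
  case: i {sw}; case: j s => s; [exact: erefl|exact: esym s|exact: s|exact: erefl].
apply: (etrans (congr2 +%R (sw2 false) (sw2 true))); apply/esym.
have c2 j : Ck 1 U (pd j (pd j v)) by exact: Ck_pd (Ck_pd j cv).
by apply: pdD; [exact: Ck_derivable (c2 false) Ux|exact: Ck_derivable (c2 true) Ux].
Qed.

Lemma harm_pd U v i : open U -> harm U v -> harm U (pd i v).
Proof.
move=> oU hv; split; first by apply: Ck_pd; exact: harm_Ck.
move=> x Ux; rewrite (lap_pd i oU (harm_Ck 3 oU hv) Ux).
rewrite (pd_ext i oU (g := fun=> 0) _ Ux); last exact: hv.2.
exact: derive_cst.
Qed.

Lemma harm_sub U V v : V `<=` U -> harm U v -> harm V v.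
Proof.
by move=> VU [cv hv]; split => [|x /VU]; [exact: Ck_subset cv|exact: hv].
Qed.

Section InteriorEstimates.
Variables (U : set (plane R)) (v : plane R -> R) (x : plane R) (rho : R).
Hypotheses (oU : open U) (hv : harm U v) (rho0 : 0 < rho).
Let D := [set y : plane R | enorm (y - x) <= rho].
Hypothesis DU : D `<=` U.

Let cD : closed D := cdisk_closed (z := x) (a := rho).
Let mD : measurable (D : set (mplane R)) := closed_measurable2 cD.
Let DM y : D y -> enorm y <= enorm x + rho.
Proof. by move=> h; rewrite -lerBlDl; apply: le_trans (enormB_le _ _) h. Qed.
Let s := 2 * rho ^- 2.
Let r20 : 0 < rho ^- 2. Proof. by rewrite invr_gt0 exprn_gt0. Qed.
Let s0 : 0 <= s. Proof. by rewrite mulr_ge0// ltW. Qed.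
Let rs : rho ^- 2 < s. Proof. by rewrite /s; have := r20; lra. Qed.

Let mean w : harm U w -> `|w x| <= 8 * `|\int[area R]_(y in D) (s * ker 2 s x y * w y)|.
Proof.
move=> hw.
have := weighted_mean 0 oU cD DU DM rho0 (fun y h => h) hw rs.
have := ker_mass_ge 0 rho0 cD DM (fun y (h : enorm (y - x) <= rho) => h).
rewrite -/s; set c0 := Rintegral _ _ _ => h ->.
rewrite normrM mulrCA ler_peMr//.
rewrite ger0_norm; last by apply: le_trans h; rewrite invr_ge0 exprn_ge0.
have e8 : (2 : R) ^+ 3 = 8 by ring.
by move: h; rewrite e8; move: c0 => c0 h; lra.
Qed.

(** The kernel is at most 1, and [16 * rho ^- 2 = 8 * s], where 8 is the inverse of the mass bound
    of [ker_mass_ge]. *)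
Lemma harm_le_L1 : `|v x| <= 16 * rho ^- 2 * \int[area R]_(y in D) `|v y|.
Proof.
have cv y : U y -> {for y, continuous v} by move=> Uy; exact: Ck_continuous hv.1 Uy.
have iv : integ D v by exact: (integ_continuous oU cD DU DM cv).
apply: le_trans (mean hv) _.
have ck y : U y -> {for y, continuous (ker 2 s x)}.
  by move=> Uy; exact: Ck_continuous (@Ck_ker _ 1 s x U oU) Uy.
have ik : integ D (fun y => s * ker 2 s x y * v y).
  apply: (integ_continuous oU cD DU DM) => y Uy.
  apply: cvgM; last exact: cv.
  by apply: cvgM; [exact: cvg_cst|exact: ck].
have -> : 16 * rho ^- 2 = 8 * s by rewrite /s; ring.
rewrite -mulrA ler_wpM2l// -RintegralZl//; last exact: integ_norm.
apply: le_trans (le_normr_Rintegral mD ik) _.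
apply: le_Rintegral => //.
- exact: integ_norm.
- by apply: integZ => //; exact: integ_norm.
- move=> y Dy; rewrite normrM normrM (ger0_norm s0) -mulrA ler_wpM2l//.
  by rewrite ger0_norm ?ker_ge0// ler_piMl// ker_le1.
Qed.

(** In the mean value of the harmonic function [pd i v] the derivative is moved onto the kernel. The
    derivative of the kernel is at most [4 * s * rho] and the area at most [16 * rho ^+ 2]; with
    [s = 2 * rho ^- 2] the constant is [8 * 2 * 8 * 16 = 2048]. *)
Lemma harm_grad_le i (A : R) : (forall y, D y -> `|v y| <= A) ->
  `|pd i v x| <= 2048 * rho^-1 * A.
Proof.
move=> vA.
have Dx : D x by rewrite /D /= subrr enorm0 ltW.
have A0 : 0 <= A by exact: le_trans (normr_ge0 _) (vA x Dx).
have cv y : U y -> {for y, continuous v} by move=> Uy; exact: Ck_continuous hv.1 Uy.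
have hp := harm_pd i oU hv.
apply: le_trans (mean hp) _.
have ck : Ck 1 U (ker 2 s x) by exact: Ck_ker.
have cpk : Ck 0 U (pd i (ker 2 s x)) by exact: Ck_pd.
have Z : \int[area R]_(y in D) pd i (fun y => ker 2 s x y * v y) y = 0.
  apply: (integral_pd_eq0_on i oU cD DU DM).
    exact: (CkM oU ck (Ck_pred hv.1)).
  by move=> y Dy; rewrite ker_eq0 ?mul0r//; apply: (sq_off rho0 (fun y (h : enorm (y - x) <= rho) => h) rs Dy).
have E : \int[area R]_(y in D) (s * ker 2 s x y * pd i v y) =
    - s * \int[area R]_(y in D) (v y * pd i (ker 2 s x) y).
  have i1 : integ D (fun y => ker 2 s x y * pd i v y).
    apply: (integ_continuous oU cD DU DM) => y Uy; apply: cvgM.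
      exact: Ck_continuous ck Uy.
    exact: Ck_continuous hp.1 Uy.
  have i2 : integ D (fun y => v y * pd i (ker 2 s x) y).
    apply: (integ_continuous oU cD DU DM) => y Uy; apply: cvgM; first exact: cv.
    exact: Ck_continuous cpk Uy.
  have : \int[area R]_(y in D) (ker 2 s x y * pd i v y) + \int[area R]_(y in D) (v y * pd i (ker 2 s x) y) = 0.
    rewrite -RintegralD//; apply: etrans Z; apply: eq_Rintegral => y /set_mem/DU Uy.
    by rewrite pdM//; [exact: Ck_derivable ck Uy|exact: Ck_derivable hv.1 Uy].
  move=> /eqP; rewrite addr_eq0 => /eqP h.
  rewrite mulNr -mulrN -h -RintegralZl//.
  by apply: eq_Rintegral => y _; rewrite mulrA.
rewrite E normrM normrN (ger0_norm s0).
have aD : fine (area R D) <= 16 * rho ^+ 2.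
  have rr : 0 < 2 * rho by rewrite mulr_gt0.
  rewrite -lee_fin fineK; last by rewrite ge0_fin_numE//; exact: area_bounded_lty DM.
  have -> : 16 * rho ^+ 2 = 4 * (2 * rho) ^+ 2 by ring.
  apply: le_trans (area_disk_le x rr); apply: le_measure; rewrite ?inE//.
    by apply: open_measurable2; exact: disk_open.
  by move=> y; rewrite /D /disk /= => h; apply: le_lt_trans h _; rewrite ltr_pMl// ltr1n.
have B : `|\int[area R]_(y in D) (v y * pd i (ker 2 s x) y)| <= (A * (4 * s * rho)) * fine (area R D).
  apply: normr_Rintegral_le => //; first exact: area_bounded_lty DM.
    apply: (integ_continuous oU cD DU DM) => y Uy; apply: cvgM; first exact: cv.
    exact: Ck_continuous cpk Uy.
  move=> y Dy; rewrite normrM ler_pM//; first exact: vA.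
  have s40 : 0 <= 4 * s by rewrite mulr_ge0.
  have -> : pd i (ker 2 s x) y = - (4 * s * ((co i y - co i x) * ker 1 s x y)).
    by rewrite pd_ker; ring.
  rewrite normrN normrM (ger0_norm s40) ler_wpM2l//.
  rewrite normrM -[rho]mulr1 ler_pM//; last first.
    by rewrite ger0_norm ?ker_ge0// ker_le1.
  apply: le_trans Dy.
  by case: i {hp cpk Z E} => /=; [exact: (abs2_le_enorm (y - x))|exact: (abs1_le_enorm (y - x))].
apply: (@le_trans _ _ (8 * (s * (A * (4 * s * rho) * (16 * rho ^+ 2))))).
  rewrite ler_wpM2l// ler_wpM2l//; apply: le_trans B _.
  by rewrite ler_wpM2l// !mulr_ge0// ltW.
by rewrite le_eqVlt; apply/orP; left; apply/eqP; rewrite /s; field; rewrite gt_eqF.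
Qed.

End InteriorEstimates.
End Convolution.

(** * Maximum principle and boundary barrier *)

Section MaximumPrinciple.
Context {R : realType}.
Implicit Types (U K : set (plane R)) (f g v w b : plane R -> R) (x y c : plane R).

(** If [c] were positive, [h'] would be positive just to the right of its zero at 0, and by the mean
    value theorem [h] would exceed [h 0] there. *)
Lemma second_derivative_test (h h' : R -> R) (c e : R) : 0 < e ->
  (forall t : R, `|t| < e -> is_derive t (1 : R) h (h' t)) ->
  is_derive (0 : R) (1 : R) h' c -> (forall t, `|t| < e -> h t <= h 0) -> c <= 0.
Proof.
move=> e0 dh dh' hmax; rewrite leNgt; apply/negP => c0.
have ine (t : R) : t \in `]- e, e[ -> `|t| < e by rewrite in_itv /= ltr_norml.
have h'0 : h' 0 = 0.
  have [_ <-] := dh 0 (eqbRL (congr1 (fun u => u < e) (normr0 R)) e0).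
  have [|t /ine te||t /ine te|_ ->//] := @derive1_at_max _ h (- e) e 0.
  - by lra.
  - by have [] := dh t te.
  - by rewrite in_itv /=; apply/andP; split; lra.
  - exact: hmax.
have [cv vE] := dh'.
have L : (t^-1 *: (h' (t *: 1 + 0) - h' 0)) @[t --> (0 : R)^'] --> c.
  by rewrite -vE; exact: cv.
have /cvgrPdist_lt/(_ _ c0) := L.
rewrite near_withinE => /nbhs_ballP[d /= d0 hd].
have pos t : 0 < t -> t < d -> 0 < h' t.
  move=> t0 td; have := hd t; rewrite -ball_normE /= sub0r normrN gtr0_norm//.
  move=> /(_ td (lt0r_neq0 t0)); rewrite addr0 [t *: (1 : R)]mulr1 h'0 subr0 /GRing.scale /=.
  rewrite ltr_norml => /andP[_]; rewrite ltrBlDr -ltrBlDl subrr.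
  by rewrite pmulr_rgt0// invr_gt0.
set t := Num.min d e / 2.
have m0 : 0 < Num.min d e by rewrite lt_min d0 e0.
have t0 : 0 < t by rewrite divr_gt0.
have [td te] : t < d /\ t < e.
  have : t < Num.min d e by rewrite /t ltr_pdivrMr// ltr_pMr// ltr1n.
  by rewrite lt_min => /andP.
have D s : 0 <= s <= t -> is_derive s (1 : R) h (h' s).
  by move=> /andP[s0 st]; apply: dh; rewrite ger0_norm// (le_lt_trans st).
have [s|s|s] := @MVT _ h h' 0 t t0.
- by rewrite in_itv /= => /andP[s0 st]; apply: D; rewrite !ltW.
- move: s; apply: derivable_within_continuous => s; rewrite in_itv /= => sI.
  by have [] := D s sI.
rewrite in_itv /= => /andP[s0 st] E; rewrite subr0 in E.
have := hmax t; rewrite gtr0_norm// => /(_ te); apply/negP; rewrite -ltNge -subr_gt0 E.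
by rewrite mulr_gt0// pos// (lt_trans st).
Qed.

(** Carries explicit first and second derivatives along one axis. The barrier is built by sums and
    compositions, and in this form its Laplacian is assembled by rules instead of being computed
    from nested limits. *)
Definition twice_pd U i f f1 f2 := forall x, U x ->
  is_derive x (ee i) f (f1 x) /\ is_derive x (ee i) f1 (f2 x).

Lemma twice_pd_max U i f f1 f2 x : open U -> U x -> twice_pd U i f f1 f2 ->
  (forall y, U y -> f y <= f x) -> f2 x <= 0.
Proof.
move=> oU Ux df fmax; have [e e0 eU] := disk_nbhs oU Ux.
have inU (t : R) : `|t| < e -> U (x + t *: ee i).
  by move=> te; apply: eU; apply: diskD; rewrite enormZ enorm_ee mulr1.
apply: (@second_derivative_test (fun t => f (x + t *: ee i)) (fun t => f1 (x + t *: ee i)) _ e) => //.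
- move=> t /inU Ut; have [[d1 <-] _] := df _ Ut; exact: is_derive_line.
- have [_ [d2 E2]] := df _ Ux; have d : derivable f1 (x + 0 *: ee i) (ee i) by rewrite scale0r addr0.
  by have := is_derive_line d; rewrite scale0r addr0 E2.
- by move=> t /inU Ut; rewrite scale0r addr0; exact: fmax.
Qed.

Lemma twice_pdD U i f f1 f2 g g1 g2 : twice_pd U i f f1 f2 -> twice_pd U i g g1 g2 ->
  twice_pd U i (fun x => f x + g x) (fun x => f1 x + g1 x) (fun x => f2 x + g2 x).
Proof.
by move=> hf hg x Ux; have [a1 a2] := hf x Ux; have [b1 b2] := hg x Ux; split; exact: is_deriveD.
Qed.

Lemma twice_pdZ U i (a : R) f f1 f2 : twice_pd U i f f1 f2 ->
  twice_pd U i (fun x => a * f x) (fun x => a * f1 x) (fun x => a * f2 x).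
Proof.
by move=> hf x Ux; have [a1 a2] := hf x Ux; split;
  [exact: (is_deriveZ a a1)|exact: (is_deriveZ a a2)].
Qed.

Lemma twice_pd_cst U i (a : R) : twice_pd U i (fun=> a) (fun=> 0) (fun=> 0).
Proof. by move=> x _; split; exact: is_derive_cst. Qed.

Lemma twice_pd_Ck U i f : Ck 2 U f -> twice_pd U i f (pd i f) (pd i (pd i f)).
Proof.
move=> cf x Ux; split; first exact: derivableP (Ck_derivable cf Ux).
exact: derivableP (Ck_derivable (Ck_pd i cf) Ux).
Qed.

Lemma twice_pd_sq U i c : twice_pd U i (sq c) (fun x => 2 * (co i x - co i c)) (fun=> 2).
Proof.
move=> x _; split; first exact: is_derive_sq.
have d := is_deriveZ 2 (is_deriveB (is_derive_co i i x) (is_derive_cst (co i c) x (ee i))).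
by apply: is_derive_eq d _; rewrite eqxx subr0 /GRing.scale /= mulr1.
Qed.

Lemma twice_pd_comp U i f f1 f2 (h h1 h2 : R -> R) :
  (forall x, U x -> is_derive (f x) (1 : R) h (h1 (f x)) /\
                    is_derive (f x) (1 : R) h1 (h2 (f x))) ->
  twice_pd U i f f1 f2 ->
  twice_pd U i (fun x => h (f x)) (fun x => h1 (f x) * f1 x)
    (fun x => h2 (f x) * f1 x ^+ 2 + h1 (f x) * f2 x).
Proof.
move=> dh df x Ux; have [dh1 dh2] := dh x Ux; have [df1 df2] := df x Ux; split.
  exact: is_derive_comp dh1 df1.
have d := is_deriveM (is_derive_comp dh2 df1) df2.
by apply: is_derive_eq d _; rewrite /GRing.scale /= expr2 mulrA [f1 x * _]mulrC addrC.
Qed.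

Lemma twice_pd_powR U i (a : R) f f1 f2 : (forall x, U x -> 0 < f x) ->
  twice_pd U i f f1 f2 ->
  twice_pd U i (fun x => f x `^ a) (fun x => a * f x `^ (a - 1) * f1 x)
    (fun x => a * (a - 1) * f x `^ (a - 2) * f1 x ^+ 2 + a * f x `^ (a - 1) * f2 x).
Proof.
move=> f0 df.
apply: (@twice_pd_comp U i f f1 f2 (fun t => t `^ a) (fun t => a * t `^ (a - 1))
  (fun t => a * (a - 1) * t `^ (a - 2))) => // x Ux; split.
  exact: is_derive1_powR (f0 x Ux).
have d := is_deriveZ a (is_derive1_powR (a - 1) (f0 x Ux)).
by apply: is_derive_eq d _; rewrite /GRing.scale /= mulrA -addrA -opprD.
Qed.

Lemma twice_pd_ln U i f f1 f2 : (forall x, U x -> 0 < f x) ->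
  twice_pd U i f f1 f2 ->
  twice_pd U i (fun x => ln (f x)) (fun x => (f x)^-1 * f1 x)
    (fun x => - (f x) ^- 2 * f1 x ^+ 2 + (f x)^-1 * f2 x).
Proof.
move=> f0 df.
apply: (@twice_pd_comp U i f f1 f2 (@ln R) (fun t => t^-1) (fun t => - t ^- 2)) => // x Ux.
split; first exact: is_derive1_ln (f0 x Ux).
have n0 := lt0r_neq0 (f0 x Ux).
have dv : derivable (fun t : R => t^-1) (f x) 1 by apply: derivableV.
apply: DeriveDef => //.
have did : derivable id (f x) (1 : R) by exact: derivable_id.
by have := deriveV n0 did; rewrite derive_id /GRing.scale /= mulr1.
Qed.

Lemma twice_pd_lap U f (f1 f2 : bool -> plane R -> R) x : open U -> U x ->
  (forall i, twice_pd U i f (f1 i) (f2 i)) -> laplacian f x = f2 false x + f2 true x.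
Proof.
move=> oU Ux df; have E i : pd i (pd i f) x = f2 i x.
  have e1 y : U y -> pd i f y = f1 i y by move=> Uy; have [[_ e] _] := df i y Uy; exact: e.
  by rewrite (pd_ext i oU e1 Ux); have [_ [_ e]] := df i x Ux; exact: e.
exact: (congr2 +%R (E false) (E true)).
Qed.

Lemma harm_lin U f g (p q : R) : open U -> harm U f -> harm U g ->
  harm U (fun x => p * f x + q * g x).
Proof.
move=> oU hf hg; split.
  exact: (CkD oU (CkZ p oU hf.1) (CkZ q oU hg.1)).
move=> x Ux.
have lin (s t s' t' : R) : s + t = 0 -> s' + t' = 0 -> p * s + q * s' + (p * t + q * t') = 0.
  by rewrite addrACA -!mulrDr => -> ->; rewrite !mulr0 addr0.
have h1 : pd false (pd false f) x + pd true (pd true f) x = 0 by exact: hf.2.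
have h2 : pd false (pd false g) x + pd true (pd true g) x = 0 by exact: hg.2.
apply: etrans (lin _ _ _ _ h1 h2).
exact: (twice_pd_lap oU Ux (fun i => twice_pdD (twice_pdZ p (twice_pd_Ck i hf.1)) (twice_pdZ q (twice_pd_Ck i hg.1)))).
Qed.

Lemma harm_subc U f (q : R) : open U -> harm U f -> harm U (fun x => f x - q).
Proof.
move=> oU hf; have := harm_lin 1 (- q) oU hf (harm_cst U 1).
by congr harm; apply/funext => x; rewrite mul1r mulr1.
Qed.

(** Adding [e * sq 0], whose Laplacian is [4 * e > 0], makes [w - b] strictly subharmonic and
    excludes a maximum in [U]. *)
Lemma max_principle K U w b (b1 b2 : bool -> plane R -> R) : compact K -> open U -> U `<=` K ->
  harm U w -> {within K, continuous w} -> {within K, continuous b} ->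
  (forall i, twice_pd U i b (b1 i) (b2 i)) ->
  (forall x, U x -> b2 false x + b2 true x <= 0) ->
  (forall x, K x -> ~ U x -> w x <= b x) ->
  forall x, K x -> w x <= b x.
Proof.
move=> cK oU UK [cw hw] kw kb db lb bd x0 Kx0.
rewrite leNgt; apply/negP => wb.
have csq : {within K, continuous (sq (0 : plane R))}.
  by apply: continuous_subspaceT => x; exact: Ck_continuous (@Ck_sq _ 0 setT 0 openT) Logic.I.
have [C C0 sC] := compact_bounded_fun cK csq.
set m := w x0 - b x0; have m0 : 0 < m by rewrite subr_gt0.
(* [C] bounds [sq 0] on [K], so the perturbation stays below the excess [m] and cannot create a
   maximum outside [U]. *)
set e := m / (C + 1).
have C1 : 0 < C + 1 by rewrite ltr_wpDl.
have e0 : 0 < e by rewrite divr_gt0.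
have eC : e * C < m by rewrite /e mulrAC ltr_pdivrMr// ltr_pM2l// ltrDl.
pose v x := w x + ((-1) * b x + e * sq 0 x).
have cv : {within K, continuous v}.
  move=> x; apply: cvgD; first exact: kw.
  by apply: cvgD; [apply: cvgM; [exact: cvg_cst|exact: kb]|apply: cvgM; [exact: cvg_cst|exact: csq]].
have [p /set_mem Kp pmax] := compact_EVT_max (ex_intro _ x0 Kx0) cK cv.
have vp : m <= v p.
  apply: (@le_trans _ _ (v x0)); last by apply: pmax; rewrite inE.
  by rewrite /v /m mulN1r addrA lerDl mulr_ge0 ?sq_ge0// ltW.
have Up : U p.
  apply: contrapT => nUp; have := bd p Kp nUp; rewrite -subr_le0 => h.
  have := sC p Kp; rewrite ger0_norm ?sq_ge0// => sp.
  have : v p <= e * C.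
    rewrite /v mulN1r addrA -[leRHS]add0r; apply: lerD => //.
    by rewrite ler_wpM2l// ltW.
  by move=> /(le_trans vp); rewrite leNgt eC.
have dv i := twice_pdD (twice_pd_Ck i cw) (twice_pdD (twice_pdZ (-1) (db i)) (twice_pdZ e (@twice_pd_sq U i 0))).
have neg i := twice_pd_max oU Up (dv i) (fun y Uy => pmax y (mem_set (UK y Uy))).
have := lerD (neg false) (neg true); have := lb p Up; have := hw p Up.
rewrite /laplacian -[partial1 (partial1 w) p]/(pd false (pd false w) p) -[partial2 (partial2 w) p]/(pd true (pd true w) p).
move: (pd _ _ _) (pd _ _ _) (b2 _ _) (b2 _ _) => A B a b'; clear -e0 => h1 h2 h3; lra.
Qed.

End MaximumPrinciple.

(** * Powers with real exponent *)

Section PowerFacts.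
Context {R : realType}.
Implicit Types (a x y e : R).

Lemma powR_half_sqr e a : 0 <= e -> (e ^+ 2) `^ (a / 2) = e `^ a.
Proof. by move=> e0; rewrite -powR_mulrn// -powRrM mulrC divfK. Qed.

Lemma powR_anti a x y : a <= 0 -> 0 < x -> x <= y -> y `^ a <= x `^ a.
Proof.
move=> a0 x0 xy; rewrite -[a]opprK !(powRN _ (- a)).
rewrite lef_pV2 ?posrE ?powR_gt0//; last exact: lt_le_trans xy.
by apply: ge0_ler_powR; rewrite ?nnegrE ?oppr_ge0// ltW// (lt_le_trans x0).
Qed.

Lemma powRS a x : 0 < x -> x * x `^ (a - 1) = x `^ a.
Proof.
move=> x0; rewrite -{1}[x]powRr1 ?(ltW x0)// -powRD; first by rewrite addrC subrK.
by rewrite (lt0r_neq0 x0) implybT.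
Qed.

(** Truncation at 0 gives a function continuous on the whole line. The barrier needs this on the
    circle itself, where the base of one of its powers vanishes. *)
Lemma max_powR_continuous a : 0 < a -> continuous (fun t : R => Num.max t 0 `^ a).
Proof.
move=> a0 t; have [t0|t0|->] := ltgtP t 0.
- have E : {near t, (fun=> 0 : R) =1 (fun t => Num.max t 0 `^ a)}.
    near=> s; rewrite max_r ?powR0 ?gt_eqF//; apply: ltW; near: s.
    by apply: open_nbhs_nbhs; split => //; exact: open_lt.
  have h0 : Num.max t 0 = 0 by rewrite max_r// ltW.
  rewrite /continuous_at /= h0 powR0 ?gt_eqF//.
  by apply: cvg_trans (near_eq_cvg E) _; exact: cvg_cst.
- have E : {near t, (fun t => t `^ a) =1 (fun t => Num.max t 0 `^ a)}.
    near=> s; rewrite max_l//; apply: ltW; near: s.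
    by apply: open_nbhs_nbhs; split => //; exact: open_gt.
  have h0 : Num.max t 0 = t by rewrite max_l// ltW.
  rewrite /continuous_at /= h0.
  apply: cvg_trans (near_eq_cvg E) _.
  have [h _] := is_derive1_powR a t0.
  exact: (differentiable_continuous ((derivable1_diffP _ _).1 h)).
- rewrite /continuous_at maxxx powR0 ?gt_eqF//.
  apply/cvgrPdist_le => e e0; apply/nbhs_ballP; exists (e `^ a^-1) => /=.
    exact: powR_gt0.
  move=> s /=; rewrite !sub0r !normrN => hs.
  rewrite ger0_norm ?powR_ge0//.
  apply: (@le_trans _ _ ((e `^ a^-1) `^ a)).
    apply: ge0_ler_powR; rewrite ?nnegrE ?powR_ge0 ?(ltW a0)//.
      by rewrite le_max lexx orbT.
    rewrite ge_max powR_ge0 andbT; apply: le_trans (ltW hs); exact: ler_norm.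
  by rewrite -powRrM mulVf ?gt_eqF// powRr1// ltW.
Unshelve. all: by end_near. Qed.

End PowerFacts.

(** * Barrier and gradient bound in the collar of a circle *)

Section Collar.
Context {R : realType}.
Variables (a : R) (c : plane R) (r sg d : R).
Hypotheses (a01 : 0 < a < 1) (d0 : 0 < d) (dr : d <= r)
  (sgE : sg = 1 \/ sg = - 1).
Implicit Types (x y : plane R).

(* [sg = 1] outside a hole, [sg = -1] inside the outer circle: [bdist] is the
   distance to the circle on the side of the collar. *)
Definition bdist y := sg * (enorm (y - c) - r).

Let r0 : 0 < r. Proof. exact: lt_le_trans dr. Qed.
Let sg2 : sg ^+ 2 = 1.
Proof. by case: sgE => ->; rewrite ?sqrrN expr1n. Qed.
Let nsg : `|sg| = 1.
Proof. by case: sgE => ->; rewrite ?normrN normr1. Qed.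

Lemma bdist_lip x y : `|bdist x - bdist y| <= enorm (x - y).
Proof.
rewrite /bdist -mulrBr normrM nsg mul1r opprB addrA subrK ler_norml.
have := enormB_le (x - c) (y - c); have := enormB_le (y - c) (x - c).
have sub (z z' : plane R) : z - c - (z' - c) = z - z' by rewrite opprB addrA subrK.
rewrite !sub (enorm_sym y x) => h1 h2; apply/andP; split; lra.
Qed.

Lemma bdist_continuous : continuous bdist.
Proof.
move=> y; apply: cvgM; first exact: cvg_cst.
by apply: cvgB; [exact: enorm_continuous|exact: cvg_cst].
Qed.

Definition collar t := [set y | 0 < bdist y < t].
Definition ccollar t := [set y | 0 <= bdist y <= t].

Lemma collar_open t : open (collar t).
Proof.
rewrite (_ : collar t = bdist @^-1` [set s | 0 < s] `&` bdist @^-1` [set s | s < t]).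
  apply: openI; apply: open_comp.
  - by move=> x _; exact: bdist_continuous.
  - exact: open_gt.
  - by move=> x _; exact: bdist_continuous.
  - exact: open_lt.
by apply/seteqP; split => y /= => [/andP[]//|[h1 h2]]; apply/andP.
Qed.

Lemma ccollar_closed t : closed (ccollar t).
Proof.
rewrite (_ : ccollar t = bdist @^-1` [set s | 0 <= s] `&` bdist @^-1` [set s | s <= t]).
  apply: closedI; apply: closed_comp.
  - by move=> x _; exact: bdist_continuous.
  - exact: closed_ge.
  - by move=> x _; exact: bdist_continuous.
  - exact: closed_le.
by apply/seteqP; split => y /= => [/andP[]//|[h1 h2]]; apply/andP.
Qed.

Lemma ccollar_radius y : ccollar (d / 2) y -> r / 2 <= enorm (y - c) <= 3 / 2 * r.
Proof.
rewrite /ccollar /bdist /=; move: dr => dr' /andP[]; case: sgE => ->; rewrite ?mul1r ?mulN1r => h1 h2;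
  apply/andP; split; lra.
Qed.

Lemma ccollar_compact : compact (ccollar (d / 2)).
Proof.
apply: (closed_bounded_compact (M := enorm c + 3 / 2 * r)); first exact: ccollar_closed.
move=> y /ccollar_radius /andP[_ h].
by rewrite -lerBlDl; apply: le_trans (enormB_le _ _) h.
Qed.

(** Equal to [2 * r * sg * ln (|y - c| / r)]: the radial harmonic function that vanishes on the
    circle, normalized to be comparable to [bdist]. *)
Definition lbar y := (r * sg) * ln (sq c y) + - ((r * sg) * ln (r ^+ 2)).

(** From [ln (1 + x) <= x], applied with [1 + x = |y - c| / r] outside the circle and with the
    inverse quotient inside; in the latter case [r / |y - c| <= 2] doubles the constant. *)
Lemma lbar_bounds y : ccollar (d / 2) y -> 0 <= lbar y <= 4 * bdist y.
Proof.
move=> Ky; have /andP[h1 h2] := ccollar_radius Ky.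
move: Ky; rewrite /ccollar /= => /andP[k1 k2].
have e0 : 0 < enorm (y - c) by apply: lt_le_trans h1; rewrite divr_gt0.
set e := enorm (y - c) in h1 h2 e0 *.
rewrite /lbar sqE -/e !lnXn// -mulrN -mulrDr -mulrnBl.
have E : ln e - ln r = ln (e / r) by rewrite ln_div// posrE.
have er0 : 0 < e / r by rewrite divr_gt0.
have re0 : 0 < r / e by rewrite divr_gt0.
have l1 : ln e - ln r <= (e - r) / r.
  rewrite E -[e / r](subrKC 1) [1 + _]addrC -[e / r - 1 + 1]addrC.
  apply: le_trans (le_ln1Dx _) _; first by rewrite ltrBrDr addNr.
  by rewrite mulrBl divff// gt_eqF.
have l2 : ln r - ln e <= (r - e) / e.
  rewrite -ln_div ?posrE// -[r / e](subrKC 1).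
  apply: le_trans (le_ln1Dx _) _; first by rewrite ltrBrDr addNr.
  by rewrite mulrBl divff// gt_eqF.
move: k1; rewrite /bdist -/e mulr2n.
have rl1 : r * (ln e - ln r) <= e - r by rewrite mulrC -ler_pdivlMr.
have rl2 : r * (ln r - ln e) <= 2 * (r - e) \/ r < e.
  have [re|] := leP e r; [left|by right].
  apply: (@le_trans _ _ (r * ((r - e) / e))); first by rewrite ler_wpM2l// ltW.
  rewrite mulrA ler_pdivrMr//; nra.
have mono1 : r <= e -> 0 <= r * (ln e - ln r).
  by move=> re; rewrite mulr_ge0 ?(ltW r0)// subr_ge0 ler_ln// posrE.
have mono2 : e <= r -> 0 <= r * (ln r - ln e).
  by move=> re; rewrite mulr_ge0 ?(ltW r0)// subr_ge0 ler_ln// posrE.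
have -> : r * sg * (ln e - ln r + (ln e - ln r)) = 2 * sg * (r * (ln e - ln r)) by ring.
move: mono1 mono2 rl1 rl2; rewrite -(opprB (ln e)) mulrN.
move: (r * (ln e - ln r)) => X m1 m2 b1 b2.
case: sgE => -> ; rewrite ?mul1r ?mulr1 ?mulrN1 ?mulN1r => k1.
  have := m1 ltac:(lra) => ?; apply/andP; split; lra.
have := m2 ltac:(lra) => ?; case: b2 => ?; apply/andP; split; lra.
Qed.

Lemma lbar_gt0 y : collar (d / 2) y -> 0 < lbar y.
Proof.
rewrite /collar /= => /andP[k1 k2].
have /ccollar_radius /andP[h1 _] : ccollar (d / 2) y by rewrite /ccollar /= !ltW.
have e0 : 0 < enorm (y - c) by apply: lt_le_trans h1; rewrite divr_gt0.
rewrite /lbar sqE !lnXn// -mulrN -mulrDr -mulrnBl -mulrA mulr_gt0//.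
move: k1; rewrite /bdist mulr2n; case: sgE => ->; rewrite ?mul1r ?mulN1r => k1.
  have : ln r < ln (enorm (y - c)) by rewrite ltr_ln ?posrE//; lra.
  lra.
have : ln (enorm (y - c)) < ln r by rewrite ltr_ln ?posrE//; lra.
lra.
Qed.

Section Barrier.
Variable x0 : plane R.
Hypothesis hx0 : circle c r x0.

Lemma bdist_le y : bdist y <= enorm (y - x0).
Proof.
have -> : bdist y = bdist y - bdist x0 by rewrite [bdist x0]/bdist hx0 subrr mulr0 subr0.
exact: le_trans (ler_norm _) (bdist_lip _ _).
Qed.

Let M := 16 / (1 - a).
(* [lbar] is harmonic, so [M * lbar `^ a] is strictly superharmonic; it absorbs the
   Laplacian [a ^+ 2 * |y - x0| `^ (a - 2)] of the first term. *)
Definition barrier y := sq x0 y `^ (a / 2) + M * lbar y `^ a.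

Lemma barrier_ge y : enorm (y - x0) `^ a <= barrier y.
Proof.
rewrite /barrier sqE powR_half_sqr ?enorm_ge0// lerDl mulr_ge0 ?powR_ge0//.
by case/andP: a01 => _ a1; rewrite divr_ge0// subr_ge0 ltW.
Qed.

Lemma barrier_le y : ccollar (d / 2) y -> barrier y <= (1 + 4 * M) * enorm (y - x0) `^ a.
Proof.
move=> Ky; have /andP[s0 s1] := lbar_bounds Ky; have /andP[a0 a1] := a01.
have M0 : 0 <= M by rewrite divr_ge0// subr_ge0 ltW.
rewrite /barrier sqE powR_half_sqr ?enorm_ge0// mulrDl mul1r lerD2l.
rewrite -mulrA mulrCA ler_wpM2l//.
have s2 : lbar y <= 4 * enorm (y - x0).
  by apply: le_trans s1 _; rewrite ler_wpM2l// bdist_le.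
apply: (@le_trans _ _ ((4 * enorm (y - x0)) `^ a)).
  by apply: ge0_ler_powR; rewrite ?nnegrE ?mulr_ge0 ?enorm_ge0 ?(ltW a0).
rewrite powRM ?enorm_ge0// ler_wpM2r ?powR_ge0//.
by apply: ler1_powR; [rewrite ler1n|exact: ltW].
Qed.

(** First and second derivatives: [f1], [f2] of the power of [sq x0], [l1], [l2] of [lbar], [g1],
    [g2] of the power of [lbar]. The terms [+ 0] are derivatives of an additive constant, kept to
    match the output of [twice_pdD]. *)
Let f1 i y := a / 2 * sq x0 y `^ (a / 2 - 1) * (2 * (co i y - co i x0)).
Let f2 i y := a / 2 * (a / 2 - 1) * sq x0 y `^ (a / 2 - 2) * (2 * (co i y - co i x0)) ^+ 2
  + a / 2 * sq x0 y `^ (a / 2 - 1) * 2.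
Let l1 i y := r * sg * ((sq c y)^-1 * (2 * (co i y - co i c))) + 0.
Let l2 i y := r * sg * (- (sq c y) ^- 2 * (2 * (co i y - co i c)) ^+ 2 + (sq c y)^-1 * 2) + 0.
Let g1 i y := a * lbar y `^ (a - 1) * l1 i y.
Let g2 i y := a * (a - 1) * lbar y `^ (a - 2) * l1 i y ^+ 2 + a * lbar y `^ (a - 1) * l2 i y.

Lemma collar_pos y : collar (d / 2) y -> [/\ ccollar (d / 2) y, 0 < sq x0 y & 0 < sq c y].
Proof.
rewrite /collar /= => /andP[k1 k2].
have Ky : ccollar (d / 2) y by rewrite /ccollar /= !ltW.
split => //; rewrite sqE exprn_gt0//.
  exact: lt_le_trans k1 (bdist_le _).
have /andP[h _] := ccollar_radius Ky; apply: lt_le_trans h; by rewrite divr_gt0.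
Qed.

Lemma barrier_twice_pd i : twice_pd (collar (d / 2)) i barrier
  (fun y => f1 i y + M * g1 i y) (fun y => f2 i y + M * g2 i y).
Proof.
apply: twice_pdD.
  apply: twice_pd_powR; last exact: twice_pd_sq.
  by move=> y /collar_pos[].
apply: twice_pdZ; apply: twice_pd_powR; first exact: lbar_gt0.
apply: twice_pdD; last exact: twice_pd_cst.
apply: twice_pdZ; apply: twice_pd_ln; last exact: twice_pd_sq.
by move=> y /collar_pos[].
Qed.

(** Put [e = |y - x0|]. The Laplacian of [lbar ^ a] is [a * (a - 1) * lbar ^ (a - 2) * |D lbar| ^
    2]. Here [|D lbar| >= 1] because [|y - c| <= 3 / 2 * r], and [lbar <= 4 * e] gives
    [lbar ^ (a - 2) >= e ^ (a - 2) / 16]. Since [M * (1 - a) = 16], what remains is at most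
    [(a ^+ 2 - a) * e ^ (a - 2) <= 0]. *)
Lemma barrier_superharmonic y : collar (d / 2) y ->
  f2 false y + M * g2 false y + (f2 true y + M * g2 true y) <= 0.
Proof.
move=> Uy; have [Ky Q0 P0] := collar_pos Uy; have S0 := lbar_gt0 Uy.
have /andP[_ S1] := lbar_bounds Ky; have /andP[a0 a1] := a01.
have /andP[_ P1] := ccollar_radius Ky.
set e := enorm (y - x0); have e0 : 0 < e by move: Q0; rewrite sqE -/e exprn_even_gt0//= lt_def enorm_ge0 andbT.
have eF : f2 false y + f2 true y = a ^+ 2 * e `^ (a - 2).
  have E : (2 * (co false y - co false x0)) ^+ 2 + (2 * (co true y - co true x0)) ^+ 2 = 4 * sq x0 y.
    by rewrite /sq; ring.
  have Q1 : sq x0 y `^ (a / 2 - 2) * sq x0 y = sq x0 y `^ (a / 2 - 1).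
    rewrite mulrC -[RHS]powRS//; congr (_ * _ `^ _); ring.
  have Q2 : sq x0 y `^ (a / 2 - 1) = e `^ (a - 2).
    rewrite sqE -/e -(powR_half_sqr (a - 2)) ?(ltW e0)//; congr (_ `^ _); lra.
  rewrite /f2 -Q2 -Q1.
  have -> : forall A B X Y Z : R, A * B * X ^+ 2 + Z + (A * B * Y ^+ 2 + Z) =
      A * B * (X ^+ 2 + Y ^+ 2) + 2 * Z by move=> *; ring.
  by rewrite E; field.
have eL : l2 false y + l2 true y = 0.
  have Pn : sq c y != 0 by rewrite gt_eqF.
  have E : (2 * (co false y - co false c)) ^+ 2 + (2 * (co true y - co true c)) ^+ 2 = 4 * sq c y.
    by rewrite /sq; ring.
  rewrite /l2 !addr0 -mulrDr; apply/eqP; rewrite mulf_eq0; apply/orP; right; apply/eqP.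
  have -> : forall A B X Y : R, - A * X ^+ 2 + B * 2 + (- A * Y ^+ 2 + B * 2) =
      - A * (X ^+ 2 + Y ^+ 2) + 4 * B by move=> *; ring.
  by rewrite E; move: (sq c y) Pn => P Pn; field.
have eG : l1 false y ^+ 2 + l1 true y ^+ 2 = 4 * r ^+ 2 / sq c y.
  have Pn : sq c y != 0 by rewrite gt_eqF.
  have E : (co false y - co false c) ^+ 2 + (co true y - co true c) ^+ 2 = sq c y by [].
  rewrite /l1 !addr0.
  have -> : forall A X Y : R, (r * sg * (A * (2 * X))) ^+ 2 + (r * sg * (A * (2 * Y))) ^+ 2 =
      4 * r ^+ 2 * (A ^+ 2 * sg ^+ 2 * (X ^+ 2 + Y ^+ 2)) by move=> *; ring.
  by rewrite E sg2 mulr1 expr2 -(mulrA (sq c y)^-1) mulVf// mulr1.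
have -> : f2 false y + M * g2 false y + (f2 true y + M * g2 true y) =
    (f2 false y + f2 true y) + M * (a * (a - 1) * lbar y `^ (a - 2) * (l1 false y ^+ 2 + l1 true y ^+ 2)
     + a * lbar y `^ (a - 1) * (l2 false y + l2 true y)).
  by rewrite /g2; ring.
rewrite eF eL eG mulr0 addr0.
have h1 : e `^ (a - 2) / 16 <= lbar y `^ (a - 2).
  have S2 : lbar y <= 4 * e by apply: le_trans S1 _; rewrite ler_wpM2l// bdist_le.
  apply: le_trans (powR_anti _ S0 S2); last by lra.
  rewrite powRM ?(ltW e0)// mulrC ler_wpM2r ?powR_ge0//.
  apply: (@le_trans _ _ (4 `^ (- 2%:R))); last by apply: ler_powR; [rewrite ler1n|lra].
  rewrite powR_invn// (_ : 16 = 4 ^+ 2)//; ring.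
have h2 : 1 <= 4 * r ^+ 2 / sq c y.
  rewrite ler_pdivlMr// mul1r sqE; have := enorm_ge0 (y - c); nra.
have X0 : 0 < e `^ (a - 2) by exact: powR_gt0.
have M1 : M * (1 - a) = 16 by rewrite /M divfK// gt_eqF// subr_gt0.
have M0 : 0 < M by rewrite /M divr_gt0// subr_gt0.
move: (lbar y `^ (a - 2)) (4 * r ^+ 2 / sq c y) (e `^ (a - 2)) h1 h2 X0 => S T X h1 h2 X0.
have h3 : X / 16 <= S * T by apply: (le_trans h1); rewrite ler_peMr//; apply: le_trans h1; rewrite ltW// divr_gt0.
have -> : M * (a * (a - 1) * S * T) = - (a * (M * (1 - a)) * (S * T)) by ring.
rewrite M1; move: (S * T) h3 => V h3.
have h4 : 0 <= a * (16 * V - X) by rewrite mulr_ge0 ?(ltW a0)// subr_ge0; lra.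
have h5 : 0 <= a * ((1 - a) * X) by rewrite !mulr_ge0 ?subr_ge0 ?ltW.
have -> : a ^+ 2 * X - a * 16 * V = - (a * (16 * V - X) + a * ((1 - a) * X)) by ring.
by rewrite oppr_le0 addr_ge0.
Qed.

Lemma barrier_continuous : {within ccollar (d / 2), continuous barrier}.
Proof.
have /andP[a0 a1] := a01.
pose b' y := Num.max (sq x0 y) 0 `^ (a / 2) + M * Num.max (lbar y) 0 `^ a.
apply: (@subspace_eq_continuous _ _ _ b').
  move=> y /set_mem /lbar_bounds /andP[s0 _].
  by rewrite /b' max_l ?sq_ge0// max_l.
apply: continuous_in_subspaceT => y /set_mem Ky.
have csq c' : {for y, continuous (sq c')}.
  exact: Ck_continuous (@Ck_sq _ 0 setT c' openT) Logic.I.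
have P0 : 0 < sq c y.
  have /andP[h _] := ccollar_radius Ky; rewrite sqE exprn_gt0//.
  by apply: lt_le_trans h; rewrite divr_gt0.
apply: cvgD; last apply: cvgM; first last.
- apply: (continuous_comp (f := lbar) (g := fun t => Num.max t 0 `^ a)).
    apply: cvgD; last exact: cvg_cst.
    apply: cvgM; first exact: cvg_cst.
    by apply: (continuous_comp (f := sq c) (g := @ln R)) => //; exact: continuous_ln.
  exact: max_powR_continuous.
- exact: cvg_cst.
- apply: (continuous_comp (f := sq x0) (g := fun t => Num.max t 0 `^ (a / 2))) => //.
  by apply: max_powR_continuous; rewrite divr_gt0.
Qed.

(** Comparison of [w - w x0] and of its opposite with [k * barrier]. On the circle [H] suffices; on
    the far edge the distance to [x0] is at least [d / 2], so [(2 / d) ^ a * |y - x0| ^ a >= 1] and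
    the term with [S] suffices. *)
Lemma barrier_bound w (H S : R) : 0 <= H -> 0 <= S ->
  harm (collar (d / 2)) w -> {within ccollar (d / 2), continuous w} ->
  (forall y, circle c r y -> `|w y - w x0| <= H * enorm (y - x0) `^ a) ->
  (forall y, bdist y = d / 2 -> `|w y - w x0| <= S) ->
  forall y, ccollar (d / 2) y ->
  `|w y - w x0| <= (1 + 4 * M) * (H + S * (2 / d) `^ a) * enorm (y - x0) `^ a.
Proof.
have /andP[a0 a1] := a01.
move=> H0 S0 hw cw wH wS y Ky.
set k := H + S * (2 / d) `^ a.
have k0 : 0 <= k by rewrite addr_ge0// mulr_ge0// powR_ge0.
have bdk z : ccollar (d / 2) z -> ~ collar (d / 2) z -> `|w z - w x0| <= k * barrier z.
  rewrite /ccollar /collar /= => /andP[z0 z1] nz.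
  apply: (@le_trans _ _ (k * enorm (z - x0) `^ a)); last by rewrite ler_wpM2l// barrier_ge.
  have [zd|zd] := leP (bdist z) 0.
    have cz : circle c r z.
      have : bdist z = 0 by apply/eqP; rewrite eq_le zd.
      rewrite /bdist /circle /= => /eqP; rewrite mulf_eq0 -normr_eq0 nsg oner_eq0 /=.
      by rewrite subr_eq0 => /eqP.
    apply: le_trans (wH z cz) _; rewrite ler_wpM2r ?powR_ge0// /k lerDl.
    by rewrite mulr_ge0// powR_ge0.
  have zE : bdist z = d / 2.
    apply/eqP; rewrite eq_le z1 /= leNgt; apply/negP => zl; apply: nz; exact/andP.
  apply: le_trans (wS z zE) _.
  apply: (@le_trans _ _ (S * (2 / d) `^ a * (d / 2) `^ a)).
    rewrite -mulrA -powRM ?divr_ge0 ?(ltW d0)//.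
    have -> : 2 / d * (d / 2) = 1 by field; rewrite gt_eqF.
    by rewrite powR1 mulr1.
  apply: ler_pM; rewrite ?powR_ge0 ?mulr_ge0 ?powR_ge0//; first by rewrite /k lerDr.
  apply: ge0_ler_powR; rewrite ?nnegrE ?enorm_ge0 ?(ltW a0) ?divr_ge0 ?(ltW d0)//.
  by rewrite -zE; exact: bdist_le.
have kb : {within ccollar (d / 2), continuous (fun z => k * barrier z)}.
  by move=> z; apply: cvgM; [exact: cvg_cst|exact: barrier_continuous].
have oU : open (collar (d / 2)) by exact: collar_open.
have UK : collar (d / 2) `<=` ccollar (d / 2).
  by move=> z; rewrite /collar /ccollar /= => /andP[/ltW -> /ltW ->].
have main (e : R) : (e = 1 \/ e = -1) -> e * (w y - w x0) <= k * barrier y.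
  move=> he; pose w' z := e * (w z - w x0).
  have hw' : harm (collar (d / 2)) w'.
    have := harm_lin e 0 oU (harm_subc (w x0) oU hw) (harm_cst _ 0).
    by congr harm; apply/funext => z; rewrite mulr0 addr0.
  have kw' : {within ccollar (d / 2), continuous w'}.
    move=> z; apply: cvgM; first exact: cvg_cst.
    by apply: cvgB; [exact: cw|exact: cvg_cst].
  apply: (max_principle ccollar_compact oU UK hw' kw' kb (fun i => twice_pdZ k (@barrier_twice_pd i))) => //.
    by move=> z Uz; rewrite -mulrDr mulr_ge0_le0// barrier_superharmonic.
  move=> z Kz nUz; apply: le_trans (bdk z Kz nUz); apply: le_trans (ler_norm _) _.
  by rewrite normrM; case: he => ->; rewrite ?normrN normr1 mul1r.
have : `|w y - w x0| <= k * barrier y.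
  rewrite ler_norml lerNl; apply/andP; split.
    by have := main _ (or_intror erefl); rewrite mulN1r.
  by have := main _ (or_introl erefl); rewrite mul1r.
move=> h; apply: (le_trans h); rewrite -mulrA mulrCA ler_wpM2l//.
exact: barrier_le.
Qed.

End Barrier.

Lemma ball_collar y t z : 0 < bdist y -> bdist y <= t / 2 -> enorm (z - y) <= bdist y / 2 ->
  collar t z.
Proof.
move=> y0 yt h; have := bdist_lip z y; rewrite ler_norml => /andP[h1 h2].
by rewrite /collar /=; apply/andP; split; lra.
Qed.

Definition bproj y := c + (r / enorm (y - c)) *: (y - c).

Lemma ccollar_center y : ccollar (d / 2) y -> 0 < enorm (y - c).
Proof. by move=> /ccollar_radius/andP[h _]; apply: lt_le_trans h; rewrite divr_gt0. Qed.

Lemma bproj_circle y : ccollar (d / 2) y -> circle c r (bproj y).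
Proof.
move=> /ccollar_center y0.
by rewrite /circle /bproj /= addrC addKr enormZ ger0_norm ?divr_ge0 ?(ltW r0) ?(ltW y0)// divfK// gt_eqF.
Qed.

Lemma bproj_dist y : ccollar (d / 2) y -> enorm (y - bproj y) = bdist y.
Proof.
move=> Ky; have y0 := ccollar_center Ky.
have -> : y - bproj y = (1 - r / enorm (y - c)) *: (y - c).
  by rewrite /bproj scalerBl scale1r opprD addrA.
rewrite enormZ -{2}(ger0_norm (ltW y0)) -normrM mulrBl mul1r divfK ?gt_eqF//.
have b0 : 0 <= bdist y by case/andP: Ky.
by rewrite -[RHS]ger0_norm// /bdist normrM nsg mul1r.
Qed.

(** The interior gradient estimate on the disk of radius [bdist y / 2] about [y], for [w] minus its
    value at the projection of [y]; points of that disk are within [2 * bdist y] of the projection.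
    The constant is [8192 = 2048 * 2 * 2], one 2 from the radius and one from [2 ^ a <= 2]. *)
Lemma collar_grad w (H S : R) : 0 <= H -> 0 <= S ->
  harm (collar (d / 2)) w -> {within ccollar (d / 2), continuous w} ->
  (forall x y, circle c r x -> circle c r y -> `|w y - w x| <= H * enorm (y - x) `^ a) ->
  (forall x y, circle c r x -> bdist y = d / 2 -> `|w y - w x| <= S) ->
  forall i y, collar (d / 4) y ->
  `|pd i w y| <= 8192 * (1 + 4 * (16 / (1 - a))) * (H + S * (2 / d) `^ a) * bdist y `^ (a - 1).
Proof.
have /andP[a0 a1] := a01.
move=> H0 S0 hw cw wH wS i y; rewrite /collar /= => /andP[y0 y1].
have Ky : ccollar (d / 2) y by rewrite /ccollar /=; apply/andP; split; lra.
have oU : open (collar (d / 2)) by exact: collar_open.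
set x0 := bproj y; have cx0 : circle c r x0 by exact: bproj_circle.
set k := (1 + 4 * (16 / (1 - a))) * (H + S * (2 / d) `^ a).
have k0 : 0 <= k.
  apply: mulr_ge0; last by rewrite addr_ge0// mulr_ge0 ?powR_ge0.
  by rewrite addr_ge0// mulr_ge0// divr_ge0// subr_ge0 ltW.
have B z : ccollar (d / 2) z -> `|w z - w x0| <= k * enorm (z - x0) `^ a.
  apply: (barrier_bound cx0 H0 S0 hw cw) => [z' hz|z' hz]; first exact: wH.
  exact: wS.
have hw' : harm (collar (d / 2)) (fun z => w z - w x0).
  exact: harm_subc.
have Uy : collar (d / 2) y by rewrite /collar /=; apply/andP; split; lra.
have pE : pd i w y = pd i (fun z => w z - w x0) y.
  apply/esym; apply: etrans (pdD (Ck_derivable hw.1 Uy) (derivable_cst _ _ _)) _.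
  by rewrite [X in _ + X]derive_cst addr0.
have y20 : 0 < bdist y / 2 by rewrite divr_gt0.
have sub : [set z : plane R | enorm (z - y) <= bdist y / 2] `<=` collar (d / 2).
  by move=> z /= hz; apply: ball_collar hz => //; lra.
have vA z : enorm (z - y) <= bdist y / 2 -> `|w z - w x0| <= k * (2 * bdist y `^ a).
  move=> hz; have Kz : ccollar (d / 2) z.
    by have := sub z hz; rewrite /collar /ccollar /= => /andP[/ltW -> /ltW ->].
  apply: le_trans (B z Kz) _; rewrite ler_wpM2l//.
  have h2 : enorm (z - x0) <= 2 * bdist y.
    apply: le_trans (enorm_sub z y x0) _; rewrite bproj_dist//; lra.
  apply: (@le_trans _ _ ((2 * bdist y) `^ a)).
    apply: ge0_ler_powR => //; [exact: ltW|rewrite nnegrE; exact: enorm_ge0|].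
    by rewrite nnegrE mulr_ge0// ltW.
  rewrite powRM ?(ltW y0)// ler_wpM2r ?powR_ge0//.
  by apply: ler1_powR; [rewrite ler1n|exact: ltW].
rewrite pE; apply: le_trans (harm_grad_le oU hw' y20 sub i vA) _.
rewrite -[8192 * _ * _]mulrA -/k -(powRS a y0).
rewrite le_eqVlt; apply/orP; left; apply/eqP.
by move: (_ `^ _) => X; field; rewrite gt_eqF.
Qed.

End Collar.

Section PowerIncrement.
Context {R : realType}.

(** For [a < 1] the bound on [h'] is singular but integrable at 0. Instead of an improper integral,
    [psi] is shown to be nonincreasing, from its derivative in the open interval and its continuity
    up to the ends. *)
Lemma powR_increment (a B T : R) (h h' : R -> R) : 0 < a -> 0 < T ->
  (forall t : R, 0 <= t <= T -> is_derive t (1 : R) h (h' t)) ->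
  (forall t : R, 0 < t < T -> `|h' t| <= B * t `^ (a - 1)) ->
  `|h T - h 0| <= B / a * T `^ a.
Proof.
move=> a0 T0 dh hB.
have main (e : R) : e = 1 \/ e = -1 -> e * (h T - h 0) <= B / a * T `^ a.
  move=> he.
  pose psi t := e * h t - B / a * t `^ a.
  have dpsi (t : R) : 0 < t < T -> is_derive t (1 : R) psi (e * h' t - B * t `^ (a - 1)).
    move=> /andP[t0 tT].
    have t01 : 0 <= t <= T by rewrite !ltW.
    have d1 := is_deriveZ e (dh t t01).
    have d2 := is_deriveZ (B / a) (is_derive1_powR a t0).
    have := is_deriveB d1 d2.
    move=> d; apply: is_derive_eq d _; rewrite /GRing.scale /= mulrA divfK// gt_eqF//.
  have cpsi : {within `[0, T], continuous psi}.
    apply: (@subspace_eq_continuous _ _ _ (fun t => e * h t - B / a * Num.max t 0 `^ a)).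
      by move=> t; rewrite inE /= in_itv /= => /andP[t0 _]; rewrite max_l.
    apply: continuous_in_subspaceT => t; rewrite inE /= in_itv /= => t01.
    apply: cvgB; apply: cvgM; try exact: cvg_cst.
      by apply: differentiable_continuous; apply/derivable1_diffP; have [] := dh t t01.
    exact: max_powR_continuous.
  have := @ler0_derive1_nincr _ psi 0 T _ _ cpsi 0 T (lexx _) (ltW T0) (lexx _).
  have -> : psi T <= psi 0 = (e * (h T - h 0) <= B / a * T `^ a).
    rewrite /psi powR0 ?gt_eqF// mulr0 subr0 lerBlDr -lerBlDl mulrBr; congr (_ <= _).
  apply.
  - by move=> t; rewrite in_itv /= => /dpsi[].
  - move=> t; rewrite in_itv /= => tT; rewrite derive1E; have [_ ->] := dpsi t tT.
    rewrite subr_le0; apply: le_trans (hB t tT); apply: le_trans (ler_norm _) _.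
    by rewrite normrM; case: he => ->; rewrite ?normrN normr1 mul1r.
rewrite ler_norml lerNl; apply/andP; split.
  by have := main _ (or_intror erefl); rewrite mulN1r.
by have := main _ (or_introl erefl); rewrite mul1r.
Qed.

End PowerIncrement.

(** The Hessian of a harmonic function has rows [(A, B)] and [(B, - A)], so it is
    [sqrt (A ^ 2 + B ^ 2)] times an orthogonal matrix. Its size is determined by its action on one
    vector: the radial derivative of the gradient controls all second derivatives. *)
Lemma symmetric_traceless_bound {R : realType} (A B x1 x2 e r X : R) :
  e ^+ 2 = x1 ^+ 2 + x2 ^+ 2 -> 0 < r -> r / 2 <= e ->
  `|x1 * A + x2 * B| <= r * X -> `|x1 * B - x2 * A| <= r * X ->
  `|A| <= 4 * X /\ `|B| <= 4 * X.
Proof.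
move=> eE r0 re h1 h2.
have X0 : 0 <= X by have := le_trans (normr_ge0 _) h1; rewrite pmulr_rge0.
have e0 : 0 <= e by apply: le_trans re; rewrite divr_ge0// ltW.
have s1 : (x1 * A + x2 * B) ^+ 2 <= (r * X) ^+ 2.
  by rewrite -(real_normK (num_real (_ + _))) lerXn2r// nnegrE mulr_ge0// ltW.
have s2 : (x1 * B - x2 * A) ^+ 2 <= (r * X) ^+ 2.
  by rewrite -(real_normK (num_real (_ - _))) lerXn2r// nnegrE mulr_ge0// ltW.
have key : (A ^+ 2 + B ^+ 2) * e ^+ 2 <= 2 * (r * X) ^+ 2.
  have -> : (A ^+ 2 + B ^+ 2) * e ^+ 2 = (x1 * A + x2 * B) ^+ 2 + (x1 * B - x2 * A) ^+ 2.
    by rewrite eE; ring.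
  by lra.
have r20 : 0 < r / 2 by rewrite divr_gt0.
have rX : 0 <= 2 * (r * X) by rewrite mulr_ge0// mulr_ge0// ltW.
have fin u : u ^+ 2 <= A ^+ 2 + B ^+ 2 -> `|u| <= 4 * X.
  move=> hu; rewrite -(ler_pM2r r20).
  have -> : 4 * X * (r / 2) = 2 * (r * X) by field.
  rewrite -(ler_pXn2r (n := 2)) ?nnegrE// ; last by rewrite mulr_ge0// ltW.
  rewrite exprMn real_normK ?num_real//.
  apply: (@le_trans _ _ ((A ^+ 2 + B ^+ 2) * e ^+ 2)).
    by apply: ler_pM; rewrite ?sqr_ge0// lerXn2r ?nnegrE// ltW.
  apply: (le_trans key); rewrite [leRHS]exprMn; apply: ler_wpM2r; first exact: sqr_ge0.
  by rewrite expr2; lra.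
by split; apply: fin; rewrite ?lerDl ?lerDr sqr_ge0.
Qed.

(** * Regularity in a collar of a circle *)

Section CollarRegularity.
Context {R : realType}.
Variables (a : R) (c : plane R) (r sg d : R).
Hypotheses (a01 : 0 < a < 1) (d0 : 0 < d) (dr : d <= r)
  (sgE : sg = 1 \/ sg = - 1).
Implicit Types (x y z : plane R).
Local Notation bd := (bdist c r sg).
Local Notation co_ := (collar c r sg).

Let r0 : 0 < r. Proof. exact: lt_le_trans dr. Qed.
Let a0 : 0 < a. Proof. by case/andP: a01. Qed.
Let a1 : a < 1. Proof. by case/andP: a01. Qed.
Let sg2 : sg * sg = 1.
Proof. by case: sgE => ->; rewrite ?mulrNN mulr1. Qed.
Let nsg : `|sg| = 1.
Proof. by case: sgE => ->; rewrite ?normrN normr1. Qed.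

Let powa b t : 0 < b -> b <= t -> t `^ (a - 1) <= b `^ (a - 1).
Proof. by move=> b0 bt; apply: powR_anti => //; rewrite subr_le0 ltW. Qed.

Definition nu x := (enorm (x - c))^-1 *: (x - c).
(** A step along the ray through [c], directed away from the circle on either side, so that within
    the collar [bdist] grows by exactly [t]. *)
Definition rshift x t := x + (t * sg) *: nu x.

Lemma collar_radius t x : t <= d / 2 -> co_ t x -> r / 2 <= enorm (x - c) <= 3 / 2 * r.
Proof.
move=> td /andP[h1 h2]; apply: (ccollar_radius dr sgE).
by rewrite /ccollar /=; apply/andP; split; lra.
Qed.

Lemma enorm_nu x : 0 < enorm (x - c) -> enorm (nu x) = 1.
Proof. by move=> h; rewrite /nu enormZ ger0_norm ?invr_ge0 ?enorm_ge0// mulVf// gt_eqF. Qed.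

Lemma rshift_sub x t : 0 < enorm (x - c) ->
  rshift x t - c = (1 + t * sg / enorm (x - c)) *: (x - c).
Proof. by move=> h; rewrite /rshift /nu addrAC scalerA scalerDl scale1r. Qed.

Lemma enorm_rshift x t : co_ (d / 2) x -> 0 <= t -> t < d / 2 ->
  enorm (rshift x t - c) = enorm (x - c) + t * sg.
Proof.
move=> Cx t0 td; have /andP[h1 h2] := collar_radius (lexx _) Cx.
have e0 : 0 < enorm (x - c) by apply: lt_le_trans h1; rewrite divr_gt0.
rewrite rshift_sub// enormZ -{2}(ger0_norm (ltW e0)) -normrM mulrDl mul1r divfK ?gt_eqF//.
rewrite ger0_norm//; move: dr => dr'; case: sgE => ->; lra.
Qed.

Lemma bdist_rshift x t : co_ (d / 2) x -> 0 <= t -> t < d / 2 ->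
  bd (rshift x t) = bd x + t.
Proof.
move=> Cx t0 td; rewrite /bdist enorm_rshift//.
by rewrite addrAC mulrDr [t * sg]mulrC mulrA sg2 mul1r.
Qed.

Lemma nu_lip x y : co_ (d / 2) x -> co_ (d / 2) y -> enorm (nu x - nu y) <= 4 / r * enorm (x - y).
Proof.
move=> Cx Cy; have /andP[h1 _] := collar_radius (lexx _) Cx.
have /andP[k1 _] := collar_radius (lexx _) Cy.
set X := enorm (x - c) in h1 *; set Y := enorm (y - c) in k1 *.
have r20 : 0 < r / 2 by rewrite divr_gt0.
have X0 : 0 < X by apply: lt_le_trans h1.
have Y0 : 0 < Y by apply: lt_le_trans k1.
have E : nu x - nu y = X^-1 *: (x - y) + (X^-1 - Y^-1) *: (y - c).
  rewrite /nu -/X -/Y scalerBl addrA; congr (_ - _).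
  by rewrite -scalerDr; congr (_ *: _); rewrite addrA subrK.
rewrite E; apply: le_trans (enormD _ _) _; rewrite !enormZ.
have V0 : 0 <= X^-1 by rewrite invr_ge0 ltW.
have e1 : `|X^-1 - Y^-1| * Y = `|Y - X| / X.
  have -> : X^-1 - Y^-1 = (Y - X) / X / Y by field; rewrite !gt_eqF.
  by rewrite !normrM !normfV (gtr0_norm X0) (gtr0_norm Y0) divfK// gt_eqF.
rewrite -/Y e1 (ger0_norm V0).
have e2 : `|Y - X| <= enorm (x - y).
  have := bdist_lip c r sgE y x; rewrite /bdist -mulrBr normrM nsg mul1r opprB addrA subrK.
  by rewrite (enorm_sym y x).
have i1 : X^-1 <= 2 / r.
  by rewrite -[2 / r]invf_div lef_pV2 ?posrE.
have := enorm_ge0 (x - y); move: (enorm (x - y)) e2 => D e2 D0.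
have -> : 4 / r * D = 2 / r * D + D * (2 / r) by ring.
apply: lerD; first by rewrite ler_wpM2r.
by apply: ler_pM.
Qed.

Lemma rshift_in x t : co_ (d / 2) x -> 0 <= t -> t + bd x < d / 2 -> co_ (d / 2) (rshift x t).
Proof.
move=> Cx t0 td; have /andP[b0 _] := Cx; rewrite /collar /= bdist_rshift//; last by lra.
by apply/andP; split; lra.
Qed.

Lemma is_derive_rshift F x t : Ck 1 (co_ (d / 2)) F -> co_ (d / 2) (rshift x t) ->
  is_derive t (1 : R) (fun s => F (rshift x s)) (sg * dot (nu x) (grad F (rshift x t))).
Proof.
move=> cF Ct.
have oU : open (co_ (d / 2)) by exact: collar_open.
have dc (p q : R) : is_derive t (1 : R) (fun s : R => p + s * sg * q) (sg * q).
  have d1 := is_deriveD (is_derive_cst p t (1 : R)) (is_deriveM (is_deriveM (is_derive_id t (1 : R)) (is_derive_cst sg t (1 : R))) (is_derive_cst q t (1:R))).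
  by apply: is_derive_eq d1 _; rewrite /GRing.scale /= !mulr0 !add0r mulr1 mulrC.
have := C1_chain oU cF _ (dc x.1 (nu x).1) (dc x.2 (nu x).2).
move=> /(_ Ct) D; apply: is_derive_eq D _.
rewrite -[pd false F _]/(partial1 F (rshift x t)) -[pd true F _]/(partial2 F (rshift x t)).
rewrite /dot /=; move: (partial1 _ _) (partial2 _ _) (nu x).1 (nu x).2 => g1 g2 n1 n2.
by ring.
Qed.

Lemma grad_norm_le F x (B : R) : (forall i, `|pd i F x| <= B) -> enorm (grad F x) <= 2 * B.
Proof.
move=> h; apply: le_trans (enorm_le_abs _) _; rewrite mulr_natl mulr2n.
by apply: lerD; [exact: (h false)|exact: (h true)].
Qed.

Lemma radial_increment F x (L T : R) : 0 <= L -> Ck 1 (co_ (d / 2)) F ->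
  (forall i y, co_ (d / 4) y -> `|pd i F y| <= L * bd y `^ (a - 1)) ->
  co_ (d / 4) x -> 0 < T -> bd x + T <= d / 4 ->
  `|F (rshift x T) - F x| <= 2 * L / a * T `^ a.
Proof.
move=> L0 cF hF /andP[b0 b1] T0 bT.
have Cx : co_ (d / 2) x by rewrite /collar /=; apply/andP; split; lra.
have /andP[h1 _] := collar_radius (lexx _) Cx.
have x0 : 0 < enorm (x - c) by apply: lt_le_trans h1; rewrite divr_gt0.
have E0 : rshift x 0 = x by rewrite /rshift mul0r scale0r addr0.
rewrite -{2}E0.
apply: (@powR_increment _ a (2 * L) T (fun s => F (rshift x s))
  (fun s => sg * dot (nu x) (grad F (rshift x s)))) => // t.
  move=> /andP[t0 tT]; apply: is_derive_rshift => //; apply: rshift_in => //; lra.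
move=> /andP[t0 tT].
have bt : bd (rshift x t) = bd x + t by rewrite bdist_rshift//; lra.
have Ct : co_ (d / 4) (rshift x t) by rewrite /collar /= bt; apply/andP; split; lra.
rewrite normrM nsg mul1r; apply: le_trans (dot_le _ _) _.
rewrite enorm_nu// mul1r -mulrA; apply: grad_norm_le => i.
apply: le_trans (hF i _ Ct) _; rewrite ler_wpM2l// bt.
by apply: powa => //; rewrite lerDr ltW.
Qed.

(** Both points are pushed radially to a distance of order [h = |x - y|] from the circle. The radial
    legs cost [h ^ a] by [radial_increment]; between the shifted points the gradient is at most of
    order [h ^ (a - 1)] over a length of order [h]. *)
Lemma hardy_littlewood F (L : R) : 0 <= L -> Ck 1 (co_ (d / 2)) F ->
  (forall i y, co_ (d / 4) y -> `|pd i F y| <= L * bd y `^ (a - 1)) ->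
  forall x y, co_ (d / 8) x -> co_ (d / 8) y -> x != y -> enorm (x - y) <= d / 64 ->
  `|F x - F y| <= (16 / a + 4) * L * enorm (x - y) `^ a.
Proof.
move=> L0 cF hF x y Cx Cy xy hd.
have C4 z : co_ (d / 8) z -> co_ (d / 4) z.
  by rewrite /collar /= => /andP[z0 z1]; apply/andP; split; lra.
have C2 z : co_ (d / 8) z -> co_ (d / 2) z.
  by rewrite /collar /= => /andP[z0 z1]; apply/andP; split; lra.
have hxy : 0 < enorm (x - y) by rewrite enorm_gt0 subr_eq0.
have shift_le z : co_ (d / 8) z -> `|F (rshift z (4 * enorm (x - y))) - F z| <=
    8 * L / a * enorm (x - y) `^ a.
  move=> Cz; have /andP[z0 z1] := Cz.
  apply: le_trans (radial_increment L0 cF hF (C4 z Cz) _ _) _; try lra.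
  rewrite powRM ?(ltW hxy)//.
  have h4 : (4 : R) `^ a <= 4 by apply: ler1_powR; [rewrite ler1n|exact: ltW].
  have La : 0 <= L / a by rewrite divr_ge0// ltW.
  have P0 : 0 <= enorm (x - y) `^ a by exact: powR_ge0.
  have -> : 2 * L / a * (4 `^ a * enorm (x - y) `^ a) = 4 `^ a * (2 * (L / a) * enorm (x - y) `^ a) by ring.
  have -> : 8 * L / a * enorm (x - y) `^ a = 4 * (2 * (L / a) * enorm (x - y) `^ a) by ring.
  by apply: ler_wpM2r h4; rewrite mulr_ge0// mulr_ge0.
set h := enorm (x - y) in hxy hd shift_le *.
(* The middle segment has length at most [2 * h], so along it the distance to the circle stays above
   [4 * h - 2 * h], and below [d / 8 + 6 * h < d / 4] because [h <= d / 64]. *)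
set x' := rshift x (4 * h) in shift_le *; set y' := rshift y (4 * h).
have d1 : enorm (y' - x') <= 2 * h.
  have -> : y' - x' = (y - x) + (4 * h * sg) *: (nu y - nu x).
    by rewrite /y' /x' /rshift scalerBr opprD addrACA.
  apply: le_trans (enormD _ _) _; rewrite enormZ normrM nsg mulr1 enorm_sym -/h.
  rewrite ger0_norm; last by rewrite mulr_ge0// ltW.
  have nl := nu_lip (C2 y Cy) (C2 x Cx); rewrite (enorm_sym y x) -/h in nl.
  have : 4 * h * enorm (nu y - nu x) <= 4 * h * (4 / r * h) by rewrite ler_wpM2l// mulr_ge0// ltW.
  have : 4 * h * (4 / r * h) <= h.
    have -> : 4 * h * (4 / r * h) = h * (16 * h / r) by ring.
    rewrite ger_pMr// ler_pdivrMr// mul1r; have := dr; lra.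
  lra.
have /andP[bx0 bx1] := Cx.
have bx' : bd x' = bd x + 4 * h by rewrite bdist_rshift//; [exact: C2|lra|lra].
have d2 : `|F y' - F x'| <= 4 * L * h `^ a.
  have -> : y' = x' + (y' - x') by rewrite addrC subrK.
  apply: (@le_trans _ _ (2 * (L * h `^ (a - 1)) * enorm (y' - x'))); last first.
    rewrite -(powRS a hxy); have X0 : 0 <= L * h `^ (a - 1) by rewrite mulr_ge0// powR_ge0.
    have -> : 4 * L * (h * h `^ (a - 1)) = 2 * (L * h `^ (a - 1)) * (2 * h) by ring.
    by rewrite ler_wpM2l// mulr_ge0.
  apply: (@C1_segment _ (co_ (d / 2))) => //; first exact: collar_open.
  move=> s /andP[s0 s1].
  have lp := bdist_lip c r sgE (x' + s *: (y' - x')) x'.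
  have sn : enorm (s *: (y' - x')) <= 2 * h.
    rewrite enormZ ger0_norm//; have := enorm_ge0 (y' - x'); nra.
  rewrite [x' + _ - x']addrC addKr bx' in lp.
  have /andP[l1 l2] : - (2 * h) <= bd (x' + s *: (y' - x')) - (bd x + 4 * h) <= 2 * h.
    by rewrite -ler_norml; exact: le_trans lp sn.
  have Cz : co_ (d / 4) (x' + s *: (y' - x')) by rewrite /collar /=; apply/andP; split; lra.
  split; first by rewrite /collar /=; apply/andP; split; lra.
  apply: grad_norm_le => i; apply: le_trans (hF i _ Cz) _; rewrite ler_wpM2l//.
  by apply: powa => //; lra.
have := shift_le x Cx; have := shift_le y Cy; rewrite -/y' -/x' => s1 s2.
have -> : (16 / a + 4) * L * h `^ a = 8 * L / a * h `^ a + (4 * L * h `^ a + 8 * L / a * h `^ a) by field; rewrite gt_eqF.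
have -> : F x - F y = - (F x' - F x) + (- (F y' - F x') + (F y' - F y)) by ring.
apply: le_trans (ler_normD _ _) _; rewrite normrN; apply: lerD => //.
by apply: le_trans (ler_normD _ _) _; rewrite normrN; apply: lerD.
Qed.

Lemma hess_radial_bound v (X : R) i j y : harm (co_ (d / 2)) v -> co_ (d / 2) y ->
  (forall k, `|dot (y - c) (grad (pd k v) y)| <= r * X) -> `|pd j (pd i v) y| <= 4 * X.
Proof.
move=> hv Cy h.
have oU : open (co_ (d / 2)) by exact: collar_open.
have /andP[h1 _] := collar_radius (lexx _) Cy.
have s12 := schwarz oU hv.1 Cy.
have lap : pd false (pd false v) y + pd true (pd true v) y = 0 by exact: hv.2.
have D22 : pd true (pd true v) y = - pd false (pd false v) y.
  by apply/eqP; rewrite -addr_eq0 addrC lap.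
have e1 := h false; have e2 := h true.
have sE := sqr_enorm (y - c).
rewrite /dot /grad /= -[partial1 (pd false v) y]/(pd false (pd false v) y)
  -[partial2 (pd false v) y]/(pd true (pd false v) y) s12 in e1.
rewrite /dot /grad /= -[partial1 (pd true v) y]/(pd false (pd true v) y)
  -[partial2 (pd true v) y]/(pd true (pd true v) y) D22 mulrN in e2.
have [fA fB] := symmetric_traceless_bound sE r0 h1 e1 e2.
case: i; case: j; rewrite ?D22 ?normrN; [exact: fA|exact: fB| |exact: fA].
by rewrite s12.
Qed.

(** Lets the lower-order term of a radial relation be absorbed in the singular factor, since
    [bd y < d <= r] and [a < 1]. *)
Lemma inv_d_le y : co_ (d / 4) y -> r^-1 <= d `^ (- a) * bd y `^ (a - 1).
Proof.
move=> /andP[b0 b1]; apply: (@le_trans _ _ d^-1); first by rewrite lef_pV2 ?posrE.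
have -> : d^-1 = d `^ (- a) * d `^ (a - 1).
  rewrite -powRD; last by rewrite (lt0r_neq0 d0) implybT.
  by rewrite addKr powR_inv1// ltW.
rewrite ler_wpM2l ?powR_ge0//; apply: powa => //; lra.
Qed.

(** * Consequences of a radial relation, applied to [u], to [wnor] and to the derivatives of [u] *)

Section RadialRelation.
Variables (v : plane R -> R) (q : bool -> plane R -> R) (L m : R).
Hypotheses (L0 : 0 <= L) (m0 : 0 <= m) (hv : harm (co_ (d / 2)) v).
Hypothesis rel : forall i y, co_ (d / 4) y ->
  pd i v y + dot (y - c) (grad (pd i v) y) = r * q i y.
Hypothesis hq : forall i y, co_ (d / 4) y -> `|q i y| <= L * bd y `^ (a - 1).
Hypothesis hm : forall i y, d / 8 <= bd y < d / 4 -> `|pd i v y| <= m.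

(** In the collar the radius lies between [r / 2] and [3 / 2 * r]; the coefficient 3 is the ratio of
    these extremes, and 2 that of [r] to the smaller one. *)
Definition sup_bound := 3 * m + 2 / a * L * d `^ a.

Lemma sup_bound_ge0 : 0 <= sup_bound.
Proof. by rewrite addr_ge0 ?mulr_ge0 ?powR_ge0 ?invr_ge0// ltW. Qed.

(* Along a ray through the centre, [rho |-> rho * pd i v] has derivative [r * q i]. *)
Lemma radial_sup i y : co_ (d / 4) y -> `|pd i v y| <= sup_bound.
Proof.
move=> Cy; have /andP[b0 b1] := Cy.
have mB : m <= sup_bound.
  have : 0 <= 2 / a * L * d `^ a by rewrite !mulr_ge0 ?powR_ge0 ?invr_ge0// ltW.
  rewrite /sup_bound; have := m0; lra.
have [by8|by8] := leP (d / 8) (bd y).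
  by apply: le_trans mB; apply: hm; rewrite by8.
have oU : open (co_ (d / 2)) by exact: collar_open.
have C2y : co_ (d / 2) y by rewrite /collar /=; apply/andP; split; lra.
have /andP[h1 h2] := collar_radius (lexx _) C2y.
have e0 : 0 < enorm (y - c) by apply: lt_le_trans h1; rewrite divr_gt0.
have cv : Ck 1 (co_ (d / 2)) (pd i v) by exact: Ck_pd hv.1.
(* A point with [bd y < d / 8] is carried by this shift into the zone where [hm] applies. *)
set T := d / 8; have T0 : 0 < T by rewrite divr_gt0.
pose h t := (enorm (y - c) + t * sg) * pd i v (rshift y t).
have E0 : rshift y 0 = y by rewrite /rshift mul0r scale0r addr0.
have sub t : 0 <= t <= T -> bd (rshift y t) = bd y + t /\ enorm (rshift y t - c) = enorm (y - c) + t * sg.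
  move=> /andP[t0 tT]; rewrite /T in tT; split; first by rewrite bdist_rshift//; lra.
  by rewrite enorm_rshift//; lra.
have dh t : 0 <= t <= T -> is_derive t (1 : R) h
   (sg * (pd i v (rshift y t) + dot (rshift y t - c) (grad (pd i v) (rshift y t)))).
  move=> tT; have [bt et] := sub t tT; move: tT => /andP[t0 tT]; rewrite /T in tT.
  have Ct : co_ (d / 2) (rshift y t) by rewrite /collar /= bt; apply/andP; split; lra.
  have d1 := is_deriveD (is_derive_cst (enorm (y - c)) t (1 : R)) (is_deriveM (is_derive_id t (1 : R)) (is_derive_cst sg t (1 : R))).
  have d2 := is_deriveM d1 (is_derive_rshift cv Ct).
  apply: is_derive_eq d2 _.
  have -> : cst sg t = sg :> R by [].
  have -> : (cst (enorm (y - c)) + id * cst sg) t = enorm (y - c) + t * sg by [].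
  have -> : rshift y t - c = (enorm (y - c) + t * sg) *: nu y.
    by rewrite rshift_sub// /nu scalerA mulrDl divff ?gt_eqF.
  rewrite /GRing.scale /= /dot /= /GRing.scale /=.
  move: (partial1 _ _) (partial2 _ _) (pd i v _) (nu y).1 (nu y).2 (enorm _) => g1 g2 p n1 n2 e.
  by ring.
have hT : `|h T - h 0| <= r * L / a * T `^ a.
  apply: (@powR_increment _ a (r * L) T h _ a0 T0 dh) => t /andP[t0 tT].
  have tT' : 0 <= t <= T by rewrite !ltW.
  have [bt et] := sub t tT'; rewrite /T in tT.
  have Ct : co_ (d / 4) (rshift y t) by rewrite /collar /= bt; apply/andP; split; lra.
  rewrite rel// normrM nsg mul1r normrM (gtr0_norm r0) -mulrA ler_wpM2l ?(ltW r0)//.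
  apply: le_trans (hq i Ct) _; rewrite ler_wpM2l//.
  by apply: powa => //; lra.
have TT : 0 <= T <= T by rewrite lexx ltW.
have [bT eT] := sub T TT.
have vT : `|pd i v (rshift y T)| <= m.
  by apply: hm; rewrite bT /T; apply/andP; split; lra.
move: hT; rewrite /h mul0r addr0 E0 => hT.
have rT : 0 <= enorm (y - c) + T * sg <= 3 / 2 * r.
  rewrite -eT enorm_ge0 /=.
  have CT : co_ (d / 2) (rshift y T) by rewrite /collar /= bT /T; apply/andP; split; lra.
  by have /andP[] := collar_radius (lexx _) CT.
have Ta : T `^ a <= d `^ a.
  by apply: ge0_ler_powR; rewrite ?nnegrE ?(ltW a0) ?(ltW T0) ?(ltW d0)// /T; lra.
have La : 0 <= r * L / a by rewrite !mulr_ge0 ?invr_ge0// ltW.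
have K : enorm (y - c) * `|pd i v y| <= 3 / 2 * r * m + r * L / a * d `^ a.
  rewrite -{1}(gtr0_norm e0) -normrM.
  have -> : enorm (y - c) * pd i v y = (enorm (y - c) + T * sg) * pd i v (rshift y T) -
     ((enorm (y - c) + T * sg) * pd i v (rshift y T) - enorm (y - c) * pd i v y) by rewrite subKr.
  apply: le_trans (ler_normB _ _) _; apply: lerD; last first.
    by apply: (le_trans hT); rewrite ler_wpM2l.
  rewrite normrM; apply: ler_pM => //; rewrite ger0_norm; by case/andP: rT.
have K2 : r / 2 * `|pd i v y| <= 3 / 2 * r * m + r * L / a * d `^ a.
  by apply: le_trans K; rewrite ler_wpM2r.
rewrite -(ler_pM2l (x := r / 2)) ?divr_gt0//; apply: (le_trans K2).
rewrite le_eqVlt; apply/orP; left; apply/eqP; rewrite /sup_bound; field.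
by rewrite gt_eqF.
Qed.

(** The relation gives the radial derivative of [pd k v] as [r * q k - pd k v], and
    [hess_radial_bound] passes from it to the full Hessian. *)
Lemma radial_hess i j y : co_ (d / 4) y ->
  `|pd j (pd i v) y| <= 4 * (L + sup_bound * d `^ (- a)) * bd y `^ (a - 1).
Proof.
move=> Cy; have /andP[b0 b1] := Cy.
have C2y : co_ (d / 2) y by rewrite /collar /=; apply/andP; split; lra.
have H := @hess_radial_bound v ((L + sup_bound * d `^ (- a)) * bd y `^ (a - 1)) i j y hv C2y.
rewrite -(mulrA 4); apply: H => k.
have -> : dot (y - c) (grad (pd k v) y) = r * q k y - pd k v y.
  by rewrite -rel// [pd k v y + _]addrC addrK.
have -> : r * ((L + sup_bound * d `^ (- a)) * bd y `^ (a - 1)) =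
   r * L * bd y `^ (a - 1) + r * (sup_bound * d `^ (- a)) * bd y `^ (a - 1) by ring.
apply: le_trans (ler_normB _ _) _; rewrite normrM (gtr0_norm r0); apply: lerD.
  rewrite -(mulrA r L); apply: ler_wpM2l; first exact: ltW.
  exact: hq.
apply: (le_trans (radial_sup k Cy)).
have -> : r * (sup_bound * d `^ (- a)) * bd y `^ (a - 1) = sup_bound * (r * (d `^ (- a) * bd y `^ (a - 1))) by ring.
apply: ler_peMr; first exact: sup_bound_ge0.
have := inv_d_le Cy; move: (_ * _) => X hX.
have := ler_wpM2l (ltW r0) hX.
by rewrite (divff (lt0r_neq0 r0)).
Qed.

Lemma radial_holder i x y : co_ (d / 8) x -> co_ (d / 8) y -> x != y -> enorm (x - y) <= d / 64 ->
  `|pd i v x - pd i v y| <=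
    (16 / a + 4) * (4 * (L + sup_bound * d `^ (- a))) * enorm (x - y) `^ a.
Proof.
apply: hardy_littlewood.
- by rewrite mulr_ge0// addr_ge0// mulr_ge0 ?powR_ge0// sup_bound_ge0.
- exact: Ck_pd hv.1.
- by move=> j z Cz; exact: radial_hess.
Qed.

End RadialRelation.
End CollarRegularity.

(** * The radial derivative of harmonic functions *)

Section RadialField.
Context {R : realType}.
Implicit Types (x y c : plane R) (U : set (plane R)) (f : plane R -> R).

Lemma harm_ext U f h : open U -> (forall x, U x -> f x = h x) -> harm U f -> harm U h.
Proof.
move=> oU fh [cf lf]; split; first exact: (Ck_ext oU fh cf).
move=> x Ux; rewrite -(lf x Ux); apply: (congr2 +%R).
  apply: (@pd_ext _ U (pd false h) (pd false f) false x oU _ Ux) => y Uy.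
  by apply/esym; apply: (pd_ext false oU fh Uy).
apply: (@pd_ext _ U (pd true h) (pd true f) true x oU _ Ux) => y Uy.
by apply/esym; apply: (pd_ext true oU fh Uy).
Qed.

Definition radial c f y : R :=
  (co false y - co false c) * pd false f y + (co true y - co true c) * pd true f y.

Lemma radialE c f y : radial c f y = dot (y - c) (grad f y).
Proof. by []. Qed.

Lemma Ck_radial m U c f : open U -> Ck m.+1 U f -> Ck m U (radial c f).
Proof.
move=> oU cf; apply: CkD => //; apply: CkM => //; first 1 last.
- exact: Ck_pd.
- by apply: CkB => //; [exact: Ck_co|exact: Ck_cst].
- exact: Ck_pd.
- by apply: CkB => //; [exact: Ck_co|exact: Ck_cst].
Qed.

Lemma pd_radial U c f i y : open U -> Ck 2 U f -> U y ->
  pd i (radial c f) y = pd i f y + radial c (pd i f) y.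
Proof.
move=> oU cf Uy.
have dc k : derivable (fun y => co k y - co k c) y (ee i).
  by apply: (@Ck_derivable _ 0 U) => //; apply: CkB => //; [exact: Ck_co|exact: Ck_cst].
have dp k : derivable (pd k f) y (ee i) by apply: (@Ck_derivable _ 0 U) => //; exact: Ck_pd.
have pc k : pd i (fun y => co k y - co k c) y = (k == i)%:R.
  have [_ E] := is_deriveB (is_derive_co k i y) (is_derive_cst (co k c) y (ee i)).
  by apply: etrans E _; rewrite subr0.
have sw : pd i (pd (~~ i) f) y = pd (~~ i) (pd i f) y.
  by case: i {dc dp pc}; rewrite /= (schwarz oU cf Uy).
apply: etrans (pdD (derivableM (dc false) (dp false)) (derivableM (dc true) (dp true))) _.
rewrite (pdM (dc false) (dp false)) (pdM (dc true) (dp true)) !pc.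
rewrite /radial; case: i {dc dp pc} sw => /= sw; rewrite sw.
  move: (pd true f y) (pd false f y) (pd false _ y) (pd true _ y) => p q s t.
  by ring.
move: (pd true f y) (pd false f y) (pd false _ y) (pd true _ y) => p q s t.
by ring.
Qed.

(** The field [x - c] generates dilations, which preserve harmonicity: the Laplacian of [radial c f]
    is twice the Laplacian of [f] plus its radial derivative, and both vanish. *)
Lemma harm_radial U c f : open U -> harm U f -> harm U (radial c f).
Proof.
move=> oU hf.
have c3 : Ck 3 U f by exact: harm_Ck.
have c4 : Ck 4 U f by exact: harm_Ck.
split; first exact: Ck_radial.
move=> x Ux.
have D i : pd i (pd i (radial c f)) x =
    2 * pd i (pd i f) x + radial c (pd i (pd i f)) x.
  have E y : U y -> pd i (radial c f) y = pd i f y + radial c (pd i f) y.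
    by move=> Uy; apply: (pd_radial _ _ oU (Ck_pred c3)).
  apply: etrans (pd_ext i oU E Ux) _.
  have c2 : Ck 3 U (pd i f) by exact: Ck_pd.
  have cr : Ck 1 U (radial c (pd i f)) by apply: Ck_radial => //; exact: Ck_pred.
  apply: etrans (pdD (Ck_derivable c2 Ux) (Ck_derivable cr Ux)) _.
  rewrite (pd_radial c i oU (Ck_pred c2) Ux).
  by move: (pd i (pd i f) x) (radial _ _ _) => p q; ring.
have L i : pd i (pd false (pd false f)) x + pd i (pd true (pd true f)) x = 0.
  have d1 j : derivable (pd j (pd j f)) x (ee i).
    by apply: (@Ck_derivable _ 0 U) => //; do 2 apply: Ck_pd; exact: c3.
  have := pdD (d1 false) (d1 true); move=> <-.
  have -> : 0 = pd i (fun=> 0) x by rewrite /pd derive_cst.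
  exact: (pd_ext i oU hf.2 Ux).
have l0 := hf.2 x Ux.
rewrite -[laplacian _ _]/(pd false (pd false (radial c f)) x + pd true (pd true (radial c f)) x).
rewrite !D.
have -> (p q s t : R) : 2 * p + s + (2 * q + t) = 2 * (p + q) + (s + t) by ring.
have aux (k l p q s t w : R) : w = 0 -> p + s = 0 -> q + t = 0 ->
    2 * w + (k * p + l * q + (k * s + l * t)) = 0.
  move=> -> ps qt; have -> : k * p + l * q + (k * s + l * t) = k * (p + s) + l * (q + t) by ring.
  by rewrite ps qt !mulr0 !addr0.
exact: (aux _ _ _ _ _ _ _ l0 (L false) (L true)).
Qed.

End RadialField.

(** * Rotations about the centre *)

Section Rotation.
Context {R : realType}.
Variables (c : plane R) (cs sn : R).
Hypothesis cs1 : cs ^+ 2 + sn ^+ 2 = 1.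
Implicit Types (x y : plane R) (U V : set (plane R)) (f : plane R -> R).

Definition rot y : plane R :=
  (c.1 + cs * (y.1 - c.1) - sn * (y.2 - c.2), c.2 + sn * (y.1 - c.1) + cs * (y.2 - c.2)).

Lemma rot_dist x y : enorm (rot x - rot y) = enorm (x - y).
Proof.
rewrite /enorm /=; congr Num.sqrt.
by rewrite -[RHS]mul1r -cs1; ring.
Qed.

Lemma rot_center y : enorm (rot y - c) = enorm (y - c).
Proof.
have {1}-> : c = rot c; last exact: rot_dist.
by rewrite /rot !subrr !mulr0 !addr0 subr0; case: (c).
Qed.

(** The transposed Jacobian of [rot]: the derivative in direction [i] of its coordinate [j]. *)
Definition rotc (i j : bool) : R := if i == j then cs else if i then - sn else sn.

Lemma is_derive_rot U f i y : open U -> Ck 1 U f -> U (rot y) ->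
  is_derive y (ee i) (fun x => f (rot x))
    (rotc i false * pd false f (rot y) + rotc i true * pd true f (rot y)).
Proof.
move=> oU cf Uy; apply: is_derive_of_line.
have lin (p q s t u v : R) :
    is_derive (0 : R) (1 : R) (fun t : R => p + q * (s + t * u - v)) (q * u).
  have d1 := is_deriveD (is_derive_cst p (0 : R) (1 : R)) (is_deriveM (is_derive_cst q (0 : R) (1 : R)) (is_deriveB (is_deriveD (is_derive_cst s (0 : R) (1 : R)) (is_deriveM (is_derive_id (0 : R) (1 : R)) (is_derive_cst u (0 : R) (1:R)))) (is_derive_cst v (0 : R) (1 : R)))).
  by apply: is_derive_eq d1 _; rewrite /GRing.scale /= !mul0r !mulr0 !add0r !mulr1 !addr0 subr0.
have lin2 (p q q' s s' u u' v v' : R) :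
    is_derive (0 : R) (1 : R) (fun t : R => p + q * (s + t * u - v) + q' * (s' + t * u' - v')) (q * u + q' * u').
  have d1 := is_deriveD (lin p q s 0 u v) (lin 0 q' s' 0 u' v').
  have -> : (fun t : R => p + q * (s + t * u - v) + q' * (s' + t * u' - v')) =
    ((fun t : R => p + q * (s + t * u - v)) + (fun t : R => 0 + q' * (s' + t * u' - v')))%R.
    by apply/funext => t; rewrite [RHS]/GRing.add /= add0r.
  exact: d1.
pose c1 t := c.1 + cs * (y.1 + t * (ee i).1 - c.1) + (- sn) * (y.2 + t * (ee i).2 - c.2) : R.
pose c2 t := c.2 + sn * (y.1 + t * (ee i).1 - c.1) + cs * (y.2 + t * (ee i).2 - c.2) : R.
have E t : rot (y + t *: ee i) = (c1 t, c2 t) by rewrite /rot /c1 /c2 mulNr.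
have E0 : rot y = (c1 0, c2 0) by rewrite -E scale0r addr0.
have := C1_chain oU cf _ (lin2 c.1 cs (- sn) y.1 y.2 (ee i).1 (ee i).2 c.1 c.2)
  (lin2 c.2 sn cs y.1 y.2 (ee i).1 (ee i).2 c.1 c.2).
rewrite -[(_, _)]/((c1 0, c2 0)) -E0 => /(_ Uy) D.
have -> : (fun t : R => f (rot (y + t *: ee i))) = (fun t : R => f (c1 t, c2 t)).
  by apply/funext => t; rewrite E.
apply: is_derive_eq D _; case: i {c1 c2 E E0}; rewrite /rotc /= ?mulr0 ?mulr1 ?addr0 ?add0r //.
Qed.

Lemma Ck_rot m U V f : open U -> open V -> (forall y, V y -> U (rot y)) ->
  Ck m U f -> Ck m V (fun y => f (rot y)).
Proof.
move=> oU oV VU; have crot : continuous rot.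
  move=> y A /nbhs_diskP [e e0 eA]; apply/nbhs_diskP; exists e => // x hx.
  by apply: eA; rewrite /disk /= rot_dist.
have ccomp f' : (forall x, U x -> {for x, continuous f'}) ->
    forall x, V x -> {for x, continuous (fun y => f' (rot y))}.
  by move=> cf x Vx; apply: (continuous_comp (crot x)); exact: cf (VU x Vx).
elim: m f => [|m IH] f cf.
  by split => //; apply: ccomp => x Ux; exact: Ck_continuous cf Ux.
have c1 : Ck 1 U f by exact: Ck_leq cf.
apply/CkS; split.
- by apply: ccomp => x Ux; exact: Ck_continuous cf Ux.
- by move=> i x Vx; have [] := is_derive_rot i oU c1 (VU x Vx).
move=> i; apply: (@Ck_ext _ m V (fun y => rotc i false * pd false f (rot y) + rotc i true * pd true f (rot y))) => //.
  by move=> x Vx; have [_ E] := is_derive_rot i oU c1 (VU x Vx); rewrite -E.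
by apply: CkD => //; apply: CkZ => //; apply: IH; exact: Ck_pd.
Qed.

Lemma pd_rot U V f i y : open U -> Ck 1 U f -> U (rot y) ->
  pd i (fun x => f (rot x)) y =
    rotc i false * pd false f (rot y) + rotc i true * pd true f (rot y).
Proof. by move=> oU cf Uy; have [_ E] := is_derive_rot i oU cf Uy. Qed.

Lemma harm_rot U V f : open U -> open V -> (forall y, V y -> U (rot y)) ->
  harm U f -> harm V (fun y => f (rot y)).
Proof.
move=> oU oV VU [cf lf]; split; first exact: Ck_rot cf.
move=> x Vx.
have D i : pd i (pd i (fun y => f (rot y))) x =
    rotc i false * (rotc i false * pd false (pd false f) (rot x) + rotc i true * pd true (pd false f) (rot x)) +
    rotc i true * (rotc i false * pd false (pd true f) (rot x) + rotc i true * pd true (pd true f) (rot x)).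
  have E y : V y -> pd i (fun y => f (rot y)) y = rotc i false * pd false f (rot y) + rotc i true * pd true f (rot y).
    by move=> Vy; apply: (pd_rot V i oU (Ck_pred cf)); exact: VU.
  apply: etrans (pd_ext i oV E Vx) _.
  have cp k : Ck 1 U (pd k f) by exact: Ck_pd.
  have d k : derivable (fun y => pd k f (rot y)) x (ee i).
    by have [] := is_derive_rot i oU (cp k) (VU x Vx).
  apply: etrans (pdD (derivableM (derivable_cst _ _ _) (d false)) (derivableM (derivable_cst _ _ _) (d true))) _.
  by rewrite (pdZ _ (d false)) (pdZ _ (d true)) !(pd_rot V i oU (cp _) (VU x Vx)).
rewrite -[laplacian _ _]/(pd false (pd false (fun y => f (rot y))) x + pd true (pd true (fun y => f (rot y))) x).
rewrite !D /rotc /= (schwarz oU cf (VU x Vx)).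
have := lf _ (VU x Vx); rewrite /laplacian.
rewrite -[partial1 (partial1 f) _]/(pd false (pd false f) (rot x)) -[partial2 (partial2 f) _]/(pd true (pd true f) (rot x)).
move: (pd false (pd false f) (rot x)) (pd true (pd true f) (rot x)) (pd false (pd true f) (rot x)) => A B E AB.
have -> : cs * (cs * A + sn * E) + sn * (cs * E + sn * B) + (- sn * (- sn * A + cs * E) + cs * (- sn * E + cs * B)) =
  (cs ^+ 2 + sn ^+ 2) * (A + B) by ring.
by rewrite AB mulr0.
Qed.

End Rotation.

Section WithinContinuity.
Context {R : realType}.
Implicit Types (x y : plane R) (A : set (plane R)) (f : plane R -> R).

Lemma within_continuousP A f : {within A, continuous f} <->
  forall x e, A x -> 0 < e -> exists2 t, 0 < t &
    forall y, A y -> enorm (y - x) < t -> `|f y - f x| < e.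
Proof.
split.
- move=> /subspace_continuousP cf x e Ax e0.
  have /cvgrPdist_lt /(_ e e0) := cf x Ax.
  rewrite /within /= => /nbhs_diskP [t t0 h]; exists t => // y Ay yx.
  by rewrite distrC; apply: h.
move=> h; apply/subspace_continuousP => x Ax; apply/cvgrPdist_lt => e e0.
have [t t0 ht] := h x e Ax e0.
by rewrite /within /=; apply/nbhs_diskP; exists t => // y yx Ay; rewrite distrC; apply: ht.
Qed.

End WithinContinuity.

Section CollarConstants.
Context {R : realType}.
Variable a : R.
Hypothesis a01 : 0 < a < 1.

(** The constant of [collar_grad]. That of [kB] is [sup_bound] with [m = J] and
    [L = 6 * kA * Q * d ^ (- a)], in units of [Q] and with [J <= Q]. *)
Definition kA : R := 8192 * (1 + 4 * (16 / (1 - a))).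
Definition kB : R := 3 + 12 * kA / a.

Lemma kA_ge0 : 0 <= kA.
Proof.
have /andP[a0 a1] := a01; have h : 0 <= 16 / (1 - a) by rewrite divr_ge0// subr_ge0 ltW.
by apply: mulr_ge0; [exact: ler0n|apply: addr_ge0 => //; apply: mulr_ge0].
Qed.

Lemma kB_ge0 : 0 <= kB.
Proof.
have /andP[a0 a1] := a01; apply: addr_ge0 => //; apply: divr_ge0; last exact: ltW.
by apply: mulr_ge0 => //; exact: kA_ge0.
Qed.

End CollarConstants.

(** * The Neumann problem in a collar: first derivatives *)

Section CollarNeumann.
Context {R : realType}.
Variables (a : R) (c : plane R) (r sg d : R).
Hypotheses (a01 : 0 < a < 1) (d0 : 0 < d) (dr : d <= r)
  (sgE : sg = 1 \/ sg = - 1).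
Implicit Types (x y z : plane R).
Local Notation bd := (bdist c r sg).
Local Notation co_ := (collar c r sg).
Local Notation cco := (ccollar c r sg).

Variables (u g : plane R -> R) (G : plane R -> plane R) (J Sg Hg : R).
Hypotheses (J0 : 0 <= J) (Sg0 : 0 <= Sg) (Hg0 : 0 <= Hg).
Hypotheses (hu : harm (co_ d) u) (cG : {within cco (d / 2), continuous G})
  (GE : forall y, co_ d y -> G y = grad u y)
  (Gg : forall x, circle c r x -> dot (G x) (outer_normal c r x) = g x).
Hypotheses (hS : forall x, circle c r x -> `|g x| <= Sg)
  (hH : forall x y, circle c r x -> circle c r y -> `|g y - g x| <= Hg * enorm (y - x) `^ a).
Hypotheses (hJ1 : forall i y, d / 8 <= bd y <= d / 2 -> `|pd i u y| <= J)
  (hJ2 : forall i j y, d / 8 <= bd y <= d / 2 -> `|pd j (pd i u) y| <= J / d).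

Let r0 : 0 < r. Proof. exact: lt_le_trans dr. Qed.
Let a0 : 0 < a. Proof. by case/andP: a01. Qed.
Let a1 : a < 1. Proof. by case/andP: a01. Qed.
Let oU t : open (co_ t). Proof. by exact: collar_open. Qed.
Let co_sub s t y : s <= t -> co_ s y -> co_ t y.
Proof. by move=> st /andP[h1 h2]; rewrite /collar /= h1 (lt_le_trans h2). Qed.
Let hu2 : harm (co_ (d / 2)) u.
Proof. by apply: harm_sub hu => y; apply: co_sub; have := d0; lra. Qed.

(* The harmonic function whose trace on the circle is the Neumann datum. *)
Definition wnor y : R := r^-1 * radial c u y.

Lemma harm_wnor : harm (co_ d) wnor.
Proof.
have h := harm_lin (r^-1) 0 (@oU _) (harm_radial c (@oU _) hu) (harm_radial c (@oU _) hu).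
by apply: (harm_ext (@oU _) _ h) => x _; rewrite mul0r addr0.
Qed.

Lemma wnor_rel i y : co_ d y -> pd i u y + dot (y - c) (grad (pd i u) y) = r * pd i wnor y.
Proof.
move=> Cy; rewrite -radialE.
have cu : Ck 2 (co_ d) u by case: hu.
have cr : Ck 1 (co_ d) (radial c u).
  by apply: Ck_radial; [exact: oU|exact: cu].
have -> : pd i wnor y = r^-1 * pd i (radial c u) y by apply: pdZ; exact: Ck_derivable cr Cy.
by rewrite (pd_radial c i (@oU _) cu Cy) mulrA divff ?mul1r// gt_eqF.
Qed.

(** The continuous extension of [wnor] to the circle, where it equals [g]. *)
Let W y := dot (G y) (outer_normal c r y).

Let WE y : co_ d y -> W y = wnor y.
Proof.
move=> Cy; rewrite /W GE// /wnor /radial /dot /grad /outer_normal /=.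
rewrite -[partial1 u y]/(pd false u y) -[partial2 u y]/(pd true u y).
by move: (pd false u y) (pd true u y) => p q; ring.
Qed.

Let cW : {within cco (d / 2), continuous W}.
Proof.
move=> x.
have cn i : {for x, continuous (fun y : subspace (cco (d / 2)) => (co i y - co i c) / r)}.
  move: x; apply: continuous_subspaceT => x; apply: cvgM; last exact: cvg_cst.
  apply: cvgB; last exact: cvg_cst.
  exact: Ck_continuous (@Ck_co R 0 setT i) Logic.I.
have c1 : {for x, continuous (fun y : subspace (cco (d / 2)) => (G y).1)}.
  by apply: (continuous_comp (f := G : subspace (cco (d / 2)) -> _) (g := fst)); [exact: cG|exact: cvg_fst].
have c2 : {for x, continuous (fun y : subspace (cco (d / 2)) => (G y).2)}.
  by apply: (continuous_comp (f := G : subspace (cco (d / 2)) -> _) (g := snd)); [exact: cG|exact: cvg_snd].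
by apply: cvgD; apply: cvgM => //; [exact: (cn false)|exact: (cn true)].
Qed.

Let harmW : harm (co_ (d / 2)) W.
Proof.
have hw : harm (co_ (d / 2)) wnor by apply: harm_sub harm_wnor => y; apply: co_sub; have := d0; lra.
apply: (harm_ext (@oU _) _ hw) => x Cx; apply/esym; apply: WE.
by apply: co_sub Cx; have := d0; lra.
Qed.

(** The size of the gradient near the circle: the interior bound, the size of [g], and its
    oscillation over a length [d]. *)
Let Q := J + Sg + Hg * d `^ a.
Local Notation kA := (kA a).
Local Notation kB := (kB a).

Let Q0 : 0 <= Q.
Proof. by rewrite !addr_ge0// mulr_ge0// powR_ge0. Qed.

Let pda : d `^ a * d `^ (- a) = 1.
Proof. by rewrite -powRD ?subrr ?powRr0// (lt0r_neq0 d0) implybT. Qed.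

Let powR_2d : (2 / d) `^ a <= 2 * d `^ (- a).
Proof.
have -> : (2 / d) `^ a = 2 `^ a * d `^ (- a).
  by rewrite powRM ?invr_ge0 ?(ltW d0)// -(powR_inv1 (ltW d0)) -powRrM mulN1r.
by apply: ler_wpM2r; [exact: powR_ge0|apply: ler1_powR; [rewrite ler1n|exact: ltW]].
Qed.

(** Brings the data of [collar_grad] to the form [T * d ^ (- a)], with [T] of the dimension of the
    function itself; the 2 is [2 ^ a <= 2]. *)
Let collar_data_le (H S T : R) : 0 <= S -> H * d `^ a + 2 * S <= T ->
  H + S * (2 / d) `^ a <= T * d `^ (- a).
Proof.
move=> S0 hT; have P0 : 0 <= d `^ (- a) by exact: powR_ge0.
apply: le_trans (ler_wpM2r P0 hT).
have -> : (H * d `^ a + 2 * S) * d `^ (- a) = H * (d `^ a * d `^ (- a)) + S * (2 * d `^ (- a)) by ring.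
rewrite pda mulr1 lerD2l; exact: ler_wpM2l S0 _ _ powR_2d.
Qed.

Let bd_far_pt y : d / 8 <= bd y <= d / 2 -> co_ d y /\ r / 2 <= enorm (y - c) <= 3 / 2 * r.
Proof.
move=> /andP[h1 h2]; split.
  by rewrite /collar /=; apply/andP; split; have := d0; lra.
apply: (ccollar_radius dr sgE); rewrite /ccollar /=; apply/andP; split => //; have := d0; lra.
Qed.

Lemma wnor_far y : d / 8 <= bd y <= d / 2 -> `|wnor y| <= 3 * J.
Proof.
move=> h; have [_ /andP[_ hy]] := bd_far_pt h.
rewrite /wnor radialE normrM ger0_norm ?invr_ge0 ?(ltW r0)//.
rewrite mulrC ler_pdivrMr//; apply: le_trans (dot_le _ _) _.
have g2 : enorm (grad u y) <= 2 * J by apply: grad_norm_le => i; apply: hJ1.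
have := ler_pM (enorm_ge0 _) (enorm_ge0 _) hy g2.
by move=> h'; apply: (le_trans h'); rewrite le_eqVlt; apply/orP; left; apply/eqP; field.
Qed.

Lemma wnor_grad i y : co_ (d / 4) y -> `|pd i wnor y| <= 6 * kA * Q * d `^ (- a) * bd y `^ (a - 1).
Proof.
move=> Cy.
have Cy2 : co_ (d / 2) y by apply: co_sub Cy; have := d0; lra.
have <- : pd i W y = pd i wnor y.
  apply: (pd_ext i (@oU _) _ Cy2) => z Cz; apply: WE.
  by apply: co_sub Cz; have := d0; lra.
(* [W] is at most [3 * J] on the far edge and [Sg] on the circle. Twice the sum, added to the
   Hoelder term, is at most [6 * Q]. *)
have S0 : 0 <= 3 * J + Sg by rewrite addr_ge0// mulr_ge0.
have wH x z : circle c r x -> circle c r z -> `|W z - W x| <= Hg * enorm (z - x) `^ a.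
  by move=> cx cz; rewrite /W !Gg//; exact: hH.
have wS x z : circle c r x -> bd z = d / 2 -> `|W z - W x| <= 3 * J + Sg.
  move=> cx bz; apply: le_trans (ler_normB _ _) _; apply: lerD; last by rewrite /W Gg//; exact: hS.
  have hz : d / 8 <= bd z <= d / 2 by rewrite bz; apply/andP; split; have := d0; lra.
  have [Cz _] := bd_far_pt hz; rewrite WE//; exact: wnor_far.
apply: le_trans (collar_grad a01 d0 dr sgE Hg0 S0 harmW cW wH wS i Cy) _.
apply: ler_wpM2r; first exact: powR_ge0.
have -> : 6 * kA * Q * d `^ (- a) = kA * (6 * Q * d `^ (- a)) by ring.
rewrite -[8192 * _]/kA; apply: (ler_wpM2l (kA_ge0 a01)).
apply: collar_data_le => //.
have H1 : 0 <= Hg * d `^ a by rewrite mulr_ge0// powR_ge0.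
rewrite /Q; move: (Hg * d `^ a) H1 => X X0; have := J0; have := Sg0; lra.
Qed.

Let L1 := 6 * kA * Q * d `^ (- a).
Let L10 : 0 <= L1.
Proof.
apply: mulr_ge0; last exact: powR_ge0; apply: mulr_ge0 => //.
by apply: mulr_ge0 => //; exact: kA_ge0.
Qed.

Let hJ8 i y : d / 8 <= bd y < d / 4 -> `|pd i u y| <= J.
Proof. by move=> /andP[h1 h2]; apply: hJ1; rewrite h1 /=; have := d0; lra. Qed.

Let rel1 i y : co_ (d / 4) y -> pd i u y + dot (y - c) (grad (pd i u) y) = r * pd i wnor y.
Proof. by move=> Cy; apply: wnor_rel; apply: co_sub Cy; have := d0; lra. Qed.

Let sup1 : sup_bound a d L1 J <= kB * Q.
Proof.
have -> : sup_bound a d L1 J = 3 * J + 12 * kA / a * Q * (d `^ a * d `^ (- a)).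
  by rewrite /sup_bound /L1; ring.
have -> : kB * Q = 3 * Q + 12 * kA / a * Q by rewrite /kB; ring.
rewrite pda mulr1 lerD2r ler_pM2l// /Q.
by rewrite -addrA lerDl addr_ge0// mulr_ge0// powR_ge0.
Qed.

Lemma collar_grad_bound i y : co_ (d / 4) y -> `|pd i u y| <= kB * Q.
Proof.
move=> Cy; apply: le_trans sup1.
exact: (radial_sup a01 d0 dr sgE L10 J0 hu2 rel1 wnor_grad hJ8).
Qed.

Definition kC : R := (16 / a + 4) * (4 * (6 * kA + kB)).

Lemma collar_grad_holder i x y : co_ (d / 8) x -> co_ (d / 8) y -> x != y ->
  enorm (x - y) <= d / 64 ->
  `|pd i u x - pd i u y| <= kC * (Q * d `^ (- a)) * enorm (x - y) `^ a.
Proof.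
move=> Cx Cy xy hd.
apply: (le_trans (radial_holder a01 d0 dr sgE L10 J0 hu2 rel1 wnor_grad hJ8 i Cx Cy xy hd)).
apply: ler_wpM2r; first exact: powR_ge0.
rewrite /kC -mulrA; apply: ler_wpM2l; first by rewrite addr_ge0// divr_ge0// ltW.
rewrite -mulrA; apply: ler_wpM2l => //.
have -> : (6 * kA + kB) * (Q * d `^ (- a)) = L1 + kB * Q * d `^ (- a) by rewrite /L1; ring.
by rewrite lerD2l; apply: ler_wpM2r sup1; exact: powR_ge0.
Qed.

(** * The Neumann problem in a collar: second derivatives *)

Section SecondOrder.
Variables (dg : plane R -> R) (S1 H1 : R).
Hypotheses (S10 : 0 <= S1) (H10 : 0 <= H1).
Hypothesis hdg : forall x, circle c r x ->
  is_derive (0 : R) (1 : R) (fun t : R => g (arclength c r x t)) (dg x).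
Hypotheses (hS1 : forall x, circle c r x -> `|dg x| <= S1)
  (hH1 : forall x y, circle c r x -> circle c r y -> `|dg y - dg x| <= H1 * enorm (y - x) `^ a).

(** The analogue of [Q] one derivative higher, with [g'] for [g] and [Q / d] for the interior
    bound. *)
Let P := Q / d + S1 + H1 * d `^ a.

Let P0 : 0 <= P.
Proof. by rewrite !addr_ge0// ?mulr_ge0// ?powR_ge0// invr_ge0 ltW. Qed.

Let JP : J / d <= P.
Proof.
have QJ : J / d <= Q / d.
  by apply: ler_wpM2r; [rewrite invr_ge0 ltW|rewrite /Q -addrA lerDl addr_ge0// mulr_ge0// powR_ge0].
by apply: (le_trans QJ); rewrite /P -addrA lerDl addr_ge0// mulr_ge0// powR_ge0.
Qed.

Local Notation arc := (arclength c r).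

Lemma arclength_circle x t : circle c r x -> circle c r (arc x t).
Proof. by move=> cx; rewrite /circle /= (rot_center _ (cos2Dsin2 _)). Qed.

Lemma arclengthD x s t : arc (arc x s) t = arc x (s + t).
Proof.
rewrite /arclength /= mulrDl cosD sinD.
by congr pair; ring.
Qed.

Lemma arclength0 x : arc x 0 = x.
Proof. by rewrite /arclength mul0r cos0 sin0; case: x => x1 x2 /=; congr pair; ring. Qed.

Lemma bdist_arclength x t : bd (arc x t) = bd x.
Proof. by rewrite /bdist (rot_center _ (cos2Dsin2 _)). Qed.

Lemma arclength_dist x y t : enorm (arc x t - arc y t) = enorm (x - y).
Proof. exact: (rot_dist _ (cos2Dsin2 _)). Qed.

Definition tangent y : plane R := (- (y.2 - c.2) / r, (y.1 - c.1) / r).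

Let is_derive_angle t : is_derive t (1 : R) (fun s : R => cos (s / r)) (- sin (t / r) / r) /\
  is_derive t (1 : R) (fun s : R => sin (s / r)) (cos (t / r) / r).
Proof.
have dq : is_derive t (1 : R) (fun s : R => s / r) r^-1.
  have d1 := is_deriveM (is_derive_id t (1 : R)) (is_derive_cst r^-1 t (1 : R)).
  by apply: is_derive_eq d1 _; rewrite /GRing.scale /= mulr0 add0r mulr1.
split.
  by have := @is_derive1_comp _ cos (fun s : R => s / r) t _ _ (is_derive_cos (t / r)) dq.
by have := @is_derive1_comp _ sin (fun s : R => s / r) t _ _ (is_derive_sin (t / r)) dq.
Qed.

Lemma is_derive_arclength F y t : Ck 1 (co_ d) F -> co_ d y ->
  is_derive t (1 : R) (fun s => F (arc y s)) (dot (tangent (arc y t)) (grad F (arc y t))).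
Proof.
move=> cF Cy.
have [dcs dsn] := is_derive_angle t.
have lin (p q w : R) (h1 h2 : R -> R) (l1 l2 : R) : is_derive t (1 : R) h1 l1 -> is_derive t (1 : R) h2 l2 ->
    is_derive t (1 : R) (fun s => p + h1 s * q + h2 s * w) (l1 * q + l2 * w).
  move=> k1 k2.
  have d1 := is_deriveD (is_deriveD (is_derive_cst p t (1 : R)) (is_deriveM k1 (is_derive_cst q t (1 : R)))) (is_deriveM k2 (is_derive_cst w t (1 : R))).
  by apply: is_derive_eq d1 _; rewrite /GRing.scale /= !mulr0 !add0r mulrC (mulrC w).
have d1 := lin c.1 (y.1 - c.1) (- (y.2 - c.2)) _ _ _ _ dcs dsn.
have d2 := lin c.2 (y.1 - c.1) (y.2 - c.2) _ _ _ _ dsn dcs.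
have E1 : (fun s : R => c.1 + cos (s / r) * (y.1 - c.1) + sin (s / r) * - (y.2 - c.2)) = fun s => (arc y s).1.
  by apply/funext => s; rewrite mulrN.
rewrite E1 in d1.
have Ct : co_ d (arc y t) by rewrite /collar /= bdist_arclength.
have D := C1_chain (c1 := fun s => (arc y s).1) (c2 := fun s => (arc y s).2) (@oU _) cF Ct d1 d2.
apply: is_derive_eq D _.
rewrite /dot /tangent /grad -[pd false F _]/(partial1 F (arc y t)) -[pd true F _]/(partial2 F (arc y t)) /=.
by move: (partial1 _ _) (partial2 _ _) => p q; ring.
Qed.

Lemma tangent_norm y : enorm (tangent y) = enorm (y - c) / r.
Proof.
have -> : tangent y = r^-1 *: (- (y.2 - c.2), y.1 - c.1).
  by rewrite /tangent; congr pair; rewrite mulrC.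
rewrite enormZ ger0_norm ?invr_ge0 ?(ltW r0)// mulrC; congr (_ / _).
by rewrite /enorm /= sqrrN addrC.
Qed.

(** The passage to the limit in the estimates for [Wq t], which are uniform in [t > 0]. *)
Lemma derive_le (h : R -> R) (D K : R) : is_derive (0 : R) (1 : R) h D ->
  (forall t, 0 < t -> `|t^-1 * (h t - h 0)| <= K) -> `|D| <= K.
Proof.
move=> [dh E] hK; rewrite leNgt; apply/negP => KD.
have e0 : 0 < `|D| - K by rewrite subr_gt0.
have := dh; rewrite /derivable => cv.
have cv' : (fun t => t^-1 *: ((h \o shift 0) (t *: (1 : R)) - h 0)) @ (0 : R)^' --> D.
  by rewrite -E; exact: cv.
move/cvgrPdist_lt/(_ _ e0) : cv'; rewrite /dnbhs /within /= => -[t /= t0 ht].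
have t20 : 0 < t / 2 by rewrite divr_gt0.
have := ht (t / 2); rewrite /= sub0r normrN gtr0_norm//.
have tt : t / 2 < t by rewrite gtr_pMr// invf_lt1 ?ltr1n.
move=> /(_ tt (lt0r_neq0 t20)).
rewrite addr0 [_ *: 1]mulr1.
have := hK _ t20; rewrite /GRing.scale /= => k1 k2.
have := ler_distD (t / 2)^-1 D 0.
have := lerB_dist D ((t / 2)^-1 * (h (t / 2) - h 0)).
lra.
Qed.

Lemma wnor_derive_far i y : d / 8 <= bd y <= d / 2 -> `|pd i wnor y| <= 4 * (J / d).
Proof.
move=> h; have [Cy /andP[_ hy]] := bd_far_pt h.
have := wnor_rel i Cy; have j1 := hJ1 i h.
have g2 : enorm (grad (pd i u) y) <= 2 * (J / d) by apply: grad_norm_le => k; apply: hJ2.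
have d2 := ler_pM (enorm_ge0 _) (enorm_ge0 _) hy g2.
have d3 := le_trans (dot_le (y - c) (grad (pd i u) y)) d2.
move: (pd i wnor y) (dot _ _) d3 => w D hD E.
have rw : r * `|w| <= r * (4 * (J / d)).
  rewrite -{1}(gtr0_norm r0) -normrM -E; apply: le_trans (ler_normD _ _) _.
  (* One of the four parts pays for [pd i u], as [J <= r * (J / d)]; the other three pay for the
     radial derivative. *)
  have -> : r * (4 * (J / d)) = r * (J / d) + 3 / 2 * r * (2 * (J / d)) by field; rewrite gt_eqF.
  apply: lerD => //; apply: (le_trans j1); rewrite mulrC -mulrA; apply: ler_peMr => //.
  by rewrite mulrC ler_pdivlMr// mul1r.
by rewrite ler_pM2l in rw.
Qed.

(** The difference quotient of [W] under a rotation by the arclength [t] on the circle. Unlike the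
    angular derivative of [W], it is known to be continuous up to the circle; rotations preserve
    harmonicity and the collar. *)
Let Wq (t : R) y := t^-1 * W (arc y t) + (- t^-1) * W y.

Let arc_co t s y : co_ s y -> co_ s (arc y t).
Proof. by rewrite /collar /= bdist_arclength. Qed.

Let harmWq t : harm (co_ (d / 2)) (Wq t).
Proof.
apply: (harm_lin _ _ (@oU _)) harmW.
exact: (harm_rot (cos2Dsin2 _) (@oU _) (@oU _) (@arc_co t _) harmW).
Qed.

Let cWq t : {within cco (d / 2), continuous (Wq t)}.
Proof.
have cWt : {within cco (d / 2), continuous (fun y => W (arc y t))}.
  apply/within_continuousP => x e Cx e0.
  have Ct : cco (d / 2) (arc x t) by rewrite /ccollar /= bdist_arclength.
  have [s s0 hs] := (within_continuousP _ _).1 cW _ _ Ct e0.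
  exists s => // y Cy yx; apply: hs; last by rewrite arclength_dist.
  by rewrite /ccollar /= bdist_arclength.
move=> x; apply: cvgD; apply: cvgM; [exact: cvg_cst|exact: cWt|exact: cvg_cst|exact: cW].
Qed.

Let garc_derive x s : circle c r x ->
  is_derive s (1 : R) (fun t : R => g (arc x t)) (dg (arc x s)).
Proof.
move=> cx.
have d1 : is_derive s (1 : R) (fun t : R => t - s) 1.
  have d1 := is_deriveB (is_derive_id s (1 : R)) (is_derive_cst s s (1 : R)).
  by apply: is_derive_eq d1 _; rewrite subr0.
have h := hdg (arclength_circle s cx).
have h' : is_derive (s - s) (1 : R) (fun t : R => g (arc (arc x s) t)) (dg (arc x s)) by rewrite subrr.
have := @is_derive1_comp _ _ (fun t : R => t - s) s _ _ h' d1.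
rewrite mulr1; have -> // : ((fun t : R => g (arc (arc x s) t)) \o (fun t : R => t - s)) = (fun t : R => g (arc x t)).
by apply/funext => t /=; rewrite arclengthD addrC subrK.
Qed.

Let quot_le (h h' : R -> R) (t K : R) : 0 < t -> (forall s : R, is_derive s (1 : R) h (h' s)) ->
  (forall s, `|h' s| <= K) -> `|t^-1 * (h t - h 0)| <= K.
Proof.
move=> t0 dh hK.
have [|s _ ->] := @MVT R h h' 0 t t0 (fun s _ => dh s).
  apply: continuous_subspaceT => s; apply: differentiable_continuous.
  by apply/derivable1_diffP; have [] := dh s.
by rewrite subr0 mulrC mulfK ?gt_eqF.
Qed.

Let Wq_circle t x : circle c r x -> Wq t x = t^-1 * (g (arc x t) - g (arc x 0)).
Proof.
move=> cx; rewrite /Wq /W !Gg ?arclength0//; last exact: arclength_circle.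
by rewrite mulrBr mulNr.
Qed.

(** The mean value theorem for [g (arc y s) - g (arc x s)] in [s]: the derivative is a difference of
    values of [g'] at two points whose distance is still [|y - x|]. *)
Let WqH t x y : 0 < t -> circle c r x -> circle c r y ->
  `|Wq t y - Wq t x| <= H1 * enorm (y - x) `^ a.
Proof.
move=> t0 cx cy; rewrite !Wq_circle// -mulrBr.
have -> : g (arc y t) - g (arc y 0) - (g (arc x t) - g (arc x 0)) =
  (g (arc y t) - g (arc x t)) - (g (arc y 0) - g (arc x 0)) by ring.
apply: (@quot_le (fun s => g (arc y s) - g (arc x s)) (fun s => dg (arc y s) - dg (arc x s))) => // s.
  exact: is_deriveB (garc_derive s cy) (garc_derive s cx).
by rewrite -(arclength_dist y x s); apply: hH1; exact: arclength_circle.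
Qed.

(** The 12 is [3 / 2 * 2 * 4]: the length of [tangent] at radius at most [3 / 2 * r], the passage
    from components to the gradient, and [wnor_derive_far]. *)
Let WqS t x y : 0 < t -> circle c r x -> bd y = d / 2 ->
  `|Wq t y - Wq t x| <= 12 * (J / d) + S1.
Proof.
move=> t0 cx by2; apply: le_trans (ler_normB _ _) _; apply: lerD; last first.
  rewrite Wq_circle//; apply: (@quot_le (fun s => g (arc x s)) (fun s => dg (arc x s)) t S1 t0) => s.
    exact: garc_derive.
  by apply: hS1; exact: arclength_circle.
have hy s : d / 8 <= bd (arc y s) <= d / 2.
  by rewrite bdist_arclength by2; apply/andP; split; have := d0; lra.
have [Cy _] := bd_far_pt (hy 0); rewrite arclength0 in Cy.
have -> : Wq t y = t^-1 * (wnor (arc y t) - wnor (arc y 0)).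
  by rewrite /Wq !WE ?arclength0 ?mulrBr ?mulNr//; exact: arc_co.
have cw : Ck 1 (co_ d) wnor by apply: Ck_pred; case: harm_wnor.
apply: (quot_le t0 (fun s => is_derive_arclength s cw Cy)) => s.
apply: le_trans (dot_le _ _) _; rewrite tangent_norm.
have [_ /andP[_ h]] := bd_far_pt (hy s).
have h' : enorm (arc y s - c) / r <= 3 / 2 by rewrite ler_pdivrMr.
have g2 : enorm (grad wnor (arc y s)) <= 2 * (4 * (J / d)).
  by apply: grad_norm_le => i; apply: wnor_derive_far.
have e0 : 0 <= enorm (arc y s - c) / r by rewrite divr_ge0 ?enorm_ge0// ltW.
apply: (le_trans (ler_pM e0 (enorm_ge0 _) h' g2)); move: (J / d) => X; lra.
Qed.

Let L2 := 24 * kA * P * d `^ (- a).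
Let L20 : 0 <= L2.
Proof.
apply: mulr_ge0; last exact: powR_ge0; apply: mulr_ge0 => //.
by apply: mulr_ge0 => //; exact: kA_ge0.
Qed.

Let Wq_grad t i y : 0 < t -> co_ (d / 4) y -> `|pd i (Wq t) y| <= L2 * bd y `^ (a - 1).
Proof.
move=> t0 Cy.
have S0 : 0 <= 12 * (J / d) + S1 by rewrite addr_ge0// mulr_ge0// divr_ge0// ltW.
have H := @collar_grad R a c r sg d a01 d0 dr sgE (Wq t) H1 _ H10 S0 (harmWq t) (@cWq t)
  (fun x y => @WqH t x y t0) (fun x y => @WqS t x y t0) i y Cy.
apply: (le_trans H).
apply: ler_wpM2r; first exact: powR_ge0.
have -> : L2 = kA * (24 * P * d `^ (- a)) by rewrite /L2; ring.
rewrite -[8192 * _]/kA; apply: (ler_wpM2l (kA_ge0 a01)).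
apply: collar_data_le => //.
have h1 : 0 <= H1 * d `^ a by rewrite mulr_ge0// powR_ge0.
have QJ : J / d <= Q / d.
  by apply: ler_wpM2r; [rewrite invr_ge0 ltW|rewrite /Q -addrA lerDl addr_ge0// mulr_ge0// powR_ge0].
have J0' : 0 <= J / d by rewrite divr_ge0// ltW.
rewrite /P; move: (H1 * d `^ a) (J / d) (Q / d) h1 QJ J0' => X Y Z; have := S10; lra.
Qed.

(** By [pd_radial] this is [r^-1] times a component of the gradient of [radial c wnor], written so
    that the radial relation for [wnor] holds by definition. *)
Definition qrad i y := r^-1 * (pd i wnor y + dot (y - c) (grad (pd i wnor) y)).

Let rel2 i y : co_ (d / 4) y ->
  pd i wnor y + dot (y - c) (grad (pd i wnor) y) = r * qrad i y.
Proof. by move=> _; rewrite /qrad mulrA divff ?mul1r// gt_eqF. Qed.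

(** The gradient of [wnor] composed with a rotation, differentiated in the angle, is the gradient of
    the angular derivative. Up to sign the angular and radial derivatives of a harmonic function are
    harmonic conjugates, so this is the gradient of the radial derivative turned by a right angle:
    hence the swapped index and the sign. *)
Let is_derive_rotgrad i y : co_ d y ->
  is_derive (0 : R) (1 : R) (fun t : R =>
    rotc (cos (t / r)) (sin (t / r)) i false * pd false wnor (arc y t) +
    rotc (cos (t / r)) (sin (t / r)) i true * pd true wnor (arc y t))
   (if i then - qrad false y else qrad true y).
Proof.
move=> Cy.
have cw k : Ck 1 (co_ d) (pd k wnor) by apply: Ck_pd; case: harm_wnor.
have dk k := is_derive_arclength 0 (cw k) Cy.
have [dcs dsn] := is_derive_angle 0.
have sw : pd true (pd false wnor) y = pd false (pd true wnor) y.
  by apply: (schwarz (@oU d)) Cy; case: harm_wnor.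
have lap : pd false (pd false wnor) y + pd true (pd true wnor) y = 0.
  by have [_ h] := harm_wnor; exact: h.
have D22 : pd true (pd true wnor) y = - pd false (pd false wnor) y.
  by apply/eqP; rewrite -addr_eq0 addrC lap.
have qE k : qrad k y = r^-1 * (pd k wnor y +
   ((y.1 - c.1) * pd false (pd k wnor) y + (y.2 - c.2) * pd true (pd k wnor) y)) by [].
have T k : dot (tangent (arc y 0)) (grad (pd k wnor) (arc y 0)) =
   - (y.2 - c.2) / r * pd false (pd k wnor) y + (y.1 - c.1) / r * pd true (pd k wnor) y.
  by rewrite arclength0.
have c0 : cos (0 / r) = 1 by rewrite mul0r cos0.
have s0 : sin (0 / r) = 0 by rewrite mul0r sin0.
have e k : pd k wnor (arc y 0) = pd k wnor y by rewrite arclength0.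
have qf := qE false; have qt := qE true; have Tf := T false; have Tt := T true.
rewrite D22 in qt Tt; rewrite sw in qf Tf.
have dkf := is_derive_eq (dk false) Tf; have dkt := is_derive_eq (dk true) Tt.
have ef := e false; have et := e true.
have aux1 (p q s t v1 v2 : R) : - 0 * (- v2 / r * s + v1 / r * t) + p * - (1 / r) +
    (1 * (- v2 / r * t + v1 / r * - s) + q * (- 0 / r)) = - (r^-1 * (p + (v1 * s + v2 * t))) by ring.
have aux2 (p q s t v1 v2 : R) : 1 * (- v2 / r * s + v1 / r * t) + p * (- 0 / r) +
    (0 * (- v2 / r * t + v1 / r * - s) + q * (1 / r)) = r^-1 * (q + (v1 * t + v2 * - s)) by ring.
case: i; rewrite /rotc /=.
  have D1 := is_deriveD (is_deriveM (is_deriveN dsn) dkf) (is_deriveM dcs dkt).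
  apply: is_derive_eq D1 _; rewrite qf [(- (fun s : R => sin (s / r))) 0]/(- sin (0 / r)) c0 s0 ef et.
  exact: aux1.
have D1 := is_deriveD (is_deriveM dcs dkf) (is_deriveM dsn dkt).
apply: is_derive_eq D1 _; rewrite qt c0 s0 ef et.
exact: aux2.
Qed.

Let rotgrad0 (b : bool) y :
  rotc (cos (0 / r)) (sin (0 / r)) b false * pd false wnor (arc y 0) +
  rotc (cos (0 / r)) (sin (0 / r)) b true * pd true wnor (arc y 0) = pd b wnor y.
Proof.
rewrite arclength0 mul0r cos0 sin0.
have ri (p q : R) : rotc 1 0 b false * p + rotc 1 0 b true * q = if b then q else p.
  by case: b; rewrite /rotc /= ?oppr0 ?mul1r ?mul0r ?addr0 ?add0r.
by apply: etrans (ri _ _) _; case: b {ri}.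
Qed.

Lemma qrad_le i y : co_ (d / 4) y -> `|qrad i y| <= L2 * bd y `^ (a - 1).
Proof.
move=> Cy.
have Cy2 : co_ (d / 2) y by apply: co_sub Cy; have := d0; lra.
have Cyd : co_ d y by apply: co_sub Cy; have := d0; lra.
have cw : Ck 1 (co_ d) wnor by apply: Ck_pred; case: harm_wnor.
(* The negated index undoes the quarter turn. *)
have D := is_derive_rotgrad (~~ i) Cyd.
suff : `|if ~~ i then - qrad false y else qrad true y| <= L2 * bd y `^ (a - 1).
  by case: i {D} => //=; rewrite normrN.
apply: (derive_le D) => t t0.
have := @Wq_grad t (~~ i) y t0 Cy.
have -> // : pd (~~ i) (Wq t) y = t^-1 *
  (rotc (cos (t / r)) (sin (t / r)) (~~ i) false * pd false wnor (arc y t) +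
   rotc (cos (t / r)) (sin (t / r)) (~~ i) true * pd true wnor (arc y t) -
  (rotc (cos (0 / r)) (sin (0 / r)) (~~ i) false * pd false wnor (arc y 0) +
   rotc (cos (0 / r)) (sin (0 / r)) (~~ i) true * pd true wnor (arc y 0))).
have E z : co_ (d / 2) z -> Wq t z = t^-1 * wnor (arc z t) + (- t^-1) * wnor z.
  move=> Cz; have Czd : co_ d z by apply: co_sub Cz; have := d0; lra.
  by rewrite /Wq !WE//; exact: arc_co.
apply: etrans (pd_ext (~~ i) (@oU _) E Cy2) _.
have Ct : co_ d (arc y t) by exact: arc_co.
have [d1 e1] := is_derive_rot (cs := cos (t / r)) (sn := sin (t / r)) (c := c) (~~ i) (@oU _) cw Ct.
have d2 : derivable wnor y (ee (~~ i)) by exact: Ck_derivable cw Cyd.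
apply: etrans (pdD (derivableM (derivable_cst _ _ _) d1) (derivableM (derivable_cst _ _ _) d2)) _.
rewrite (pdZ _ d1) (pdZ _ d2).
have aux (p X A B H : R) : X = A -> H = B -> p * X + - p * B = p * (A - H).
  by move=> -> ->; rewrite mulrBr mulNr.
exact: (aux _ _ _ _ _ e1 (rotgrad0 (~~ i) y)).
Qed.

(** [sup_bound] for [wnor]: [12 = 3 * 4] with the 4 of [wnor_derive_far], and [48 = 2 * 24] with the
    24 of [L2]. *)
Definition kD : R := 12 + 48 * kA / a.
Definition kE : R := 4 * (24 * kA + kD).

Let JP0 : 0 <= 4 * (J / d).
Proof. by rewrite mulr_ge0// divr_ge0// ltW. Qed.

Let hW2 : harm (co_ (d / 2)) wnor.
Proof. by apply: harm_sub harm_wnor => y; apply: co_sub; have := d0; lra. Qed.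

Let hm2 i y : d / 8 <= bd y < d / 4 -> `|pd i wnor y| <= 4 * (J / d).
Proof. by move=> /andP[h1 h2]; apply: wnor_derive_far; rewrite h1 /=; have := d0; lra. Qed.

Let sup2 : sup_bound a d L2 (4 * (J / d)) <= kD * P.
Proof.
have -> : sup_bound a d L2 (4 * (J / d)) = 12 * (J / d) + 48 * kA / a * P * (d `^ a * d `^ (- a)).
  by rewrite /sup_bound /L2; ring.
have -> : kD * P = 12 * P + 48 * kA / a * P by rewrite /kD; ring.
by rewrite pda mulr1 lerD2r ler_pM2l.
Qed.

Lemma wnor_grad_bound i y : co_ (d / 4) y -> `|pd i wnor y| <= kD * P.
Proof.
move=> Cy; apply: le_trans sup2.
exact: (radial_sup a01 d0 dr sgE L20 JP0 hW2 rel2 qrad_le hm2).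
Qed.

Lemma wnor_hess_bound i j y : co_ (d / 4) y ->
  `|pd j (pd i wnor) y| <= kE * (P * d `^ (- a)) * bd y `^ (a - 1).
Proof.
move=> Cy.
apply: (le_trans (radial_hess a01 d0 dr sgE L20 JP0 hW2 rel2 qrad_le hm2 i j Cy)).
apply: ler_wpM2r; first exact: powR_ge0.
have -> : kE * (P * d `^ (- a)) = 4 * (L2 + kD * P * d `^ (- a)) by rewrite /kE /L2; ring.
by apply: ler_wpM2l => //; rewrite lerD2l; apply: ler_wpM2r sup2; exact: powR_ge0.
Qed.

Definition kF : R := 4 * (kD + kB).

(** The radial derivative of [pd k u] is [r * pd k wnor - pd k u], and both terms are already
    bounded up to the circle; the second one fits because [Q <= d * P <= r * P]. *)
Lemma collar_hess_bound i j y : co_ (d / 4) y -> `|pd j (pd i u) y| <= kF * P.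
Proof.
move=> Cy; have Cy2 : co_ (d / 2) y by apply: co_sub Cy; have := d0; lra.
have -> : kF * P = 4 * ((kD + kB) * P) by rewrite /kF; ring.
apply: (@hess_radial_bound R c r sg d d0 dr sgE u ((kD + kB) * P) i j y hu2 Cy2) => k.
have -> : dot (y - c) (grad (pd k u) y) = r * pd k wnor y - pd k u y.
  by rewrite -rel1// [pd k u y + _]addrC addrK.
apply: le_trans (ler_normB _ _) _; rewrite normrM (gtr0_norm r0).
have -> : r * ((kD + kB) * P) = r * (kD * P) + kB * (r * P) by ring.
apply: lerD; first by apply: ler_wpM2l; [exact: ltW|exact: wnor_grad_bound].
apply: (le_trans (collar_grad_bound k Cy)).
apply: ler_wpM2l; first exact: kB_ge0.
have : Q / d <= P by rewrite /P -addrA lerDl addr_ge0// mulr_ge0// powR_ge0.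
rewrite ler_pdivrMr// mulrC => h; apply: (le_trans h).
by apply: ler_wpM2r.
Qed.

Let L3 := (kE + kF) * P * d `^ (- a).

(** Differentiating [wnor_rel] once more gives a radial relation for [pd i u]. It produces a second
    copy of [pd j (pd i u)], which is moved to the right side, where [inv_d_le] absorbs the
    [r^-1]. *)
Let q3 i j y := pd j (pd i wnor) y - r^-1 * pd j (pd i u) y.

Let kD0 : 0 <= kD.
Proof.
apply: addr_ge0 => //; apply: divr_ge0; last exact: ltW.
by apply: mulr_ge0 => //; exact: kA_ge0.
Qed.

Let kE0 : 0 <= kE.
Proof. by apply: mulr_ge0 => //; apply: addr_ge0 => //; apply: mulr_ge0 => //; exact: kA_ge0. Qed.

Let kF0 : 0 <= kF.
Proof. by apply: mulr_ge0 => //; apply: addr_ge0 => //; exact: kB_ge0. Qed.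

Let L30 : 0 <= L3.
Proof. by rewrite mulr_ge0 ?powR_ge0// mulr_ge0// addr_ge0. Qed.

Let rel3 i j y : co_ (d / 4) y ->
  pd j (pd i u) y + dot (y - c) (grad (pd j (pd i u)) y) = r * q3 i j y.
Proof.
move=> Cy; have Cyd : co_ d y by apply: co_sub Cy; have := d0; lra.
have h3 : Ck 3 (co_ d) u by apply: harm_Ck hu; exact: oU.
have ci : Ck 2 (co_ d) (pd i u) by exact: Ck_pd.
have cw : Ck 1 (co_ d) (pd i wnor) by apply: Ck_pd; case: harm_wnor.
rewrite -radialE; apply: etrans (esym (pd_radial c j (@oU _) ci Cyd)) _.
have E z : co_ d z -> radial c (pd i u) z = r * pd i wnor z + (- 1) * pd i u z.
  by move=> Cz; rewrite -wnor_rel// radialE mulN1r [pd i u z + _]addrC addrK.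
apply: etrans (pd_ext j (@oU _) E Cyd) _.
have d1 := Ck_derivable (i := j) cw Cyd; have d2 := Ck_derivable (i := j) ci Cyd.
apply: etrans (pdD (derivableM (derivable_cst _ _ _) d1) (derivableM (derivable_cst _ _ _) d2)) _.
rewrite (pdZ _ d1) (pdZ _ d2) /q3 mulrBr mulrA mulfV ?gt_eqF// mul1r mulN1r.
by [].
Qed.

Let q3_le i j y : co_ (d / 4) y -> `|q3 i j y| <= L3 * bd y `^ (a - 1).
Proof.
move=> Cy; apply: le_trans (ler_normB _ _) _.
have -> : L3 * bd y `^ (a - 1) = kE * (P * d `^ (- a)) * bd y `^ (a - 1) +
   kF * P * (d `^ (- a) * bd y `^ (a - 1)) by rewrite /L3; ring.
apply: lerD; first exact: wnor_hess_bound.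
rewrite normrM ger0_norm ?invr_ge0 ?(ltW r0)// mulrC.
apply: ler_pM => //; [by rewrite invr_ge0 ltW|exact: collar_hess_bound|].
exact: inv_d_le.
Qed.

Let hJP : 0 <= J / d.
Proof. by rewrite divr_ge0// ltW. Qed.

Let hm3 i j y : d / 8 <= bd y < d / 4 -> `|pd j (pd i u) y| <= J / d.
Proof. by move=> /andP[h1 h2]; apply: hJ2; rewrite h1 /=; have := d0; lra. Qed.

Let hpu i : harm (co_ (d / 2)) (pd i u).
Proof. by apply: harm_pd hu2; exact: oU. Qed.

Definition kG : R := 3 + 2 / a * (kE + kF).
Definition kH : R := (16 / a + 4) * (4 * (kE + kF + kG)).

Lemma collar_hess_holder i j x y : co_ (d / 8) x -> co_ (d / 8) y -> x != y ->
  enorm (x - y) <= d / 64 ->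
  `|pd j (pd i u) x - pd j (pd i u) y| <= kH * (P * d `^ (- a)) * enorm (x - y) `^ a.
Proof.
move=> Cx Cy xy hd.
apply: (le_trans (radial_holder a01 d0 dr sgE L30 hJP (hpu i) (@rel3 i) (@q3_le i) (@hm3 i) j Cx Cy xy hd)).
apply: ler_wpM2r; first exact: powR_ge0.
rewrite /kH -mulrA; apply: ler_wpM2l; first by rewrite addr_ge0// divr_ge0// ltW.
rewrite -mulrA; apply: ler_wpM2l => //.
have -> : (kE + kF + kG) * (P * d `^ (- a)) = L3 + kG * P * d `^ (- a) by rewrite /L3; ring.
rewrite lerD2l; apply: ler_wpM2r; first exact: powR_ge0.
have -> : sup_bound a d L3 (J / d) = 3 * (J / d) + 2 / a * (kE + kF) * P * (d `^ a * d `^ (- a)).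
  by rewrite /sup_bound /L3; ring.
have -> : kG * P = 3 * P + 2 / a * (kE + kF) * P by rewrite /kG; ring.
by rewrite pda mulr1 lerD2r ler_pM2l.
Qed.

End SecondOrder.
End CollarNeumann.

(** * Geometry of the holed disk *)

Section DiskGeometry.
Context {R : realType}.
Implicit Types (x y z : plane R).

(** Any unit vector serves for [x = 0], so concentric disks need no separate argument below. *)
Lemma unit_direction x : exists2 e : plane R, enorm e = 1 & x = enorm x *: e.
Proof.
have [->|x0] := eqVneq x 0.
  exists (ee false); first exact: enorm_ee.
  by rewrite enorm0 scale0r.
have h : 0 < enorm x by rewrite enorm_gt0.
exists ((enorm x)^-1 *: x).
  by rewrite enormZ ger0_norm ?invr_ge0 ?enorm_ge0// mulVf// gt_eqF.
by rewrite scalerA divff ?scale1r// gt_eqF.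
Qed.

Lemma closure_disk z (r : R) : 0 < r ->
  closure (disk z r) = [set x | enorm (x - z) <= r].
Proof.
move=> r0; apply/seteqP; split.
  rewrite [X in _ `<=` X](_ : _ = closure [set x | enorm (x - z) <= r]).
    by apply: closure_subset => x; rewrite /disk /=; exact: ltW.
  by apply/closure_id; exact: cdisk_closed.
move=> x /= hx A /nbhs_diskP [e e0 eA].
have [xz|xz] := ltP (enorm (x - z)) r.
  by exists x; split => //; apply: eA; exact: disk_center.
have {}hx : enorm (x - z) = r by apply/le_anti; rewrite hx.
pose t := Num.min (e / (2 * r)) 1.
have t0 : 0 < t by rewrite /t lt_min ltr01 andbT divr_gt0// mulr_gt0.
have t1 : t <= 1 by rewrite /t ge_min lexx orbT.
have te : t * r < e.
  have : t <= e / (2 * r) by rewrite /t ge_min lexx.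
  rewrite ler_pdivlMr ?mulr_gt0// mulrCA; have := mulr_gt0 t0 r0; lra.
exists (x - t *: (x - z)); split.
  rewrite /disk /= addrAC -[X in enorm (X - _)]scale1r -scalerBl enormZ hx.
  by rewrite ger0_norm ?subr_ge0// gtr_pMl//; lra.
apply: eA; rewrite /disk /= addrAC subrr add0r enormN enormZ hx.
by rewrite gtr0_norm.
Qed.

(** The test point lies beyond [z] on the ray from [z'], at distance at least [r'] from [z'].
    Truncating [t] at 0 covers a centre [z] that is itself outside the larger disk. *)
Lemma disk_subset_dist z z' (r r' : R) : 0 < r -> disk z r `<=` disk z' r' ->
  enorm (z - z') + r <= r'.
Proof.
move=> r0 h; have [e e1 ze] := unit_direction (z - z').
rewrite leNgt; apply/negP => hlt.
pose t := Num.max (r' - enorm (z - z')) 0.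
have tr : t < r by rewrite /t gt_max r0 andbT ltrBlDl.
have t0 : 0 <= t by rewrite /t le_max lexx orbT.
have := h (z + t *: e); rewrite /disk /= addrAC subrr add0r enormZ e1 mulr1 ger0_norm//.
move=> /(_ tr); rewrite addrAC {1}ze -scalerDl enormZ e1 mulr1.
rewrite ger0_norm ?addr_ge0 ?enorm_ge0//; apply/negP; rewrite -leNgt.
by rewrite -lerBlDl /t le_max lexx.
Qed.

(** The test points lie on the segment of the centres, at distances [s] and [s'] from [z]. They are
    the closest pair if the disks are disjoint, and one common point if they overlap, which [0 < d]
    forbids. *)
Lemma setdist_disk z z' (r r' d : R) : 0 < r -> 0 < r' -> 0 < d ->
  (d%:E <= setdist (closure (disk z r)) (closure (disk z' r')))%E ->
  r + r' + d <= enorm (z - z').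
Proof.
move=> r0 r'0 d0 h.
have hxy x y : enorm (x - z) <= r -> enorm (y - z') <= r' -> d <= enorm (x - y).
  move=> hx hy; rewrite -lee_fin; apply: (le_trans h); apply: ereal_inf_lbound.
  by exists x, y; rewrite !closure_disk.
have [e e1 ze] := unit_direction (z' - z).
set D := enorm (z' - z) in ze.
have D0 : 0 <= D by exact: enorm_ge0.
have Ez : z' = z + D *: e by rewrite -ze addrC subrK.
rewrite (enorm_sym z) -/D.
have ns (s : R) : enorm (s *: e) = `|s| by rewrite enormZ e1 mulr1.
pose s := Num.min r D.
have s0 : 0 <= s by rewrite le_min (ltW r0).
have sr : s <= r by rewrite ge_min lexx.
have sD : s <= D by rewrite ge_min lexx orbT.
pose s' := Num.max (D - r') s.
have := hxy (z + s *: e) (z + s' *: e).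
rewrite Ez.
have E1 (p q : R) : z + p *: e - (z + q *: e) = (p - q) *: e.
  by rewrite opprD addrACA subrr add0r scalerBl.
have E2 (p : R) : z + p *: e - z = p *: e by rewrite addrAC subrr add0r.
rewrite !E1 !E2 !ns ger0_norm// => /(_ sr).
have s'D : s' <= D by rewrite /s' ge_max sD andbT lerBlDr lerDl ltW.
have s'r : D - r' <= s' by rewrite /s' le_max lexx.
have ss' : s <= s' by rewrite /s' le_max lexx orbT.
rewrite ler0_norm ?subr_le0// => /(_ _)/wrap[]; first by lra.
rewrite ler0_norm ?subr_le0//.
have : s' = D - r' \/ s' = s by rewrite /s'; case: (leP (D - r') s) => _; [right|left].
have : s = r \/ s = D by rewrite /s; case: (leP r D) => _; [left|right].
by move=> [] -> [] ->; lra.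
Qed.

End DiskGeometry.

(** * Distances to the boundary circles and the shape of the domain *)

Section HoledDiskGeometry.
Context {R : realType} {n : nat}.
Variables (z : 'I_n.+1 -> plane R) (r : 'I_n.+1 -> R) (d : R).
Hypotheses (n1 : (1 <= n)%N) (d0 : 0 < d) (hr : forall i, i != ord0 -> d <= r i).
Hypothesis hin : forall i, i != ord0 -> disk (z i) (r i + d) `<=` disk (z ord0) (r ord0).
Hypothesis hsep : forall i j, i != ord0 -> j != ord0 -> i != j ->
  ((2 * d)%:E <= setdist (closure (disk (z i) (r i))) (closure (disk (z j) (r j))))%E.
Implicit Types (x y : plane R) (i j k : 'I_n.+1).

Local Notation E := (holed_disk z r).

Definition side k : R := if k == ord0 then -1 else 1.
Definition bdk k := bdist (z k) (r k) (side k).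

Lemma sideP k : side k = 1 \/ side k = -1.
Proof. by rewrite /side; case: eqP => _; [right|left]. Qed.

Let rpos i : i != ord0 -> 0 < r i.
Proof. by move=> /hr; exact: lt_le_trans. Qed.

Let inner_dist i : i != ord0 -> enorm (z i - z ord0) + r i + d <= r ord0.
Proof.
move=> i0; rewrite -addrA; apply: disk_subset_dist; first by rewrite addr_gt0// rpos.
exact: hin.
Qed.

(** For the outer circle the bound comes from a hole inside it, which exists by [1 <= n]. *)
Lemma radius_ge k : d <= r k.
Proof.
have [->|k0] := eqVneq k ord0; last exact: hr.
have h1 : (lift ord0 (Ordinal n1) : 'I_n.+1) != ord0 by [].
have := inner_dist h1; have := hr h1; have := enorm_ge0 (z (lift ord0 (Ordinal n1)) - z ord0).
by move: d0; lra.
Qed.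

Lemma radius_gt0 k : 0 < r k.
Proof. exact: lt_le_trans (radius_ge k). Qed.

Lemma radius_le k : r k <= r ord0.
Proof.
have [->//|k0] := eqVneq k ord0.
by have := inner_dist k0; have := enorm_ge0 (z k - z ord0); move: d0; lra.
Qed.

(** The form in which the separation of the circles is used: a point closer than [d / 2] to one
    circle is farther than [d / 2] from all others, so the collars of width [d / 2] are disjoint. *)
Lemma bdk_sum i j y : i != j -> d <= bdk i y + bdk j y.
Proof.
have sym k l : k != ord0 -> l = ord0 -> d <= bdk k y + bdk l y.
  move=> k0 ->; rewrite /bdk /bdist /side (negbTE k0) eqxx.
  have := inner_dist k0; have := enorm_sub y (z k) (z ord0); lra.
have [->|i0] := eqVneq i ord0; have [->|j0] := eqVneq j ord0 => // ij.
- by rewrite addrC; exact: sym.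
- exact: sym.
have h := setdist_disk (rpos i0) (rpos j0) (mulr_gt0 _ d0) (hsep i0 j0 ij).
rewrite /bdk /bdist /side (negbTE i0) (negbTE j0).
have := h (ltr0n _ 2); have := enorm_sub (z i) y (z j); rewrite (enorm_sym (z i) y).
have := d0; lra.
Qed.

Lemma holed_diskP x : E x <-> forall k, 0 < bdk k x.
Proof.
split.
- move=> [h0 h1] k; rewrite /bdk /bdist /side.
  have [->|k0] := eqVneq k ord0; first by move: h0; rewrite /disk /=; lra.
  rewrite mul1r subr_gt0 ltNge; apply/negP => hk; apply: h1; exists k => //.
  by rewrite closure_disk ?rpos.
- move=> h; split.
    by have := h ord0; rewrite /bdk /bdist /side eqxx /disk /=; lra.
  move=> [k /= k0]; rewrite closure_disk ?rpos//= => hk.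
  by have := h k; rewrite /bdk /bdist /side (negbTE k0) mul1r subr_gt0 ltNge hk.
Qed.

Lemma collar_holed_disk k y : collar (z k) (r k) (side k) d y -> E y.
Proof.
move=> /andP[h0 h1]; apply/holed_diskP => j.
have [->//|jk] := eqVneq j k.
by have := bdk_sum y jk; rewrite -/(bdk k y) in h1; lra.
Qed.

Lemma interior_disk (t : R) x y : (forall k, t < bdk k x) -> enorm (y - x) <= t -> E y.
Proof.
move=> h yx; apply/holed_diskP => k; have := bdist_lip (z k) (r k) (sideP k) y x.
rewrite -/(bdk k y) -/(bdk k x) ler_norml => /andP[l1 _]; have := h k; lra.
Qed.

Lemma holed_disk_open : open E.
Proof.
rewrite openE => x /holed_diskP hx.
have : \forall y \near x, forall k, 0 < bdk k y.
  apply: (@filter_forall _ _ (fun k y => 0 < bdk k y) (nbhs x) _) => k.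
  apply: open_nbhs_nbhs; split; last exact: hx.
  apply: (@open_comp _ _ (bdk k) [set s | 0 < s]); last exact: open_gt.
  by move=> y _; apply: bdist_continuous; exact: sideP.
by apply: filterS => y hy; apply/holed_diskP.
Qed.

Lemma ccollar_closure k : ccollar (z k) (r k) (side k) (d / 2) `<=` closure E.
Proof.
move=> x /andP[h0 h1].
have [b0|b0] := ltP 0 (bdk k x).
  apply: subset_closure; apply: (@collar_holed_disk k); rewrite /collar /= b0 /=.
  by apply: (le_lt_trans h1); move: d0; lra.
have {}b0 : bdk k x = 0 by apply/le_anti; rewrite b0.
have s2 : side k * side k = 1 by case: (sideP k) => ->; rewrite ?mulrNN mulr1.
have r0 := radius_gt0 k; have rd := radius_ge k.
have ex : enorm (x - z k) = r k.
  move: b0; rewrite /bdk /bdist => /(congr1 (fun t => side k * t)).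
  by rewrite mulrA s2 mul1r mulr0 => /subr0_eq.
move=> A /nbhs_diskP [e e0 eA].
(* A point of the circle is approached along its ray from the side of [E], by steps short enough to
   stay in the collar. *)
pose t := Num.min (e / 2) (d / 2).
have t0 : 0 < t by rewrite /t lt_min !divr_gt0.
have te : t <= e / 2 by rewrite /t ge_min lexx.
have td : t <= d / 2 by rewrite /t ge_min lexx orbT.
have ns : `|side k| = 1 by case: (sideP k) => ->; rewrite ?normrN normr1.
exists (x + (t * side k / r k) *: (x - z k)); split.
  apply: (@collar_holed_disk k); rewrite /collar /bdist /=.
  have -> : x + (t * side k / r k) *: (x - z k) - z k = (1 + t * side k / r k) *: (x - z k).
    by rewrite addrAC scalerDl scale1r.
  have h : 0 <= 1 + t * side k / r k.
    have -> : 1 + t * side k / r k = (r k + t * side k) / r k by field; rewrite gt_eqF.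
    apply: divr_ge0; last exact: ltW.
    by case: (sideP k) => ->; lra.
  rewrite enormZ ger0_norm// ex mulrDl mul1r divfK ?gt_eqF// addrAC subrr add0r mulrCA s2 mulr1.
  by rewrite t0 /=; lra.
apply: eA; rewrite /disk /= addrAC subrr add0r enormZ ex !normrM ns mulr1.
rewrite normrV ?unitfE ?gt_eqF// !gtr0_norm// divfK ?gt_eqF//; lra.
Qed.

Lemma closure_holed_disk x : closure E x -> forall k, 0 <= bdk k x.
Proof.
move=> cx k.
have cl : closed [set y | 0 <= bdk k y].
  apply: (@closed_comp _ _ (bdk k) [set s | 0 <= s]); last exact: closed_ge.
  by move=> y _; apply: bdist_continuous; exact: sideP.
suff : [set y | 0 <= bdk k y] x by [].
move/closure_id : cl => ->.
by apply: closure_subset cx => y /holed_diskP h; exact: ltW.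
Qed.

Lemma holed_disk_bounded x : closure E x -> enorm x <= enorm (z ord0) + r ord0.
Proof.
move=> /closure_holed_disk /(_ ord0); rewrite /bdk /bdist /side eqxx.
have := enormB_le x (z ord0); lra.
Qed.

Lemma closure_holed_disk_compact : compact (closure E).
Proof.
apply: closed_bounded_compact holed_disk_bounded; exact: closed_closure.
Qed.

End HoledDiskGeometry.

(** * Energy estimate *)

Section Cutoff.
Context {R : realType}.

(** A C^1 spline rising from 0 to 1 on the unit interval, quadratic on each half; [dramp] is the
    tent of height 2 with vertex at [1 / 2]. *)
Definition ramp (t : R) : R := 2 * (pp 2 t - 2 * pp 2 (t - 2^-1) + pp 2 (t - 1)).
Definition dramp (t : R) : R := 4 * (pp 1 t - 2 * pp 1 (t - 2^-1) + pp 1 (t - 1)).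
(** Rises from 0 at [e] to 1 at [2 * e]. Its derivative [dcut e] has integral 1 and concentrates at
    0 as [e] decreases, so that it can stand for a surface measure. *)
Definition cut (e s : R) : R := ramp (s / e - 1).
Definition dcut (e s : R) : R := dramp (s / e - 1) / e.

Lemma is_derive_ramp (t : R) : is_derive t (1 : R) ramp (dramp t).
Proof.
have sh (c : R) : is_derive t (1 : R) (fun t => pp 2 (t - c)) (2 * pp 1 (t - c)).
  have d1 := is_deriveB (is_derive_id t (1 : R)) (is_derive_cst c t (1 : R)).
  rewrite subr0 in d1.
  have := @is_derive1_comp _ (pp 2) (fun t => t - c) t _ _ (is_derive_pp 0 (t - c)) d1.
  by rewrite mulr1.
have d0 := is_derive_pp 0 t.
have d1 := is_deriveZ (2 : R) (is_deriveD (is_deriveB d0 (is_deriveZ (2 : R) (sh 2^-1))) (sh 1)).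
by apply: is_derive_eq d1 _; rewrite /dramp /GRing.scale /=; ring.
Qed.

Lemma ramp_le0 t : t <= 0 -> ramp t = 0.
Proof. by move=> t0; rewrite /ramp !pp_le0//; [ring|lra|lra]. Qed.

Lemma ramp_ge1 t : 1 <= t -> ramp t = 1.
Proof. by move=> t1; rewrite /ramp !pp_pos//; [field|lra|lra|lra]. Qed.

Lemma dramp_bound t : 0 <= dramp t <= 2.
Proof.
rewrite /dramp /pp !expr1.
case: (leP t 0) => h0; case: (leP (t - 2^-1) 0) => h1; case: (leP (t - 1) 0) => h2;
  apply/andP; split; lra.
Qed.

Lemma dramp_eq0 t : t <= 0 \/ 1 <= t -> dramp t = 0.
Proof.
rewrite /dramp /pp !expr1 => h.
case: (leP t 0) => h0; case: (leP (t - 2^-1) 0) => h1; case: (leP (t - 1) 0) => h2;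
  case: h => h; lra.
Qed.

Lemma ramp_ge0 t : 0 <= ramp t.
Proof.
have [t0|t0] := leP t 0; first by rewrite ramp_le0.
have [t1|t1] := leP 1 t; first by rewrite ramp_ge1.
rewrite /ramp (pp_pos 2 (ltW t0)) (pp_le0 1 (_ : t - 1 <= 0)); last by lra.
have [h|h] := leP (t - 2^-1) 0; first by rewrite pp_le0//; have := sqr_ge0 t; lra.
rewrite pp_pos ?(ltW h)// !expr2; nra.
Qed.

Lemma ramp_le1 t : ramp t <= 1.
Proof.
have [t0|t0] := leP t 0; first by rewrite ramp_le0.
have [t1|t1] := leP 1 t; first by rewrite ramp_ge1.
rewrite /ramp (pp_pos 2 (ltW t0)) (pp_le0 1 (_ : t - 1 <= 0)); last by lra.
have [h|h] := leP (t - 2^-1) 0.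
  rewrite pp_le0// expr2; nra.
rewrite pp_pos ?(ltW h)// !expr2; have := sqr_ge0 (1 - t); rewrite expr2; nra.
Qed.

Lemma dcut_continuous (e : R) : continuous (dcut e).
Proof.
move=> s; apply: cvgM; last exact: cvg_cst.
have sc (c : R) : {for s, continuous (fun s : R => pp 1 (s / e - 1 - c))}.
  apply: (continuous_comp (f := fun s : R => s / e - 1 - c) (g := pp 1)); last exact: pp_continuous.
  apply: cvgB; last exact: cvg_cst.
  by apply: cvgB; [apply: cvgM; [exact: cvg_id|exact: cvg_cst]|exact: cvg_cst].
apply: cvgM; first exact: cvg_cst.
apply: cvgD; last exact: (sc 1).
apply: cvgB; last by apply: cvgM; [exact: cvg_cst|exact: (sc 2^-1)].
apply: (continuous_comp (f := fun s : R => s / e - 1) (g := pp 1)); last exact: pp_continuous.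
by apply: cvgB; [apply: cvgM; [exact: cvg_id|exact: cvg_cst]|exact: cvg_cst].
Qed.

Variable e : R.
Hypothesis e0 : 0 < e.

Lemma is_derive_cut (s : R) : is_derive s (1 : R) (cut e) (dcut e s).
Proof.
have d1 := is_deriveB (is_deriveM (is_derive_id s (1 : R)) (is_derive_cst e^-1 s (1 : R))) (is_derive_cst (1 : R) s (1 : R)).
have d2 : is_derive s (1 : R) (fun s : R => s / e - 1) e^-1.
  by apply: is_derive_eq d1 _; rewrite /GRing.scale /= mulr0 add0r mulr1 subr0.
have := @is_derive1_comp _ ramp (fun s : R => s / e - 1) s _ _ (is_derive_ramp _) d2.
by [].
Qed.

Lemma cut_continuous : continuous (cut e).
Proof.
move=> s; apply: differentiable_continuous; apply/derivable1_diffP.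
by have [] := is_derive_cut s.
Qed.

Lemma cut_eq0 s : s <= e -> cut e s = 0.
Proof. by move=> h; rewrite /cut ramp_le0// subr_le0 ler_pdivrMr// mul1r. Qed.

Lemma cut_eq1 s : 2 * e <= s -> cut e s = 1.
Proof.
move=> h; rewrite /cut ramp_ge1//; have : 2 <= s / e by rewrite ler_pdivlMr.
lra.
Qed.

Lemma cut_ge0 s : 0 <= cut e s. Proof. exact: ramp_ge0. Qed.
Lemma cut_le1 s : cut e s <= 1. Proof. exact: ramp_le1. Qed.

Lemma dcut_ge0 s : 0 <= dcut e s.
Proof. by rewrite divr_ge0 ?(ltW e0)//; have /andP[] := dramp_bound (s / e - 1). Qed.

Lemma dcut_le s : dcut e s <= 2 / e.
Proof.
rewrite /dcut ler_wpM2r ?invr_ge0 ?(ltW e0)//.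
by have /andP[] := dramp_bound (s / e - 1).
Qed.

Lemma dcut_eq0 s : s <= e \/ 2 * e <= s -> dcut e s = 0.
Proof.
move=> h; rewrite /dcut dramp_eq0 ?mul0r//.
case: h => h; [left|right]; first by rewrite subr_le0 ler_pdivrMr// mul1r.
by have : 2 <= s / e by [rewrite ler_pdivlMr]; lra.
Qed.

Lemma Ck_cut U (f : plane R -> R) : open U -> Ck 1 U f -> Ck 1 U (fun x => cut e (f x)).
Proof.
move=> oU cf; have cc (c : R) : Ck 1 U (fun x => pp 2 (f x / e - 1 - c)).
  exact: (Ck_pp oU (CkB oU (CkB oU (CkM oU cf (Ck_cst 1 U e^-1)) (Ck_cst 1 U 1)) (Ck_cst 1 U c))).
have c0 : Ck 1 U (fun x => pp 2 (f x / e - 1)).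
  by apply: Ck_ext (cc 0) => // x _; rewrite subr0.
exact: (CkZ 2 oU (CkD oU (CkB oU c0 (CkZ 2 oU (cc 2^-1))) (cc 1))).
Qed.

End Cutoff.

(** The last summand is [sg / 2] times the integrand of [shell_identity], whose integral vanishes.
    It replaces the density [X] by [Y] at the cost of terms carrying the factor [P], and these are
    at most [|V| + |W| / 2]. *)
Lemma shell_pointwise {R : realType} (sg P X Y Z V W : R) : sg = 1 \/ sg = -1 ->
  `|P| <= 1 -> 0 <= Y -> 0 <= Z ->
  X * Z * V <= Y * Z * `|V| + `|V| + `|W| / 2 +
    sg / 2 * (2 * sg * ((X - Y) * Z * V) + P * (2 * V + W)).
Proof.
move=> sgE P1 Y0 Z0.
have h1 : Y * Z * V <= Y * Z * `|V| by apply: ler_wpM2l; [exact: mulr_ge0|exact: ler_norm].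
have h2 : - (sg / 2 * P * (2 * V + W)) <= `|V| + `|W| / 2.
  have -> : `|V| + `|W| / 2 = 2^-1 * (2 * `|V| + `|W|) by field.
  apply: le_trans (ler_norm _) _; rewrite normrN !normrM.
  have -> : `|sg| = 1 by case: sgE => ->; rewrite ?normrN normr1.
  rewrite mul1r ger0_norm ?invr_ge0// -mulrA; apply: ler_wpM2l; first by rewrite invr_ge0.
  apply: (@le_trans _ _ (1 * `|2 * V + W|)); first exact: ler_wpM2r.
  by rewrite mul1r; apply: le_trans (ler_normD _ _) _; rewrite normrM ger0_norm.
have -> : sg / 2 * (2 * sg * ((X - Y) * Z * V) + P * (2 * V + W)) =
  sg * sg * (X * Z * V - Y * Z * V) + sg / 2 * P * (2 * V + W) by field.
have -> : sg * sg = 1 by case: sgE => ->; rewrite ?mulrNN mulr1.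
by move: h1 h2; move: (sg / 2 * P * _) (X * Z * V) (Y * Z * V) (Y * Z * `|V|) => p1 p0 p2 p3; lra.
Qed.

(** * Integrals over shells around a circle *)

Section Shell.
Context {R : realType}.
Variables (c : plane R) (r sg : R).
Hypotheses (r0 : 0 < r) (sgE : sg = 1 \/ sg = -1).
Implicit Types (x y : plane R) (U : set (plane R)) (v : plane R -> R).

(** A defining function of the circle, positive on the side of the collar. Unlike [bdist] it is a
    polynomial, and its gradient is [2 * sg * (y - c)]. *)
Definition cdef y : R := sg * (sq c y - r ^+ 2).

Let sg2 : sg * sg = 1.
Proof. by case: sgE => ->; rewrite ?mulrNN mulr1. Qed.

Lemma sq_cdef y : sq c y = r ^+ 2 + sg * cdef y.
Proof. by rewrite /cdef mulrA sg2 mul1r addrC subrK. Qed.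

Lemma Ck_cdef m U : open U -> Ck m U cdef.
Proof.
by move=> oU; apply: CkZ => //; apply: CkB => //; [exact: Ck_sq|exact: Ck_cst].
Qed.

Lemma is_derive_cdef i x : is_derive x (ee i) cdef (sg * (2 * (co i x - co i c))).
Proof.
have d := is_deriveZ sg (is_deriveB (is_derive_sq i c x) (is_derive_cst (r ^+ 2) x (ee i))).
by apply: is_derive_eq d _; rewrite subr0.
Qed.

Lemma is_derive_cut_cdef e i x : 0 < e ->
  is_derive x (ee i) (fun y => cut e (cdef y)) (dcut e (cdef x) * (sg * (2 * (co i x - co i c)))).
Proof. by move=> e0; apply: is_derive_comp; [exact: is_derive_cut|exact: is_derive_cdef]. Qed.

Section ShellIdentity.
Variables (U : set (plane R)) (v : plane R -> R) (e e2 : R).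
Hypotheses (oU : open U) (e0 : 0 < e) (ee2 : e <= e2) (cv : Ck 1 U v).
Let D := [set y | e <= cdef y <= 2 * e2].
Variable M : R.
Hypotheses (DU : D `<=` U) (DM : forall x, D x -> enorm x <= M).

Let e20 : 0 < e2. Proof. exact: lt_le_trans ee2. Qed.

Lemma shell_closed : closed D.
Proof.
have cc : continuous cdef by move=> x; exact: Ck_continuous (@Ck_cdef 0 setT openT) Logic.I.
rewrite (_ : D = cdef @^-1` [set s | e <= s] `&` cdef @^-1` [set s | s <= 2 * e2]).
  apply: closedI; apply: closed_comp.
  - by move=> x _; exact: cc.
  - exact: closed_ge.
  - by move=> x _; exact: cc.
  - exact: closed_le.
by apply/seteqP; split => y /= => [/andP[]//|[h1 h2]]; apply/andP.
Qed.

Let mD : measurable (D : set (mplane R)) := closed_measurable2 shell_closed.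

(** Vanishes off the closed shell [D]: near the circle both cutoffs are 0, and far from it both are
    1. *)
Let p y := cut e (cdef y) - cut e2 (cdef y).

Let p_off y : ~ D y -> p y = 0.
Proof.
move=> nD; rewrite /p; have [h|h] := leP (cdef y) e.
  by rewrite !cut_eq0 ?subrr// (le_trans h).
have h2 : 2 * e2 <= cdef y.
  by rewrite leNgt; apply/negP => h2; apply: nD; rewrite /D /= (ltW h) (ltW h2).
by rewrite !cut_eq1 ?subrr// (le_trans _ h2)// ler_pM2l.
Qed.

Let p_abs y : `|p y| <= 1.
Proof.
have := cut_ge0 e (cdef y); have := cut_le1 e (cdef y).
have := cut_ge0 e2 (cdef y); have := cut_le1 e2 (cdef y).
by rewrite /p ler_norml => *; apply/andP; split; lra.
Qed.

Let F i y := p y * (v y * (co i y - co i c)).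

Let cF i : Ck 1 U (F i).
Proof.
have c1 := CkB oU (Ck_cut e oU (Ck_cdef 1 oU)) (Ck_cut e2 oU (Ck_cdef 1 oU)).
exact: (CkM oU c1 (CkM oU cv (CkB oU (Ck_co 1 U i) (Ck_cst 1 U (co i c))))).
Qed.

Let q y := dcut e (cdef y) - dcut e2 (cdef y).

Let pdF i y : U y -> pd i (F i) y =
  q y * (sg * (2 * (co i y - co i c))) * (v y * (co i y - co i c)) +
  p y * (v y + (co i y - co i c) * pd i v y).
Proof.
move=> Uy.
have d1 := is_deriveB (is_derive_cut_cdef i y e0) (is_derive_cut_cdef i y e20).
have d2 := derivableP (Ck_derivable (i := i) cv Uy).
have d3 := is_deriveB (is_derive_co i i y) (is_derive_cst (co i c) y (ee i)).
have [_ E] := is_deriveM d1 (is_deriveM d2 d3).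
apply: etrans E _; rewrite -[X in X = _]/(p y *: (v y *: _ + (co i y - co i c) *: pd i v y) + (v y * (co i y - co i c)) *: _).
rewrite eqxx /GRing.scale /= /q subr0 mulr1.
by move: (pd i v y) => w; ring.
Qed.

Let G1 y := 2 * sg * (q y * sq c y * v y) + p y * (2 * v y + radial c v y).

(** [G1] is the divergence of the compactly supported field [p * v * (y - c)]. *)
Lemma shell_identity : \int[area R]_(y in D) G1 y = 0.
Proof.
have iF i : integ D (fun y => pd i (F i) y).
  apply: (integ_continuous oU shell_closed DU DM) => x Ux.
  exact: Ck_continuous (Ck_pd i (cF i)) Ux.
have off i y : ~ D y -> F i y = 0 by move=> nD; rewrite /F p_off// mul0r.
have z i := integral_pd_eq0_on i oU shell_closed DU DM (cF i) (off i).
have := RintegralD mD (iF false) (iF true).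
rewrite !z addr0 => <-; apply: eq_Rintegral => y /set_mem Dy.
rewrite !pdF//; try exact: DU.
rewrite /G1 /sq /radial; move: (pd false v y) (pd true v y) => w1 w2.
by ring.
Qed.

(** A trace inequality: the mass of [v] on the thin shell at scale [e] is controlled by the density
    at the fixed scale [e2], by [v], and by its radial derivative, with constants free of [e]. *)
Lemma shell_estimate : \int[area R]_(y in D) (dcut e (cdef y) * sq c y * v y) <=
  \int[area R]_(y in D) (dcut e2 (cdef y) * sq c y * `|v y| + `|v y| + `|radial c v y| / 2).
Proof.
have cs : forall x, U x -> {for x, continuous (sq c)} by move=> x Ux; exact: Ck_continuous (Ck_sq 0 c oU) Ux.
have cd : forall x, U x -> {for x, continuous cdef} by move=> x Ux; exact: Ck_continuous (@Ck_cdef 0 U oU) Ux.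
have cvv : forall x, U x -> {for x, continuous v} by move=> x Ux; exact: Ck_continuous cv Ux.
have cr : forall x, U x -> {for x, continuous (radial c v)}.
  by move=> x Ux; exact: Ck_continuous (Ck_radial c oU cv) Ux.
have ig f : (forall x, U x -> {for x, continuous f}) -> integ D f.
  exact: (integ_continuous oU shell_closed DU DM).
pose A y := dcut e (cdef y) * sq c y * v y.
pose B y := dcut e2 (cdef y) * sq c y * `|v y| + `|v y| + `|radial c v y| / 2.
have dc e' x : U x -> {for x, continuous (fun y => dcut e' (cdef y))}.
  by move=> Ux; apply: (continuous_comp (f := cdef) (g := dcut e')); [exact: cd|exact: dcut_continuous].
have cc e' x : 0 < e' -> U x -> {for x, continuous (fun y => cut e' (cdef y))}.
  by move=> h Ux; apply: (continuous_comp (f := cdef) (g := cut e')); [exact: cd|exact: cut_continuous].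
have iA : integ D A.
  by apply: ig => x Ux; apply: cvgM; [apply: cvgM; [exact: dc|exact: cs]|exact: cvv].
have cn (f : plane R -> R) x : {for x, continuous f} -> {for x, continuous (fun y => `|f y|)}.
  by move=> cf; apply: (continuous_comp (f := f) (g := fun t : R => `|t|)) => //; exact: norm_continuous.
have iB : integ D B.
  apply: ig => x Ux; apply: cvgD; [apply: cvgD|].
  - by apply: cvgM; [apply: cvgM; [exact: dc|exact: cs]|apply: cn; exact: cvv].
  - by apply: cn; exact: cvv.
  - by apply: cvgM; [apply: cn; exact: cr|exact: cvg_cst].
have iG : integ D G1.
  apply: ig => x Ux; apply: cvgD; apply: cvgM.
  - exact: cvg_cst.
  - by apply: cvgM; [apply: cvgM; [apply: cvgB; exact: dc|exact: cs]|exact: cvv].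
  - by apply: cvgB; apply: cc.
  - by apply: cvgD; [apply: cvgM; [exact: cvg_cst|exact: cvv]|exact: cr].
have h : \int[area R]_(y in D) A y <= \int[area R]_(y in D) (B y + sg / 2 * G1 y).
  apply: le_Rintegral => //; first by apply: integD => //; exact: integZ.
  move=> y _.
  exact: (shell_pointwise (dcut e (cdef y)) (v y) (radial c v y) sgE (p_abs y) (dcut_ge0 e20 (cdef y)) (sq_ge0 c y)).
apply: (le_trans h); have i2 := integZ (sg / 2) mD iG.
rewrite (RintegralD mD iB i2) (RintegralZl (sg / 2) mD iG) shell_identity mulr0 addr0.
by [].
Qed.

End ShellIdentity.
End Shell.

Section BoundedContinuous.
Context {R : realType}.
Variables (E : set (plane R)) (M : R).
Hypotheses (oE : open E) (EM : forall x, E x -> enorm x <= M).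
Implicit Types (f h : plane R -> R).

(** A class closed under the algebraic operations and, [E] being open and bounded, made of
    integrable functions; it reduces integrability to the structure of the integrand. *)
Definition bcont f :=
  (forall x, E x -> {for x, continuous f}) /\ exists C : R, forall x, E x -> `|f x| <= C.

Lemma bcontD f h : bcont f -> bcont h -> bcont (fun x => f x + h x).
Proof.
move=> [cf [C hC]] [ch [C' hC']]; split.
  by move=> x Ex; apply: cvgD; [exact: cf|exact: ch].
exists (C + C') => x Ex; apply: le_trans (ler_normD _ _) _.
by apply: lerD; [exact: hC|exact: hC'].
Qed.

Lemma bcontM f h : bcont f -> bcont h -> bcont (fun x => f x * h x).
Proof.
move=> [cf [C hC]] [ch [C' hC']]; split.
  by move=> x Ex; apply: cvgM; [exact: cf|exact: ch].
exists (C * C') => x Ex; rewrite normrM.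
by apply: ler_pM => //; [exact: hC|exact: hC'].
Qed.

Lemma bcont_cst (a : R) : bcont (fun=> a).
Proof. by split; [move=> x _; exact: cvg_cst|exists `|a|]. Qed.

Lemma bcontB f h : bcont f -> bcont h -> bcont (fun x => f x - h x).
Proof.
move=> bf bh; have := bcontD bf (bcontM (bcont_cst (-1)) bh).
rewrite (_ : (fun x => f x + -1 * h x) = (fun x => f x - h x))//.
by apply/funext => x; rewrite mulN1r.
Qed.

Lemma bcont_norm f : bcont f -> bcont (fun x => `|f x|).
Proof.
move=> [cf [C hC]]; split; last by exists C => x Ex; rewrite normr_id; exact: hC.
move=> x Ex; apply: (continuous_comp (f := f) (g := fun t : R => `|t|)); first exact: cf.
exact: norm_continuous.
Qed.

Lemma bcont_sum m (F : 'I_m -> plane R -> R) : (forall i, bcont (F i)) ->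
  bcont (fun x => \sum_(i < m) F i x).
Proof.
move=> bF; elim: m F bF => [|m IH] F bF.
  rewrite (_ : (fun x => _) = (fun=> 0)); first exact: bcont_cst.
  by apply/funext => x; rewrite big_ord0.
rewrite (_ : (fun x => _) = (fun x => (\sum_(i < m) F (widen_ord (leqnSn m) i) x) + F ord_max x)).
  by apply: bcontD; first apply: (IH (fun i => F (widen_ord (leqnSn m) i))).
by apply/funext => x; rewrite big_ord_recr.
Qed.

Lemma bcont_integ f : bcont f -> integ E f.
Proof.
move=> [cf [C hC]]; apply: (integ_bounded (open_measurable2 oE) EM _ hC).
exact: open_continuous_measurable2.
Qed.

Let mE : measurable (E : set (mplane R)) := open_measurable2 oE.

Lemma bcont_Rintegral_sum m (F : 'I_m -> plane R -> R) : (forall i, bcont (F i)) ->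
  \int[area R]_(x in E) (\sum_(i < m) F i x) = \sum_(i < m) \int[area R]_(x in E) F i x.
Proof.
move=> bF; elim: m F bF => [|m IH] F bF.
  rewrite big_ord0 (_ : (fun x => _) = (fun=> 0)).
    by rewrite /Rintegral integral0.
  by apply/funext => x; rewrite big_ord0.
rewrite big_ord_recr /= -(IH (fun i => F (widen_ord (leqnSn m) i)))//.
rewrite -RintegralD//.
- by apply: eq_Rintegral => x _; rewrite big_ord_recr.
- by apply: bcont_integ; exact: bcont_sum.
- exact: bcont_integ.
Qed.

Lemma Rintegral_off A f : measurable (A : set (mplane R)) -> A `<=` E ->
  (forall x, E x -> ~ A x -> f x = 0) ->
  \int[area R]_(x in E) f x = \int[area R]_(x in A) f x.
Proof.
move=> mA AE f0; rewrite Rintegral_mkcond [RHS]Rintegral_mkcond.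
apply: eq_Rintegral => x _; rewrite !patchE.
case: ifPn => Ex; case: ifPn => Ax //.
  by apply: f0; [exact/set_mem|move=> h; case/negP: Ax; exact/mem_set].
by case/negP: Ex; apply/mem_set; apply: AE; exact/set_mem.
Qed.

End BoundedContinuous.

Section ShellMass.
Context {R : realType}.

(** This is [shell_estimate] for [v = 1] and [e2 = r ^+ 2 / 4]. The integrand on the right is at
    most [12 + 1], the area at most [16 * r ^+ 2], and [sq >= r ^+ 2 / 2] on the left, which gives
    [2 * 13 * 16 = 416]. The gradient of [cdef] has length [2 * r] on the circle, so the integral
    scales like the length over [r], and no power of [r] remains. *)
Lemma shell_mass (c : plane R) (r sg e : R) : 0 < r -> sg = 1 \/ sg = -1 ->
  0 < e -> 4 * e <= r ^+ 2 ->
  \int[area R]_(y in [set y | e <= cdef c r sg y <= r ^+ 2 / 2]) dcut e (cdef c r sg y) <= 416.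
Proof.
move=> r0 sgE e0 er.
have r20 : 0 < r ^+ 2 by rewrite exprn_gt0.
set e2 := r ^+ 2 / 4; have e20 : 0 < e2 by rewrite divr_gt0.
have ee2 : e <= e2 by rewrite /e2; lra.
have -> : r ^+ 2 / 2 = 2 * e2 by rewrite /e2; field.
set D := [set y | _].
have sqb y : D y -> r ^+ 2 / 2 <= sq c y <= 3 / 2 * r ^+ 2.
  move=> /andP[h1 h2]; rewrite (sq_cdef c r sgE).
  by rewrite /e2 in h2; apply/andP; split; move: r20; case: sgE => -> in h1 h2 *; lra.
have DM y : D y -> enorm y <= enorm c + 2 * r.
  move=> /sqb /andP[_ h].
  have : enorm (y - c) <= 2 * r.
    rewrite -(ler_pXn2r (n := 2)) ?nnegrE ?enorm_ge0 ?mulr_ge0 ?(ltW r0)//.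
    by rewrite -sqE exprMn (le_trans h)// ler_wpM2r ?(ltW r20)// expr2; lra.
  have := enormB_le y c; lra.
have cD : closed D by exact: shell_closed.
have mD : measurable (D : set (mplane R)) := closed_measurable2 cD.
have DU : D `<=` setT by [].
have D2 : D `<=` disk c (2 * r).
  move=> y /sqb /andP[_ h]; rewrite /disk /=.
  rewrite -(ltr_pXn2r (n := 2)) ?nnegrE ?enorm_ge0 ?mulr_ge0 ?(ltW r0)//.
  by rewrite -sqE exprMn (le_lt_trans h)// ltr_pM2r// expr2; lra.
have aD : (area R D <= (16 * r ^+ 2)%:E)%E.
  apply: le_trans (_ : area R (disk c (2 * r)) <= _)%E.
    apply: le_measure; rewrite ?inE//; apply: open_measurable2; exact: disk_open.
  apply: le_trans (area_disk_le _ _) _; first by rewrite mulr_gt0.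
  by rewrite lee_fin exprMn; move: (r ^+ 2) => w; rewrite expr2; lra.
have aDf : fine (area R D) <= 16 * r ^+ 2.
  rewrite -lee_fin fineK// ge0_fin_numE ?measure_ge0//.
  by apply: le_lt_trans aD _; rewrite ltry.
have aDlt : (area R D < +oo)%E by apply: le_lt_trans aD _; rewrite ltry.
have S := shell_estimate sgE openT e0 ee2 (Ck_cst 1 setT 1) DU DM.
have rE : radial c (fun=> 1) = cst (0 : R).
  by apply/funext => y; rewrite /radial /pd !derive_cst !mulr0 addr0.
rewrite -/D rE in S.
have cs : continuous (sq c) by move=> x; exact: Ck_continuous (Ck_sq 0 c openT) Logic.I.
have cd : continuous (cdef c r sg) by move=> x; exact: Ck_continuous (@Ck_cdef _ c r sg 0 setT openT) Logic.I.
have ig f : continuous f -> integ D f.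
  by move=> cf; apply: (integ_continuous openT cD DU DM) => x _; exact: cf.
have dc e' : continuous (fun y => dcut e' (cdef c r sg y)).
  by move=> x; apply: (continuous_comp (f := cdef c r sg) (g := dcut e')); [exact: cd|exact: dcut_continuous].
have i1 := ig _ (dc e).
have L : r ^+ 2 / 2 * \int[area R]_(y in D) dcut e (cdef c r sg y) <=
    \int[area R]_(y in D) (dcut e (cdef c r sg y) * sq c y * 1).
  rewrite -(RintegralZl _ mD i1); apply: le_Rintegral => //; first exact: integZ.
    by apply: ig => x; apply: cvgM; [apply: cvgM; [exact: dc|exact: cs]|exact: cvg_cst].
  move=> y Dy; rewrite mulr1 mulrC; apply: ler_wpM2l; first exact: dcut_ge0.
  by have /andP[] := sqb y Dy.
have U : \int[area R]_(y in D) (dcut e2 (cdef c r sg y) * sq c y * `|1| + `|1| + `|cst (0 : R) y| / 2) <=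
    13 * (16 * r ^+ 2).
  apply: le_trans (ler_norm _) _.
  apply: le_trans (normr_Rintegral_le (C := 13) mD aDlt _ _) _; last by rewrite ler_pM2l.
    apply: ig => x; apply: cvgD; first apply: cvgD.
    - by apply: cvgM; [apply: cvgM; [exact: dc|exact: cs]|exact: cvg_cst].
    - exact: cvg_cst.
    exact: (cvg_cst (`|0 : R| / 2)).
  move=> y Dy; rewrite /cst normr0 mul0r addr0 normr1 mulr1.
  have X0 := dcut_ge0 e20 (cdef c r sg y); have X1 := dcut_le e20 (cdef c r sg y).
  have /andP[_ s1] := sqb y Dy; have s0 := sq_ge0 c y.
  have XS := mulr_ge0 X0 s0; rewrite ger0_norm; last by rewrite addr_ge0.
  have := ler_pM X0 s0 X1 s1.
  have -> : 2 / e2 * (3 / 2 * r ^+ 2) = 12 by rewrite /e2; field; rewrite gt_eqF.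
  have -> : (13 : R) = 12 + 1 by ring.
  by rewrite lerD2r.
have := le_trans L (le_trans S U).
have -> : 13 * (16 * r ^+ 2) = r ^+ 2 / 2 * 416 by field.
by rewrite ler_pM2l// divr_gt0.
Qed.

End ShellMass.

(** Turns the right side of [shell_estimate] for [u ^+ 2] into [r / 2] times [hen]. [X] is the
    density at [e2 = r * d / 8], at most [2 / e2], so [X * s <= 25 * r / d]; Young's inequality with
    weight [d] splits the cross term. The sum [25 + 1 + 5 / 8] is rounded up to 27. *)
Lemma trace_pointwise {R : realType} (d r X s u w g : R) : 0 < d -> d <= r ->
  0 <= X <= 16 / (r * d) -> 0 <= s <= 25 / 16 * r ^+ 2 -> 0 <= g -> `|w| <= 5 / 4 * r * g ->
  X * s * `|u ^+ 2| + `|u ^+ 2| + `|2 * u * w| / 2 <=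
    r / 2 * (54 / d * u ^+ 2 + 2 * d * g ^+ 2).
Proof.
move=> d0 dr /andP[X0 X1] /andP[s0 s1] g0 hw.
have r0 : 0 < r by exact: lt_le_trans dr.
have rd : 0 < r / d by rewrite divr_gt0.
have rd1 : 1 <= r / d by rewrite ler_pdivlMr// mul1r.
have Xs : X * s <= 25 * (r / d).
  apply: le_trans (ler_pM X0 s0 X1 s1) _.
  by rewrite le_eqVlt; apply/orP; left; apply/eqP; field; rewrite !gt_eqF.
rewrite (ger0_norm (sqr_ge0 u)); have u0 := sqr_ge0 u.
have -> : `|2 * u * w| / 2 = `|u| * `|w| by rewrite !normrM ger0_norm//; field.
have t0 : 0 <= `|u| by [].
have h1 := ler_wpM2l t0 hw; have h2 := ler_wpM2r u0 Xs.
have h3 := ler_wpM2r u0 rd1; rewrite mul1r in h3.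
have am : `|u| * g <= (u ^+ 2 / d + d * g ^+ 2) / 2.
  have -> : (u ^+ 2 / d + d * g ^+ 2) / 2 = `|u| * g + (`|u| - d * g) ^+ 2 / d / 2.
    by rewrite -(real_normK (num_real u)); field; rewrite gt_eqF.
  by rewrite lerDl divr_ge0// divr_ge0 ?sqr_ge0// ltW.
have h4 : `|u| * (5 / 4 * r * g) <= 5 / 8 * (r / d * u ^+ 2) + 5 / 8 * (r * d * g ^+ 2).
  have -> : `|u| * (5 / 4 * r * g) = 5 / 4 * r * (`|u| * g) by ring.
  have h : 0 <= 5 / 4 * r by rewrite mulr_ge0// ltW.
  apply: le_trans (ler_wpM2l h am) _.
  by rewrite le_eqVlt; apply/orP; left; apply/eqP; field; rewrite gt_eqF.
have -> : r / 2 * (54 / d * u ^+ 2 + 2 * d * g ^+ 2) = 27 * (r / d * u ^+ 2) + r * d * g ^+ 2.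
  by field; rewrite gt_eqF.
have h5 : 0 <= r * d * g ^+ 2 by rewrite mulr_ge0 ?sqr_ge0// mulr_ge0// ltW.
rewrite -(mulrA 25) in h2; move: h1 h2 h3 h4 h5 u0.
move: (X * s * u ^+ 2) (r / d * u ^+ 2) (u ^+ 2) (`|u| * `|w|) (`|u| * (5 / 4 * r * g)) (r * d * g ^+ 2).
by move=> A T B P Q V; lra.
Qed.

Lemma sum_le1_disjoint {R : realType} m (b : 'I_m -> R) : (forall i, 0 <= b i <= 1) ->
  (forall i j, i != j -> b i = 0 \/ b j = 0) -> 0 <= \sum_(i < m) b i <= 1.
Proof.
move=> b01 bd; apply/andP; split; first by apply: sumr_ge0 => i _; case/andP: (b01 i).
have [/forallP h|/forallPn[i hi]] := boolP [forall i, b i == 0].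
  by rewrite big1// => i _; exact/eqP.
rewrite (bigD1 i)//= big1 ?addr0; first by case/andP: (b01 i).
by move=> j ji; case: (bd i j); rewrite 1?eq_sym// => h; rewrite h eqxx in hi.
Qed.

(** * Energy estimate with cutoffs near the circles *)

Section Energy.
Context {R : realType} {n : nat}.
Variables (z : 'I_n.+1 -> plane R) (r : 'I_n.+1 -> R) (d M r0 : R) (E : set (plane R)).
Hypotheses (d0 : 0 < d) (oE : open E) (EM : forall x, E x -> enorm x <= M).
Hypotheses (gE : forall x, E x <-> forall k, 0 < bdk z r k x)
  (rd : forall k, d <= r k) (rr0 : forall k, r k <= r0)
  (bsum : forall i j y, i != j -> d <= bdk z r i y + bdk z r j y).
Implicit Types (x y : plane R) (i j k : 'I_n.+1).

Definition sdef k y := cdef (z k) (r k) (side k) y.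

Let rpos k : 0 < r k. Proof. exact: lt_le_trans (rd k). Qed.
Let mE : measurable (E : set (mplane R)) := open_measurable2 oE.

Lemma sdefE k y : sdef k y = bdk z r k y * (enorm (y - z k) + r k).
Proof. by rewrite /sdef /cdef sqE /bdk /bdist; ring. Qed.

Lemma sdef_gt0 k x : E x -> 0 < sdef k x.
Proof.
move=> /gE /(_ k) h; rewrite sdefE mulr_gt0//.
by have := rpos k; have := enorm_ge0 (x - z k); lra.
Qed.

Lemma bdk_le_sdef k y t : 0 < t -> sdef k y <= r k * t -> bdk z r k y <= t.
Proof.
move=> t0; rewrite sdefE => h; rewrite leNgt; apply/negP => ht.
have e0 := enorm_ge0 (y - z k); have r0' := rpos k.
have : r k * t < bdk z r k y * (enorm (y - z k) + r k).
  apply: (@lt_le_trans _ _ (bdk z r k y * r k)); first by rewrite mulrC ltr_pM2r.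
  by rewrite ler_wpM2l ?lerDr// ltW// (lt_trans t0).
by rewrite ltNge h.
Qed.

Lemma sdef_collar k y : 0 < sdef k y -> sdef k y <= r k * d / 4 ->
  E y /\ r k ^+ 2 / 2 <= sq (z k) y <= 25 / 16 * r k ^+ 2.
Proof.
move=> s0 s1.
have b1 : bdk z r k y <= d / 4 by apply: bdk_le_sdef; rewrite ?divr_gt0// mulrA.
have rk := rpos k; have rdk := rd k; have e0 := enorm_ge0 (y - z k).
have b0 : 0 < bdk z r k y.
  by move: s0; rewrite sdefE pmulr_lgt0//; lra.
split.
  apply/gE => j; have [->//|jk] := eqVneq j k.
  by have := bsum y jk; move: d0; lra.
have /andP[h1 h2] : 3 / 4 * r k <= enorm (y - z k) <= 5 / 4 * r k.
  move: b0 b1; rewrite /bdk /bdist; case: (@sideP R n k) => ->.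
    by rewrite !mul1r => *; apply/andP; split; lra.
  by rewrite !mulN1r => *; apply/andP; split; lra.
rewrite sqE; move: (enorm (y - z k)) (r k) rk h1 h2 => p q q0 h1 h2.
have q34 : 0 <= 3 / 4 * q by rewrite mulr_ge0// ltW.
have p0 : 0 <= p by exact: le_trans h1.
have := ler_pM q34 q34 h1 h1; have := ler_pM p0 p0 h2 h2; rewrite -!expr2 !exprMn.
have := sqr_ge0 q; move: (q ^+ 2) (p ^+ 2) => a b a0; rewrite !expr2 => h3 h4.
by apply/andP; split; lra.
Qed.

Variable e : R.
Hypotheses (e0 : 0 < e) (he : 16 * e <= d ^+ 2).

Let erd k : 16 * e <= r k * d.
Proof. by apply: (le_trans he); rewrite expr2 ler_wpM2r// ltW. Qed.

Let err k : 16 * e <= r k ^+ 2.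
Proof. by apply: (le_trans (erd k)); rewrite expr2 ler_wpM2l// ltW. Qed.

Let dc k e' x : {for x, continuous (fun y => dcut e' (sdef k y))}.
Proof.
apply: (continuous_comp (f := sdef k) (g := dcut e')); last exact: dcut_continuous.
exact: Ck_continuous (@Ck_cdef _ (z k) (r k) (side k) 0 setT openT) Logic.I.
Qed.

Lemma bcont_dcut k : bcont E (fun y => dcut e (sdef k y)).
Proof.
split; first by move=> x _; exact: dc.
exists (2 / e) => x _; rewrite ger0_norm ?dcut_ge0//; exact: dcut_le.
Qed.

Lemma bcont_cut k e' : 0 < e' -> bcont E (fun y => cut e' (sdef k y)).
Proof.
move=> h; split.
  move=> x _; apply: (continuous_comp (f := sdef k) (g := cut e')); last exact: cut_continuous.
  exact: Ck_continuous (@Ck_cdef _ (z k) (r k) (side k) 0 setT openT) Logic.I.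
by exists 1 => x _; rewrite ger0_norm ?cut_ge0//; exact: cut_le1.
Qed.

Lemma mass_le k : \int[area R]_(y in E) dcut e (sdef k y) <= 416.
Proof.
set A := [set y | e <= cdef (z k) (r k) (side k) y <= 2 * e].
set A' := [set y | e <= cdef (z k) (r k) (side k) y <= r k ^+ 2 / 2].
have cA : closed A by exact: shell_closed.
have cA' : closed A'.
  have -> : A' = [set y | e <= cdef (z k) (r k) (side k) y <= 2 * (r k ^+ 2 / 4)].
    by rewrite /A'; congr mkset; apply/funext => y; congr (is_true (_ <= _ <= _)); field.
  exact: shell_closed.
have AA' : A `<=` A'.
  move=> y /andP[h1 h2]; rewrite /A' /= h1 /=; apply: (le_trans h2).
  by have := err k; move: e0; lra.
have AE : A `<=` E.
  move=> y /andP[h1 h2]; have [] // := @sdef_collar k y; first exact: lt_le_trans h1.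
  by apply: (le_trans h2); have := erd k; move: e0; lra.
rewrite (@Rintegral_off _ _ A _ (closed_measurable2 cA) AE); last first.
  move=> x _ nA; apply: dcut_eq0 => //; rewrite /A /= in nA.
  have [h|h] := leP (sdef k x) e; [by left|right].
  by rewrite leNgt; apply/negP => h'; apply: nA; rewrite !ltW.
have he4 : 4 * e <= r k ^+ 2 by have := err k; move: e0; lra.
apply: le_trans _ (shell_mass (z k) (rpos k) (sideP k) e0 he4).
apply: le_Rintegral_subset => //; [exact: closed_measurable2|exact: closed_measurable2| |].
  have bA' y : A' y -> enorm y <= enorm (z k) + 2 * r k.
    move=> /andP[h1 h2]; have h0 := le_trans (ltW e0) h1; have : enorm (y - z k) <= 2 * r k.
      rewrite -(ler_pXn2r (n := 2)) ?nnegrE ?enorm_ge0 ?mulr_ge0 ?(ltW (rpos k))//.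
      rewrite -sqE (sq_cdef (z k) (r k) (sideP k)) exprMn.
      have := exprn_gt0 2 (rpos k); move: h0 h2; rewrite (expr2 2).
      case: (@sideP R n k) => ->; rewrite ?mul1r ?mulN1r.
        by move: (cdef _ _ _ _) (r k ^+ 2) => s q; lra.
      by move: (cdef _ _ _ _) (r k ^+ 2) => s q; lra.
    by have := enormB_le y (z k); lra.
  by apply: (integ_continuous openT cA' _ bA') => // x _; exact: dc.
by move=> x _; exact: dcut_ge0.
Qed.

Variable u : plane R -> R.
Hypotheses (hu : harm E u) (bu : bcont E u) (bpu : forall i : bool, bcont E (pd i u)).

Definition gsq y := pd false u y ^+ 2 + pd true u y ^+ 2.
(** The weights are those of a trace inequality on a collar of width [d]; they lead to the two terms
    [d ^ (-1/2) * C_P] and [d ^ (1/2)] in [B]. *)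
Definition hen y := 54 / d * u y ^+ 2 + 2 * d * gsq y.

Let gsq_ge0 y : 0 <= gsq y.
Proof. by rewrite addr_ge0// sqr_ge0. Qed.

Let hen_ge0 y : 0 <= hen y.
Proof.
by rewrite addr_ge0// mulr_ge0 ?sqr_ge0// ?mulr_ge0 ?invr_ge0 ?(ltW d0)//.
Qed.

Lemma bcont_gsq : bcont E gsq.
Proof.
have b (i : bool) := bcontM (bpu i) (bpu i).
exact: (bcontD (b false) (b true)).
Qed.

Lemma bcont_hen : bcont E hen.
Proof.
exact: (bcontD (bcontM (bcont_cst E (54 / d)) (bcontM bu bu)) (bcontM (bcont_cst E (2 * d)) bcont_gsq)).
Qed.

Let bcont_u2 : bcont E (fun y => u y ^+ 2).
Proof. exact: bcontM bu bu. Qed.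

Let cu1 : Ck 1 E u. Proof. by apply: Ck_pred; case: hu. Qed.

(** Equal to 1 on the shell that carries the trace inequality of circle [k], and supported near that
    circle only. The supports are disjoint, so summing over [k] costs the integral of [hen] once. *)
Let b_ k y := 1 - cut (r k * d / 4) (sdef k y).

Let rd4 k : 0 < r k * d / 4.
Proof. by rewrite divr_gt0// mulr_gt0. Qed.

Let bcont_b k : bcont E (b_ k).
Proof. exact: (bcontB (bcont_cst E 1) (bcont_cut k (rd4 k))). Qed.

Let b_01 k y : 0 <= b_ k y <= 1.
Proof.
by rewrite /b_ subr_ge0 cut_le1 /= lerBlDl lerDr cut_ge0.
Qed.

Lemma trace_le k : r k * \int[area R]_(y in E) (dcut e (sdef k y) * u y ^+ 2) <=
  \int[area R]_(y in E) (b_ k y * hen y).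
Proof.
have rk := rpos k.
pose e2 := r k * d / 8; have e20 : 0 < e2 by rewrite divr_gt0// mulr_gt0.
have ee2 : e <= e2 by rewrite /e2; have := erd k; move: e0; lra.
have e2E : 2 * e2 = r k * d / 4 by rewrite /e2; field.
set A := [set y | e <= cdef (z k) (r k) (side k) y <= 2 * e2].
have cA : closed A by exact: shell_closed.
have mA := closed_measurable2 cA.
have sub y : A y -> E y /\ r k ^+ 2 / 2 <= sq (z k) y <= 25 / 16 * r k ^+ 2.
  move=> /andP[h1 h2]; apply: sdef_collar; first exact: lt_le_trans h1.
  by apply: (le_trans h2); rewrite /e2; lra.
have AE : A `<=` E by move=> y /sub[].
have AM y : A y -> enorm y <= M by move=> /AE /EM.
have cu2 : Ck 1 E (fun y => u y ^+ 2) by exact: CkM oE cu1 cu1.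
have S := shell_estimate (sideP k) oE e0 ee2 cu2 AE AM; rewrite -/A in S.
rewrite (@Rintegral_off _ _ A _ mA AE); last first.
  move=> x _ nA; rewrite dcut_eq0 ?mul0r//; have [h|h] := leP (sdef k x) e; [by left|right].
  rewrite leNgt; apply/negP => h'; apply: nA; rewrite /A /= !ltW//.
  by apply: (lt_le_trans h'); rewrite ler_pM2l.
have bi f : bcont E f -> integ A f.
  by move=> bf; apply: integ_subset AE _ => //; exact: (bcont_integ oE EM).
have bd2 : bcont E (fun y => dcut e (sdef k y) * u y ^+ 2) by exact: bcontM (bcont_dcut k) bcont_u2.
have i1 := bi _ bd2.
have L : r k ^+ 2 / 2 * \int[area R]_(y in A) (dcut e (sdef k y) * u y ^+ 2) <=
    \int[area R]_(y in A) (dcut e (sdef k y) * sq (z k) y * u y ^+ 2).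
  rewrite -(RintegralZl _ mA i1); apply: le_Rintegral => //; first exact: integZ.
    apply: (integ_continuous oE cA AE AM) => x Ex; apply: cvgM; last exact: bcont_u2.1 x Ex.
    by apply: cvgM; [exact: dc|exact: Ck_continuous (Ck_sq 0 (z k) oE) Ex].
  move=> y /sub[_ /andP[h _]].
  have D0 := dcut_ge0 e0 (sdef k y); have u0 := sqr_ge0 (u y).
  by have := ler_wpM2r (mulr_ge0 D0 u0) h; rewrite [X in _ -> _ <= X]mulrAC [X in _ -> _ <= X]mulrC.
have U : \int[area R]_(y in A) (dcut e2 (cdef (z k) (r k) (side k) y) * sq (z k) y * `|u y ^+ 2| + `|u y ^+ 2| +
      `|radial (z k) (fun y => u y ^+ 2) y| / 2) <=
    r k / 2 * \int[area R]_(y in A) hen y.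
  have ih := bi _ bcont_hen.
  rewrite -(RintegralZl _ mA ih); apply: le_Rintegral => //; last first.
  - move=> y Ay; have [Ey /andP[_ h]] := sub y Ay.
    have rE : radial (z k) (fun y => u y ^+ 2) y = 2 * u y * radial (z k) u y.
      have D (i : bool) : pd i (fun y => u y ^+ 2) y = 2 * u y * pd i u y.
        have dd := Ck_derivable (i := i) cu1 Ey.
        by apply: etrans (pdM dd dd) _; ring.
      rewrite /radial !D; move: (pd false u y) (pd true u y) => p q; ring.
    rewrite rE; have gE2 : gsq y = enorm (grad u y) ^+ 2 by rewrite sqr_enorm.
    rewrite /hen gE2; apply: trace_pointwise => //.
    - rewrite dcut_ge0//=; apply: le_trans (dcut_le e20 _) _.
      by rewrite le_eqVlt; apply/orP; left; apply/eqP; rewrite /e2; field; rewrite !gt_eqF.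
    - by rewrite sq_ge0.
    - exact: enorm_ge0.
    rewrite radialE; apply: le_trans (dot_le _ _) _; apply: ler_wpM2r; first exact: enorm_ge0.
    rewrite -(ler_pXn2r (n := 2)) ?nnegrE ?enorm_ge0 ?mulr_ge0 ?(ltW rk)//.
    by rewrite -sqE exprMn; apply: (le_trans h); rewrite le_eqVlt; apply/orP; left; apply/eqP; field.
  - exact: integZ.
  have cn (f : plane R -> R) x : {for x, continuous f} -> {for x, continuous (fun y => `|f y|)}.
    by move=> cf; apply: (continuous_comp (f := f) (g := fun t : R => `|t|)) => //; exact: norm_continuous.
  have cu2c x : E x -> {for x, continuous (fun y => u y ^+ 2)} by move=> Ex; exact: bcont_u2.1 x Ex.
  apply: (integ_continuous oE cA AE AM) => x Ex; apply: cvgD; first apply: cvgD.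
  - apply: cvgM; last by apply: cn; exact: cu2c.
    by apply: cvgM; [exact: dc|exact: Ck_continuous (Ck_sq 0 (z k) oE) Ex].
  - by apply: cn; exact: cu2c.
  - apply: cvgM; last exact: cvg_cst.
    by apply: cn; exact: Ck_continuous (Ck_radial (z k) oE cu2) Ex.
have B : \int[area R]_(y in A) hen y <= \int[area R]_(y in E) (b_ k y * hen y).
  have bbh := bcontM (bcont_b k) bcont_hen.
  apply: le_trans (le_Rintegral_subset mA mE AE (bcont_integ oE EM bbh) _); last first.
    by move=> x _; apply: mulr_ge0 => //; case/andP: (b_01 k x).
  rewrite le_eqVlt; apply/orP; left; apply/eqP; apply: eq_Rintegral => y /set_mem /andP[_ h2].
  rewrite /b_ cut_eq0 ?subr0 ?mul1r//.
  by apply: (le_trans h2); rewrite e2E.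
have := le_trans L (le_trans S U).
have -> : r k ^+ 2 / 2 = r k / 2 * r k by field.
by rewrite -mulrA ler_pM2l ?divr_gt0// => h; apply: (le_trans h B).
Qed.

Lemma trace_sum_le : \sum_(k < n.+1) (r k * \int[area R]_(y in E) (dcut e (sdef k y) * u y ^+ 2)) <=
  \int[area R]_(y in E) hen y.
Proof.
have bbh k := bcontM (bcont_b k) bcont_hen.
apply: le_trans (ler_sum _ (fun k _ => trace_le k)) _.
rewrite -(bcont_Rintegral_sum oE EM bbh); apply: le_Rintegral => //.
- by apply: (bcont_integ oE EM); exact: bcont_sum.
- exact: (bcont_integ oE EM bcont_hen).
move=> y _; rewrite -mulr_suml; apply: ler_piMl => //.
have /andP[] // : 0 <= \sum_(k < n.+1) b_ k y <= 1.
apply: sum_le1_disjoint => [k|i j ij]; first exact: b_01.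
have small k : b_ k y != 0 -> bdk z r k y < d / 2.
  move=> h; rewrite ltNge; apply/negP => h2; case/negP: h; apply/eqP.
  rewrite /b_ cut_eq1 ?subrr//.
  rewrite sdefE; apply: (@le_trans _ _ (d / 2 * r k)); first by have := rpos k; move: d0; lra.
  apply: ler_pM => //; [by rewrite divr_ge0// ltW|exact: ltW|by rewrite lerDr enorm_ge0].
have [->|hi] := eqVneq (b_ i y) 0; first by left.
have [->|hj] := eqVneq (b_ j y) 0; first by right.
have := bsum y ij; have := small _ hi; have := small _ hj; lra.
Qed.

(** Since at most one summand is nonzero, this is the product of the cutoffs, written so that its
    derivative is a plain sum over the circles. *)
Definition eta y := 1 - \sum_(k < n.+1) (1 - cut e (sdef k y)).

Lemma eta_sum_bounds y : 0 <= \sum_(k < n.+1) (1 - cut e (sdef k y)) <= 1.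
Proof.
apply: sum_le1_disjoint => [k|i j ij]; first by rewrite subr_ge0 cut_le1 lerBlDl lerDr cut_ge0.
have small k : 1 - cut e (sdef k y) != 0 -> bdk z r k y < d / 2.
  move=> h; rewrite ltNge; apply/negP => h2; case/negP: h; apply/eqP.
  rewrite cut_eq1 ?subrr// sdefE; apply: (@le_trans _ _ (d / 2 * r k)).
    by have := erd k; move: e0; lra.
  by apply: ler_pM => //; [rewrite divr_ge0// ltW|exact: ltW|rewrite lerDr enorm_ge0].
have [->|hi] := eqVneq (1 - cut e (sdef i y)) 0; first by left.
have [->|hj] := eqVneq (1 - cut e (sdef j y)) 0; first by right.
have := bsum y ij; have := small _ hi; have := small _ hj; lra.
Qed.

Lemma eta_bounds y : 0 <= eta y <= 1.
Proof. by have /andP[h1 h2] := eta_sum_bounds y; rewrite /eta subr_ge0 h2 lerBlDl lerDr. Qed.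

Lemma bcont_eta : bcont E eta.
Proof.
apply: (bcontB (bcont_cst E 1)); apply: bcont_sum => k.
exact: (bcontB (bcont_cst E 1) (bcont_cut k e0)).
Qed.

Let D := [set y | forall k, e <= sdef k y].

Let cD : closed D.
Proof.
have -> : D = \bigcap_k (sdef k @^-1` [set s | e <= s]).
  by apply/seteqP; split => y h k; [move=> _; exact: h|exact: (h k Logic.I)].
apply: closed_bigI => k _; apply: closed_comp; last exact: closed_ge.
by move=> x _; exact: Ck_continuous (@Ck_cdef _ (z k) (r k) (side k) 0 setT openT) Logic.I.
Qed.

Let DE : D `<=` E.
Proof.
move=> y Dy; apply/gE => k; have := lt_le_trans e0 (Dy k).
by rewrite sdefE pmulr_lgt0//; have := rpos k; have := enorm_ge0 (y - z k); lra.
Qed.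

Let eta_off y : ~ D y -> eta y = 0.
Proof.
move=> nD; have [k hk] : exists k, sdef k y < e.
  apply: contrapT => h; apply: nD => k; rewrite leNgt; apply/negP => hk.
  by apply: h; exists k.
have /andP[_ s1] := eta_sum_bounds y.
have h : 1 <= \sum_(k < n.+1) (1 - cut e (sdef k y)).
  rewrite (bigD1 k)//= (cut_eq0 e0 (ltW hk)) subr0 lerDl; apply: sumr_ge0 => j _.
  by rewrite subr_ge0 cut_le1.
by apply/eqP; rewrite /eta subr_eq0; apply/eqP/le_anti; rewrite h s1.
Qed.

Let is_derive_eta (i : bool) y : is_derive y (ee i) eta
  (\sum_(k < n.+1) dcut e (sdef k y) * (side k * (2 * (co i y - co i (z k))))).
Proof.
have d1 k : is_derive y (ee i) (fun y => 1 - cut e (sdef k y))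
    (0 - dcut e (sdef k y) * (side k * (2 * (co i y - co i (z k))))).
  exact: is_deriveB (is_derive_cst (1 : R) y (ee i)) (is_derive_cut_cdef (z k) (r k) (side k) i y e0).
have d2 := is_deriveB (is_derive_cst (1 : R) y (ee i)) (is_derive_sum d1).
have -> : eta = cst 1 - \sum_(k < n.+1) (fun y => 1 - cut e (sdef k y)).
  apply/funext => x; rewrite /eta -[RHS]/(1 - (\sum_(k < n.+1) (fun y => 1 - cut e (sdef k y))) x).
  by rewrite fct_sumE.
apply: is_derive_eq d2 _; rewrite sub0r -sumrN; apply: eq_bigr => k _.
by rewrite sub0r opprK.
Qed.

Let flux k y := dcut e (sdef k y) * (2 * side k * (u y * radial (z k) u y)).

Let bcont_radial k : bcont E (radial (z k) u).
Proof.
have bco (i : bool) : bcont E (fun y => co i y - co i (z k)).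
  apply: bcontB; last exact: bcont_cst.
  split; first by move=> x _; exact: Ck_continuous (@Ck_co R 0 setT i) Logic.I.
  exists M => x Ex; apply: le_trans (EM Ex).
  by case: i; [exact: abs2_le_enorm|exact: abs1_le_enorm].
exact: (bcontD (bcontM (bco false) (bpu false)) (bcontM (bco true) (bpu true))).
Qed.

Let bcont_flux k : bcont E (flux k).
Proof.
exact: (bcontM (bcont_dcut k) (bcontM (bcont_cst E (2 * side k)) (bcontM bu (bcont_radial k)))).
Qed.

(** The divergence of [eta * u * Du], with [u] harmonic. The derivative of [eta] lives on the thin
    shells, where [flux k] stands for the boundary term, [u] times its normal derivative. *)
Lemma energy_identity :
  \int[area R]_(y in E) (eta y * gsq y + \sum_(k < n.+1) flux k y) = 0.
Proof.
pose F (i : bool) y := eta y * (u y * pd i u y).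
have c2 : Ck 2 E u by case: hu.
have ck k : Ck 1 E (fun y => 1 - cut e (sdef k y)).
  exact: (CkB oE (Ck_cst 1 E 1) (Ck_cut e oE (Ck_cdef (z k) (r k) (side k) 1 oE))).
have ceta : Ck 1 E eta.
  exact: (CkB oE (Ck_cst 1 E 1) (Ck_sum (index_enum _) (P := xpredT) oE (fun k _ => ck k))).
have cF (i : bool) : Ck 1 E (F i) by exact: (CkM oE ceta (CkM oE cu1 (Ck_pd i c2))).
have off (i : bool) y : ~ D y -> F i y = 0 by move=> nD; rewrite /F eta_off// mul0r.
have DM y : D y -> enorm y <= M by move=> /DE /EM.
have zz (i : bool) := integral_pd_eq0_on i oE cD DE DM (cF i) (off i).
have pdF (i : bool) y : E y -> pd i (F i) y =
   (\sum_(k < n.+1) dcut e (sdef k y) * (side k * (2 * (co i y - co i (z k))))) * (u y * pd i u y) +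
   eta y * (pd i u y ^+ 2 + u y * pd i (pd i u) y).
  move=> Ey.
  have d2 := derivableP (Ck_derivable (i := i) cu1 Ey).
  have d3 := derivableP (Ck_derivable (i := i) (Ck_pd i c2) Ey).
  have [_ H] := is_deriveM (is_derive_eta i y) (is_deriveM d2 d3).
  apply: etrans H _; rewrite -/(pd i u y) -/(pd i (pd i u) y).
  have -> : (u * pd i u) y = u y * pd i u y by [].
  move: (\sum_(k < _) _) (eta y) (u y) (pd i u y) (pd i (pd i u) y) => a b p q t.
  by rewrite /GRing.scale /=; ring.
have mD := closed_measurable2 cD.
have iF (i : bool) : integ D (fun y => pd i (F i) y).
  apply: (integ_continuous oE cD DE DM) => x Ux.
  exact: Ck_continuous (Ck_pd i (cF i)) Ux.
transitivity (\int[area R]_(y in E) (pd false (F false) y + pd true (F true) y)).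
  apply: eq_Rintegral => y /set_mem Ey; rewrite !pdF//.
  have lap : pd false (pd false u) y + pd true (pd true u) y = 0 by case: hu => _; exact.
  have fE : \sum_(k < n.+1) flux k y =
     (\sum_(k < n.+1) dcut e (sdef k y) * (side k * (2 * (co false y - co false (z k))))) * (u y * pd false u y) +
     (\sum_(k < n.+1) dcut e (sdef k y) * (side k * (2 * (co true y - co true (z k))))) * (u y * pd true u y).
    rewrite !mulr_suml -big_split; apply: eq_bigr => k _; rewrite /flux /radial.
    by move: (pd false u y) (pd true u y) => p q /=; ring.
  rewrite fE /gsq; move: (pd false (pd false u) y) (pd true (pd true u) y) lap => a b.
  move=> /eqP; rewrite addr_eq0 => /eqP ->.
  move: (\sum_(k < _) _) (\sum_(k < _) _) (pd false u y) (pd true u y) (eta y) (u y) => *.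
  by ring.
rewrite (@Rintegral_off _ _ D _ mD DE); last first.
  by move=> x _ nD; rewrite (pd_eq0_off _ cD (off false) nD) (pd_eq0_off _ cD (off true) nD) addr0.
apply: etrans (RintegralD mD (iF false) (iF true)) _.
by apply: etrans (congr2 +%R (zz false) (zz true)) _; rewrite addr0.
Qed.

(** The boundary term is linear in [u] and the trace inequality quadratic;
    [2 * |u| <= l + u ^+ 2 / l] passes from one to the other, and [l] is left free for later
    optimization. *)
Lemma energy_le (S l : R) : 0 <= S -> 0 < l ->
  (forall k x, E x -> e < sdef k x < 2 * e -> `|radial (z k) u x| <= r k * S) ->
  \int[area R]_(y in E) (eta y * gsq y) <=
    S * (l * (416 * \sum_(k < n.+1) r k) + l^-1 * \int[area R]_(y in E) hen y).
Proof.
move=> S0 l0 hS.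
have b1 := bcontM bcont_eta bcont_gsq.
have b2 := bcont_sum bcont_flux.
have i1 := bcont_integ oE EM b1; have i2 := bcont_integ oE EM b2.
have H := energy_identity; rewrite (RintegralD mE i1 i2) in H.
pose T k y := S * l * r k * dcut e (sdef k y) + S / l * r k * (dcut e (sdef k y) * u y ^+ 2).
have bdu k : bcont E (fun y => dcut e (sdef k y) * u y ^+ 2) by exact: bcontM (bcont_dcut k) bcont_u2.
have bT1 k : bcont E (fun y => S * l * r k * dcut e (sdef k y)) by exact: bcontM (bcont_cst E _) (bcont_dcut k).
have bT2 k : bcont E (fun y => S / l * r k * (dcut e (sdef k y) * u y ^+ 2)) by exact: bcontM (bcont_cst E _) (bdu k).
have bT k : bcont E (T k) by exact: bcontD (bT1 k) (bT2 k).
have -> : \int[area R]_(y in E) (eta y * gsq y) = - \int[area R]_(y in E) (\sum_(k < n.+1) flux k y).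
  by apply/eqP; rewrite -addr_eq0 H.
apply: (@le_trans _ _ (\int[area R]_(y in E) (\sum_(k < n.+1) T k y))).
  rewrite -mulN1r -(RintegralZl _ mE i2); apply: le_Rintegral => //; first exact: integZ.
    by apply: (bcont_integ oE EM); exact: bcont_sum.
  move=> y Ey; rewrite mulN1r -sumrN; apply: ler_sum => k _.
  rewrite /flux /T; have [h|h] := leP (sdef k y) e.
    by rewrite dcut_eq0 ?mul0r ?mulr0 ?addr0 ?oppr0//; left.
  have [h2|h2] := leP (2 * e) (sdef k y).
    by rewrite dcut_eq0 ?mul0r ?mulr0 ?addr0 ?oppr0//; right.
  have hr : `|radial (z k) u y| <= r k * S by apply: hS; rewrite ?h ?h2.
  have D0 := dcut_ge0 e0 (sdef k y); have rk := rpos k.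
  have -> : S * l * r k * dcut e (sdef k y) + S / l * r k * (dcut e (sdef k y) * u y ^+ 2) =
    dcut e (sdef k y) * (r k * S * (l + u y ^+ 2 / l)) by ring.
  rewrite -mulrN; apply: ler_wpM2l => //.
  apply: le_trans (ler_norm _) _; rewrite normrN !normrM (ger0_norm (_ : 0 <= 2))//.
  have -> : `|side k| = 1 :> R by case: (@sideP R n k) => ->; rewrite ?normrN normr1.
  rewrite mulr1.
  have am : 2 * `|u y| <= l + u y ^+ 2 / l.
    have -> : l + u y ^+ 2 / l = 2 * `|u y| + (l - `|u y|) ^+ 2 / l.
      by rewrite -(real_normK (num_real (u y))); field; rewrite gt_eqF.
    by rewrite lerDl divr_ge0 ?sqr_ge0// ltW.
  by rewrite mulrA mulrC; apply: ler_pM => //; rewrite mulr_ge0.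
rewrite (bcont_Rintegral_sum oE EM bT).
have -> : S * (l * (416 * \sum_(k < n.+1) r k) + l^-1 * \int[area R]_(y in E) hen y) =
   \sum_(k < n.+1) S * l * r k * 416 + S / l * \int[area R]_(y in E) hen y.
  by rewrite -mulr_suml -mulr_sumr; move: (\sum_(k < _) _) (Rintegral _ _ _) => p q; ring.
have h0 : 0 <= S / l by rewrite divr_ge0// ltW.
apply: le_trans _ (lerD (lexx _) (ler_wpM2l h0 trace_sum_le)).
rewrite mulr_sumr -big_split; apply: ler_sum => k _.
rewrite /T (RintegralD mE (bcont_integ oE EM (bT1 k)) (bcont_integ oE EM (bT2 k))).
rewrite (RintegralZl _ mE (bcont_integ oE EM (bcont_dcut k))) (RintegralZl _ mE (bcont_integ oE EM (bdu k))).
apply: lerD; last by rewrite mulrA.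
apply: ler_wpM2l; last exact: mass_le.
by rewrite !mulr_ge0// ltW// rpos.
Qed.

End Energy.

(** Extends the boundary condition, known on the circles only, to a bound on thin shells: by
    compactness the local neighbourhoods yield one threshold [t]. *)
Lemma near_zero_set_bound {R : realType} (K : set (plane R)) (w b : plane R -> R) (A e : R) :
  compact K -> {within K, continuous w} -> continuous b -> (forall x, K x -> 0 <= b x) ->
  (forall x, K x -> b x = 0 -> `|w x| <= A) -> 0 < e ->
  exists2 t : R, 0 < t & forall x, K x -> b x < t -> `|w x| <= A + e.
Proof.
move=> cK cw cb b0 wA e0.
have cov := (compact_near_coveringP K).1 cK R (0 : R)^'+
  (fun t x => K x -> b x < t -> `|w x| <= A + e) _.
have : \forall t \near (0 : R)^'+, K `<=` (fun x => K x -> b x < t -> `|w x| <= A + e).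
  apply: cov => x Kx; have [bx|bx] := eqVneq (b x) 0.
    have [t t0 ht] := (within_continuousP _ _).1 cw x e Kx e0.
    exists (disk x t, setT) => /=.
      by split; [apply/nbhs_diskP; exists t|exact: filterT].
    move=> [y s] /= [yx _] Ky _.
    have := ht y Ky yx; have := wA x Kx bx.
    rewrite -[w y](subrK (w x)) => h1 h2; apply: le_trans (ler_normD _ _) _.
    by move: h1 h2; rewrite subrK; move: (`|_|) (`|_|) => p q; lra.
  have bx0 : 0 < b x by rewrite lt_def bx b0.
  have bx2 : 0 < b x / 2 by rewrite divr_gt0.
  exists ([set y | b x / 2 < b y], [set t | t < b x / 2]) => /=.
    split; last by exact: nbhs_right_lt.
    apply: (@open_nbhs_nbhs _ x); split; last by rewrite /= gtr_pMr// invf_lt1// ltr1n.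
    apply: (@open_comp _ _ b [set s | b x / 2 < s]); last exact: open_gt.
    by move=> y _; exact: cb.
  by move=> [y t] /= [h1 h2] _ h3; have := lt_trans (lt_trans h1 h3) h2; rewrite ltxx.
move=> H; have [t [ht t0]] := filter_ex (filterI H (nbhs_right_gt 0)).
by exists t => // x Kx; exact: ht.
Qed.

Section IntegralLimit.
Context {R : realType}.
Variables (E : set (plane R)) (M : R).
Hypotheses (oE : open E) (EM : forall x, E x -> enorm x <= M).

Lemma Rintegral_limit_le (f : plane R -> R) (f_ : nat -> plane R -> R) (K : R) :
  bcont E f -> (forall m, bcont E (f_ m)) ->
  (forall m x, E x -> `|f_ m x| <= f x) ->
  (forall x, E x -> \forall m \near \oo, f_ m x = f x) ->
  (\forall m \near \oo, \int[area R]_(x in E) f_ m x <= K) ->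
  \int[area R]_(x in E) f x <= K.
Proof.
move=> bf bf_ fle fE hK.
have mE : measurable (E : set (mplane R)) := open_measurable2 oE.
have if_ m := bcont_integ oE EM (bf_ m); have if0 := bcont_integ oE EM bf.
have H := @dominated_cvg _ (mplane R) R (area R) E mE (fun m => EFin \o f_ m) (EFin \o f) (EFin \o f)
  (fun m => measurable_int _ (if_ m)) _ _ if0 _.
have {}H : (\int[area R]_(x in E) (EFin \o f_ m) x)%E @[m --> \oo] --> (\int[area R]_(x in E) (EFin \o f) x)%E.
  apply: H => //.
  - move=> x Ex; apply: (cvg_trans _ (cvg_cst ((f x)%:E) (F := \oo))).
    by apply: near_eq_cvg; apply: filterS (fE x Ex) => m h /=; rewrite h.
rewrite -lee_fin /Rintegral fineK; last exact: integrable_fin_num.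
apply: (cvge_to_le H) => //.
apply: filterS hK => m; rewrite -lee_fin /Rintegral fineK//.
exact: integrable_fin_num (if_ m).
Qed.

End IntegralLimit.

Section Dirichlet.
Context {R : realType} {n : nat}.
Variables (z : 'I_n.+1 -> plane R) (r : 'I_n.+1 -> R) (d M : R) (E : set (plane R)).
Hypotheses (d0 : 0 < d) (oE : open E) (EM : forall x, E x -> enorm x <= M).
Hypotheses (gE : forall x, E x <-> forall k, 0 < bdk z r k x)
  (rd : forall k, d <= r k)
  (bsum : forall i j y, i != j -> d <= bdk z r i y + bdk z r j y).
Variable u : plane R -> R.
Hypotheses (hu : harm E u) (bu : bcont E u) (bpu : forall i : bool, bcont E (pd i u)).
Variable S : R.
Hypotheses (S0 : 0 <= S) (hflux : forall e, 0 < e -> exists2 t : R, 0 < t &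
  forall k x, E x -> bdk z r k x < t -> `|radial (z k) u x| <= r k * (S + e)).

(** The limit of [energy_le] along shells shrinking to the circles: [eta] becomes 1 at each point of
    [E], and the bound on the flux tends to [S]. *)
Lemma dirichlet_le (l : R) : 0 < l ->
  \int[area R]_(y in E) gsq u y <=
    S * (l * (416 * \sum_(k < n.+1) r k) + l^-1 * \int[area R]_(y in E) hen d u y).
Proof.
move=> l0; set K := l * _ + _.
have rk k : 0 < r k by exact: lt_le_trans (rd k).
have K0 : 0 <= K.
  have n0 : 0 <= 416 :> R by rewrite ler0n.
  apply: addr_ge0; apply: mulr_ge0; try by rewrite ?invr_ge0 ltW.
    by apply: (mulr_ge0 n0); apply: sumr_ge0 => k _; exact: ltW.
  apply: Rintegral_ge0 => y _; apply: addr_ge0.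
    by apply: mulr_ge0; [apply: divr_ge0 => //; exact: ltW|exact: sqr_ge0].
  apply: mulr_ge0; first by apply: mulr_ge0 => //; exact: ltW.
  by apply: addr_ge0; exact: sqr_ge0.
apply/ler_addgt0Pr => e e0.
pose e' := e / (K + 1).
have K1 : 0 < K + 1 by apply: ltr_wpDl.
have e'0 : 0 < e' by rewrite divr_gt0.
have [t t0 ht] := hflux e'0.
have b1 := bcont_gsq bpu.
have a1 : 0 < d ^+ 2 / 16 by rewrite divr_gt0// exprn_gt0.
(* The first factor grants the smallness condition [16 * e <= d ^+ 2] for every [m]. *)
pose s m : R := d ^+ 2 / 16 * m.+1%:R^-1.
have s0 m : 0 < s m by rewrite mulr_gt0// invr_gt0.
have s16 m : 16 * s m <= d ^+ 2.
  have : s m <= d ^+ 2 / 16 by rewrite /s ger_pMr// invf_le1// ler1n.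
  lra.
apply: (@le_trans _ _ ((S + e') * K)); last first.
  rewrite mulrDl lerD2l /e' mulrAC ler_pdivrMr// ler_wpM2l ?(ltW e0)//.
  by rewrite lerDl.
have sm (a : R) : 0 < a -> \forall m \near \oo, s m < a.
  move=> a0; have q0 : 0 < a / (d ^+ 2 / 16) by rewrite divr_gt0.
  have := @near_infty_natSinv_lt R (PosNum q0).
  by apply: filterS => m /=; rewrite ltr_pdivlMr// mulrC.
apply: (Rintegral_limit_le oE EM b1 (f_ := fun m y => eta z r (s m) y * gsq u y)).
- by move=> m; apply: bcontM => //; exact: bcont_eta.
- move=> m x Ex.
  have g0 : 0 <= gsq u x by apply: addr_ge0; exact: sqr_ge0.
  have /andP[h1 h2] := eta_bounds d0 rd bsum (s0 m) (s16 m) x.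
  by rewrite ger0_norm ?mulr_ge0// ler_piMl.
- move=> x Ex.
  have : \forall m \near \oo, forall k, 2 * s m <= sdef z r k x.
    apply: (@filter_forall _ _ (fun k m => 2 * s m <= sdef z r k x) \oo _) => k.
    have h : 0 < sdef z r k x / 2 by rewrite divr_gt0// (sdef_gt0 d0 gE rd).
    by apply: filterS (sm _ h) => m; lra.
  apply: filterS => m hm; rewrite /eta big1 ?subr0 ?mul1r// => k _.
  by rewrite cut_eq1 ?subrr.
have a2 : 0 < d * t / 2 by rewrite divr_gt0// mulr_gt0.
apply: filterS (sm _ a2) => m h2.
apply: (energy_le d0 oE EM gE rd bsum (s0 m) _ hu bu bpu _ l0).
- exact: s16.
- by apply: addr_ge0 => //; exact: ltW.
move=> k x Ex /andP[_ hs]; apply: ht => //.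
rewrite ltNge; apply/negP => hb.
have : r k * t <= sdef z r k x.
  rewrite sdefE mulrC; apply: ler_pM => //; [exact: ltW|exact: ltW|].
  by rewrite lerDr enorm_ge0.
have : d * t <= r k * t by rewrite ler_wpM2r// ltW.
by move: hs h2; lra.
Qed.

End Dirichlet.

(** * Bound on the integral of [|u|] through the Poincare constant *)

Section NeumannProblem.
Context {R : realType} {n : nat}.
Variables (z : 'I_n.+1 -> plane R) (r : 'I_n.+1 -> R) (d : R).
Hypotheses (n1 : (1 <= n)%N) (d0 : 0 < d) (hr : forall i, i != ord0 -> d <= r i).
Hypothesis hin : forall i, i != ord0 -> disk (z i) (r i + d) `<=` disk (z ord0) (r ord0).
Hypothesis hsep : forall i j, i != ord0 -> j != ord0 -> i != j ->
  ((2 * d)%:E <= setdist (closure (disk (z i) (r i))) (closure (disk (z j) (r j))))%E.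
Variables (g u : plane R -> R) (G : plane R -> plane R).
Local Notation E := (holed_disk z r).
Hypotheses (cu : Ck 2 E u) (lu : forall x, E x -> laplacian u x = 0)
  (cuc : {within closure E, continuous u}) (cG : {within closure E, continuous G})
  (GE : forall x, E x -> G x = grad u x)
  (Gg : forall k x, circle (z k) (r k) x -> dot (G x) (outer_normal (z k) (r k) x) = g x).

Let rd := radius_ge n1 d0 hr hin.
Let oE : open E. Proof. by exact: holed_disk_open d0 hr. Qed.
Let M := enorm (z ord0) + r ord0.
Let EM x : E x -> enorm x <= M.
Proof. by move=> Ex; apply: (holed_disk_bounded d0 hr); exact: subset_closure. Qed.
Let mE : measurable (E : set (mplane R)) := open_measurable2 oE.
Let gE := holed_diskP z d0 hr.
Let bsum i j y := @bdk_sum R n z r d d0 hr hin hsep i j y.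
Let rk k : 0 < r k. Proof. exact: lt_le_trans (rd k). Qed.
Let hu : harm E u. Proof. by split. Qed.
Let cE : compact (closure E). Proof. by exact: closure_holed_disk_compact d0 hr. Qed.

Lemma neumann_bcont : bcont E u.
Proof.
split; first by move=> x Ex; exact: Ck_continuous cu Ex.
have [C _ hC] := compact_bounded_fun cE cuc.
by exists C => x Ex; apply: hC; exact: subset_closure.
Qed.

Let cGi (i : bool) : {within closure E, continuous (fun x => co i (G x))}.
Proof.
move=> x; case: i.
  by apply: (continuous_comp (f := G : subspace (closure E) -> _) (g := snd)); [exact: cG|exact: cvg_snd].
by apply: (continuous_comp (f := G : subspace (closure E) -> _) (g := fst)); [exact: cG|exact: cvg_fst].
Qed.

Lemma neumann_grad_bcont (i : bool) : bcont E (pd i u).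
Proof.
split; first by move=> x Ex; exact: Ck_continuous (Ck_pd i cu) Ex.
have [C _ hC] := compact_bounded_fun cE (@cGi i).
exists C => x Ex; have := hC x (subset_closure Ex); rewrite GE//.
by case: i {hC}.
Qed.

Variable S : R.
Hypotheses (S0 : 0 <= S) (gS : forall k x, circle (z k) (r k) x -> `|g x| <= S).

Lemma neumann_flux e : 0 < e -> exists2 t : R, 0 < t &
  forall k x, E x -> bdk z r k x < t -> `|radial (z k) u x| <= r k * (S + e).
Proof.
move=> e0.
pose w k x := dot (x - z k) (G x).
have H k : \forall t \near (0 : R)^'+, forall x, E x -> bdk z r k x < t -> `|radial (z k) u x| <= r k * (S + e).
  have cw : {within closure E, continuous (w k)}.
    have cc (i : bool) : {within closure E, continuous (fun x => co i x - co i (z k))}.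
      apply: continuous_subspaceT => x; apply: cvgB; last exact: cvg_cst.
      exact: Ck_continuous (@Ck_co R 0 setT i) Logic.I.
    have c1 : {within closure E, continuous (fun x => (G x).1)} := @cGi false.
    have c2 : {within closure E, continuous (fun x => (G x).2)} := @cGi true.
    move=> x; apply: cvgD; apply: cvgM.
    - exact: (cc false).
    - exact: c1.
    - exact: (cc true).
    - exact: c2.
  have b0 x : closure E x -> 0 <= bdk z r k x by move=> cx; exact: (closure_holed_disk d0 hr cx).
  have cb : continuous (bdk z r k) by move=> x; apply: bdist_continuous; exact: sideP.
  have wA x : closure E x -> bdk z r k x = 0 -> `|w k x| <= r k * S.
    move=> cx bx; have hx : circle (z k) (r k) x.
      move: bx; rewrite /bdk /bdist /circle /=; case: (@sideP R n k) => ->.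
        by rewrite mul1r => /subr0_eq.
      by rewrite mulN1r opprB => /subr0_eq.
    have -> : w k x = r k * dot (G x) (outer_normal (z k) (r k) x).
      by rewrite /w /dot /outer_normal /=; field; rewrite gt_eqF.
    by rewrite (Gg hx) normrM gtr0_norm// ler_pM2l//; exact: gS hx.
  have re0 : 0 < r k * e by rewrite mulr_gt0.
  have [t t0 ht] := near_zero_set_bound cE cw cb b0 wA re0.
  near=> s => x Ex hs.
  rewrite radialE -GE// mulrDr; apply: ht; first exact: subset_closure.
  by apply: (lt_trans hs); near: s; exact: nbhs_right_lt.
have H' : \forall t \near (0 : R)^'+, forall k x, E x -> bdk z r k x < t -> `|radial (z k) u x| <= r k * (S + e).
  exact: filter_forall H.
have [t [ht t0]] := filter_ex (filterI H' (nbhs_right_gt 0)).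
by exists t => // k x Ex; exact: ht.
Unshelve. all: by end_near. Qed.

Lemma neumann_dirichlet_le (l : R) : 0 < l ->
  \int[area R]_(y in E) gsq u y <=
    S * (l * (416 * \sum_(k < n.+1) r k) + l^-1 * \int[area R]_(y in E) hen d u y).
Proof.
apply: (dirichlet_le d0 oE EM gE rd bsum hu neumann_bcont neumann_grad_bcont S0 neumann_flux).
Qed.

(** The factor [s] is included because a competitor in the Poincare constant must have a gradient of
    norm 1. *)
Lemma weak_gradient_u (s : R) : weak_gradient E (fun x => s * u x) (fun x => s *: grad u x).
Proof.
move=> psi [cpsi cK KE].
set K := closure [set x | psi x != 0] in cK KE.
have clK : closed K by exact: closed_closure.
have p0 x : ~ K x -> psi x = 0.
  by move=> nK; apply/eqP/negPn/negP => h; apply: nK; exact: subset_closure.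
have cps m : Ck m E psi by exact: Ck_subset (cpsi m).
have cu1 : Ck 1 E u by exact: Ck_pred.
have KM x : K x -> enorm x <= M by move=> /KE /EM.
have mK := closed_measurable2 clK.
have ic f : (forall x, E x -> {for x, continuous f}) -> integ K f.
  exact: (integ_continuous oE clK KE KM).
have main (i : bool) : \int[area R]_(x in E) (s * u x * pd i psi x) =
    - \int[area R]_(x in E) (s * pd i u x * psi x).
  have z0 := integral_pd_eq0_on i oE clK KE KM (CkM oE cu1 (cps 1%N)) (f := fun x => u x * psi x) _.
  have {}z0 : \int[area R]_(x in K) pd i (fun x => u x * psi x) x = 0.
    by apply: z0 => x nK; rewrite p0// mulr0.
  have i1 : integ K (fun x => s * u x * pd i psi x).
    apply: ic => x Ex; apply: cvgM; last exact: Ck_continuous (Ck_pd i (cps 1%N)) Ex.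
    by apply: cvgM; [exact: cvg_cst|exact: Ck_continuous cu Ex].
  have i2 : integ K (fun x => s * pd i u x * psi x).
    apply: ic => x Ex; apply: cvgM; last exact: Ck_continuous (cps 0%N) Ex.
    by apply: cvgM; [exact: cvg_cst|exact: Ck_continuous (Ck_pd i cu) Ex].
  have i3 : integ K (fun x => pd i (fun x => u x * psi x) x).
    apply: ic => x Ex; exact: Ck_continuous (Ck_pd i (CkM oE cu1 (cps 1%N))) Ex.
  rewrite (@Rintegral_off _ _ K _ mK KE); last first.
    by move=> x _ nK; rewrite (pd_eq0_off i clK p0 nK) mulr0.
  rewrite (@Rintegral_off _ _ K (fun x => s * pd i u x * psi x) mK KE); last first.
    by move=> x _ nK; rewrite p0// mulr0.
  apply/eqP; rewrite -addr_eq0 -(RintegralD mK i1 i2).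
  apply/eqP; rewrite -[RHS](mulr0 s) -z0 -(RintegralZl _ mK i3).
  apply: eq_Rintegral => x /set_mem /KE Ex.
  have d1 := Ck_derivable (i := i) cu1 Ex; have d2 := Ck_derivable (i := i) (cps 1%N) Ex.
  rewrite (pdM d1 d2); move: (pd i u x) (pd i psi x) => p q; ring.
by split; [exact: (main false)|exact: (main true)].
Qed.

Let D2 := \int[area R]_(y in E) gsq u y.
Let U2 := \int[area R]_(y in E) u y ^+ 2.

Let b_u2 : bcont E (fun y => u y ^+ 2).
Proof. exact: (bcontM neumann_bcont neumann_bcont). Qed.

Let b_gsq : bcont E (gsq u) := bcont_gsq neumann_grad_bcont.

Let L2normE (f : plane R -> R) (W : Type) (N : W -> R) (F : plane R -> W) (s : R) :
  bcont E f -> (forall x, N (F x) ^+ 2 = s * f x) ->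
  L2norm E N F = ((s * \int[area R]_(y in E) f y) `^ 2^-1)%:E.
Proof.
move=> bf NF; rewrite /L2norm.
have ib := bcont_integ oE EM (bcontM (bcont_cst E s) bf).
have -> : (\int[area R]_(x in E) (N (F x) ^+ 2)%:E)%E = (\int[area R]_(x in E) (s * f x))%:E.
  rewrite /Rintegral fineK; last exact: integrable_fin_num ib.
  by apply: eq_integral => x _; rewrite NF.
rewrite (RintegralZl _ mE (bcont_integ oE EM bf)).
by rewrite poweR_EFin.
Qed.

Let mb f : bcont E f -> measurable_fun (E : set (mplane R)) (f : mplane R -> R).
Proof. by move=> [cf _]; exact: open_continuous_measurable2. Qed.

Hypothesis mean0 : \int[area R]_(y in E) u y = 0.

Let U20 : 0 <= U2.
Proof. by apply: Rintegral_ge0 => y _; exact: sqr_ge0. Qed.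

(** The solution divided by the norm of its gradient is a competitor; its mean vanishes by
    [mean0]. *)
Lemma poincare_ge : 0 < D2 -> ((Num.sqrt (D2^-1 * U2))%:E <= poincare E)%E.
Proof.
move=> D0; pose s := (Num.sqrt D2)^-1.
have s0 : 0 < s by rewrite invr_gt0 sqrtr_gt0.
have s2 : s ^+ 2 = D2^-1 by rewrite exprVn sqr_sqrtr// ltW.
apply: ereal_sup_ubound; exists (fun x => s * u x), (fun x => s *: grad u x).
have bsu := bcontM (bcont_cst E s) neumann_bcont.
have bsp (i : bool) := bcontM (bcont_cst E s) (neumann_grad_bcont i).
have L f : bcont E f -> L2 E f.
  move=> bf; split; first exact: mb.
  rewrite (L2normE (s := 1) (bcontM bf bf)) ?ltry// => x.
  by rewrite mul1r real_normK ?num_real// expr2.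
split.
- split; [exact: L|exact: (L _ (bsp false))|exact: (L _ (bsp true))|exact: weak_gradient_u].
- rewrite (L2normE (s := s ^+ 2) b_gsq) => [|x].
    by rewrite s2 mulVf ?gt_eqF// powR1.
  by rewrite enormZ exprMn sqr_enorm real_normK ?num_real.
- by rewrite (RintegralZl _ mE (bcont_integ oE EM neumann_bcont)) mean0 mulr0.
rewrite (L2normE (s := s ^+ 2) b_u2) => [|x].
  by rewrite s2 powR12_sqrt// mulr_ge0// invr_ge0 ltW.
by rewrite real_normK ?num_real// exprMn.
Qed.

Lemma poincare_L2_le (CP : R) : 0 < D2 -> (poincare E <= CP%:E)%E -> 0 <= CP /\ U2 <= CP ^+ 2 * D2.
Proof.
move=> D0 hP; have := le_trans (poincare_ge D0) hP; rewrite lee_fin => h.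
have CP0 : 0 <= CP by apply: le_trans h; exact: sqrtr_ge0.
split => //; have X0 : 0 <= D2^-1 * U2 by rewrite mulr_ge0// invr_ge0 ltW.
rewrite -ler_pdivrMr// mulrC -(sqr_sqrtr X0).
by rewrite lerXn2r ?nnegrE ?sqrtr_ge0.
Qed.

(** The integral of [hen] is at most [54 * (T * s) ^+ 2] and the sum of the radii at most
    [2 * N ^+ 2], so [l = T * s / N] balances the two terms: [416 * 2 + 54 = 886]. The left side is
    [s ^+ 2], the right side linear in [s], and one factor [s] cancels. *)
Let dirichlet_bound (CP : R) : 0 < D2 -> (poincare E <= CP%:E)%E ->
  Num.sqrt D2 <= 886 * S * (CP / Num.sqrt d + Num.sqrt d) * (Num.sqrt n%:R * Num.sqrt (r ord0)).
Proof.
move=> D0 hP; have [CP0 hU] := poincare_L2_le D0 hP.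
set s := Num.sqrt D2; have s0 : 0 < s by rewrite sqrtr_gt0.
have s2 : s ^+ 2 = D2 by rewrite sqr_sqrtr// ltW.
set q := Num.sqrt d; have q0 : 0 < q by rewrite sqrtr_gt0.
have q2 : q ^+ 2 = d by rewrite sqr_sqrtr// ltW.
set T := CP / q + q; have T0 : 0 < T.
  by apply: ltr_wpDl => //; rewrite divr_ge0// ltW.
set N := Num.sqrt n%:R * Num.sqrt (r ord0).
have N0 : 0 < N by rewrite mulr_gt0// sqrtr_gt0 ?ltr0n// rk.
have N2 : N ^+ 2 = n%:R * r ord0 by rewrite exprMn !sqr_sqrtr// ltW// rk.
(* There are [n.+1 <= 2 * n] circles, each of radius at most [r ord0]. *)
have sumr2 : \sum_(k < n.+1) r k <= 2 * N ^+ 2.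
  apply: (@le_trans _ _ (\sum_(k < n.+1) r ord0)).
    by apply: ler_sum => k _; exact: (radius_le d0 hr hin).
  rewrite sumr_const card_ord N2 -[leLHS]mulr_natl mulrA; apply: ler_wpM2r; first exact: ltW.
  by rewrite -natrM ler_nat mul2n -addnn -addn1 leq_add2l.
have hI : \int[area R]_(y in E) hen d u y <= 54 * (T * s) ^+ 2.
  have i1 := bcont_integ oE EM b_u2; have i2 := bcont_integ oE EM b_gsq.
  rewrite /hen (RintegralD mE (integZ (54 / d) mE i1) (integZ (2 * d) mE i2)).
  rewrite (RintegralZl _ mE i1) (RintegralZl _ mE i2) -/U2 -/D2.
  have d1 : 0 <= 54 / d by rewrite divr_ge0// ltW.
  apply: le_trans (lerD (ler_wpM2l d1 hU) (lexx _)) _.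
  have -> : 54 / d * (CP ^+ 2 * D2) + 2 * d * D2 = (54 * (CP / q) ^+ 2 + 2 * q ^+ 2) * D2.
    by rewrite -q2; field; rewrite gt_eqF.
  have -> : (T * s) ^+ 2 = T ^+ 2 * D2 by rewrite exprMn s2.
  rewrite mulrA; apply: ler_wpM2r; first exact: ltW.
  rewrite /T.
  have p0 : 0 <= CP / q by rewrite divr_ge0// ltW.
  have := mulr_ge0 p0 (ltW q0); have := sqr_ge0 q; move: (CP / q) => p a b.
  have -> : (p + q) ^+ 2 = p ^+ 2 + 2 * (p * q) + q ^+ 2 by ring.
  by move: (p ^+ 2) (p * q) (q ^+ 2) a b => a1 a2 a3; lra.
pose l := T * s / N; have l0 : 0 < l by rewrite divr_gt0// mulr_gt0.
have H := neumann_dirichlet_le l0.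
have H2 : D2 <= S * (l * (416 * (2 * N ^+ 2)) + l^-1 * (54 * (T * s) ^+ 2)).
  apply: (le_trans H); apply: ler_wpM2l => //; apply: lerD.
    by apply: ler_wpM2l; [exact: ltW|exact: (ler_wpM2l (ler0n _ 416) sumr2)].
  by apply: ler_wpM2l => //; rewrite invr_ge0 ltW.
have H3 : S * (l * (416 * (2 * N ^+ 2)) + l^-1 * (54 * (T * s) ^+ 2)) = 886 * S * T * N * s.
  by rewrite /l; field; rewrite !gt_eqF.
by rewrite H3 -s2 expr2 ler_pM2r// in H2.
Qed.

(** Cauchy-Schwarz, from [|u| <= l / 2 + u ^+ 2 / (2 * l)] with the optimal [l]. This [l]
    degenerates when the area or [U2] is 0, hence the two cases settled by a limit in [l]. *)
Lemma neumann_L1_le (CP : R) : 0 < D2 -> (poincare E <= CP%:E)%E ->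
  \int[area R]_(y in E) `|u y| <=
    886 * (Num.sqrt (fine (area R E)) * CP * (CP / Num.sqrt d + Num.sqrt d) *
      (Num.sqrt n%:R * Num.sqrt (r ord0))) * S.
Proof.
move=> D0 hP; have [CP0 hU] := poincare_L2_le D0 hP.
have b := dirichlet_bound D0 hP.
set a := fine (area R E); have a0 : 0 <= a by rewrite fine_ge0.
have U2s : Num.sqrt U2 <= CP * Num.sqrt D2.
  rewrite -(ger0_norm CP0) -sqrtr_sqr -sqrtrM ?sqr_ge0// ler_sqrt//.
  by rewrite mulr_ge0 ?sqr_ge0// ltW.
suff : \int[area R]_(y in E) `|u y| <= Num.sqrt a * Num.sqrt U2.
  move=> h; apply: (le_trans h); apply: le_trans (ler_wpM2l (sqrtr_ge0 a) U2s) _.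
  apply: le_trans (ler_wpM2l (sqrtr_ge0 a) (ler_wpM2l CP0 b)) _.
  by rewrite le_eqVlt; apply/orP; left; apply/eqP; ring.
have bn := bcont_norm neumann_bcont.
have aE : (area R E = a%:E)%E.
  by rewrite /a fineK// ge0_fin_numE//; apply: (area_bounded_lty mE EM).
have cs (l : R) : 0 < l -> \int[area R]_(y in E) `|u y| <= (l * a + U2 / l) / 2.
  move=> l0; have i1 := bcont_integ oE EM b_u2; have i0 := bcont_integ oE EM (bcont_cst E (l / 2)).
  apply: (@le_trans _ _ (\int[area R]_(y in E) (l / 2 + (2 * l)^-1 * u y ^+ 2))).
    apply: le_Rintegral => //; [exact: (bcont_integ oE EM bn)| |].
      by apply: integD => //; exact: integZ.
    move=> y _; have -> : l / 2 + (2 * l)^-1 * u y ^+ 2 = `|u y| + (l - `|u y|) ^+ 2 / (2 * l).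
      by rewrite -(real_normK (num_real (u y))); field; rewrite gt_eqF.
    by rewrite lerDl divr_ge0 ?sqr_ge0// mulr_ge0// ltW.
  rewrite (RintegralD mE i0 (integZ _ mE i1)) (RintegralZl _ mE i1).
  rewrite Rintegral_cst// -/U2 -/a le_eqVlt; apply/orP; left; apply/eqP; field.
  by rewrite gt_eqF.
have [a00|a00] := eqVneq a 0.
  rewrite a00 sqrtr0 mul0r; apply/ler_addgt0Pr => e e0; rewrite add0r.
  have l0 : 0 < (U2 + 1) / e by rewrite divr_gt0// ltr_wpDl.
  apply: le_trans (cs _ l0) _; rewrite a00 mulr0 add0r ler_pdivrMr// invf_div mulrA ler_pdivrMr ?ltr_wpDl//.
  by rewrite mulrC; move: e0 U20; move: U2 => X; nra.
have [U00|U00] := eqVneq U2 0.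
  rewrite U00 sqrtr0 mulr0; apply/ler_addgt0Pr => e e0; rewrite add0r.
  have a1 : 0 < a by rewrite lt_def a00.
  have l0 : 0 < e / a by rewrite divr_gt0.
  by apply: le_trans (cs _ l0) _; rewrite U00 mul0r addr0 divfK//; move: e0; lra.
have a1 : 0 < Num.sqrt a by rewrite sqrtr_gt0 lt_def a00.
have u1 : 0 < Num.sqrt U2 by rewrite sqrtr_gt0 lt_def U00.
have l0 : 0 < Num.sqrt U2 / Num.sqrt a by rewrite divr_gt0.
apply: le_trans (cs _ l0) _.
have aux (p q A U : R) : 0 < p -> 0 < q -> p ^+ 2 = A -> q ^+ 2 = U ->
    (q / p * A + U / (q / p)) / 2 = p * q.
  by move=> p0 q0 <- <-; field; rewrite !gt_eqF.
by rewrite (aux _ _ _ _ a1 u1 (sqr_sqrtr a0) (sqr_sqrtr U20)).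
Qed.

End NeumannProblem.

(** * Estimates up to the boundary *)

Section InteriorDerivatives.
Context {R : realType}.
Variables (E : set (plane R)) (u : plane R -> R) (d : R).
Hypotheses (oE : open E) (hu : harm E u) (d0 : 0 < d) (iu : integ E u).

(** With [rho = d / 128] in [harm_grad_le], each derivative costs [kI / d]. The last factor of [kJ]
    is that of [harm_le_L1] at the same radius; the cube serves derivatives of all orders up to 3,
    as [1 <= kI]. *)
Definition kI : R := 2048 * 128.
Definition kJ : R := kI ^+ 3 * (16 * 128 ^+ 2).

Definition jet_bound : R := kJ * d ^- 3 * \int[area R]_(y in E) `|u y|.

Lemma kI_ge1 : 1 <= kI.
Proof.
rewrite -[1]mulr1; apply: ler_pM => //; by rewrite ler1n.
Qed.

Lemma jet_bound_ge0 : 0 <= jet_bound.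
Proof.
apply: mulr_ge0; last exact: Rintegral_ge0.
apply: mulr_ge0; last by rewrite invr_ge0 exprn_ge0// ltW.
apply: mulr_ge0; first by rewrite exprn_ge0// (le_trans _ kI_ge1).
by rewrite mulr_ge0// exprn_ge0.
Qed.

Lemma interior_jet x : (forall y, enorm (y - x) <= d / 32 -> E y) ->
  [/\ forall i, `|pd i u x| <= jet_bound,
      forall i j, `|pd j (pd i u) x| <= jet_bound / d &
      forall i j k, `|pd k (pd j (pd i u)) x| <= jet_bound / d / d].
Proof.
(* Four radii fit in [d / 32]: one for the mean value and one for each of three derivatives. *)
move=> hx; pose rho := d / 128.
have rho0 : 0 < rho by rewrite divr_gt0.
have rE : 4 * rho = d / 32 by rewrite /rho; field.
set I := \int[area R]_(y in E) `|u y|.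
have I0 : 0 <= I by exact: Rintegral_ge0.
pose A := 16 * 128 ^+ 2 * d ^- 2 * I.
have A0 : 0 <= A.
  apply: mulr_ge0 => //; apply: mulr_ge0; last by rewrite invr_ge0 exprn_ge0// ltW.
  by rewrite mulr_ge0// exprn_ge0.
have near y w (s : R) : enorm (y - x) <= s -> enorm (w - y) <= rho -> enorm (w - x) <= s + rho.
  by move=> h1 h2; have := enorm_sub w y x; move: h1 h2; lra.
have sub (s : R) y : s + rho <= 4 * rho -> enorm (y - x) <= s -> [set w | enorm (w - y) <= rho] `<=` E.
  by move=> hs hy w /= hw; apply: hx; rewrite -rE; apply: le_trans hs; exact: near hy hw.
have h0 y : enorm (y - x) <= 3 * rho -> `|u y| <= A.
  move=> hy; have hs : 3 * rho + rho <= 4 * rho by move: rho0; lra.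
  apply: le_trans (harm_le_L1 oE hu rho0 (sub _ _ hs hy)) _.
  have -> : A = 16 * rho ^- 2 * I by rewrite /A /rho; field; rewrite gt_eqF.
  apply: ler_wpM2l; first by rewrite mulr_ge0// invr_ge0 exprn_ge0// ltW.
  apply: le_Rintegral_subset (sub _ _ hs hy) _ _ => //.
  - by apply: closed_measurable2; exact: cdisk_closed.
  - exact: open_measurable2.
  - exact: integ_norm.
have stepE (B : R) : 2048 * rho^-1 * B = kI * (B / d).
  by rewrite /rho /kI; field; rewrite gt_eqF.
have h1 i y : enorm (y - x) <= 2 * rho -> `|pd i u y| <= kI * (A / d).
  move=> hy; have hs : 2 * rho + rho <= 4 * rho by move: rho0; lra.
  rewrite -stepE; apply: (harm_grad_le oE hu rho0 (sub _ _ hs hy)) => w hw; apply: h0.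
  by apply: (le_trans (near _ _ _ hy hw)); move: rho0; lra.
have h2 i j y : enorm (y - x) <= rho -> `|pd j (pd i u) y| <= kI * (kI * (A / d) / d).
  move=> hy; have hs : rho + rho <= 4 * rho by move: rho0; lra.
  rewrite -stepE; apply: (harm_grad_le oE (harm_pd i oE hu) rho0 (sub _ _ hs hy)) => w hw; apply: h1.
  by apply: (le_trans (near _ _ _ hy hw)); move: rho0; lra.
have h3 i j k : `|pd k (pd j (pd i u)) x| <= kI * (kI * (kI * (A / d) / d) / d).
  have x0 : enorm (x - x) <= 0 by rewrite subrr enorm0.
  have hs : 0 + rho <= 4 * rho by move: rho0; lra.
  rewrite -stepE; apply: (harm_grad_le oE (harm_pd j oE (harm_pd i oE hu)) rho0 (sub _ _ hs x0)) => w hw.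
  by apply: h2.
have k1 := kI_ge1; have k0 : 0 <= kI by exact: le_trans k1.
have JE : jet_bound = kI * (kI * (kI * (A / d))).
  by rewrite /jet_bound /kJ -/I /A; field; rewrite gt_eqF.
have Ad : 0 <= A / d by rewrite divr_ge0// ltW.
have up (B : R) : 0 <= B -> B <= kI * B by move=> B0; exact: ler_peMl.
have kA : 0 <= kI * (A / d) by exact: mulr_ge0.
have kkA : 0 <= kI * (kI * (A / d)) by exact: mulr_ge0.
have xr : enorm (x - x) <= rho by rewrite subrr enorm0 ltW.
split.
- move=> i; apply: (le_trans (h1 i x _)); first by apply: (le_trans xr); move: rho0; lra.
  by rewrite JE; apply: (le_trans (up _ kA)); exact: up.
- move=> i j; apply: (le_trans (h2 i j x xr)); rewrite JE.
  have -> : kI * (kI * (kI * (A / d))) / d = kI * (kI * (kI * (A / d)) / d) by ring.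
  apply: ler_wpM2l => //; have di : 0 <= d^-1 by rewrite invr_ge0 ltW.
  exact: (ler_wpM2r di (up _ kA)).
move=> i j k; apply: (le_trans (h3 i j k)); rewrite JE.
by rewrite le_eqVlt; apply/orP; left; apply/eqP; ring.
Qed.

End InteriorDerivatives.

(** * From collars and interior to the whole domain *)

Section Glue.
Context {R : realType} {n : nat}.
Variables (a : R) (z : 'I_n.+1 -> plane R) (r : 'I_n.+1 -> R) (d : R) (E : set (plane R)).
Hypotheses (a01 : 0 < a < 1) (d0 : 0 < d) (oE : open E).
Hypothesis gE : forall x, E x <-> forall k, 0 < bdk z r k x.

(** Three cases. For points more than [d / 64] apart the sup bound is enough, with [128 = 2 * 64].
    Close points with [x] near a circle both lie in its collar of width [d / 8]. Otherwise the
    gradient bound applies along the segment. *)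
Lemma holder_glue (F : plane R -> R) (B L Y : R) : 0 <= B -> 0 <= L -> 0 <= Y ->
  Ck 1 E F -> (forall x, E x -> `|F x| <= B) ->
  (forall k x y, collar (z k) (r k) (side k) (d / 8) x -> collar (z k) (r k) (side k) (d / 8) y ->
     x != y -> enorm (x - y) <= d / 64 -> `|F x - F y| <= L * enorm (x - y) `^ a) ->
  (forall i x, (forall k, d / 32 < bdk z r k x) -> `|pd i F x| <= Y) ->
  forall x y, E x -> E y -> x != y ->
    `|F x - F y| <= (128 * (B * d `^ (- a)) + L + 2 * (Y * d * d `^ (- a))) * enorm (x - y) `^ a.
Proof.
move=> B0 L0 Y0 cF FB FL FY x y Ex Ey xy.
have /andP[a0 a1] := a01.
have h0 : 0 < enorm (x - y) by rewrite enorm_gt0 subr_eq0.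
set h := enorm (x - y) in h0 *.
have P0 : 0 <= h `^ a by exact: powR_ge0.
have Q0 : 0 <= d `^ (- a) by exact: powR_ge0.
have t1 : 0 <= 128 * (B * d `^ (- a)) * h `^ a by rewrite !mulr_ge0.
have t2 : 0 <= L * h `^ a by rewrite mulr_ge0.
have t3 : 0 <= 2 * (Y * d * d `^ (- a)) * h `^ a.
  by apply: mulr_ge0 => //; apply: mulr_ge0 => //; apply: mulr_ge0 => //; rewrite mulr_ge0// ltW.
rewrite !mulrDl.
have [hd|hd] := leP h (d / 64); last first.
  apply: (@le_trans _ _ (128 * (B * d `^ (- a)) * h `^ a)); last by move: t2 t3; lra.
  apply: (@le_trans _ _ (2 * B)).
    apply: le_trans (ler_normB _ _) _; rewrite mulr_natl mulr2n.
    by apply: lerD; exact: FB.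
  have d64 : (d / 64) `^ a <= h `^ a.
    by apply: ge0_ler_powR; rewrite ?nnegrE ?(ltW a0) ?(ltW h0) ?divr_ge0 ?(ltW d0) ?(ltW hd).
  have e64 : 64^-1 <= (64^-1 : R) `^ a.
    have -> : (64^-1 : R) `^ a = ((64 : R) `^ a)^-1.
      by rewrite -powR_inv1// -powRrM mulN1r powRN.
    rewrite lef_pV2 ?posrE ?powR_gt0//; apply: ler1_powR; [by rewrite ler1n|exact: ltW].
  have dd : d `^ (- a) * d `^ a = 1 by rewrite -powRD ?addNr ?powRr0// (lt0r_neq0 d0) implybT.
  apply: (@le_trans _ _ (128 * (B * d `^ (- a)) * (d `^ a * 64^-1))); last first.
    apply: ler_wpM2l; first by rewrite !mulr_ge0.
    apply: le_trans d64; rewrite powRM ?invr_ge0 ?(ltW d0)//.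
    by apply: ler_wpM2l => //; exact: powR_ge0.
  have -> : 128 * (B * d `^ (- a)) * (d `^ a * 64^-1) = 2 * B * (d `^ (- a) * d `^ a) by field.
  by rewrite dd mulr1.
have lip k p q : `|bdk z r k p - bdk z r k q| <= enorm (p - q) by exact: bdist_lip (sideP k) p q.
have [[k hk]|hno] := pselect (exists k, bdk z r k x < d / 16).
  apply: (@le_trans _ _ (L * h `^ a)); last by move: t1 t3; lra.
  apply: (FL k) => //.
    rewrite /collar /= (gE x).1//=; apply: (lt_trans hk); move: d0; lra.
  rewrite /collar /= (gE y).1//=; have := lip k y x; rewrite enorm_sym -/h ler_norml => /andP[_].
  by rewrite -/(bdk z r k y); move: hk hd d0; lra.
apply: (@le_trans _ _ (2 * (Y * d * d `^ (- a)) * h `^ a)); last by move: t1 t2; lra.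
(* As [d / 16 - d / 64 > d / 32], the whole segment stays in the interior zone. *)
have far k : d / 16 <= bdk z r k x by rewrite leNgt; apply/negP => hk; apply: hno; exists k.
have hyx : enorm (y - x) = h by rewrite enorm_sym.
apply: (@le_trans _ _ (2 * Y * h)).
  rewrite distrC -[X in _ * X]hyx.
  have -> : F y = F (x + (y - x)) by congr F; rewrite addrC subrK.
  apply: (C1_segment oE cF) => s /andP[s0 s1].
  have deep k : d / 32 < bdk z r k (x + s *: (y - x)).
    have := lip k (x + s *: (y - x)) x; rewrite [x + _ - x]addrC addKr enormZ hyx (ger0_norm s0).
    rewrite ler_norml => /andP[hl _]; have := far k.
    have : s * h <= d / 64 by apply: le_trans hd; rewrite ler_piMl// ltW.
    by move: hl d0; lra.
  split; first by apply/gE => k; apply: lt_trans (deep k); rewrite divr_gt0.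
  by apply: grad_norm_le => i; apply: FY.
have hp : h = h `^ a * h `^ (1 - a).
  by rewrite -powRD ?subrKC ?powRr1 ?(ltW h0)// (lt0r_neq0 h0) implybT.
have hb : h `^ (1 - a) <= d * d `^ (- a).
  have -> : d * d `^ (- a) = d `^ (1 - a).
    by rewrite powRD ?powRr1 ?(ltW d0)// (lt0r_neq0 d0) implybT.
  apply: ge0_ler_powR; rewrite ?nnegrE ?subr_ge0 ?(ltW a1) ?(ltW h0) ?(ltW d0)//.
  by apply: (le_trans hd); move: d0; lra.
have -> : 2 * (Y * d * d `^ (- a)) * h `^ a = 2 * Y * (h `^ a * (d * d `^ (- a))) by ring.
rewrite {1}hp; apply: ler_wpM2l; first by rewrite mulr_ge0.
exact: ler_wpM2l.
Qed.

End Glue.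

Section LocalEstimates.
Context {R : realType} {n : nat}.
Variables (a : R) (z : 'I_n.+1 -> plane R) (r : 'I_n.+1 -> R) (d : R) (E : set (plane R)).
Hypotheses (a01 : 0 < a < 1) (d0 : 0 < d) (oE : open E).
Hypotheses (gE : forall x, E x <-> forall k, 0 < bdk z r k x)
  (rd : forall k, d <= r k)
  (bsum : forall i j y, i != j -> d <= bdk z r i y + bdk z r j y)
  (cclo : forall k x, ccollar (z k) (r k) (side k) (d / 2) x -> closure E x).
Variables (u g : plane R -> R) (G : plane R -> plane R) (J Sg Hg : R).
Hypotheses (J0 : 0 <= J) (Sg0 : 0 <= Sg) (Hg0 : 0 <= Hg).
Hypotheses (hu : harm E u) (cG : {within closure E, continuous G})
  (GE : forall x, E x -> G x = grad u x)
  (Gg : forall k x, circle (z k) (r k) x -> dot (G x) (outer_normal (z k) (r k) x) = g x).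
Hypotheses (gS : forall k x, circle (z k) (r k) x -> `|g x| <= Sg)
  (gH : forall k x y, circle (z k) (r k) x -> circle (z k) (r k) y ->
     `|g y - g x| <= Hg * enorm (y - x) `^ a).
Hypothesis jet : forall x, (forall k, d / 32 < bdk z r k x) ->
  [/\ forall i, `|pd i u x| <= J, forall i j, `|pd j (pd i u) x| <= J / d &
      forall i j k, `|pd k (pd j (pd i u)) x| <= J / d / d].

Let Q := J + Sg + Hg * d `^ a.

Let coE k y : collar (z k) (r k) (side k) d y -> E y.
Proof.
move=> /andP[h0 h1]; apply/gE => j; have [->//|jk] := eqVneq j k.
by have := bsum y jk; rewrite -/(bdk z r k y) in h1; lra.
Qed.

Let huk k : harm (collar (z k) (r k) (side k) d) u.
Proof. by apply: harm_sub hu => y; exact: coE. Qed.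

Let cGk k : {within ccollar (z k) (r k) (side k) (d / 2), continuous G}.
Proof. by apply: continuous_subspaceW cG => x; exact: cclo. Qed.

Let GEk k y : collar (z k) (r k) (side k) d y -> G y = grad u y.
Proof. by move=> /coE; exact: GE. Qed.

(** By [bsum], distance at most [d / 2] to one circle leaves at least [d / 2] to the others. The
    interior jet thus supplies the far data required in each collar. *)
Let deep k y : d / 8 <= bdk z r k y <= d / 2 -> forall j, d / 32 < bdk z r j y.
Proof.
move=> /andP[h1 h2] j; have [->|jk] := eqVneq j k; first by move: d0; lra.
by have := bsum y jk; move: d0; lra.
Qed.

Let J1 k (i : bool) y : d / 8 <= bdist (z k) (r k) (side k) y <= d / 2 -> `|pd i u y| <= J.
Proof. by move=> h; have [] := jet (deep h). Qed.

Let J2 k (i j : bool) y : d / 8 <= bdist (z k) (r k) (side k) y <= d / 2 -> `|pd j (pd i u) y| <= J / d.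
Proof. by move=> h; have [] := jet (deep h). Qed.

Let a0 : 0 < a. Proof. by case/andP: a01. Qed.

Let Q0 : 0 <= Q.
Proof. by rewrite !addr_ge0// mulr_ge0// powR_ge0. Qed.

Let JQ : J <= Q.
Proof. by rewrite /Q -addrA lerDl addr_ge0// mulr_ge0// powR_ge0. Qed.

Let kB1 : 1 <= kB a.
Proof.
apply: (@le_trans _ _ 3); first by rewrite ler1n.
rewrite /kB lerDl; apply: divr_ge0; last exact: ltW.
by apply: mulr_ge0 => //; exact: kA_ge0.
Qed.

Lemma pd_bound (i : bool) x : E x -> `|pd i u x| <= kB a * Q.
Proof.
move=> Ex; have [[k hk]|hno] := pselect (exists k, bdk z r k x < d / 8).
  apply: (collar_grad_bound a01 d0 (rd k) (sideP k) J0 Sg0 Hg0 (huk k) (@cGk k)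
    (GEk (k := k)) (Gg (k := k)) (gS (k := k)) (@gH k) (J1 (k := k))).
  by rewrite /collar /= ((gE x).1 Ex k) /=; apply: (lt_trans hk); move: d0; lra.
have dp k : d / 32 < bdk z r k x.
  have : d / 8 <= bdk z r k x by rewrite leNgt; apply/negP => hk; apply: hno; exists k.
  by move: d0; lra.
have [h _ _] := jet dp; apply: (le_trans (h i)); apply: (le_trans JQ).
exact: ler_peMl.
Qed.

Definition kK := 128 * kB a + kC a + 2.

Let dn : 0 <= d `^ (- a). Proof. exact: powR_ge0. Qed.

Let kC0 : 0 <= kC a.
Proof.
apply: mulr_ge0; first by rewrite addr_ge0// divr_ge0// ltW.
apply: mulr_ge0 => //; apply: addr_ge0; last exact: kB_ge0.
by apply: mulr_ge0 => //; exact: kA_ge0.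
Qed.

Lemma pd_holder (i : bool) x y : E x -> E y -> x != y ->
  `|pd i u x - pd i u y| <= kK * (Q * d `^ (- a)) * enorm (x - y) `^ a.
Proof.
move=> Ex Ey xy.
have B0 : 0 <= kB a * Q by rewrite mulr_ge0// (le_trans _ kB1).
have L0 : 0 <= kC a * (Q * d `^ (- a)) by rewrite mulr_ge0// mulr_ge0.
have Y0 : 0 <= J / d by rewrite divr_ge0// ltW.
have cF : Ck 1 E (pd i u) by apply: Ck_pd; case: hu.
have H := holder_glue a01 d0 oE gE B0 L0 Y0 cF (pd_bound i) _ _ Ex Ey xy.
have {}H := H _ _; apply: le_trans (H _ _) _.
- move=> k p q Cp Cq pq hpq.
  exact: (collar_grad_holder a01 d0 (rd k) (sideP k) J0 Sg0 Hg0 (huk k) (@cGk k)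
    (GEk (k := k)) (Gg (k := k)) (gS (k := k)) (@gH k) (J1 (k := k)) i Cp Cq pq hpq).
- by move=> j p dp; have [_ h _] := jet dp; exact: h.
apply: ler_wpM2r; first exact: powR_ge0.
have -> : J / d * d = J by rewrite divfK// gt_eqF.
have -> : kK * (Q * d `^ (- a)) = 128 * (kB a * Q * d `^ (- a)) + kC a * (Q * d `^ (- a)) + 2 * (Q * d `^ (- a)).
  by rewrite /kK; ring.
by rewrite lerD2l ler_pM2l//; apply: ler_wpM2r.
Qed.

Section SecondOrderEstimates.
Variables (dg : plane R -> R) (S1 H1 : R).
Hypotheses (S10 : 0 <= S1) (H10 : 0 <= H1).
Hypothesis hdg : forall k x, circle (z k) (r k) x ->
  is_derive (0 : R) (1 : R) (fun t : R => g (arclength (z k) (r k) x t)) (dg x).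
Hypotheses (hS1 : forall k x, circle (z k) (r k) x -> `|dg x| <= S1)
  (hH1 : forall k x y, circle (z k) (r k) x -> circle (z k) (r k) y ->
     `|dg y - dg x| <= H1 * enorm (y - x) `^ a).

Let P := Q / d + S1 + H1 * d `^ a.

Let P0 : 0 <= P.
Proof. by rewrite !addr_ge0// ?mulr_ge0// ?powR_ge0// invr_ge0 ltW. Qed.

Let JP : J / d <= P.
Proof.
have : J / d <= Q / d by apply: ler_wpM2r => //; rewrite invr_ge0 ltW.
by move=> h; apply: (le_trans h); rewrite /P -addrA lerDl addr_ge0// mulr_ge0// powR_ge0.
Qed.

Let kF1 : 1 <= kF a.
Proof.
have h : 0 <= kD a.
  apply: addr_ge0 => //; apply: divr_ge0; last exact: ltW.
  by apply: mulr_ge0 => //; exact: kA_ge0.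
have := kB1; rewrite /kF; move: (kB a) (kD a) h => p q; lra.
Qed.

Lemma pd2_bound (i j : bool) x : E x -> `|pd j (pd i u) x| <= kF a * P.
Proof.
move=> Ex; have [[k hk]|hno] := pselect (exists k, bdk z r k x < d / 8).
  apply: (collar_hess_bound a01 d0 (rd k) (sideP k) J0 Sg0 Hg0 (huk k) (@cGk k)
    (GEk (k := k)) (Gg (k := k)) (gS (k := k)) (@gH k) (J1 (k := k)) (J2 (k := k))
    S10 H10 (hdg (k := k)) (hS1 (k := k)) (@hH1 k)).
  by rewrite /collar /= ((gE x).1 Ex k) /=; apply: (lt_trans hk); move: d0; lra.
have dp k : d / 32 < bdk z r k x.
  have : d / 8 <= bdk z r k x by rewrite leNgt; apply/negP => hk; apply: hno; exists k.
  by move: d0; lra.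
have [_ h _] := jet dp; apply: (le_trans (h i j)); apply: (le_trans JP).
exact: ler_peMl.
Qed.

Definition kL := 128 * kF a + kH a + 2.

Let kH0 : 0 <= kH a.
Proof.
have hA := kA_ge0 a01; have hB := kB_ge0 a01.
have hD : 0 <= kD a.
  by apply: addr_ge0 => //; apply: divr_ge0; [apply: mulr_ge0|exact: ltW].
have hE : 0 <= kE a.
  by apply: mulr_ge0 => //; apply: addr_ge0 => //; apply: mulr_ge0.
have hF : 0 <= kF a by exact: le_trans kF1.
have hG : 0 <= kG a.
  apply: addr_ge0 => //; apply: mulr_ge0; last exact: addr_ge0.
  by rewrite divr_ge0// ltW.
apply: mulr_ge0; first by rewrite addr_ge0// divr_ge0// ltW.
by apply: mulr_ge0 => //; apply: addr_ge0 => //; exact: addr_ge0.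
Qed.

Lemma pd2_holder (i j : bool) x y : E x -> E y -> x != y ->
  `|pd j (pd i u) x - pd j (pd i u) y| <= kL * (P * d `^ (- a)) * enorm (x - y) `^ a.
Proof.
move=> Ex Ey xy.
have B0 : 0 <= kF a * P by rewrite mulr_ge0// (le_trans _ kF1).
have L0 : 0 <= kH a * (P * d `^ (- a)) by rewrite mulr_ge0// mulr_ge0.
have Y0 : 0 <= J / d / d by rewrite divr_ge0 ?divr_ge0// ltW.
have cF : Ck 1 E (pd j (pd i u)) by apply: Ck_pd; apply: Ck_pd; apply: harm_Ck.
have H := holder_glue a01 d0 oE gE B0 L0 Y0 cF (pd2_bound i j) _ _ Ex Ey xy.
have {}H := H _ _; apply: le_trans (H _ _) _.
- move=> k p q Cp Cq pq hpq.
  exact: (collar_hess_holder a01 d0 (rd k) (sideP k) J0 Sg0 Hg0 (huk k) (@cGk k)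
    (GEk (k := k)) (Gg (k := k)) (gS (k := k)) (@gH k) (J1 (k := k)) (J2 (k := k))
    S10 H10 (hdg (k := k)) (hS1 (k := k)) (@hH1 k) i j Cp Cq pq hpq).
- by move=> l p dp; have [_ _ h] := jet dp; exact: h.
apply: ler_wpM2r; first exact: powR_ge0.
have -> : J / d / d * d = J / d by rewrite divfK// gt_eqF.
have -> : kL * (P * d `^ (- a)) = 128 * (kF a * P * d `^ (- a)) + kH a * (P * d `^ (- a)) + 2 * (P * d `^ (- a)).
  by rewrite /kL; ring.
by rewrite lerD2l ler_pM2l//; apply: ler_wpM2r.
Qed.

End SecondOrderEstimates.
End LocalEstimates.

(** * Right-hand sides in the extended reals *)

Section ExtendedReals.
Context {R : realType}.
Local Open Scope ereal_scope.

(** The quantities [B], [S], [H] may be [+oo], and [+oo * 0 = 0]. With [0 < S] and positive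
    coefficients any infinite one makes the right side [+oo], so only finite values have to be
    checked. *)
Lemma le_rhs2 (L B S H : \bar R) (c p q k : R) : (0 < c)%R -> (0 < p)%R -> (0 < q)%R -> (0 < k)%R ->
  0 <= B -> 0 < S -> 0 <= H ->
  (forall b t h, B = b%:E -> S = t%:E -> H = h%:E ->
     L <= (c * (p + b * q) * t + k * h)%:E) ->
  L <= c%:E * (p%:E + B * q%:E) * S + k%:E * H.
Proof.
move=> c0 p0 q0 k0 B0 S0 H0 hL.
have h1 : 0 <= B * q%:E by apply: mule_ge0 => //; rewrite lee_fin ltW.
have h2 : 0 < p%:E + B * q%:E by apply: (@lt_le_trans _ _ p%:E); [rewrite lte_fin|rewrite leeDl].
have X0 : 0 < c%:E * (p%:E + B * q%:E) by apply: mule_gt0.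
have k0' : 0 < k%:E by rewrite lte_fin.
have T0 : 0 <= k%:E * H by apply: mule_ge0 => //; exact: ltW.
have Y0 : 0 <= c%:E * (p%:E + B * q%:E) * S by apply: mule_ge0; exact: ltW.
have topl (x y : \bar R) : x = +oo -> 0 <= y -> L <= x + y.
  by move=> -> y0; rewrite addye ?leey//; case: y y0.
have topr (x y : \bar R) : y = +oo -> 0 <= x -> L <= x + y.
  by move=> -> x0; rewrite addey ?leey//; case: x x0.
case: H H0 hL T0 => [h _ hL T0|_ _ _|//]; last first.
  by apply: topr => //; rewrite gt0_muley.
case: S S0 hL Y0 => [t t0 hL Y0|_ _ _|//]; last first.
  by apply: topl => //; rewrite gt0_muley.
case: B B0 hL {h1 h2 X0 Y0} => [b _ hL|_ _|//]; last first.
  apply: topl => //; rewrite gt0_mulye ?lte_fin// addey// gt0_muley ?lte_fin//.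
  by rewrite gt0_mulye.
exact: hL.
Qed.

Lemma le_rhs4 (L B S H S' H' : \bar R) (c p q k k' k'' : R) :
  (0 < c)%R -> (0 < p)%R -> (0 < q)%R -> (0 < k)%R -> (0 < k')%R -> (0 < k'')%R ->
  0 <= B -> 0 < S -> 0 <= H -> 0 <= S' -> 0 <= H' ->
  (forall b t h t' h', B = b%:E -> S = t%:E -> H = h%:E -> S' = t'%:E -> H' = h'%:E ->
     L <= (c * (p + b * q) * t + k * h + k' * t' + k'' * h')%:E) ->
  L <= c%:E * (p%:E + B * q%:E) * S + k%:E * H + k'%:E * S' + k''%:E * H'.
Proof.
move=> c0 p0 q0 k0 k'0 k''0 B0 S0 H0 S'0 H'0 hL.
have X0 : 0 <= c%:E * (p%:E + B * q%:E) * S + k%:E * H.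
  apply: adde_ge0; apply: mule_ge0 => //; try by rewrite lee_fin ltW.
  - apply: mule_ge0; first by rewrite lee_fin ltW.
    by apply: adde_ge0; [rewrite lee_fin ltW|apply: mule_ge0 => //; rewrite lee_fin ltW].
  - exact: ltW.
have topr (x y : \bar R) : y = +oo -> 0 <= x -> L <= x + y.
  by move=> -> x0; rewrite addey ?leey//; case: x x0.
have T3 : 0 <= k'%:E * S' by apply: mule_ge0 => //; rewrite lee_fin ltW.
case: H' H'0 hL => [h' _ hL|_ _|//]; last first.
  by apply: topr; [rewrite gt0_muley// lte_fin|exact: adde_ge0].
case: S' S'0 hL T3 => [t' _ hL T3|_ _ _|//]; last first.
  have -> : k'%:E * +oo = +oo by rewrite gt0_muley// lte_fin.
  rewrite addey; last by case: (_ + _) X0.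
  by rewrite addye ?leey.
(* The two last terms, now finite, are moved to the left to reach the form of [le_rhs2]. *)
rewrite -addeA -!EFinM -EFinD addeC -leeBlDl//.
apply: le_rhs2 => // b t h Bb St Hh; rewrite leeBlDl//.
apply: (le_trans (hL _ _ _ _ _ Bb St Hh erefl erefl)).
by rewrite -EFinD lee_fin; lra.
Qed.

End ExtendedReals.

Section Seminorms.
Context {R : realType}.

Lemma supnorm_le {W : zmodType} (N : W -> R) A f (K : R) :
  (forall x, A x -> N (f x) <= K) -> (supnorm N A f <= K%:E)%E.
Proof. by move=> h; apply: ge_ereal_sup => _ [x Ax ->]; rewrite lee_fin; exact: h. Qed.

Lemma le_supnorm {W : zmodType} (N : W -> R) A (f : plane R -> W) x :
  A x -> ((N (f x))%:E <= supnorm N A f)%E.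
Proof. by move=> Ax; apply: ereal_sup_ubound; exists x. Qed.

Lemma holder_le {W : zmodType} (N : W -> R) (a : R) A f (K : R) :
  (forall x y, A x -> A y -> x != y -> N (f x - f y) <= K * enorm (x - y) `^ a) ->
  (holder N a A f <= K%:E)%E.
Proof.
move=> h; apply: ge_ereal_sup => _ [x [y [Ax Ay /eqP xy ->]]]; rewrite lee_fin.
by rewrite ler_pdivrMr ?powR_gt0 ?enorm_gt0 ?subr_eq0//; exact: h.
Qed.

Lemma le_holder (a : R) A (f : plane R -> R) (K : R) x y : a != 0 ->
  holder Num.norm a A f = K%:E -> A x -> A y -> `|f y - f x| <= K * enorm (y - x) `^ a.
Proof.
move=> a0 hK Ax Ay; have [->|xy] := eqVneq y x.
  by rewrite !subrr normr0 enorm0 powR0// mulr0.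
rewrite -ler_pdivrMr ?powR_gt0 ?enorm_gt0 ?subr_eq0// -lee_fin -hK.
by apply: ereal_sup_ubound; exists y, x; split => //; exact/eqP.
Qed.

Lemma hnorm_le_abs (M : plane R * plane R) :
  hnorm M <= `|M.1.1| + `|M.1.2| + (`|M.2.1| + `|M.2.2|).
Proof.
apply: (@le_trans _ _ (enorm M.1 + enorm M.2)); last by apply: lerD; exact: enorm_le_abs.
have e1 := enorm_ge0 M.1; have e2 := enorm_ge0 M.2.
rewrite /hnorm -[leRHS]ger0_norm ?addr_ge0// -sqrtr_sqr ler_sqrt ?sqr_ge0//.
by rewrite sqrrD -addrA lerD2l lerDr mulrn_wge0// mulr_ge0.
Qed.

End Seminorms.

(** * The final constant and the powers of [d] and [r0] *)

Section FinalConstants.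
Context {R : realType}.
Variables (a d r0 : R).
Hypotheses (a01 : 0 < a < 1) (d0 : 0 < d) (dr : d <= r0).

(** Joins the constant of [jet_bound] with that of [neumann_L1_le]. In [kFinal] the 2 and the 4 come
    from passing from components to the gradient and to the Hessian; a sum of nonnegative terms
    dominates all four estimates at once. *)
Definition kM : R := kJ * 886.
Definition kFinal : R := kM * (2 * kB a + 2 * kK a + 4 * kF a + 4 * kL a).

Let a0 : 0 < a. Proof. by case/andP: a01. Qed.
Let r00 : 0 < r0. Proof. exact: lt_le_trans dr. Qed.

Lemma kM_ge1 : 1 <= kM.
Proof.
rewrite /kM /kJ; have k1 := @kI_ge1 R.
have h1 : 1 <= (@kI R) ^+ 3 by exact: exprn_ege1.
have h2 : (1 : R) <= 16 * 128 ^+ 2.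
  have e1 : (1 : R) <= 128 ^+ 2 by apply: exprn_ege1; rewrite ler1n.
  have e2 : (1 : R) <= 16 by rewrite ler1n.
  by have := ler_pM ler01 ler01 e2 e1; rewrite mulr1.
have h3 : (1 : R) <= 886 by rewrite ler1n.
have h12 := ler_pM ler01 ler01 h1 h2; rewrite mulr1 in h12.
by have := ler_pM ler01 ler01 h12 h3; rewrite mulr1.
Qed.

Lemma constants_ge0 : [/\ 0 <= kB a, 0 <= kK a, 0 <= kF a & 0 <= kL a].
Proof.
have hA := kA_ge0 a01; have hB := kB_ge0 a01.
have q : 0 <= 16 / a + 4 by rewrite addr_ge0// divr_ge0// ltW.
have hC : 0 <= kC a.
  by apply: mulr_ge0 => //; apply: mulr_ge0 => //; apply: addr_ge0 => //; apply: mulr_ge0.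
have hD : 0 <= kD a.
  by apply: addr_ge0 => //; apply: divr_ge0; [apply: mulr_ge0|exact: ltW].
have hE : 0 <= kE a.
  by apply: mulr_ge0 => //; apply: addr_ge0 => //; apply: mulr_ge0.
have hF : 0 <= kF a by apply: mulr_ge0 => //; exact: addr_ge0.
have hG : 0 <= kG a.
  apply: addr_ge0 => //; apply: mulr_ge0; last exact: addr_ge0.
  by rewrite divr_ge0// ltW.
have hH : 0 <= kH a.
  by apply: mulr_ge0 => //; apply: mulr_ge0 => //; apply: addr_ge0 => //; exact: addr_ge0.
split => //; apply: addr_ge0 => //; apply: addr_ge0 => //; exact: mulr_ge0.
Qed.

Lemma kFinal_ge : [/\ 2 * kB a * kM <= kFinal, 2 * kK a * kM <= kFinal,
  4 * kF a * kM <= kFinal & 4 * kL a * kM <= kFinal].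
Proof.
have [hB hK hF hL] := constants_ge0.
have m0 : 0 <= kM by exact: le_trans kM_ge1.
have mB := mulr_ge0 hB m0; have mK := mulr_ge0 hK m0.
have mF := mulr_ge0 hF m0; have mL := mulr_ge0 hL m0.
have -> : kFinal = 2 * (kB a * kM) + 2 * (kK a * kM) + 4 * (kF a * kM) + 4 * (kL a * kM).
  by rewrite /kFinal; ring.
rewrite -(mulrA 2 (kB a)) -(mulrA 2 (kK a)) -(mulrA 4 (kF a)) -(mulrA 4 (kL a)).
move: (kB a * kM) (kK a * kM) (kF a * kM) (kL a * kM) mB mK mF mL => p q s t *.
by split; lra.
Qed.

Lemma kFinal_gt0 : 0 < kFinal.
Proof.
have [_ hK hF hL] := constants_ge0.
have m1 := kM_ge1; have m0 : 0 < kM by exact: lt_le_trans m1.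
apply: mulr_gt0 => //.
have hB : 0 < kB a.
  apply: (@lt_le_trans _ _ 3) => //; rewrite /kB lerDl; apply: divr_ge0; last exact: ltW.
  by apply: mulr_ge0 => //; exact: kA_ge0.
by move: (kB a) (kK a) (kF a) (kL a) hB hK hF hL => p q s t; lra.
Qed.

Variables (b t h t' h' J : R).
Hypotheses (b0 : 0 <= b) (t0 : 0 <= t) (h0 : 0 <= h) (t'0 : 0 <= t') (h'0 : 0 <= h').
Hypothesis hJ : J <= kM * (d ^- 3 * b * t).

Let Q := J + t + h * d `^ a.
Let P := Q / d + t' + h' * d `^ a.

Let m1 := kM_ge1.
Let m0 : 0 <= kM. Proof. exact: le_trans m1. Qed.
Let up (x : R) : 0 <= x -> x <= kM * x. Proof. by move=> x0; exact: ler_peMl. Qed.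
Let da0 : 0 <= d `^ a. Proof. exact: powR_ge0. Qed.
Let dna0 : 0 <= d `^ (- a). Proof. exact: powR_ge0. Qed.
Let dI (m : nat) : 0 <= d ^- m. Proof. by rewrite invr_ge0 exprn_ge0// ltW. Qed.
Let dv : 0 <= d^-1. Proof. by rewrite invr_ge0 ltW. Qed.

Let Q_le : Q <= kM * ((1 + b * d ^- 3) * t + d `^ a * h).
Proof.
have -> : kM * ((1 + b * d ^- 3) * t + d `^ a * h) = kM * (d ^- 3 * b * t) + kM * t + kM * (h * d `^ a).
  by ring.
apply: lerD; first by apply: lerD => //; exact: up.
by apply: up; exact: mulr_ge0.
Qed.

Let P_le : P <= kM * ((d^-1 + b * d ^- 4) * t + d^-1 * d `^ a * h + t' + d `^ a * h').
Proof.
have h1 := ler_wpM2r dv Q_le.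
have -> : kM * ((d^-1 + b * d ^- 4) * t + d^-1 * d `^ a * h + t' + d `^ a * h') =
   kM * ((1 + b * d ^- 3) * t + d `^ a * h) / d + kM * t' + kM * (h' * d `^ a).
  by field; rewrite gt_eqF.
apply: lerD; first by apply: lerD => //; exact: up.
by apply: up; exact: mulr_ge0.
Qed.

Let r0a : d `^ a <= r0 `^ a.
Proof. by apply: ge0_ler_powR; rewrite ?nnegrE ?(ltW a0) ?(ltW d0) ?(ltW r00). Qed.

Let dS (m : nat) : d ^- m = d ^- m.+1 * d.
Proof. by rewrite exprSr invfM mulrAC -mulrA mulfV ?mulr1// gt_eqF. Qed.

(** This and [dr2] are the exchanges, by [d <= r0], that produce the powers next to [B]: [r0] in the
    sup bounds and [r0 ^ (2 - a)] in the Hoelder bounds. *)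
Let dr1 (m : nat) : d ^- m <= d ^- m.+1 * r0.
Proof. by rewrite dS; exact: ler_wpM2l. Qed.

Let dr2 (m : nat) : d ^- m * d `^ (- a) <= d ^- m.+2 * r0 `^ (2 - a).
Proof.
rewrite dS dS -!mulrA; apply: ler_wpM2l => //.
have -> : d * (d * d `^ (- a)) = d `^ (2 - a).
  rewrite powRD; last by rewrite (lt0r_neq0 d0) implybT.
  by rewrite mulrA -expr2 powR_mulrn// ltW.
apply: ge0_ler_powR; rewrite ?nnegrE ?(ltW d0) ?(ltW r00)// subr_ge0.
by case/andP: a01 => _ /ltW h1; apply: (le_trans h1); rewrite ler1n.
Qed.

Let two_step (c X : R) : 0 <= c -> c * kM <= kFinal -> 0 <= X -> forall Y, Y <= kM * X -> c * Y <= kFinal * X.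
Proof.
move=> c0 hc X0 Y hY; apply: (le_trans (ler_wpM2l c0 hY)); rewrite mulrA.
exact: ler_wpM2r.
Qed.

Lemma final_grad : 2 * kB a * Q <= kFinal * (1 + b * (d ^- 4 * r0)) * t + kFinal * r0 `^ a * h.
Proof.
have [hB _ _ _] := constants_ge0; have [cB _ _ _] := kFinal_ge.
have F0 := ltW kFinal_gt0.
apply: (le_trans (two_step _ cB _ Q_le)); first by rewrite mulr_ge0.
  by rewrite addr_ge0// mulr_ge0// addr_ge0// mulr_ge0.
have -> : kFinal * (1 + b * (d ^- 4 * r0)) * t + kFinal * r0 `^ a * h =
  kFinal * ((1 + b * (d ^- 4 * r0)) * t + r0 `^ a * h) by ring.
apply: (ler_wpM2l F0); apply: lerD; apply: ler_wpM2r => //.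
by rewrite lerD2l; apply: ler_wpM2l.
Qed.

Lemma final_grad_holder : 2 * kK a * (Q * d `^ (- a)) <=
  kFinal * (d `^ (- a) + b * (d ^- 5 * r0 `^ (2 - a))) * t + kFinal * h.
Proof.
have [_ hK _ _] := constants_ge0; have [_ cK _ _] := kFinal_ge.
have F0 := ltW kFinal_gt0.
have pda : d `^ a * d `^ (- a) = 1.
  by rewrite -powRD ?subrr ?powRr0// (lt0r_neq0 d0) implybT.
have hQ : Q * d `^ (- a) <= kM * ((d `^ (- a) + b * (d ^- 3 * d `^ (- a))) * t + h).
  apply: (le_trans (ler_wpM2r dna0 Q_le)).
  have -> : kM * ((1 + b * d ^- 3) * t + d `^ a * h) * d `^ (- a) =
    kM * ((d `^ (- a) + b * (d ^- 3 * d `^ (- a))) * t + (d `^ a * d `^ (- a)) * h) by ring.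
  by rewrite pda mul1r.
have X0 : 0 <= (d `^ (- a) + b * (d ^- 3 * d `^ (- a))) * t + h.
  by rewrite addr_ge0// mulr_ge0// addr_ge0// mulr_ge0// mulr_ge0.
apply: (le_trans (two_step _ cK X0 hQ)); first by rewrite mulr_ge0.
have -> : kFinal * (d `^ (- a) + b * (d ^- 5 * r0 `^ (2 - a))) * t + kFinal * h =
  kFinal * ((d `^ (- a) + b * (d ^- 5 * r0 `^ (2 - a))) * t + h) by ring.
apply: (ler_wpM2l F0); rewrite lerD2r; apply: ler_wpM2r => //.
by rewrite lerD2l; apply: ler_wpM2l.
Qed.

Let dam1 : d^-1 * d `^ a = d `^ (a - 1).
Proof. by rewrite powRD ?powR_inv1 ?(ltW d0) 1?mulrC// (lt0r_neq0 d0) implybT. Qed.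

Let P_le2 : P <= kM * ((d^-1 + b * d ^- 4) * t + d `^ (a - 1) * h + t' + d `^ a * h').
Proof. by rewrite -dam1. Qed.

Lemma final_hess : 4 * kF a * P <=
  kFinal * (d^-1 + b * (d ^- 5 * r0)) * t + kFinal * d `^ (a - 1) * h + kFinal * t' + kFinal * r0 `^ a * h'.
Proof.
have [_ _ hF _] := constants_ge0; have [_ _ cF _] := kFinal_ge.
have F0 := ltW kFinal_gt0; have da1 : 0 <= d `^ (a - 1) by exact: powR_ge0.
have X0 : 0 <= (d^-1 + b * d ^- 4) * t + d `^ (a - 1) * h + t' + d `^ a * h'.
  by rewrite addr_ge0 ?mulr_ge0// addr_ge0// addr_ge0 ?mulr_ge0// addr_ge0 ?mulr_ge0.
apply: (le_trans (two_step _ cF X0 P_le2)); first by rewrite mulr_ge0.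
have -> : kFinal * (d^-1 + b * (d ^- 5 * r0)) * t + kFinal * d `^ (a - 1) * h + kFinal * t' +
    kFinal * r0 `^ a * h' =
  kFinal * ((d^-1 + b * (d ^- 5 * r0)) * t + d `^ (a - 1) * h + t' + r0 `^ a * h') by ring.
apply: (ler_wpM2l F0); apply: lerD; last by apply: ler_wpM2r.
rewrite lerD2r lerD2r; apply: ler_wpM2r => //.
by rewrite lerD2l; apply: ler_wpM2l.
Qed.

Lemma final_hess_holder : 4 * kL a * (P * d `^ (- a)) <=
  kFinal * (d `^ (- 1 - a) + b * (d ^- 6 * r0 `^ (2 - a))) * t + kFinal * d^-1 * h +
  kFinal * d `^ (- a) * t' + kFinal * h'.
Proof.
have [_ _ _ hL] := constants_ge0; have [_ _ _ cL] := kFinal_ge.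
have F0 := ltW kFinal_gt0.
have pda : d `^ a * d `^ (- a) = 1.
  by rewrite -powRD ?subrr ?powRr0// (lt0r_neq0 d0) implybT.
have pd1 : d `^ (- 1 - a) = d^-1 * d `^ (- a).
  by rewrite powRD ?powR_inv1 ?(ltW d0)// (lt0r_neq0 d0) implybT.
have e1 : d `^ (- 1 - a) + b * (d ^- 4 * d `^ (- a)) = (d^-1 + b * d ^- 4) * d `^ (- a).
  by rewrite pd1; ring.
have hP : P * d `^ (- a) <= kM * ((d `^ (- 1 - a) + b * (d ^- 4 * d `^ (- a))) * t + d^-1 * h + d `^ (- a) * t' + h').
  apply: (le_trans (ler_wpM2r dna0 P_le)); rewrite e1.
  have -> : kM * ((d^-1 + b * d ^- 4) * t + d^-1 * d `^ a * h + t' + d `^ a * h') * d `^ (- a) =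
    kM * ((d^-1 + b * d ^- 4) * d `^ (- a) * t + d^-1 * (d `^ a * d `^ (- a)) * h + d `^ (- a) * t' +
      (d `^ a * d `^ (- a)) * h') by ring.
  by rewrite pda mulr1 mul1r.
have X0 : 0 <= (d `^ (- 1 - a) + b * (d ^- 4 * d `^ (- a))) * t + d^-1 * h + d `^ (- a) * t' + h'.
  rewrite e1 addr_ge0// addr_ge0 ?mulr_ge0// addr_ge0 ?mulr_ge0// addr_ge0 ?mulr_ge0//.
apply: (le_trans (two_step _ cL X0 hP)); first by rewrite mulr_ge0.
have -> : kFinal * (d `^ (- 1 - a) + b * (d ^- 6 * r0 `^ (2 - a))) * t + kFinal * d^-1 * h +
    kFinal * d `^ (- a) * t' + kFinal * h' =
  kFinal * ((d `^ (- 1 - a) + b * (d ^- 6 * r0 `^ (2 - a))) * t + d^-1 * h + d `^ (- a) * t' + h') by ring.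
apply: (ler_wpM2l F0); rewrite lerD2r lerD2r lerD2r; apply: ler_wpM2r => //.
by rewrite lerD2l; apply: ler_wpM2l.
Qed.

End FinalConstants.

(** * Solutions with vanishing gradient *)

Section VanishingGradient.
Context {R : realType}.
Variables (E : set (plane R)) (u : plane R -> R).
Hypothesis oE : open E.

Lemma integral_gsq_gt0 (M : R) x : (forall y, E y -> enorm y <= M) ->
  (forall i : bool, bcont E (pd i u)) -> E x -> gsq u x != 0 ->
  0 < \int[area R]_(y in E) gsq u y.
Proof.
move=> EM bp Ex gx.
have g0 y : 0 <= gsq u y by rewrite addr_ge0// sqr_ge0.
have gx0 : 0 < gsq u x by rewrite lt_def gx g0.
have bg := bcont_gsq bp.
have h2 : 0 < gsq u x / 2 by rewrite divr_gt0.
have [s s0 hs] := near_continuous (bg.1 x Ex) h2.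
have [t t0 ht] := disk_nbhs oE Ex.
pose q := Num.min s t; have q0 : 0 < q by rewrite lt_min s0.
have qE : disk x q `<=` E.
  by move=> y; rewrite /disk /= => hy; apply: ht; rewrite /disk /= (lt_le_trans hy)// /q ge_min lexx orbT.
have mq : measurable (disk x q : set (mplane R)) by apply: open_measurable2; exact: disk_open.
have mE := open_measurable2 oE.
have iE := bcont_integ oE EM bg.
apply: (@lt_le_trans _ _ (\int[area R]_(y in disk x q) gsq u y)); last first.
  exact: (le_Rintegral_subset mq mE qE iE (fun y _ => g0 y)).
have aq : (area R (disk x q) < +oo)%E.
  by apply: le_lt_trans (area_disk_le _ q0) _; rewrite ltry.
have af : q ^+ 2 <= fine (area R (disk x q)).
  rewrite -lee_fin fineK; first exact: area_disk_ge.
  by rewrite ge0_fin_numE// measure_ge0.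
apply: (@lt_le_trans _ _ (\int[area R]_(y in disk x q) (gsq u x / 2))).
  by rewrite Rintegral_cst// mulr_gt0// (lt_le_trans _ af)// exprn_gt0.
apply: le_Rintegral => //.
- by apply: (integ_subset mq mE qE); apply: (bcont_integ oE EM); exact: bcont_cst.
- exact: integ_subset qE iE.
move=> y; rewrite /disk /= => hy.
have := hs y; rewrite /disk /= => /(_ _)/wrap[]; first by rewrite (lt_le_trans hy)// /q ge_min lexx.
by rewrite ler_norml => /andP[h _]; move: h; lra.
Qed.

Hypothesis gu0 : forall x, E x -> gsq u x = 0.

Lemma gsq0_pd (i : bool) x : E x -> pd i u x = 0.
Proof.
move=> /gu0 /eqP; rewrite paddr_eq0 ?sqr_ge0// !sqrf_eq0 => /andP[/eqP h1 /eqP h2].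
by case: i.
Qed.

Lemma gsq0_pd2 (i j : bool) x : E x -> pd j (pd i u) x = 0.
Proof.
move=> Ex; have h y : E y -> pd i u y = (fun=> 0) y by exact: gsq0_pd.
by apply: etrans (pd_ext j oE h Ex) _; rewrite /pd derive_cst.
Qed.

End VanishingGradient.

Section Bounds.
Context {R : realType}.
Variables (E : set (plane R)) (u : plane R -> R) (a : R).

Lemma grad_le (B : R) x : (forall i : bool, `|pd i u x| <= B) -> enorm (grad u x) <= 2 * B.
Proof. exact: grad_norm_le. Qed.

Lemma grad_sub_le (B : R) x y : (forall i : bool, `|pd i u x - pd i u y| <= B) ->
  enorm (grad u x - grad u y) <= 2 * B.
Proof.
move=> h; apply: le_trans (enorm_le_abs _) _; rewrite mulr_natl mulr2n.
by apply: lerD; [exact: (h false)|exact: (h true)].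
Qed.

Lemma hess_le (B : R) x : (forall i j : bool, `|pd j (pd i u) x| <= B) ->
  hnorm (hess u x) <= 4 * B.
Proof.
move=> h; apply: le_trans (hnorm_le_abs _) _.
have -> : 4 * B = B + B + (B + B) by ring.
by apply: lerD; apply: lerD; [exact: (h false false)|exact: (h false true)|exact: (h true false)|exact: (h true true)].
Qed.

Lemma hess_sub_le (B : R) x y : (forall i j : bool, `|pd j (pd i u) x - pd j (pd i u) y| <= B) ->
  hnorm (hess u x - hess u y) <= 4 * B.
Proof.
move=> h; apply: le_trans (hnorm_le_abs _) _.
have -> : 4 * B = B + B + (B + B) by ring.
by apply: lerD; apply: lerD; [exact: (h false false)|exact: (h false true)|exact: (h true false)|exact: (h true true)].
Qed.

End Bounds.

(** * Sign and finiteness of [B] *)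

Section PoincareConstant.
Context {R : realType}.
Variables (E : set (plane R)) (n : nat) (d r0 a : R).
Hypotheses (d0 : 0 < d) (r00 : 0 < r0).
Hypotheses (aE : area R E = a%:E) (a0 : 0 <= a).

Lemma Bconst_fin (p : R) : poincare E = p%:E ->
  Bconst E n d r0 = (Num.sqrt a * p * (p / Num.sqrt d + Num.sqrt d) * (Num.sqrt n%:R * Num.sqrt r0))%:E.
Proof.
move=> pE; rewrite /Bconst pE; set A := area _ _; rewrite (_ : A = a%:E)// poweR_EFin.
rewrite powRN !powR12_sqrt ?ler0n ?(ltW d0) ?(ltW r00)//.
by rewrite (mulrC p (Num.sqrt d)^-1).
Qed.

(** A supremum over the empty set is [-oo], which happens if no competitor exists; otherwise it is a
    supremum of norms. *)
Lemma poincare_cases : poincare E = -oo%E \/ (0 <= poincare E)%E.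
Proof.
rewrite /poincare; set S := [set e | _].
have [->|/set0P[e Se]] := eqVneq S set0; first by left; exact: ereal_sup0.
right; apply: le_trans (ereal_sup_ubound Se).
by case: Se => phi [G [_ _ _ ->]]; exact: poweR_ge0.
Qed.

Lemma Bconst_ge0 : (0 <= Bconst E n d r0)%E.
Proof.
rewrite /Bconst; set A := area _ _; rewrite (_ : A = a%:E)// poweR_EFin.
apply: mule_ge0; last by rewrite lee_fin mulr_ge0// powR_ge0.
have p1 := powR_ge0 a 2^-1; have p2 := powR_gt0 (- 2^-1) d0; have p3 := powR_ge0 d 2^-1.
case: poincare_cases => [->|x0]; last first.
  apply: mule_ge0; first by apply: mule_ge0 => //; rewrite lee_fin.
  apply: adde_ge0; last by rewrite lee_fin.
  by apply: mule_ge0 => //; rewrite lee_fin ltW.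
(* When [poincare E] is [-oo], the product is 0 if the area vanishes and otherwise contains two
   factors [-oo], whose product is [+oo]. *)
move: p1; rewrite le_eqVlt => /predU1P[<-|p1]; first by rewrite !mul0e.
have -> : ((a `^ 2^-1)%:E * -oo)%E = -oo%E by rewrite gt0_muleNy// lte_fin.
have -> : ((d `^ (- 2^-1))%:E * -oo)%E = -oo%E by rewrite gt0_muleNy// lte_fin.
by rewrite addNye mulNyNy.
Qed.

Lemma Bconst_pinfty : 0 < a -> (1 <= n)%N -> poincare E = +oo%E -> Bconst E n d r0 = +oo%E.
Proof.
move=> ap n1 pE; rewrite /Bconst pE; set A := area _ _; rewrite (_ : A = a%:E)// poweR_EFin.
have -> : ((a `^ 2^-1)%:E * +oo)%E = +oo%E by rewrite gt0_muley// lte_fin powR_gt0.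
have -> : ((d `^ (- 2^-1))%:E * +oo)%E = +oo%E by rewrite gt0_muley// lte_fin powR_gt0.
by rewrite addye// mulyy gt0_mulye// lte_fin mulr_gt0// powR_gt0// ltr0n.
Qed.

End PoincareConstant.

Section CircleSeminorms.
Context {R : realType} {n : nat}.
Variables (z : 'I_n.+1 -> plane R) (r : 'I_n.+1 -> R) (a : R) (f : plane R -> R).
Hypothesis r0 : 0 < r ord0.

(** Two antipodal points of the outer circle witness that both suprema range over nonempty sets, so
    that neither is [-oo]. *)
Let circle_pt (s : R) : `|s| = 1 -> circles z r (z ord0 + (s * r ord0) *: ee false).
Proof.
move=> s1; exists ord0 => //; rewrite /circle /=.
have -> : z ord0 + (s * r ord0) *: ee false - z ord0 = (s * r ord0) *: (ee false : plane R).
  by rewrite addrC addKr.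
by rewrite enormZ enorm_ee mulr1 normrM s1 mul1r gtr0_norm.
Qed.

Lemma supnorm_circles_ge0 : (0 <= supnorm Num.norm (circles z r) f)%E.
Proof. by apply: le_trans (le_supnorm _ _ (circle_pt (normr1 R))); rewrite lee_fin. Qed.

Lemma holder_circles_ge0 : (0 <= holder Num.norm a (circles z r) f)%E.
Proof.
have c1 := circle_pt (normr1 R); have c2 := circle_pt (normrN1 R).
set x := _ + _ in c1; set y := _ + _ in c2.
apply: (@le_trans _ _ (`|f x - f y| / enorm (x - y) `^ a)%:E).
  by rewrite lee_fin divr_ge0// powR_ge0.
apply: ereal_sup_ubound; exists x, y; split => // /addrI/eqP.
rewrite -subr_eq0 -scalerBl scaler_eq0 => /orP[/eqP e0|/eqP e0].
  by move: e0; rewrite mul1r mulN1r opprK => /eqP; rewrite gt_eqF ?addr_gt0.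
by have := @enorm_ee R false; rewrite e0 enorm0 => /eqP; rewrite eq_sym oner_eq0.
Qed.

End CircleSeminorms.

(** * The four estimates when the gradient is not identically zero *)

Section Estimates.
Context {R : realType} {n : nat}.
Variables (a : R) (z : 'I_n.+1 -> plane R) (r : 'I_n.+1 -> R) (d : R).
Hypotheses (a01 : 0 < a < 1) (n1 : (1 <= n)%N) (d0 : 0 < d) (hr : forall i, i != ord0 -> d <= r i).
Hypothesis hin : forall i, i != ord0 -> disk (z i) (r i + d) `<=` disk (z ord0) (r ord0).
Hypothesis hsep : forall i j, i != ord0 -> j != ord0 -> i != j ->
  ((2 * d)%:E <= setdist (closure (disk (z i) (r i))) (closure (disk (z j) (r j))))%E.
Variables (g u : plane R -> R) (G : plane R -> plane R).
Local Notation E := (holed_disk z r).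
Hypotheses (cu : Ck 2 E u) (lu : forall x, E x -> laplacian u x = 0)
  (cuc : {within closure E, continuous u}) (cG : {within closure E, continuous G})
  (GE : forall x, E x -> G x = grad u x)
  (Gg : forall k x, circle (z k) (r k) x -> dot (G x) (outer_normal (z k) (r k) x) = g x)
  (mean0 : \int[area R]_(y in E) u y = 0).
Local Notation D2 := (\int[area R]_(y in E) gsq u y).
Hypothesis D0 : 0 < D2.
Local Notation r0 := (r ord0).
Local Notation B := (Bconst E n d r0).
Local Notation g_sup := (supnorm Num.norm (circles z r) g).
Local Notation g_hol := (holder Num.norm a (circles z r) g).
Local Notation J := (jet_bound E u d).

Let rd := radius_ge n1 d0 hr hin.
Let oE : open E. Proof. by exact: holed_disk_open d0 hr. Qed.
Let EM x : E x -> enorm x <= enorm (z ord0) + r ord0.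
Proof. by move=> Ex; apply: (holed_disk_bounded d0 hr); exact: subset_closure. Qed.
Let gE := holed_diskP z d0 hr.
Let bsum i j y := @bdk_sum R n z r d d0 hr hin hsep i j y.
Let cclo := @ccollar_closure R n z r d n1 d0 hr hin hsep.
Let hu : harm E u. Proof. by split. Qed.
Let r0p : 0 < r0. Proof. exact: lt_le_trans (rd ord0). Qed.
Let a0 : a != 0. Proof. by case/andP: a01 => /lt0r_neq0. Qed.
Let iu : integ E u. Proof. exact: (bcont_integ oE EM (neumann_bcont d0 hr cu (@cuc))). Qed.

Let area_fin : exists2 s : R, area R E = s%:E & 0 < s.
Proof.
have mE := open_measurable2 oE.
have fE : (area R E < +oo)%E by exact: area_bounded_lty mE EM.
have af : area R E \is a fin_num by rewrite ge0_fin_numE// measure_ge0.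
exists (fine (area R E)); first by rewrite fineK.
have [x Ex] : E !=set0.
  apply/set0P; apply/negP => /eqP E0; by move: D0; rewrite E0 Rintegral_set0 ltxx.
have [t t0 ht] := disk_nbhs oE Ex.
apply: (@lt_le_trans _ _ (t ^+ 2)); first exact: exprn_gt0.
rewrite -lee_fin fineK//; apply: le_trans (area_disk_ge x t0) _.
by apply: le_measure => //; rewrite inE//; apply: open_measurable2; exact: disk_open.
Qed.

Let J0 : 0 <= J. Proof. by exact: jet_bound_ge0. Qed.

Let jet x : (forall k, d / 32 < bdk z r k x) ->
  [/\ forall i, `|pd i u x| <= J, forall i j, `|pd j (pd i u) x| <= J / d &
      forall i j k, `|pd k (pd j (pd i u)) x| <= J / d / d].
Proof.
move=> hx; apply: (interior_jet oE hu d0 iu) => y yx.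
exact: (interior_disk d0 hr hx).
Qed.

Let gS t : g_sup = t%:E -> forall k x, circle (z k) (r k) x -> `|g x| <= t.
Proof.
move=> gt k x cx; rewrite -lee_fin -gt; apply: (le_supnorm Num.norm g).
by exists k.
Qed.

Let gH h : g_hol = h%:E -> forall k x y, circle (z k) (r k) x -> circle (z k) (r k) y ->
  `|g y - g x| <= h * enorm (y - x) `^ a.
Proof. by move=> gh k x y cx cy; apply: (le_holder a0 gh); exists k. Qed.

Let poincare_ge0 : (0 <= poincare E)%E.
Proof.
apply: le_trans (poincare_ge d0 hr cu (@cuc) (@cG) GE mean0 D0).
by rewrite lee_fin sqrtr_ge0.
Qed.

(** If [g] vanished on the circles, the energy estimate with [S = 0] would give [D2 <= 0].
    Positivity keeps the product with an infinite [B] from collapsing to 0 in [le_rhs2]. *)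
Let g_sup_gt0 : (0 < g_sup)%E.
Proof.
rewrite lt_def supnorm_circles_ge0// andbT; apply/negP => /eqP g0.
have := neumann_dirichlet_le n1 d0 hr hin hsep cu lu (@cuc) (@cG) GE Gg (lexx 0) (gS g0) ltr01.
by rewrite mul0r leNgt D0.
Qed.

Let B0 : (0 <= B)%E.
Proof. by have [s sE _] := area_fin; exact: Bconst_ge0 d0 sE. Qed.

Let g_hol0 : (0 <= g_hol)%E. Proof. exact: holder_circles_ge0. Qed.

Let dn (m : nat) : 0 < d ^- m. Proof. by rewrite invr_gt0 exprn_gt0. Qed.

Let kM_assoc (q x t : R) : kJ * q * (886 * x * t) = kM * (q * x * t).
Proof. by rewrite /kM; ring. Qed.

(** A finite [B] forces a finite Poincare constant, by [Bconst_pinfty]. The integral of [|u|] is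
    then at most [886 * b * t], which is inserted in [jet_bound]. *)
Let jet_le b t : B = b%:E -> g_sup = t%:E -> [/\ 0 <= b, 0 <= t & J <= kM * (d ^- 3 * b * t)].
Proof.
move=> Bb gt; have [s sE s0] := area_fin.
have b0 : 0 <= b by rewrite -lee_fin -Bb.
have t0 : 0 <= t by rewrite -lee_fin -gt; exact: ltW.
have c0 : 0 <= kJ * d ^- 3.
  by rewrite mulr_ge0 ?(ltW (dn 3))// mulr_ge0// exprn_ge0// (le_trans _ kI_ge1).
split => //; have := poincare_ge0; case pE : (poincare E) => [p| |] // _.
  move: Bb; rewrite (Bconst_fin n d0 r0p sE (ltW s0) pE) => -[<-].
  have := neumann_L1_le n1 d0 hr hin hsep cu lu (@cuc) (@cG) GE Gg t0 (gS gt) mean0 D0 (CP := p).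
  rewrite pE lexx sE /= => /(_ isT) h.
  apply: (le_trans (ler_wpM2l c0 h)); by rewrite kM_assoc.
by move: Bb; rewrite (Bconst_pinfty d0 r0p sE s0 n1 pE).
Qed.

Let dr : d <= r0 := rd ord0.
Let K0 : 0 < kFinal a := kFinal_gt0 a01.
Let r0a : 0 < r0 `^ a. Proof. exact: powR_gt0. Qed.
Let dp (b : R) : 0 < d `^ b. Proof. exact: powR_gt0. Qed.
Let dI : 0 < d^-1. Proof. by rewrite invr_gt0. Qed.
Let dr4 (m : nat) : 0 < d ^- m * r0 := mulr_gt0 (dn m) r0p.
Let dq (m : nat) : 0 < d ^- m * r0 `^ (2 - a).
Proof. by apply: mulr_gt0 (dn m) _; exact: powR_gt0. Qed.

Lemma neumann_grad_sup : (supnorm enorm E (grad u) <=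
  (kFinal a)%:E * (1%:E + B * (d ^- 4 * r0)%:E) * g_sup + (kFinal a * r0 `^ a)%:E * g_hol)%E.
Proof.
apply: (le_rhs2 K0 ltr01 (dr4 4) (mulr_gt0 K0 r0a) B0 g_sup_gt0 g_hol0) => b t h Bb St Hh.
have [b0 t0 hJ] := jet_le Bb St.
have h0 : 0 <= h by rewrite -lee_fin -Hh.
apply: supnorm_le => x Ex.
apply: le_trans (final_grad a01 d0 dr b0 t0 h0 hJ); rewrite -mulrA.
apply: grad_le => i.
exact: (pd_bound a01 d0 gE rd bsum cclo J0 t0 h0 hu (@cG) GE Gg (gS St) (gH Hh) jet).
Qed.

Lemma neumann_grad_holder : (holder enorm a E (grad u) <=
  (kFinal a)%:E * ((d `^ (- a))%:E + B * (d ^- 5 * r0 `^ (2 - a))%:E) * g_sup + (kFinal a)%:E * g_hol)%E.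
Proof.
apply: (le_rhs2 K0 (dp (- a)) (dq 5) K0 B0 g_sup_gt0 g_hol0) => b t h Bb St Hh.
have [b0 t0 hJ] := jet_le Bb St.
have h0 : 0 <= h by rewrite -lee_fin -Hh.
apply: holder_le => x y Ex Ey xy.
apply: le_trans (ler_wpM2r (powR_ge0 _ _) (final_grad_holder a01 d0 dr b0 t0 h0 hJ)).
rewrite -!(mulrA 2); apply: grad_sub_le => i.
exact: (pd_holder a01 d0 oE gE rd bsum cclo J0 t0 h0 hu (@cG) GE Gg (gS St) (gH Hh) jet).
Qed.

Variable dg : plane R -> R.
Hypothesis hdg : tangential_derivative z r g dg.
Local Notation dg_sup := (supnorm Num.norm (circles z r) dg).
Local Notation dg_hol := (holder Num.norm a (circles z r) dg).

Let dg_sup0 : (0 <= dg_sup)%E. Proof. exact: supnorm_circles_ge0. Qed.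
Let dg_hol0 : (0 <= dg_hol)%E. Proof. exact: holder_circles_ge0. Qed.

Let dgS t : dg_sup = t%:E -> forall k x, circle (z k) (r k) x -> `|dg x| <= t.
Proof.
move=> gt k x cx; rewrite -lee_fin -gt; apply: (le_supnorm Num.norm dg).
by exists k.
Qed.

Let dgH h : dg_hol = h%:E -> forall k x y, circle (z k) (r k) x -> circle (z k) (r k) y ->
  `|dg y - dg x| <= h * enorm (y - x) `^ a.
Proof. by move=> gh k x y cx cy; apply: (le_holder a0 gh); exists k. Qed.

Lemma neumann_hess_sup : (supnorm hnorm E (hess u) <=
  (kFinal a)%:E * (d^-1%:E + B * (d ^- 5 * r0)%:E) * g_sup + (kFinal a * d `^ (a - 1))%:E * g_hol
  + (kFinal a)%:E * dg_sup + (kFinal a * r0 `^ a)%:E * dg_hol)%E.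
Proof.
apply: (le_rhs4 K0 dI (dr4 5) (mulr_gt0 K0 (dp _)) K0 (mulr_gt0 K0 r0a) B0 g_sup_gt0 g_hol0 dg_sup0 dg_hol0)
  => b t h t' h' Bb St Hh St' Hh'.
have [b0 t0 hJ] := jet_le Bb St.
have h0 : 0 <= h by rewrite -lee_fin -Hh.
have t'0 : 0 <= t' by rewrite -lee_fin -St'.
have h'0 : 0 <= h' by rewrite -lee_fin -Hh'.
apply: supnorm_le => x Ex.
apply: le_trans (final_hess a01 d0 dr b0 t0 h0 t'0 h'0 hJ); rewrite -mulrA.
apply: hess_le => i j.
exact: (pd2_bound a01 d0 gE rd bsum cclo J0 t0 h0 hu (@cG) GE Gg (gS St) (gH Hh) jet
  t'0 h'0 hdg (dgS St') (dgH Hh')).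
Qed.

Lemma neumann_hess_holder : (holder hnorm a E (hess u) <=
  (kFinal a)%:E * ((d `^ (- 1 - a))%:E + B * (d ^- 6 * r0 `^ (2 - a))%:E) * g_sup
  + (kFinal a * d^-1)%:E * g_hol
  + (kFinal a * d `^ (- a))%:E * dg_sup + (kFinal a)%:E * dg_hol)%E.
Proof.
apply: (le_rhs4 K0 (dp _) (dq 6) (mulr_gt0 K0 dI) (mulr_gt0 K0 (dp _)) K0 B0 g_sup_gt0 g_hol0 dg_sup0 dg_hol0)
  => b t h t' h' Bb St Hh St' Hh'.
have [b0 t0 hJ] := jet_le Bb St.
have h0 : 0 <= h by rewrite -lee_fin -Hh.
have t'0 : 0 <= t' by rewrite -lee_fin -St'.
have h'0 : 0 <= h' by rewrite -lee_fin -Hh'.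
apply: holder_le => x y Ex Ey xy.
apply: le_trans (ler_wpM2r (powR_ge0 _ _) (final_hess_holder a01 d0 dr b0 t0 h0 t'0 h'0 hJ)).
rewrite -!(mulrA 4); apply: hess_sub_le => i j.
exact: (pd2_holder a01 d0 oE gE rd bsum cclo J0 t0 h0 hu (@cG) GE Gg (gS St) (gH Hh) jet
  t'0 h'0 hdg (dgS St') (dgH Hh')).
Qed.

End Estimates.

Lemma rhs_ge0 (R : realType) (B S H : \bar R) (c p q k : R) :
  0 <= c -> 0 <= p -> 0 <= q -> 0 <= k -> (0 <= B)%E -> (0 <= S)%E -> (0 <= H)%E ->
  (0 <= c%:E * (p%:E + B * q%:E) * S + k%:E * H)%E.
Proof.
move=> c0 p0 q0 k0 B0 S0 H0; apply: adde_ge0; last exact: mule_ge0.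
apply: mule_ge0 => //; apply: mule_ge0 => //; apply: adde_ge0 => //; exact: mule_ge0.
Qed.

Theorem theorem1p1 (R : realType) (alpha : R) (halpha : 0 < alpha < 1) :
  exists2 C : R, 0 < C &
  forall (n : nat) (d : R) (z : 'I_n.+1 -> plane R) (r : 'I_n.+1 -> R)
    (g dg u : plane R -> R),
  (1 <= n)%N -> 0 < d ->
  (forall i, i != ord0 -> d <= r i) ->
  (forall i, i != ord0 -> disk (z i) (r i + d) `<=` disk (z ord0) (r ord0)) ->
  (forall i j, i != ord0 -> j != ord0 -> i != j ->
     ((2 * d)%:E <= setdist (closure (disk (z i) (r i)))
                            (closure (disk (z j) (r j))))%E) ->
  C1alpha alpha z r g dg ->
  circle_integral (z ord0) (r ord0) g =
    \sum_(k < n.+1 | k != ord0) circle_integral (z k) (r k) g ->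
  neumann_solution z r g u ->
  let E := holed_disk z r in
  let r0 := r ord0 in
  let B := Bconst E n d r0 in
  let g_sup := supnorm Num.norm (circles z r) g in
  let g_hol := holder Num.norm alpha (circles z r) g in
  let dg_sup := supnorm Num.norm (circles z r) dg in
  let dg_hol := holder Num.norm alpha (circles z r) dg in
  [/\ (supnorm enorm E (grad u) <=
         C%:E * (1 + B * (d ^- 4 * r0)%:E) * g_sup
         + C%:E * (r0 `^ alpha)%:E * g_hol)%E,
      (holder enorm alpha E (grad u) <=
         C%:E * ((d `^ (- alpha))%:E
                 + B * (d ^- 5 * r0 `^ (2 - alpha))%:E) * g_sup
         + C%:E * g_hol)%E,
      (supnorm hnorm E (hess u) <=
         C%:E * (d^-1%:E + B * (d ^- 5 * r0)%:E) * g_sup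
         + C%:E * (d `^ (alpha - 1))%:E * g_hol
         + C%:E * dg_sup
         + C%:E * (r0 `^ alpha)%:E * dg_hol)%E &
      (holder hnorm alpha E (hess u) <=
         C%:E * ((d `^ (- 1 - alpha))%:E
                 + B * (d ^- 6 * r0 `^ (2 - alpha))%:E) * g_sup
         + C%:E * d^-1%:E * g_hol
         + C%:E * (d `^ (- alpha))%:E * dg_sup
         + C%:E * dg_hol)%E].
Proof.
have K0 := kFinal_gt0 halpha; exists (kFinal alpha) => //.
move=> n d z r g dg u n1 d0 hr hin hsep [hdg _] _ [cu cuc [G [cG GE Gg]] lu mean0] E r0 B g_sup g_hol dg_sup dg_hol.
have rd := radius_ge n1 d0 hr hin.
have r0p : 0 < r0 := radius_gt0 n1 d0 hr hin ord0.
have oE : open E := holed_disk_open d0 hr.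
have EM x : E x -> enorm x <= enorm (z ord0) + r ord0.
  by move=> Ex; apply: (holed_disk_bounded d0 hr); exact: subset_closure.
rewrite -!EFinM.
(* A solution with vanishing gradient cannot be normalized as a competitor in the Poincare constant,
   but then all four left sides are at most 0 and the right sides are nonnegative. *)
have [[x0 [Ex0 gx0]]|hno] := pselect (exists x, E x /\ gsq u x != 0).
  have D0 : 0 < \int[area R]_(y in E) gsq u y.
    exact: (integral_gsq_gt0 oE EM (neumann_grad_bcont d0 hr cu (@cG) GE) Ex0 gx0).
  split.
  - exact: (neumann_grad_sup halpha n1 d0 hr hin hsep cu lu (@cuc) (@cG) GE Gg mean0 D0).
  - exact: (neumann_grad_holder halpha n1 d0 hr hin hsep cu lu (@cuc) (@cG) GE Gg mean0 D0).
  - exact: (neumann_hess_sup halpha n1 d0 hr hin hsep cu lu (@cuc) (@cG) GE Gg mean0 D0 hdg).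
  - exact: (neumann_hess_holder halpha n1 d0 hr hin hsep cu lu (@cuc) (@cG) GE Gg mean0 D0 hdg).
have gu0 x : E x -> gsq u x = 0.
  by move=> Ex; apply/eqP/negPn/negP => h; apply: hno; exists x.
have B0 : (0 <= B)%E.
  have aE : area R E \is a fin_num.
    by rewrite ge0_fin_numE ?measure_ge0//; exact: area_bounded_lty (open_measurable2 oE) EM.
  exact: Bconst_ge0 d0 (esym (fineK aE)).
have gs0 : (0 <= g_sup)%E := supnorm_circles_ge0 z g r0p.
have gh0 : (0 <= g_hol)%E := holder_circles_ge0 z alpha g r0p.
have ds0 : (0 <= dg_sup)%E := supnorm_circles_ge0 z dg r0p.
have dh0 : (0 <= dg_hol)%E := holder_circles_ge0 z alpha dg r0p.
have dI m : 0 <= d ^- m by rewrite invr_ge0 exprn_ge0// ltW.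
have dv : 0 <= d^-1 by rewrite invr_ge0 ltW.
have pw (s t : R) : 0 <= s `^ t := powR_ge0 s t.
have K1 := ltW K0; have r1 := ltW r0p.
have gr0 x : E x -> grad u x = 0.
  by move=> Ex; congr pair; [exact: (gsq0_pd gu0 false Ex)|exact: (gsq0_pd gu0 true Ex)].
have he0 x : E x -> hess u x = 0.
  by move=> Ex; congr (_, _); congr (_, _);
    [exact: (gsq0_pd2 oE gu0 false false Ex)|exact: (gsq0_pd2 oE gu0 false true Ex)
    |exact: (gsq0_pd2 oE gu0 true false Ex)|exact: (gsq0_pd2 oE gu0 true true Ex)].
have hn0 : hnorm (0 : plane R * plane R) = 0.
  by rewrite /hnorm /= !(@enorm0 R) expr0n addr0 sqrtr0.
have sg : (supnorm enorm E (grad u) <= 0%:E)%E by apply: supnorm_le => x Ex; rewrite gr0// enorm0.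
have hg : (holder enorm alpha E (grad u) <= 0%:E)%E.
  by apply: holder_le => x y Ex Ey _; rewrite !gr0// subrr enorm0 mul0r.
have sh : (supnorm hnorm E (hess u) <= 0%:E)%E by apply: supnorm_le => x Ex; rewrite he0// hn0.
have hh : (holder hnorm alpha E (hess u) <= 0%:E)%E.
  by apply: holder_le => x y Ex Ey _; rewrite !he0// subrr hn0 mul0r.
split.
- apply: (le_trans sg); apply: (rhs_ge0 K1 ler01 _ _ B0 gs0 gh0); exact: mulr_ge0.
- apply: (le_trans hg); apply: (rhs_ge0 K1 _ _ K1 B0 gs0 gh0) => //; exact: mulr_ge0.
- apply: (le_trans sh); apply: adde_ge0; last by apply: mule_ge0 => //; exact: mulr_ge0.
  apply: adde_ge0; last exact: mule_ge0.
  apply: (rhs_ge0 K1 dv _ _ B0 gs0 gh0); exact: mulr_ge0.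
- apply: (le_trans hh); apply: adde_ge0; last exact: mule_ge0.
  apply: adde_ge0; last by apply: mule_ge0 => //; exact: mulr_ge0.
  apply: (rhs_ge0 K1 _ _ _ B0 gs0 gh0) => //; exact: mulr_ge0.
Qed.
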